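(* Fix $c>0$ and $\eta>0$. There exist constants $c'>0$ and $k_0$ such that for every even $k\ge k_0$, every $k$-uniform $c$-locally nice complex $X$, every finite alphabet $\Sigma$, every ensemble $\mathcal{F}=\{f_S:S\to\Sigma\}_{S\in X(k)}$, and every $\delta>e^{-c'\eta k}$: if $Agree^V_0(\mathcal{F})\ge\delta$, then \begin{enumerate} \item $\Pr_\tau[\tau\text{ is good}]\ge\frac{\delta}{2}$, and \item $\Pr_\tau[\tau\text{ is DP}\mid\tau\text{ is good}]\ge1-\delta^2$. \end{enumerate}
   Context: Complexes: a $k$-uniform simplicial complex $X$ is a finite downward-closed set family with maximal sets of size $k$, $X(j)$ its $j$-faces, with a full-support distribution $\pi_k$ on $X(k)$ inducing $\pi_j$ by uniform subsampling; the link $X_t=\{s\setminus t: t\subseteq s\in X\}$ carries the induced distribution. A graph is a $\lambda$-one-sided (two-sided) expander if the nontrivial eigenvalues of its normalized adjacency operator are at most $\lambda$ (lie in $[-\lambda,\lambda]$); a complex is a $\lambda$-one-sided (two-sided) local-spectral expander if the graph (vertices $X_s(1)$, edges $X_s(2)$) underlying every link $X_s$ of co-dimension at least 2 is. An $m$-uniform complex is $c$-nice if it is a $2^{-cm}$-two-sided local-spectral expander, or an $m$-partite $2^{-cm}$-one-sided local-spectral expander (or skeleton thereof), or the $m$-skeleton of a $D$-uniform complex whose down-up walk (delete a uniform vertex, re-add proportionally to the top distribution) has second eigenvalue at most $1-c/D$ with $D\ge2m^2$. $X$ is $c$-locally nice if every link of $X$ (including $X$) is $c$-nice. V-test agreement: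 $Agree^V_0(\mathcal{F})=\Pr[f_{t\cup s}|_t=f_{t\cup s'}|_t]$ where $t\sim\pi_{k/2}$ and $s,s'$ are drawn independently from the distribution of $X_t(k/2)$. A restriction is a pair $\tau=(t,\sigma)$ with $t\in X(k/2)$, $\sigma:t\to\Sigma$; a random restriction is $\tau=(t,f_{s\cup t}|_t)$ with $t\sim\pi_{k/2}$, $s\sim X_t(k/2)$. For $\tau=(t,\sigma)$ let $\mathcal{V}_\tau=\{s\in X_t(k/2): f_{s\cup t}|_t=\sigma\}$. $\tau$ is good if $\Pr_{s\sim X_t(k/2)}[s\in\mathcal{V}_\tau]\ge\frac{\delta}{2}$. $\tau$ is DP if there exists $g_\tau:X_t(1)\to\Sigma$ with $\Pr_{s\sim X_t(k/2)}[f_{t\cup s}|_s\text{ and }g_\tau|_s\text{ differ on more than an }\tfrac{\eta}{4}\text{ fraction of }s\mid s\in\mathcal{V}_\tau]\le\delta^2$. *)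

(* Defs.v *)
From HB Require Import structures.
From mathcomp Require Import all_boot all_order all_algebra.
From mathcomp Require Import all_classical all_reals all_analysis.
Set Implicit Arguments. Unset Strict Implicit. Unset Printing Implicit Defensive.
Import Order.TTheory GRing.Theory Num.Theory.
Local Open Scope ring_scope.

Section Complexes.
Variable R : realType.
Variable V : finType.

Definition wcomplex (k : nat) (F : {set {set V}}) (p : {set V} -> R) : Prop :=
  [/\ (forall s t : {set V}, s \in F -> t \subset s -> t \in F),
      (forall s : {set V}, s \in F ->
         exists2 s' : {set V}, s' \in F & (s \subset s') && (#|s'| == k)),
      (forall s : {set V}, (s \in F) && (#|s| == k) -> 0 < p s),
      (forall s : {set V}, ~~ ((s \in F) && (#|s| == k)) -> p s = 0) &
      \sum_(s : {set V} | (s \in F) && (#|s| == k)) p s = 1 ].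

Definition mass (p : {set V} -> R) (t : {set V}) : R :=
  \sum_(s : {set V} | t \subset s) p s.

(* pi_j(t) for |t| = j, induced from pi_k = p by uniform subsampling *)
Definition pij (k : nat) (p : {set V} -> R) (j : nat) (t : {set V}) : R :=
  mass p t / ('C(k, j))%:R.

Definition link_faces (F : {set {set V}}) (t : {set V}) : {set {set V}} :=
  [set s :\: t | s in [set s in F | t \subset s]].

Definition link_p (p : {set V} -> R) (t : {set V}) (u : {set V}) : R :=
  if [disjoint u & t] then p (u :|: t) / mass p t else 0.

(* underlying weighted graph of an n-uniform weighted complex:
   vertices X(1), edges X(2) weighted by pi_2 *)
Definition vertices (F : {set {set V}}) : {set V} := [set x : V | [set x] \in F].

Definition adj (n : nat) (p : {set V} -> R) (x y : V) : R :=
  if x == y then 0 else pij n p 2 [set x; y] / (2 * pij n p 1 [set x]).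

Definition adjmx (n : nat) (F : {set {set V}}) (p : {set V} -> R)
  : 'M[R]_#|vertices F| :=
  \matrix_(i, j) adj n p (enum_val i) (enum_val j).

Definition top (F : {set {set V}}) (D : nat) : {set {set V}} :=
  [set s in F | #|s| == D].

Definition du (D : nat) (p : {set V} -> R) (s s' : {set V}) : R :=
  (D%:R)^-1 * \sum_(v in s)
     (if (s :\ v) \subset s' then p s' / mass p (s :\ v) else 0).

Definition downupmx (D : nat) (F : {set {set V}}) (p : {set V} -> R)
  : 'M[R]_#|top F D| :=
  \matrix_(i, j) du D p (enum_val i) (enum_val j).

Definition lse_one (lam : R) (k : nat) (F : {set {set V}}) (p : {set V} -> R) :=
  forall s : {set V}, s \in F -> (#|s| + 2 <= k)%N ->
    forall a : R, eigenvalue (adjmx (k - #|s|) (link_faces F s) (link_p p s)) a ->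
      lam < a -> a = 1 /\ \rank (eigenspace (adjmx (k - #|s|) (link_faces F s) (link_p p s)) a) = 1%N.

Definition lse_two (lam : R) (k : nat) (F : {set {set V}}) (p : {set V} -> R) :=
  forall s : {set V}, s \in F -> (#|s| + 2 <= k)%N ->
    forall a : R, eigenvalue (adjmx (k - #|s|) (link_faces F s) (link_p p s)) a ->
      lam < `|a| -> a = 1 /\ \rank (eigenspace (adjmx (k - #|s|) (link_faces F s) (link_p p s)) a) = 1%N.

Definition partite (m : nat) (F : {set {set V}}) :=
  exists col : V -> 'I_m, forall s : {set V}, s \in F -> {in s &, injective col}.

Definition skeleton (m : nat) (F : {set {set V}}) (p : {set V} -> R)
  (D : nat) (G : {set {set V}}) (q : {set V} -> R) :=
  F = [set s in G | (#|s| <= m)%N] /\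
  forall t : {set V}, #|t| = m -> p t = pij D q m t.

Definition nice (c : R) (m : nat) (F : {set {set V}}) (p : {set V} -> R) :=
  [\/ lse_two (2 `^ (- (c * m%:R))) m F p,
      (exists D (G : {set {set V}}) (q : {set V} -> R),
         [/\ (m <= D)%N, wcomplex D G q, partite D G,
             lse_one (2 `^ (- (c * m%:R))) D G q & skeleton m F p D G q]) |
      (exists D (G : {set {set V}}) (q : {set V} -> R),
         [/\ (2 * m ^ 2 <= D)%N, wcomplex D G q,
             (forall a : R, eigenvalue (downupmx D G q) a -> 1 - c / D%:R < a ->
                a = 1 /\ \rank (eigenspace (downupmx D G q) a) = 1%N)
           & skeleton m F p D G q])].

Definition locally_nice (c : R) (k : nat) (F : {set {set V}}) (p : {set V} -> R) :=
  forall t : {set V}, t \in F -> nice c (k - #|t|) (link_faces F t) (link_p p t).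

Variable Sigma : finType.

Definition agreeV (k : nat) (p : {set V} -> R) (f : {set V} -> V -> Sigma) : R :=
  \sum_(t : {set V} | #|t| == k./2) pij k p k./2 t *
    \sum_(s : {set V}) \sum_(s' : {set V})
       link_p p t s * link_p p t s' *
       ([forall x in t, f (t :|: s) x == f (t :|: s') x] : bool)%:R.

(* s lies in V_tau for tau = (t, f_{t u s0}|_t) *)
Definition inV (f : {set V} -> V -> Sigma) (t s0 s : {set V}) : bool := [forall x in t, f (t :|: s) x == f (t :|: s0) x].

Definition weightV (p : {set V} -> R) (f : {set V} -> V -> Sigma) (t s0 : {set V}) : R :=
  \sum_(s : {set V}) link_p p t s * (inV f t s0 s)%:R.

Definition good (p : {set V} -> R) (f : {set V} -> V -> Sigma) (delta : R) (t s0 : {set V}) : bool :=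
  delta / 2 <= weightV p f t s0.

Definition isDP (p : {set V} -> R) (f : {set V} -> V -> Sigma) (eta delta : R) (t s0 : {set V}) : bool :=
  [exists g : {ffun V -> Sigma},
    (\sum_(s : {set V}) link_p p t s * (inV f t s0 s)%:R *
        (((eta / 4) * #|s|%:R < #|[set x in s | f (t :|: s) x != g x]|%:R)%R : bool)%:R)
      / weightV p f t s0 <= delta ^+ 2].

(* Pr over the random restriction tau = (t, f_{t u s0}|_t),
   t ~ pi_{k/2}, s0 ~ X_t(k/2), of an event depending on tau *)
Definition prob_tau (k : nat) (p : {set V} -> R) (P : {set V} -> {set V} -> bool) : R :=
  \sum_(t : {set V} | #|t| == k./2) pij k p k./2 t *
    \sum_(s0 : {set V}) link_p p t s0 * (P t s0)%:R.

End Complexes.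

(* Main.v *)
Require Import Defs.
From HB Require Import structures.
From mathcomp Require Import all_boot all_order all_algebra.
From mathcomp Require Import ring lra zify.
Set Implicit Arguments. Unset Strict Implicit. Unset Printing Implicit Defensive.
Import Order.TTheory GRing.Theory Num.Theory.
Local Open Scope ring_scope.

(** Fix a face [t] and weights [A], [B] on the top faces above it. The main tool is
    the exchange sum [GG]: summed over [l <= h], the expectation over a random face
    [E'] extending [t] by [l] vertices and two independent top faces [S], [S'] above
    [E'] of [A S * B S' * Lam ^ d], where [d] counts the vertices of [E' :\: t] on
    which [f_S] and [f_S'] disagree. Double counting over the position of [t] inside
    [E'] shows that for [A = B] the indicator of [V_tau] this sum is at most [h + 1]
    on average over [tau], as long as [Lam * h <= k / 2]: two faces that disagree on
    many vertices of [E'] rarely agree on a random [t]. Conversely, a recursion that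
    reveals one vertex of the link at a time bounds [ln GG] from below by [h] times
    the vertexwise disagreement of [A] and [B]. Its errors are controlled by two
    properties of links: [decorr] (two random vertices are nearly independent) and
    [dense_regular] (an event of probability [exp (- Omega k)] has nearly unbiased
    vertex marginals). Hence for most good [tau] the plurality function [g] is right
    on average over [V_tau], and a second recursion, between the faces of [V_tau] far
    from [g] and those close to it, shows that the former are a [delta ^ 2] fraction.

    Both properties follow from niceness. Local spectral expansion makes the entropy
    of a conditioned event nearly convex along a random flag; a gap of the down-up
    walk gives a Poincare inequality, hence exponential moments of [#|S :&: Z|]. *)

(** * Cutoff functions and two-label states *)

(** The obstacle is dependence: revealing a vertex x multiplies the density of an event by an
    unbounded factor and shifts the label laws at all other vertices, so a disagreement may
    disappear as it is being observed. Two bounded potentials pay for this. [ener], quadratic in the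
    label probabilities, grows by the variance that an observation creates; [psi], convex in the
    density, grows by a Bregman divergence. The disagreement damped by the cutoff [theta], plus
    multiples of both, is almost a submartingale ([star]). The multiple of [psi] may be large
    because [dense_regular] pins the mean of [psi] near 1/2 for heavy events. One step is a
    coupling: each side selects a share z of its weight, and a common vertex is revealed only if
    both select. The other branches use up a level without extending E, which is why the exchange
    sum contains every l <= h. The first recursion loses ln 2 per level and bounds the mean
    disagreement only by a constant. The second reveals only vertices where one side is wrong and
    the other right; it gains a constant factor per vertex, and over h = Omega(k) vertices this
    beats a fixed power of 1/delta. *)

Section Cutoff.
Variable R : realFieldType.
Implicit Types r s c P Q : R.

(** The argument is a relative density, equal to 1 on average. [breg s r] is the Bregman divergence
    of the convex function [psi]. [theta] is the square of r / (1 + r)^2, a cutoff that damps both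
    very small and very large densities; [kap r] is [theta r / r], and [dkap] is the derivative of
    [kap]. *)
Definition psi r := (1 + r)^-1.
Definition theta r := r ^+ 2 / (1 + r) ^+ 4.
Definition kap r := r / (1 + r) ^+ 4.
Definition dkap r := (1 - 3 * r) / (1 + r) ^+ 5.
Definition breg s r := (s - r) ^+ 2 / ((1 + s) * (1 + r) ^+ 2).

Lemma breg_ge0 s r : 0 <= s -> 0 <= r -> 0 <= breg s r.
Proof.
move=> s0 r0; apply: divr_ge0; first exact: sqr_ge0.
by apply: mulr_ge0; [lra | exact: sqr_ge0].
Qed.

Lemma psi_breg s r : 0 <= s -> 0 <= r ->
  psi s = psi r - (s - r) / (1 + r) ^+ 2 + breg s r.
Proof.
move=> s0 r0; rewrite /psi /breg; field; rewrite ?mulf_neq0 //; apply/andP; split; lra.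
Qed.

Lemma theta_ge0 r : 0 <= r -> 0 <= theta r.
Proof. by move=> r0; rewrite divr_ge0 ?sqr_ge0 // exprn_ge0 //; lra. Qed.

Lemma thetaE r : theta r = r * kap r.
Proof. by rewrite /theta /kap; ring. Qed.

Lemma theta_le r : 0 <= r -> theta r <= 16^-1.
Proof.
move=> r0; have h : 0 < (1 + r) ^+ 4 by rewrite exprn_gt0 //; lra.
rewrite /theta ler_pdivrMr //.
have -> : r ^+ 2 = r * r by ring.
have : 4 * r <= (1 + r) ^+ 2 by have := sqr_ge0 (1 - r); nra.
move=> h2; have : (4 * r) ^+ 2 <= ((1 + r) ^+ 2) ^+ 2 by rewrite ler_sqr ?nnegrE //; nra.
by rewrite -exprM => h3; lra.
Qed.

Lemma kap_ge0 r : 0 <= r -> 0 <= kap r.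
Proof. by move=> r0; rewrite divr_ge0 // exprn_ge0 //; lra. Qed.

Lemma kap_le1 r : 0 <= r -> kap r <= 1.
Proof.
move=> r0; have h : 0 < (1 + r) ^+ 4 by rewrite exprn_gt0 //; lra.
rewrite /kap ler_pdivrMr // mul1r.
have h1 : 1 <= (1 + r) ^+ 3 by rewrite exprn_ege1 //; lra.
rewrite exprS; nra.
Qed.

Let tau r := r / (1 + r) ^+ 2.

Lemma tau_theta r : 0 <= r -> theta r = tau r ^+ 2.
Proof. by move=> r0; rewrite /theta /tau; field; lra. Qed.

Lemma tau_ge0 r : 0 <= r -> 0 <= tau r.
Proof. by move=> r0; rewrite divr_ge0 // sqr_ge0. Qed.

(** The quotient of the two sides is (1 - r s)^2 / ((1 + s)^3 (1 + r)^2), at most 1 because |1 - r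
    s| <= (1 + s)(1 + r). So the square root of [theta] is Lipschitz for the square root of [breg];
    the comparisons of [theta] at two densities below all come from this. *)
Lemma tau_breg s r : 0 <= s -> 0 <= r -> (tau s - tau r) ^+ 2 <= breg s r.
Proof.
move=> s0 r0.
have -> : (tau s - tau r) ^+ 2 =
  breg s r * ((1 - r * s) ^+ 2 / ((1 + s) ^+ 3 * (1 + r) ^+ 2)).
  by rewrite /tau /breg; field; rewrite ?mulf_neq0 //; apply/andP; split; lra.
have b0 := breg_ge0 s0 r0.
rewrite ler_piMr // ler_pdivrMr; last by rewrite mulr_gt0 // exprn_gt0 //; lra.
rewrite mul1r.
have h1 : `|1 - r * s| <= (1 + s) * (1 + r) by rewrite ler_norml; nra.
have h2 : (1 - r * s) ^+ 2 <= ((1 + s) * (1 + r)) ^+ 2.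
  by rewrite -real_normK ?num_real // ler_sqr ?nnegrE //; nra.
apply: (le_trans h2); rewrite exprMn ler_wpM2r ?sqr_ge0 //.
by rewrite [leRHS]exprS ler_peMl ?sqr_ge0 //; lra.
Qed.

Lemma theta_breg s r : 0 <= s -> 0 <= r -> theta s <= 2 * theta r + 2 * breg s r.
Proof.
move=> s0 r0; rewrite !tau_theta //; have := tau_breg s0 r0.
have := sqr_ge0 (tau s - 2 * tau r); nra.
Qed.

Lemma theta_breg' s r : 0 <= s -> 0 <= r -> theta r <= 2 * theta s + 2 * breg s r.
Proof.
move=> s0 r0; rewrite !tau_theta //; have := tau_breg s0 r0.
have := sqr_ge0 (tau r - 2 * tau s); nra.
Qed.

Lemma theta_diff s r : 0 <= s -> 0 <= r -> (theta s - theta r) ^+ 2 <= breg s r.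
Proof.
move=> s0 r0; have := theta_le s0; have := theta_le r0.
have := theta_ge0 s0; have := theta_ge0 r0.
rewrite !tau_theta // => a1 a2 a3 a4.
have t1 := tau_ge0 s0; have t2 := tau_ge0 r0.
have -> : (tau s ^+ 2 - tau r ^+ 2) ^+ 2 = (tau s - tau r) ^+ 2 * (tau s + tau r) ^+ 2 by ring.
apply: le_trans (tau_breg s0 r0); rewrite ler_piMr ?sqr_ge0 //; nra.
Qed.

Lemma kap_diff s r : 0 <= s -> 0 <= r -> s * (kap s - kap r) ^+ 2 <= 49 * breg s r.
Proof.
move=> s0 r0; set a := 1 + s; set b := 1 + r.
have a1 : 1 <= a by rewrite /a; lra.
have b1 : 1 <= b by rewrite /b; lra.
have an : a != 0 by apply: lt0r_neq0; lra.
have bn : b != 0 by apply: lt0r_neq0; lra.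
(* In the variable a = 1 + s, [kap s] is a^-3 - a^-4. [e] and [d] are the divided differences of
   these two powers, up to the common factor (r - s) / (a b), and both are bounded. *)
pose e := (a ^+ 2 + a * b + b ^+ 2) / (a ^+ 2 * b ^+ 2).
pose d := (a ^+ 3 + a ^+ 2 * b + a * b ^+ 2 + b ^+ 3) / (a ^+ 3 * b ^+ 3).
have ai : 0 <= a^-1 <= 1 by rewrite invr_ge0 invf_le1; lra.
have bi : 0 <= b^-1 <= 1 by rewrite invr_ge0 invf_le1; lra.
have aiX k : 0 <= a^-1 ^+ k <= 1 by rewrite exprn_ge0 ?exprn_ile1 //; lra.
have biX k : 0 <= b^-1 ^+ k <= 1 by rewrite exprn_ge0 ?exprn_ile1 //; lra.
have eE : e = b^-1 ^+ 2 + a^-1 * b^-1 + a^-1 ^+ 2 by rewrite /e; field; rewrite ?an ?bn.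
have dE : d = b^-1 ^+ 3 + a^-1 * b^-1 ^+ 2 + a^-1 ^+ 2 * b^-1 + a^-1 ^+ 3.
  by rewrite /d; field; rewrite ?an ?bn.
have he : 0 <= e <= 3.
  have := aiX 2%N; have := biX 2%N; rewrite eE; move: ai bi => /andP[? ?] /andP[? ?] /andP[? ?] /andP[? ?].
  nra.
have hd : 0 <= d <= 4.
  have := aiX 3%N; have := biX 3%N; have := aiX 2%N; have := biX 2%N; rewrite dE.
  move: ai bi => /andP[? ?] /andP[? ?] /andP[? ?] /andP[? ?] /andP[? ?] /andP[? ?]; nra.
have kE : kap s - kap r = (r - s) / (a * b) * (e - d).
  have -> : r = b - 1 by rewrite /b; ring.
  have -> : s = a - 1 by rewrite /a; ring.
  rewrite /kap /e /d; have -> : 1 + (a - 1) = a by ring.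
  have -> : 1 + (b - 1) = b by ring.
  by field; rewrite ?an ?bn.
have -> : s * (kap s - kap r) ^+ 2 = breg s r * ((s / a) * (e - d) ^+ 2).
  rewrite kE /breg -/a -/b; field; by rewrite ?an ?bn.
rewrite mulrC ler_wpM2r ?breg_ge0 //.
have sa : 0 <= s / a <= 1.
  by rewrite divr_ge0 ?ler_pdivrMr /a; lra.
have : 0 <= (e - d) ^+ 2 <= 16 by rewrite sqr_ge0 /=; nra.
move: sa => /andP[? ?] /andP[? ?]; nra.
Qed.

(** Inside the norm stands the first-order Taylor error of [theta] at r. Divided by [breg] it is a
    polynomial in 1 / (1 + s) and 1 / (1 + r), hence bounded. *)
Lemma theta_taylor s r : 0 <= s -> 0 <= r ->
  `|s * (kap s - kap r) - r * dkap r * (s - r)| <= 25 * breg s r.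
Proof.
move=> s0 r0; set a := 1 + s; set b := 1 + r.
have a1 : 1 <= a by rewrite /a; lra.
have b1 : 1 <= b by rewrite /b; lra.
have an : a != 0 by apply: lt0r_neq0; lra.
have bn : b != 0 by apply: lt0r_neq0; lra.
have ai : 0 <= a^-1 <= 1 by rewrite invr_ge0 invf_le1; lra.
have bi : 0 <= b^-1 <= 1 by rewrite invr_ge0 invf_le1; lra.
pose e2 := a^-1 + 2 * b^-1.
pose e3 := a^-1 ^+ 2 + 2 * a^-1 * b^-1 + 3 * b^-1 ^+ 2.
pose e4 := a^-1 ^+ 3 + 2 * a^-1 ^+ 2 * b^-1 + 3 * a^-1 * b^-1 ^+ 2 + 4 * b^-1 ^+ 3.
have -> : s * (kap s - kap r) - r * dkap r * (s - r) = breg s r * (e2 - 2 * e3 + e4).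
  have -> : r = b - 1 by rewrite /b; ring.
  have -> : s = a - 1 by rewrite /a; ring.
  rewrite /kap /dkap /breg /e2 /e3 /e4; have -> : 1 + (a - 1) = a by ring.
  have -> : 1 + (b - 1) = b by ring.
  by field; rewrite ?an ?bn.
have bg := breg_ge0 s0 r0.
rewrite normrM (ger0_norm bg) mulrC ler_wpM2r //.
have aiX k : 0 <= a^-1 ^+ k <= 1 by rewrite exprn_ge0 ?exprn_ile1 //; lra.
have biX k : 0 <= b^-1 ^+ k <= 1 by rewrite exprn_ge0 ?exprn_ile1 //; lra.
have m01 (x y : R) : 0 <= x <= 1 -> 0 <= y <= 1 -> 0 <= x * y <= 1.
  by move=> /andP[x0 x1] /andP[y0 y1]; rewrite mulr_ge0 // mulr_ile1.
have h2 : 0 <= e2 <= 3 by rewrite /e2; lra.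
have h3 : 0 <= e3 <= 6.
  by have := aiX 2%N; have := biX 2%N; have := m01 _ _ ai bi; rewrite /e3 -!mulrA; lra.
have h4 : 0 <= e4 <= 10.
  have := aiX 3%N; have := biX 3%N; have := m01 _ _ (aiX 2%N) bi; have := m01 _ _ ai (biX 2%N).
  by rewrite /e4 -!mulrA; lra.
by rewrite ler_norml; lra.
Qed.

(* [P r] and [Q s] are the masses of one label before and after an observation. *)
Definition remd P Q r s : R :=
  Q * s * kap s - P * r * kap r - (kap r * (Q * s - P * r) + P * r * dkap r * (s - r)).

Lemma remdE P Q r s :
  remd P Q r s = (Q - P) * s * (kap s - kap r) + P * (s * (kap s - kap r) - r * dkap r * (s - r)).
Proof. by rewrite /remd; ring. Qed.

Definition crem c : R := 49 / (4 * c) + 25.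

(** The mixed term (Q - P) s (kap s - kap r) is split by Young's inequality with weight c: the label
    variance may get an arbitrarily small coefficient, at the price 49 / (4 c) on the density
    side. *)
Lemma remd_le c P Q r s : 0 < c -> 0 <= P <= 1 -> 0 <= r -> 0 <= s ->
  `|remd P Q r s| <= c * (s * (Q - P) ^+ 2) + crem c * breg s r.
Proof.
move=> c0 /andP[P0 P1] r0 s0; rewrite remdE.
apply: (le_trans (ler_normD _ _)).
have h1 : `|P * (s * (kap s - kap r) - r * dkap r * (s - r))| <= 25 * breg s r.
  rewrite normrM (ger0_norm P0); apply: le_trans (theta_taylor s0 r0).
  by rewrite ler_piMl.
have h2 : `|(Q - P) * s * (kap s - kap r)| <=
    c * (s * (Q - P) ^+ 2) + 49 / (4 * c) * breg s r.
  apply: (@le_trans _ _ (c * (s * (Q - P) ^+ 2) + (4 * c)^-1 * (s * (kap s - kap r) ^+ 2))).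
    have -> : (Q - P) * s * (kap s - kap r) = s * ((Q - P) * (kap s - kap r)) by ring.
    rewrite normrM (ger0_norm s0).
    have -> : c * (s * (Q - P) ^+ 2) + (4 * c)^-1 * (s * (kap s - kap r) ^+ 2) =
       s * (c * (Q - P) ^+ 2 + (4 * c)^-1 * (kap s - kap r) ^+ 2) by ring.
    rewrite ler_wpM2l // ler_norml.
    have e x y : c * x ^+ 2 + (4 * c)^-1 * y ^+ 2 = c^-1 * (c * x + 2^-1 * y) ^+ 2 - x * y.
      by field; lra.
    have e' x y : c * x ^+ 2 + (4 * c)^-1 * y ^+ 2 = c^-1 * (c * x - 2^-1 * y) ^+ 2 + x * y.
      by field; lra.
    have g x : 0 <= c^-1 * x ^+ 2 by rewrite mulr_ge0 ?sqr_ge0 // invr_ge0 ltW.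
    apply/andP; split; first by rewrite e; have := g (c * (Q - P) + 2^-1 * (kap s - kap r)); lra.
    by rewrite e'; have := g (c * (Q - P) - 2^-1 * (kap s - kap r)); lra.
  rewrite lerD2l; have -> : 49 / (4 * c) * breg s r = (4 * c)^-1 * (49 * breg s r) by ring.
  by rewrite ler_wpM2l ?kap_diff // invr_ge0; lra.
by rewrite /crem; lra.
Qed.

Lemma dkap_bound r : 0 <= r -> `|dkap r| * r <= 3.
Proof.
move=> r0; have h : 0 < (1 + r) ^+ 5 by rewrite exprn_gt0 //; lra.
rewrite /dkap normrM normfV (gtr0_norm h) mulrAC ler_pdivrMr //.
have h1 : `|1 - 3 * r| * r <= 3 * (1 + r) ^+ 2.
  rewrite -[X in _ * X]ger0_norm // -normrM ler_norml; nra.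
apply: (le_trans h1); rewrite ler_wpM2l // ?ler_weXn2l //; lra.
Qed.

Lemma dkap_bound2 r : 0 <= r -> `|dkap r| * r ^+ 2 <= 3.
Proof.
move=> r0; have h : 0 < (1 + r) ^+ 5 by rewrite exprn_gt0 //; lra.
rewrite /dkap normrM normfV (gtr0_norm h) mulrAC ler_pdivrMr //.
have h1 : `|1 - 3 * r| <= 3 * (1 + r) by rewrite ler_norml; lra.
apply: (@le_trans _ _ (3 * (1 + r) * (1 + r) ^+ 2)).
  by apply: ler_pM => //; [exact: sqr_ge0 | rewrite ler_sqr ?nnegrE //; lra].
by rewrite -mulrA -exprS ler_wpM2l // ler_weXn2l //; lra.
Qed.

End Cutoff.

(** * States: the masses of the two labels at a vertex *)

Section States.
Variable R : realFieldType.
Implicit Types s t : bool -> R.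

(** Masses are relative to the current event, so [tot] is the density ratio that [theta] and [psi]
    act on. [gfun s b] is the label probability times [theta (tot s)], a bounded stand-in for the
    unbounded mass s b. *)
Definition tot s := s true + s false.
Definition prb s b := s b / tot s.
Definition gfun s b := s b * kap (tot s).
Definition dev b s t := tot s * (prb s b - prb t b) ^+ 2.
Definition ener s := \sum_b s b ^+ 2 / tot s.
Definition st_ge0 s := forall b, 0 <= s b.

Lemma sum_bool (f : bool -> R) : \sum_b f b = f true + f false.
Proof. by rewrite big_bool. Qed.

Lemma tot_ge0 s : st_ge0 s -> 0 <= tot s.
Proof. by move=> h; rewrite addr_ge0. Qed.

Lemma tot_b s b : tot s = s b + s (~~ b).
Proof. by case: b; rewrite /tot // addrC. Qed.

Lemma le_tot s b : st_ge0 s -> s b <= tot s.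
Proof. by move=> h; rewrite (tot_b s b) lerDl. Qed.

Lemma prbM s b : st_ge0 s -> prb s b * tot s = s b.
Proof.
move=> h; rewrite /prb; have [e|ne] := eqVneq (tot s) 0; last by rewrite mulfVK.
rewrite e mulr0; apply/esym/eqP; rewrite -(andbT (_ == _)) eq_le h andbT.
by rewrite andbT -e le_tot.
Qed.

Lemma prb01 s b : st_ge0 s -> 0 <= prb s b <= 1.
Proof.
move=> h; have t0 := tot_ge0 h; rewrite /prb divr_ge0 //=.
have [e|ne] := eqVneq (tot s) 0; first by rewrite e invr0 mulr0 ler01.
by rewrite ler_pdivrMr ?mul1r ?le_tot // lt_def ne.
Qed.

Lemma sum_prb s : tot s != 0 -> \sum_b prb s b = 1.
Proof. by move=> h; rewrite sum_bool -mulrDl mulfV. Qed.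

Lemma sum_prb_le s : st_ge0 s -> 0 <= \sum_b prb s b <= 1.
Proof.
move=> h; have [e|ne] := eqVneq (tot s) 0.
  by rewrite sum_bool /prb e invr0 !mulr0 addr0 lexx ler01.
by rewrite sum_prb // ler01 lexx.
Qed.

Lemma gfunE s b : st_ge0 s -> gfun s b = prb s b * theta (tot s).
Proof. by move=> h; rewrite /gfun thetaE mulrA prbM. Qed.

Lemma gfun_bd s b : st_ge0 s -> 0 <= gfun s b <= 16^-1.
Proof.
move=> h; have t0 := tot_ge0 h; rewrite gfunE //.
have /andP[p0 p1] := prb01 b h; have a := theta_ge0 t0; have c := theta_le t0.
by rewrite mulr_ge0 //=; apply: le_trans c; rewrite ler_piMl.
Qed.

Lemma dev_ge0 b s t : st_ge0 s -> 0 <= dev b s t.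
Proof. by move=> h; rewrite mulr_ge0 ?sqr_ge0 ?tot_ge0. Qed.

(** The differential at t of the map sending s to [gfun s b], applied to s. Being linear in s, it
    commutes with averaging over outcomes. *)
Definition grad t b s := kap (tot t) * s b + t b * dkap (tot t) * tot s.

Definition rema b s t := gfun s b - gfun t b - (grad t b s - grad t b t).

Lemma rema_le c b s t : 0 < c -> st_ge0 s -> st_ge0 t ->
  `|rema b s t| <= c * dev b s t + crem c * breg (tot s) (tot t).
Proof.
move=> c0 hs ht; have ts := tot_ge0 hs; have tt := tot_ge0 ht.
have -> : rema b s t = remd (prb t b) (prb s b) (tot t) (tot s).
  by rewrite /remd !prbM // /rema /gfun /grad; ring.
exact: remd_le (prb01 b ht) tt ts.
Qed.

Lemma rema_taylor b s t : gfun s b = gfun t b + (grad t b s - grad t b t) + rema b s t.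
Proof. by rewrite /rema; ring. Qed.

Lemma grad_le t b s : st_ge0 t -> st_ge0 s -> `|grad t b s| <= 4 * tot s.
Proof.
move=> ht hs; have tt := tot_ge0 ht; have ts := tot_ge0 hs.
apply: le_trans (ler_normD _ _) _; rewrite [X in _ + X]normrM [X in _ + X * _]normrM.
have h1 : `|kap (tot t) * s b| <= tot s.
  rewrite ger0_norm; last exact: mulr_ge0 (kap_ge0 tt) (hs b).
  have := le_tot b hs; have := hs b; have := kap_le1 tt.
  by have := kap_ge0 tt; nra.
have h2 : `|t b| * `|dkap (tot t)| <= 3.
  rewrite mulrC; apply: le_trans (dkap_bound tt); rewrite ler_wpM2l //.
  by rewrite ger0_norm ?le_tot.
rewrite (ger0_norm ts).
have h3 : `|t b| * `|dkap (tot t)| * tot s <= 3 * tot s by rewrite ler_wpM2r.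
lra.
Qed.

Lemma grad_self t b : st_ge0 t -> `|grad t b t| <= 4.
Proof.
move=> ht; have tt := tot_ge0 ht.
apply: le_trans (ler_normD _ _) _.
have h1 : `|kap (tot t) * t b| <= 1.
  have := gfun_bd b ht; rewrite /gfun mulrC => /andP[g0 g1]; rewrite ger0_norm //; lra.
have h2 : `|t b * dkap (tot t) * tot t| <= 3.
  rewrite -mulrA normrM.
  have [e|ne] := eqVneq (tot t) 0; first by rewrite e mulr0 normr0 mulr0.
  apply: le_trans (_ : `|tot t| * `|dkap (tot t) * tot t| <= 3).
    by rewrite ler_wpM2r // !ger0_norm ?le_tot.
  rewrite (normrM (dkap _)) (ger0_norm tt).
  have -> : tot t * (`|dkap (tot t)| * tot t) = `|dkap (tot t)| * tot t ^+ 2 by ring.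
  exact: dkap_bound2.
lra.
Qed.

Lemma gdiff_le b s t : st_ge0 s -> st_ge0 t ->
  `|gfun s b - gfun t b| <=
    theta (tot s) * `|prb s b - prb t b| + `|theta (tot s) - theta (tot t)|.
Proof.
move=> hs ht; rewrite !gfunE //.
have -> : prb s b * theta (tot s) - prb t b * theta (tot t) =
  theta (tot s) * (prb s b - prb t b) + prb t b * (theta (tot s) - theta (tot t)) by ring.
apply: le_trans (ler_normD _ _) _; rewrite (normrM (theta _)) (normrM (prb t b)).
rewrite (ger0_norm (theta_ge0 (tot_ge0 hs))) lerD2l.
have /andP[p0 p1] := prb01 b ht.
by rewrite (ger0_norm p0) ler_piMl.
Qed.

Definition cpair (c : R) := (4 * c)^-1 + 1.

Lemma cauchy_mid (c x y : R) : 0 < c -> x * y <= c * x ^+ 2 + (4 * c)^-1 * y ^+ 2.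
Proof.
move=> c0; have -> : c * x ^+ 2 + (4 * c)^-1 * y ^+ 2 = c^-1 * (c * x - 2^-1 * y) ^+ 2 + x * y.
  by field; lra.
by rewrite lerDr mulr_ge0 ?sqr_ge0 // invr_ge0 ltW.
Qed.

(** The product of the increments of both sides is separated into one contribution per side. The
    label shift of a side keeps the factor [theta (tot t')] of the other side, because [coverage]
    controls label shifts only at vertices that the other side would observe too. *)
Lemma gdiff_pair c b b' s t s' t' : 0 < c ->
  st_ge0 s -> st_ge0 t -> st_ge0 s' -> st_ge0 t' ->
  `|gfun s b - gfun t b| * `|gfun s' b' - gfun t' b'| <=
   (theta (tot s) * theta (tot t') * (prb s b - prb t b) ^+ 2
     + c * dev b s t + cpair c * breg (tot s) (tot t)) +
   (theta (tot s') * theta (tot t) * (prb s' b' - prb t' b') ^+ 2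
     + c * dev b' s' t' + cpair c * breg (tot s') (tot t')).
Proof.
move=> c0 hs ht hs' ht'.
have [[[rs rt] rs'] rt'] := (tot_ge0 hs, tot_ge0 ht, tot_ge0 hs', tot_ge0 ht').
have dP (u v : bool -> R) e : st_ge0 u -> st_ge0 v -> `|prb u e - prb v e| <= 1.
  move=> hu hv; have := prb01 e hu; have := prb01 e hv => /andP[? ?] /andP[? ?].
  by rewrite ler_norml; lra.
have d1 := dP _ _ b hs ht; have d2 := dP _ _ b' hs' ht'.
apply: le_trans (ler_pM _ _ (gdiff_le b hs ht) (gdiff_le b' hs' ht')) _ => //.
rewrite /dev -[(prb s b - _) ^+ 2]real_normK ?num_real //.
rewrite -[(prb s' b' - _) ^+ 2]real_normK ?num_real //.
have h1 := theta_diff rs rt; have h2 := theta_diff rs' rt'.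
rewrite -[X in X <= _]real_normK ?num_real // in h1.
rewrite -[X in X <= _]real_normK ?num_real // in h2.
have [q1 q2] := (theta_breg rs rt, theta_breg rs' rt').
have [k1 k2] := (theta_ge0 rs, theta_ge0 rs').
have [k3 k4] := (theta_ge0 rt, theta_ge0 rt').
have [l1 l2] := (theta_le rs, theta_le rs').
have [b1 b2] := (breg_ge0 rs rt, breg_ge0 rs' rt').
have sqth x : 0 <= x -> theta x ^+ 2 <= x :> R.
  move=> x0; have := theta_le x0; have := theta_ge0 x0.
  have := kap_le1 x0; have := kap_ge0 x0; rewrite !thetaE => ? ? ? ?; nra.
have [z1 z2] := (sqth _ rs, sqth _ rs').
move: (normr_ge0 (prb s b - prb t b)) (normr_ge0 (prb s' b' - prb t' b')) d1 d2 h1 h2.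
move: (normr_ge0 (theta (tot s) - theta (tot t))) (normr_ge0 (theta (tot s') - theta (tot t'))).
set p := `|prb s b - prb t b|; set p' := `|prb s' b' - prb t' b'|.
set e := `|theta (tot s) - theta (tot t)|; set e' := `|theta (tot s') - theta (tot t')|.
set B := breg (tot s) (tot t) in q1 b1 *; set B' := breg (tot s') (tot t') in q2 b2 *.
set x := theta (tot s) in q1 k1 l1 z1 *; set x' := theta (tot s') in q2 k2 l2 z2 *.
set y := theta (tot t) in q1 k3 *; set y' := theta (tot t') in q2 k4 *.
move=> e0 e0' p0 p0' p1 p1' eB eB'.
have m1 := cauchy_mid (x * p) e' c0; have m2 := cauchy_mid (x' * p') e c0.
have c4 : 0 <= (4 * c)^-1 by rewrite invr_ge0; lra.
have m3 : (x * p) ^+ 2 <= tot s * p ^+ 2 by rewrite exprMn ler_wpM2r ?sqr_ge0.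
have m4 : (x' * p') ^+ 2 <= tot s' * p' ^+ 2 by rewrite exprMn ler_wpM2r ?sqr_ge0.
have m5 : c * (x * p) ^+ 2 <= c * (tot s * p ^+ 2) by rewrite ler_wpM2l // ltW.
have m6 : c * (x' * p') ^+ 2 <= c * (tot s' * p' ^+ 2) by rewrite ler_wpM2l // ltW.
have m7 : (4 * c)^-1 * e' ^+ 2 <= (4 * c)^-1 * B' by rewrite ler_wpM2l.
have m8 : (4 * c)^-1 * e ^+ 2 <= (4 * c)^-1 * B by rewrite ler_wpM2l.
have ee : e * e' <= 2^-1 * B + 2^-1 * B' by have := sqr_ge0 (e - e'); nra.
have main : x * p * (x' * p') <=
   x * y' * p ^+ 2 + x' * y * p' ^+ 2 + 2^-1 * B + 2^-1 * B'.
  have n1 : x * p * (x' * p') <= 2^-1 * (x * x') * p ^+ 2 + 2^-1 * (x * x') * p' ^+ 2.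
    have : 0 <= (x * x') * (p - p') ^+ 2 by rewrite mulr_ge0 ?sqr_ge0 // mulr_ge0.
    nra.
  have sq1 : 0 <= p ^+ 2 <= 1 by rewrite sqr_ge0 /= exprn_ile1.
  have sq2 : 0 <= p' ^+ 2 <= 1 by rewrite sqr_ge0 /= exprn_ile1.
  have n2 : x * x' <= x * (2 * y' + 2 * B') by rewrite ler_wpM2l.
  have n3 : x * x' <= x' * (2 * y + 2 * B) by rewrite mulrC ler_wpM2l.
  have n4 : x * x' * p ^+ 2 <= x * (2 * y' + 2 * B') * p ^+ 2.
    by rewrite ler_wpM2r //; lra.
  have n5 : x * x' * p' ^+ 2 <= x' * (2 * y + 2 * B) * p' ^+ 2.
    by rewrite ler_wpM2r //; lra.
  have n6 : x * B' * p ^+ 2 <= 16^-1 * B'.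
    rewrite -mulrA [B' * _]mulrC mulrA ler_wpM2r //.
    apply: le_trans l1; rewrite ler_piMr //; lra.
  have n7 : x' * B * p' ^+ 2 <= 16^-1 * B.
    rewrite -mulrA [B * _]mulrC mulrA ler_wpM2r //.
    apply: le_trans l2; rewrite ler_piMr //; lra.
  lra.
rewrite /cpair; lra.
Qed.

(** Linearised at t, the energy has an error that is exactly the label variance. Hence it grows by
    [dev] whenever linear functionals of the state are conserved. *)
Lemma ener_dev s t : st_ge0 s ->
  ener s = \sum_b (2 * prb t b - \sum_d prb t d ^+ 2) * s b + \sum_b dev b s t.
Proof.
move=> hs; rewrite /ener !sum_bool /dev.
have e b : s b ^+ 2 / tot s = prb s b * s b by rewrite /prb; ring.
have [p1 p2] := (prbM true hs, prbM false hs).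
rewrite !e -p1 -p2; have : tot s = prb s true * tot s + prb s false * tot s by rewrite p1 p2.
set P := prb s true; set Q := prb s false; set r := tot s => h.
have : r * (1 - P - Q) = 0 by lra.
move=> h2; set A := prb t true; set B := prb t false.
transitivity (P * (P * r) + Q * (Q * r) + (A ^+ 2 + B ^+ 2) * (r * (1 - P - Q))).
  by rewrite h2 mulr0 addr0.
ring.
Qed.

End States.

(* Averages of states: observing a refined outcome moves the functionals by the
   expected divergence to the coarser state. *)
Section Refine.
Variables (R : realFieldType) (w : bool -> R) (s : bool -> bool -> R) (t u : bool -> R).
Hypothesis w1 : \sum_a w a = 1.
Hypothesis st : forall b, \sum_a w a * s a b = t b.
Hypothesis w0 : forall a, 0 <= w a.
Hypothesis s0 : forall a, st_ge0 (s a).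
Hypothesis u0 : st_ge0 u.

Lemma refine_ge0 : st_ge0 t.
Proof.
by move=> b; rewrite -(st b); apply: sumr_ge0 => a _; apply: mulr_ge0 (w0 a) (s0 a b).
Qed.

Lemma refine_tot : \sum_a w a * tot (s a) = tot t.
Proof.
rewrite /tot -(st true) -(st false) -big_split /=; apply: eq_bigr => a _.
by rewrite mulrDr.
Qed.

Lemma refine_dev b : \sum_a w a * dev b (s a) u =
  \sum_a w a * dev b (s a) t + dev b t u.
Proof.
have t0 := refine_ge0.
have e v (x : bool -> R) : st_ge0 v -> dev b v x = v b * prb v b - 2 * prb x b * v b + prb x b ^+ 2 * tot v.
  by move=> hv; have := prbM b hv; rewrite /dev; set p := prb v b => <-; ring.
rewrite (eq_bigr (fun a => w a * (s a b * prb (s a) b) - 2 * prb u b * (w a * s a b) +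
   prb u b ^+ 2 * (w a * tot (s a)))); last by move=> a _; rewrite e //; ring.
rewrite [X in _ = X + _](eq_bigr (fun a => w a * (s a b * prb (s a) b) - 2 * prb t b * (w a * s a b) +
   prb t b ^+ 2 * (w a * tot (s a)))); last by move=> a _; rewrite e //; ring.
rewrite !big_split /= !sumrN -!mulr_sumr !st refine_tot e //.
by have := prbM b t0; set p := prb t b => <-; ring.
Qed.

Lemma refine_breg : \sum_a w a * breg (tot (s a)) (tot u) =
  \sum_a w a * breg (tot (s a)) (tot t) + breg (tot t) (tot u).
Proof.
have t0 := refine_ge0.
have e v x : st_ge0 v -> st_ge0 x -> breg (tot v) (tot x) =
    psi (tot v) - psi (tot x) + (tot v - tot x) / (1 + tot x) ^+ 2.
  by move=> hv hx; rewrite (psi_breg (tot_ge0 hv) (tot_ge0 hx)); ring.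
rewrite (eq_bigr (fun a => w a * psi (tot (s a)) - (psi (tot u) + tot u / (1 + tot u) ^+ 2) * w a +
   (1 + tot u) ^- 2 * (w a * tot (s a)))); last by move=> a _; rewrite e //; ring.
rewrite [X in _ = X + _](eq_bigr (fun a => w a * psi (tot (s a)) - (psi (tot t) + tot t / (1 + tot t) ^+ 2) * w a +
   (1 + tot t) ^- 2 * (w a * tot (s a)))); last by move=> a _; rewrite e //; ring.
by rewrite !big_split /= !sumrN -!mulr_sumr !w1 refine_tot e //; ring.
Qed.

(** Since t is the mean of the states s a, the linear part [grad t b] averages out exactly and only
    the remainders are left. *)
Lemma refine_rem c b : 0 < c -> `|\sum_a w a * gfun (s a) b - gfun t b| <=
  c * \sum_a w a * dev b (s a) t + crem c * \sum_a w a * breg (tot (s a)) (tot t).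
Proof.
move=> c0; have t0 := refine_ge0.
have -> : \sum_a w a * gfun (s a) b - gfun t b = \sum_a w a * rema b (s a) t.
  rewrite (eq_bigr (fun a => w a * rema b (s a) t + (gfun t b - grad t b t) * w a +
     (kap (tot t) * (w a * s a b) + t b * dkap (tot t) * (w a * tot (s a))))); last first.
    by move=> a _; rewrite /rema /grad; ring.
  by rewrite !big_split /= -!mulr_sumr w1 st refine_tot /grad; ring.
apply: le_trans (ler_norm_sum _ _ _) _.
rewrite !mulr_sumr -big_split; apply: ler_sum => a _ /=.
rewrite normrM (ger0_norm (w0 a)).
have := rema_le b c0 (s0 a) t0; have := w0 a => ? ?.
have -> : c * (w a * dev b (s a) t) + crem c * (w a * breg (tot (s a)) (tot t)) =
 w a * (c * dev b (s a) t + crem c * breg (tot (s a)) (tot t)) by ring.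
by rewrite ler_wpM2l.
Qed.
End Refine.

(** Bayes' rule behind it: if an event of density r turns the probability P of a label into Q, then
    learning the label turns the density r into r Q / P. So a shift of labels is seen as a
    divergence of densities. The estimate reduces to P + r Q <= (1 + r)^2. *)
Lemma dual_breg (R : realFieldType) (P Q r : R) : 0 < P <= 1 -> 0 <= Q <= 1 -> 0 <= r ->
  theta r * (Q - P) ^+ 2 <= P * breg (r * Q / P) r.
Proof.
move=> /andP[P0 P1] /andP[Q0 Q1] r0; have Pn : P != 0 by rewrite gt_eqF.
have rq : 0 <= r * Q by rewrite mulr_ge0.
have d0 : 0 < P + r * Q by lra.
have s0 : 0 < 1 + r by lra.
have -> : P * breg (r * Q / P) r = r ^+ 2 * (Q - P) ^+ 2 / ((P + r * Q) * (1 + r) ^+ 2).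
  rewrite /breg; field; rewrite Pn gt_eqF //= !gt_eqF //.
have -> : theta r * (Q - P) ^+ 2 = r ^+ 2 * (Q - P) ^+ 2 / ((1 + r) ^+ 2 * (1 + r) ^+ 2).
  by rewrite /theta; field; rewrite gt_eqF.
apply: ler_wpM2l; first by rewrite -exprMn sqr_ge0.
rewrite lef_pV2 ?posrE ?mulr_gt0 ?exprn_gt0 //.
apply: ler_wpM2r; first exact: sqr_ge0.
by nra.
Qed.

(** One vertex y of weight p and one label. g and h are the values of [gfun] on the two sides, with
    index 0 or 1 after rejecting or selecting, and with index x after revealing x. If the selected
    part were exactly the mixture of the revealed ones, only the covariance of [gx] and [hx] would
    be lost. The subtracted terms are that covariance, the first-order deviations from the mixture,
    and the drift of the total weight from p z. *)
Lemma cross_step (R : realFieldType) (I : finType) (p z g g0 g1 h h0 h1 : R)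
    (w gx hx a b : I -> R) :
  0 < p -> 0 <= z <= 256^-1 ->
  0 <= g <= 16^-1 -> 0 <= g0 <= 16^-1 -> 0 <= g1 <= 16^-1 ->
  0 <= h <= 16^-1 -> 0 <= h0 <= 16^-1 -> 0 <= h1 <= 16^-1 ->
  (forall x, 0 <= gx x <= 16^-1) -> (forall x, 0 <= hx x <= 16^-1) ->
  (forall x, 0 <= w x) -> \sum_x w x <= p / 256 ->
  (forall x, 0 <= a x) -> (forall x, 0 <= b x) ->
  (forall x x', 0 < w x -> 0 < w x' -> `|gx x - g| * `|hx x' - h| <= a x + b x') ->
  p * g * h - p * (`|(1 - z) * g0 + z * g1 - g| + `|(1 - z) * h0 + z * h1 - h|)
   - z * (`|\sum_x w x * (gx x - g) - p * z * (g1 - g)|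
        + `|\sum_x w x * (hx x - h) - p * z * (h1 - h)|)
   - 3 * z * \sum_x w x * (a x + b x) - 3 * `|\sum_x w x - p * z|
  <= p * ((1 - z) ^+ 2 * (g0 * h0) + (1 - z) * z * (g0 * h1 + g1 * h0))
     + z * \sum_x w x * (gx x * hx x).
Proof.
move=> p0 /andP[z0 z1] hg hg0 hg1 hh hh0 hh1 hgx hhx w0 W1 a0 b0 ab.
set W := \sum_x w x in W1 *.
set SA := \sum_x w x * (gx x - g); set SB := \sum_x w x * (hx x - h).
set uA := SA - p * z * (g1 - g); set uB := SB - p * z * (h1 - h).
set rA := (1 - z) * g0 + z * g1 - g; set rB := (1 - z) * h0 + z * h1 - h.
set AB := \sum_x w x * (a x + b x).
have W0 : 0 <= W by apply: sumr_ge0.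
have AB0 : 0 <= AB by apply: sumr_ge0 => x _; rewrite mulr_ge0 // addr_ge0.
have dg x : `|gx x - g| <= 16^-1 by have := hgx x; move: hg => /andP[? ?] /andP[? ?]; rewrite ler_norml; lra.
have dh x : `|hx x - h| <= 16^-1 by have := hhx x; move: hh => /andP[? ?] /andP[? ?]; rewrite ler_norml; lra.
have dg1 : `|g1 - g| <= 16^-1 by move: hg hg1 => /andP[? ?] /andP[? ?]; rewrite ler_norml; lra.
have dh1 : `|h1 - h| <= 16^-1 by move: hh hh1 => /andP[? ?] /andP[? ?]; rewrite ler_norml; lra.
have nS (f : I -> R) : (forall x, `|f x| <= 16^-1) -> `|\sum_x w x * f x| <= W / 16.
  move=> hf; apply: le_trans (ler_norm_sum _ _ _) _; rewrite /W mulr_suml; apply: ler_sum => x _.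
  by rewrite normrM (ger0_norm (w0 x)) ler_wpM2l.
have SA1 := nS _ dg; have SB1 := nS _ dh; rewrite -/SA -/SB in SA1 SB1.
have prodE : \sum_x w x * (gx x * hx x) =
   g * h * W + g * SB + h * SA + \sum_x w x * ((gx x - g) * (hx x - h)).
  rewrite /W /SA /SB !mulr_sumr -!big_split /=; apply: eq_bigr => x _; ring.
set SAB := \sum_x w x * ((gx x - g) * (hx x - h)) in prodE.
have SAB1 : `|SAB| <= AB.
  apply: le_trans (ler_norm_sum _ _ _) _; apply: ler_sum => x _.
  rewrite normrM (ger0_norm (w0 x)); have := w0 x; rewrite le0r => /orP[/eqP->|wx].
    by rewrite !mul0r.
  by rewrite ler_wpM2l // normrM ab.
have sasb : `|SA| * `|SB| <= p * (2 * z * AB + `|W - p * z|).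
  have [le|gt] := lerP W (2 * (p * z)); last first.
    have q1 : W <= 2 * `|W - p * z| by have := ler_norm (W - p * z); lra.
    have q2 : `|SA| * `|SB| <= (W / 16) * (W / 16) by apply: ler_pM.
    have q3 : W * W <= p / 256 * W by rewrite ler_wpM2r.
    have q4 : p * W <= p * (2 * `|W - p * z|) by rewrite ler_wpM2l // ltW.
    have q5 : 0 <= p * (2 * z * AB) by rewrite !mulr_ge0 // ltW.
    nra.
  have q : `|SA| * `|SB| <= W * AB.
    apply: (@le_trans _ _ ((\sum_x w x * `|gx x - g|) * (\sum_x w x * `|hx x - h|))).
      apply: ler_pM => //; apply: le_trans (ler_norm_sum _ _ _) _; apply: ler_sum => x _;
      by rewrite normrM (ger0_norm (w0 x)).
    have -> : W * AB = \sum_x \sum_y w x * w y * (a x + b y).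
      rewrite /AB; under [X in _ * X]eq_bigr do rewrite mulrDr.
      rewrite big_split /= mulrDr.
      under [RHS]eq_bigr => x _ do under eq_bigr do rewrite mulrDr.
      under [RHS]eq_bigr => x _ do rewrite big_split /=.
      rewrite big_split /= /W; congr (_ + _).
        rewrite mulrC mulr_suml; apply: eq_bigr => x _.
        by rewrite mulr_sumr; apply: eq_bigr => y _; ring.
      rewrite mulr_suml; apply: eq_bigr => x _.
      by rewrite mulr_sumr; apply: eq_bigr => y _; ring.
    rewrite mulr_suml; apply: ler_sum => x _; rewrite mulr_sumr; apply: ler_sum => y _.
    have := w0 x; rewrite le0r => /orP[/eqP->|wx]; first by rewrite !mul0r.
    have := w0 y; rewrite le0r => /orP[/eqP->|wy]; first by rewrite mulr0 !mul0r mulr0.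
    rewrite mulrACA ler_wpM2l ?ab // mulr_ge0 // ltW //.
  have q1 : W * AB <= 2 * (p * z) * AB by rewrite ler_wpM2r.
  have q2 : 0 <= p * `|W - p * z| by rewrite mulr_ge0 // ltW.
  nra.
have D1 : p * z * (g1 - g) = SA - uA by rewrite /uA; ring.
have D2 : p * z * (h1 - h) = SB - uB by rewrite /uB; ring.
have pz0 : 0 <= p * z by rewrite mulr_ge0 // ltW.
have nD1 : `|SA - uA| <= p * z / 16 by rewrite -D1 normrM (ger0_norm pz0) ler_wpM2l.
have nD2 : `|SB - uB| <= p * z / 16 by rewrite -D2 normrM (ger0_norm pz0) ler_wpM2l.
have uA1 : `|uA| <= p.
  have : `|uA| <= `|SA| + `|SA - uA|.
    by have := ler_normB SA (SA - uA); rewrite opprB addrCA subrr addr0.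
  have : p * z <= p * 256^-1 by rewrite ler_wpM2l // ltW.
  lra.
set er := `|W - p * z| in sasb *.
have er0 : 0 <= er by exact: normr_ge0.
have We : W <= p * z + er by have := ler_norm (W - p * z); rewrite -/er; lra.
(* The cost of replacing the branch where both sides select by a commonly revealed vertex. Each
   factor is expressed through the revealed increments [SA], [SB] up to [uA], [uB]. *)
have last_ : p * z ^+ 2 * ((g1 - g) * (h1 - h)) <=
   2 * z * AB + er + er + z * `|uA| / 16 + z * `|uB| / 16.
  rewrite -(ler_pM2l p0).
  have -> : p * (p * z ^+ 2 * ((g1 - g) * (h1 - h))) = (p * z * (g1 - g)) * (p * z * (h1 - h)) by ring.
  rewrite D1 D2.
  have -> : (SA - uA) * (SB - uB) = SA * SB - uA * SB - (SA - uA) * uB by ring.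
  have t1 : SA * SB <= `|SA| * `|SB| by rewrite -normrM ler_norm.
  have t2 : - (uA * SB) <= `|uA| * (W / 16).
    apply: (@le_trans _ _ `|uA * SB|); first by rewrite -normrN ler_norm.
    by rewrite normrM ler_wpM2l.
  have t3 : - ((SA - uA) * uB) <= p * z / 16 * `|uB|.
    apply: (@le_trans _ _ `|(SA - uA) * uB|); first by rewrite -normrN ler_norm.
    by rewrite normrM ler_wpM2r.
  have t4 : `|uA| * W <= `|uA| * (p * z) + p * er.
    apply: (@le_trans _ _ (`|uA| * (p * z + er))); first by rewrite ler_wpM2l.
    by rewrite mulrDr lerD2l ler_wpM2r.
  have t5 : 0 <= `|uA| * (p * z) by rewrite mulr_ge0.
  have t6 : 0 <= p * z * `|uB| by rewrite mulr_ge0.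
  have t7 : 0 <= p * er by rewrite mulr_ge0 // ltW.
  lra.
have rAn : `|rA| * 16^-1 >= - (rA * ((1 - z) * h0 + z * h1)).
  apply: (@le_trans _ _ `|rA * ((1 - z) * h0 + z * h1)|); first by rewrite -normrN ler_norm.
  rewrite normrM ler_wpM2l // ger0_norm; move: hh0 hh1 => /andP[? ?] /andP[? ?]; nra.
have rBn : `|rB| * 16^-1 >= - (rB * g).
  apply: (@le_trans _ _ `|rB * g|); first by rewrite -normrN ler_norm.
  by rewrite normrM ler_wpM2l // ger0_norm; move: hg => /andP[? ?].
have e1 : p * ((1 - z) ^+ 2 * (g0 * h0) + (1 - z) * z * (g0 * h1 + g1 * h0)) =
  p * (g * h + rA * ((1 - z) * h0 + z * h1) + rB * g) - p * z ^+ 2 * (g1 * h1).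
  by rewrite /rA /rB; ring.
have e2 : p * z ^+ 2 * (g1 * h1) = p * z ^+ 2 * (g * h) + z * g * (p * z * (h1 - h)) +
   z * h * (p * z * (g1 - g)) + p * z ^+ 2 * ((g1 - g) * (h1 - h)) by ring.
rewrite e1 e2 D1 D2 prodE.
have k1 : p * (`|rA| + `|rB|) >= - (p * (rA * ((1 - z) * h0 + z * h1) + rB * g)).
  rewrite -mulrN ler_wpM2l ?(ltW p0) //.
  have := normr_ge0 rA; have := normr_ge0 rB; lra.
have k2 : - (z * g * uB) <= z * `|uB| * 16^-1.
  rewrite -mulrA -mulrN -mulrA ler_wpM2l //.
  apply: (@le_trans _ _ `|g * uB|); first by rewrite -normrN ler_norm.
  by rewrite normrM mulrC ler_wpM2l // ger0_norm; move: hg => /andP[? ?].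
have k3 : - (z * h * uA) <= z * `|uA| * 16^-1.
  rewrite -mulrA -mulrN -mulrA ler_wpM2l //.
  apply: (@le_trans _ _ `|h * uA|); first by rewrite -normrN ler_norm.
  by rewrite normrM mulrC ler_wpM2l // ger0_norm; move: hh => /andP[? ?].
have k4 : - (z * (g * h) * (W - p * z)) <= er.
  apply: (@le_trans _ _ `|z * (g * h) * (W - p * z)|); first by rewrite -normrN ler_norm.
  rewrite normrM -/er ler_piMl // ger0_norm; last first.
    by rewrite !mulr_ge0 //; move: hg hh => /andP[? ?] /andP[? ?].
  have /andP[gp gq] := hg; have /andP[hhp hhq] := hh.
  have gh1 : g * h <= 1 by rewrite mulr_ile1 //; [clear -gq; lra | clear -hhq; lra].
  by rewrite mulr_ile1 ?mulr_ge0 //; clear -z1; lra.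
have k5 : - (z * SAB) <= z * AB.
  rewrite -mulrN ler_wpM2l //; apply: le_trans SAB1; by rewrite -normrN ler_norm.
have z2 : 0 <= z * `|uA| by rewrite mulr_ge0.
have z3 : 0 <= z * `|uB| by rewrite mulr_ge0.
have z4 : 0 <= z * AB by rewrite mulr_ge0.
have goal_eq : p * (g * h + rA * ((1 - z) * h0 + z * h1) + rB * g) -
   (p * z ^+ 2 * (g * h) + z * g * (SB - uB) + z * h * (SA - uA) + p * z ^+ 2 * ((g1 - g) * (h1 - h))) +
   z * (g * h * W + g * SB + h * SA + SAB) =
   p * g * h + p * (rA * ((1 - z) * h0 + z * h1) + rB * g) + z * (g * h) * (W - p * z) +
   z * g * uB + z * h * uA + z * SAB - p * z ^+ 2 * ((g1 - g) * (h1 - h)) by ring.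
rewrite goal_eq; clear -k1 k2 k3 k4 k5 last_ z2 z3 z4 er0; lra.
Qed.

(** * One observation step *)

Section Player.
Variables (R : realFieldType) (I : finType).
Variables (pi : I -> R) (pi2 : I -> I -> R) (M ob : I -> R) (eps : R).
Variables (n n0 n1 : I -> bool -> R) (N : bool -> bool -> I -> I -> R).

(** M x is the probability that x is accepted for observation, so [zetaM] is the overall
    probability. [errM] measures in L1 how weighting the first vertex of a random pair distorts the
    law of the second. [nx] and [nxa] are the states at y once x is revealed, without and with its
    label. *)
Definition zetaM := \sum_x pi x * M x.
Definition errM := \sum_y `|\sum_x pi2 x y * M x - pi y * zetaM|.
Definition nx x y b : R := (\sum_a N a b x y) / tot (n x).
Definition nxa x a y b : R := N a b x y / n x a.
Local Notation z := zetaM.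

Record pairlaw : Prop := Pairlaw {
  pl_ge0 : forall x y, 0 <= pi2 x y;
  pl_sym : forall x y, pi2 x y = pi2 y x;
  pl_marg : forall x, \sum_y pi2 x y = pi x;
  pl_sum : \sum_x pi x = 1;
  pl_eps : 0 <= eps <= 1 }.

(** One side of a step. [n0] and [n1] are the states after rejecting and selecting; [p_sel] records
    how selection arises: some vertex of the face accepts, which is y itself with probability eps
    and another x otherwise. [p_M] factors the acceptance into the cutoff of this side and a factor
    [ob], later the cutoff of the other side, so that only vertices moderate for both sides are
    observed. *)
Record player : Prop := Player {
  p_n0 : forall x, st_ge0 (n0 x);
  p_n1 : forall x, st_ge0 (n1 x);
  p_n : forall x, st_ge0 (n x);
  p_N : forall a b x y, 0 <= N a b x y;
  p_Nsym : forall a b x y, N a b x y = N b a y x;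
  p_marg : forall x a, \sum_y pi2 x y * \sum_b N a b x y = pi x * n x a;
  p_abs : forall a b x y, n x a = 0 -> N a b x y = 0;
  p_mix : forall y b, n y b = (1 - z) * n0 y b + z * n1 y b;
  p_sel : forall y b, z * pi y * n1 y b =
    eps * (pi y * M y * prb (n y) b) + (1 - eps) * \sum_x pi2 x y * M x * nx x y b;
  p_ob : forall x, 0 <= ob x <= 16^-1;
  p_M : forall x, M x = theta (tot (n x)) * ob x }.

(** Expectation over the outcomes of a step seen from one side: rejected, selected while the other
    side rejects, or both select and x is revealed with its label. The branches weigh 1 - z, z (1 -
    z) and, through the sum of pi x M x, again z times z. *)
Definition EA (f : I -> (bool -> R) -> R) : R :=
  \sum_y pi y * ((1 - z) * f y (n0 y) + z * (1 - z) * f y (n1 y)) +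
  z * \sum_x \sum_y pi2 x y * M x * \sum_a prb (n x) a * f y (nxa x a y).

Lemma eq_EA f g : (forall y s, f y s = g y s) -> EA f = EA g.
Proof.
move=> h; rewrite /EA; congr (_ + z * _).
  by apply: eq_bigr => y _; rewrite !h.
apply: eq_bigr => x _; apply: eq_bigr => y _; congr (_ * _).
by apply: eq_bigr => a _; rewrite h.
Qed.

Lemma EAD f g : EA (fun y s => f y s + g y s) = EA f + EA g.
Proof.
rewrite /EA addrACA -big_split /= -mulrDr -big_split /=; congr (_ + z * _).
  by apply: eq_bigr => y _; ring.
apply: eq_bigr => x _; rewrite -big_split /=; apply: eq_bigr => y _.
rewrite -mulrDr -big_split /=; congr (_ * _); apply: eq_bigr => a _; ring.
Qed.

Lemma EAZ k f : EA (fun y s => k * f y s) = k * EA f.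
Proof.
rewrite /EA [RHS]mulrDr [k * (z * _)]mulrCA; congr (_ + z * _); rewrite mulr_sumr.
  by apply: eq_bigr => y _; ring.
apply: eq_bigr => x _; rewrite mulr_sumr; apply: eq_bigr => y _.
rewrite [RHS]mulrCA; congr (_ * _); rewrite mulr_sumr; apply: eq_bigr => a _; ring.
Qed.

Hypotheses (hpi : pairlaw) (hp : player).

Lemma pi_ge0 x : 0 <= pi x.
Proof. by rewrite -(pl_marg hpi) sumr_ge0 // => y _; exact: pl_ge0. Qed.

Lemma M_ge0 x : 0 <= M x.
Proof.
rewrite (p_M hp); have /andP[v0 _] := p_ob hp x.
exact: mulr_ge0 (theta_ge0 (tot_ge0 (p_n hp x))) v0.
Qed.

Lemma M_le x : M x <= 256^-1.
Proof.
rewrite (p_M hp); have /andP[v0 v1] := p_ob hp x.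
have t0 := theta_ge0 (tot_ge0 (p_n hp x)); have t1 := theta_le (tot_ge0 (p_n hp x)).
have -> : 256^-1 = 16^-1 * 16^-1 :> R by field.
exact: ler_pM.
Qed.

Lemma z_ge0 : 0 <= z.
Proof. by apply: sumr_ge0 => x _; rewrite mulr_ge0 ?pi_ge0 ?M_ge0. Qed.

Lemma z_le : z <= 256^-1.
Proof.
apply: le_trans (_ : \sum_x pi x * 256^-1 <= _); last by rewrite -mulr_suml (pl_sum hpi) mul1r.
by apply: ler_sum => x _; rewrite ler_wpM2l ?pi_ge0 ?M_le.
Qed.

Lemma tot_nz x : M x != 0 -> tot (n x) != 0.
Proof.
by apply: contraNneq => e; rewrite (p_M hp) e /theta expr0n /= !mul0r.
Qed.

Lemma nx_ge0 x y : st_ge0 (nx x y).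
Proof.
move=> b; rewrite divr_ge0 ?tot_ge0 //; first by rewrite sumr_ge0 // => a _; exact: p_N hp _ _ _ _.
exact: p_n hp x.
Qed.

Lemma nxa_ge0 x a y : st_ge0 (nxa x a y).
Proof. by move=> b; rewrite divr_ge0 //; [exact: p_N hp _ _ _ _ | exact: p_n hp x a]. Qed.

Lemma prb_nxa x y b : \sum_a prb (n x) a * nxa x a y b = nx x y b.
Proof.
rewrite /nx mulr_suml; apply: eq_bigr => a _; rewrite /prb /nxa.
have [e|ne] := eqVneq (n x a) 0; first by rewrite (p_abs hp) // !mul0r mulr0.
by rewrite mulrAC mulrCA divff // mulr1.
Qed.

Lemma prb_ge0 x a : 0 <= prb (n x) a.
Proof. by have /andP[] := prb01 a (p_n hp x). Qed.

Lemma M_prb x : M x * \sum_a prb (n x) a = M x.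
Proof.
have [->|ne] := eqVneq (M x) 0; first by rewrite mul0r.
by rewrite sum_prb ?mulr1 // tot_nz.
Qed.

Lemma le_EA f g : (forall y s, st_ge0 s -> f y s <= g y s) -> EA f <= EA g.
Proof.
move=> h; have z0 := z_ge0; have z1 := z_le; have p0 := pi_ge0.
apply: lerD.
  apply: ler_sum => y _; rewrite ler_wpM2l //; apply: lerD; rewrite ler_wpM2l ?mulr_ge0 //;
    by [lra | apply: h; [exact: p_n0 hp y | exact: p_n1 hp y] | apply: h; exact: p_n0 hp y | apply: h; exact: p_n1 hp y].
rewrite ler_wpM2l //; apply: ler_sum => x _; apply: ler_sum => y _.
rewrite ler_wpM2l ?mulr_ge0 ?M_ge0 ?(pl_ge0 hpi) //; apply: ler_sum => a _.
by rewrite ler_wpM2l ?prb_ge0 // h //; exact: nxa_ge0.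
Qed.

Lemma marg_y y : \sum_x pi2 x y = pi y.
Proof. by rewrite -(pl_marg hpi); apply: eq_bigr => x _; rewrite (pl_sym hpi). Qed.

(** Only in the revealing branch does y follow a law other than [pi], and there the distortion is
    what [errM] measures. *)
Lemma EA_const h k : (forall y, `|h y| <= k) ->
  `|EA (fun y _ => h y) - \sum_y pi y * h y| <= k * errM.
Proof.
move=> hk; have z0 := z_ge0; have z1 := z_le.
have -> : EA (fun y _ => h y) - \sum_y pi y * h y =
    z * \sum_y h y * (\sum_x pi2 x y * M x - pi y * z).
  rewrite /EA.
  have -> : \sum_x \sum_y pi2 x y * M x * (\sum_a prb (n x) a * h y) =
     \sum_y h y * \sum_x pi2 x y * M x.
    rewrite exchange_big; apply: eq_bigr => y _; rewrite mulr_sumr; apply: eq_bigr => x _.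
    by rewrite -mulr_suml mulrA -(mulrA (pi2 x y)) M_prb; ring.
  rewrite addrAC -sumrB !mulr_sumr -big_split /=; apply: eq_bigr => y _; ring.
rewrite normrM (ger0_norm z0).
have s1 : `|\sum_y h y * (\sum_x pi2 x y * M x - pi y * z)| <= k * errM.
  rewrite /errM mulr_sumr; apply: le_trans (ler_norm_sum _ _ _) _.
  by apply: ler_sum => y _; rewrite normrM ler_wpM2r.
apply: le_trans s1; rewrite ler_piMl //; lra.
Qed.

Lemma sum_w_nx : \sum_y \sum_x pi2 x y * M x * tot (nx x y) <= z.
Proof.
rewrite exchange_big /zetaM; apply: ler_sum => x _.
have [e|ne] := eqVneq (M x) 0.
  by rewrite e mulr0 big1 // => y _; rewrite mulr0 mul0r.
have tn := tot_nz ne.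
have -> : \sum_y pi2 x y * M x * tot (nx x y) =
    M x / tot (n x) * \sum_a \sum_y pi2 x y * \sum_b N a b x y.
  rewrite exchange_big mulr_sumr; apply: eq_bigr => y _.
  by rewrite /tot /nx -mulrDl -/(tot (n x)) !sum_bool; ring.
under eq_bigr do rewrite (p_marg hp).
by rewrite -mulr_sumr sum_bool -/(tot _) mulrCA divfK.
Qed.

Lemma sel_diff y b : \sum_x pi2 x y * M x * nx x y b - pi y * z * n1 y b =
  eps * (\sum_x pi2 x y * M x * nx x y b - pi y * M y * prb (n y) b).
Proof. by rewrite [pi y * z]mulrC (p_sel hp); ring. Qed.

Lemma sum_sel : \sum_y (\sum_x pi2 x y * M x * tot (nx x y) + pi y * M y) <= 2 * z.
Proof. by rewrite big_split /= mulr_natl mulr2n lerD // sum_w_nx. Qed.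

(** Splitting conserves states on average by [p_mix], and the selected part is the mixture of the
    revealed ones except when the accepting vertex is y itself, which has probability eps
    ([sel_diff]). *)
Lemma EA_lin k kk : (forall y b, `|k y b| <= kk) ->
  `|EA (fun y s => \sum_b k y b * s b) - \sum_y pi y * \sum_b k y b * n y b| <= 2 * kk * eps.
Proof.
move=> hk; have z0 := z_ge0; have z1 := z_le.
case: (pickP I) => [y0 _|none]; last first.
  by have := pl_sum hpi; rewrite big1 // => [/esym/eqP|i]; rewrite ?oner_eq0 // => _; have := none i.
have kk0 : 0 <= kk by apply: le_trans (hk y0 true).
have /andP[e0 e1] := pl_eps hpi.
have -> : EA (fun y s => \sum_b k y b * s b) - \sum_y pi y * \sum_b k y b * n y b =
    z * eps * \sum_y \sum_b k y b * (\sum_x pi2 x y * M x * nx x y b - pi y * M y * prb (n y) b).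
  rewrite /EA.
  have -> : \sum_x \sum_y pi2 x y * M x * (\sum_a prb (n x) a * \sum_b k y b * nxa x a y b) =
     \sum_y \sum_b k y b * \sum_x pi2 x y * M x * nx x y b.
    rewrite exchange_big; apply: eq_bigr => y _.
    under [RHS]eq_bigr do rewrite mulr_sumr.
    rewrite exchange_big; apply: eq_bigr => x _.
    by rewrite !sum_bool -!prb_nxa !sum_bool; ring.
  rewrite addrAC -sumrB -mulrA !mulr_sumr -big_split /=; apply: eq_bigr => y _.
  have dt := sel_diff y true; have df := sel_diff y false.
  have mm u v u' v' : eps * (u * v + u' * v') = u * (eps * v) + u' * (eps * v') by ring.
  rewrite !sum_bool mm -dt -df (p_mix hp y true) (p_mix hp y false).
  ring.
rewrite normrM ger0_norm ?mulr_ge0 //.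
have s1 : `|\sum_y \sum_b k y b * (\sum_x pi2 x y * M x * nx x y b - pi y * M y * prb (n y) b)|
   <= kk * (2 * z).
  apply: le_trans (_ : \sum_y kk * (\sum_x pi2 x y * M x * tot (nx x y) + pi y * M y) <= _); last first.
    by rewrite -mulr_sumr ler_wpM2l // sum_sel.
  apply: le_trans (ler_norm_sum _ _ _) _; apply: ler_sum => y _.
  apply: le_trans (ler_norm_sum _ _ _) _.
  apply: le_trans (_ : \sum_b kk * (\sum_x pi2 x y * M x * nx x y b + pi y * M y * prb (n y) b) <= _).
    apply: ler_sum => b _; rewrite normrM; apply: ler_pM => //.
    apply: le_trans (ler_normB _ _) _; apply: lerD.
      rewrite ger0_norm // sumr_ge0 // => x _.
      exact: mulr_ge0 (mulr_ge0 (pl_ge0 hpi x y) (M_ge0 x)) (nx_ge0 x y b).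
    by rewrite ger0_norm //; exact: mulr_ge0 (mulr_ge0 (pi_ge0 y) (M_ge0 y)) (prb_ge0 y b).
  rewrite -mulr_sumr big_split /=; apply: ler_wpM2l => //; apply: lerD.
    rewrite exchange_big; apply: ler_sum => x _; rewrite -mulr_sumr sum_bool lexx //.
  rewrite -mulr_sumr -mulrA M_prb //.
have q : z * eps * (kk * (2 * z)) <= 2 * kk * eps.
  have : 0 <= kk * eps by rewrite mulr_ge0.
  have -> : z * eps * (kk * (2 * z)) = (kk * eps) * (2 * (z * z)) by ring.
  have : z * z <= 1 by rewrite mulr_ile1 //; lra.
  have : 0 <= z * z by rewrite mulr_ge0.
  nra.
by apply: le_trans q; rewrite ler_wpM2l // mulr_ge0.
Qed.

Definition Udev := EA (fun y s => \sum_b dev b s (n y)).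
Definition Bq := EA (fun y s => breg (tot s) (tot (n y))).

Lemma ener_self y : ener (n y) = \sum_b (2 * prb (n y) b - \sum_d prb (n y) d ^+ 2) * n y b.
Proof.
rewrite (ener_dev (n y) (p_n hp y)) [X in _ + X]big1 ?addr0 // => b _.
by rewrite /dev subrr expr0n /= mulr0.
Qed.

(** Expanded at the old state n y, the energy is a linear functional, conserved by [EA_lin], plus
    the variance that makes up [Udev]. *)
Lemma ener_gain : \sum_y pi y * ener (n y) + Udev - 4 * eps <= EA (fun y s => ener s).
Proof.
pose k y b := 2 * prb (n y) b - \sum_d prb (n y) d ^+ 2.
have -> : EA (fun y s => ener s) = EA (fun y s => \sum_b k y b * s b) + Udev.
  rewrite -EAD; apply/eqP; rewrite eq_le; apply/andP; split; apply: le_EA => y s s0;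
  by rewrite (ener_dev (n y) s0).
have hk y b : `|k y b| <= 2.
  have hn := p_n hp y; have /andP[a0 a1] := prb01 true hn; have /andP[b0 b1] := prb01 false hn.
  have := sum_prb_le hn; rewrite !sum_bool => /andP[c0 c1].
  have /andP[d0 d1] := prb01 b hn.
  rewrite /k sum_bool ler_norml; nra.
have := EA_lin hk; rewrite ler_norml => /andP[h1 _].
have e : \sum_y pi y * ener (n y) = \sum_y pi y * \sum_b k y b * n y b.
  by apply: eq_bigr => y _; rewrite ener_self.
rewrite e; lra.
Qed.

(** As for the energy, but the tangent of [psi] also has a constant term, which brings in [errM]
    through [EA_const]. *)
Lemma psi_gain : \sum_y pi y * psi (tot (n y)) + Bq - 2 * errM - 2 * eps
  <= EA (fun y s => psi (tot s)).
Proof.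
pose h y := psi (tot (n y)) + tot (n y) / (1 + tot (n y)) ^+ 2.
pose k y (b : bool) := - (1 + tot (n y)) ^- 2.
have t0 y := tot_ge0 (p_n hp y).
have eqle (u v : R) : u = v -> u <= v by move=> ->.
have -> : EA (fun y s => psi (tot s)) = EA (fun y _ => h y) + EA (fun y s => \sum_b k y b * s b) + Bq.
  rewrite -!EAD; apply/eqP; rewrite eq_le; apply/andP; split; apply: le_EA => y s s0;
  rewrite (psi_breg (tot_ge0 s0) (t0 y)) /h /k sum_bool /tot; apply: eqle; field;
  rewrite -/(tot (n y)); apply: lt0r_neq0; have := t0 y; lra.
have inv1 y : 0 <= (1 + tot (n y))^-1 <= 1 by rewrite invr_ge0 invf_le1; have := t0 y; lra.
have hh y : `|h y| <= 2.
  rewrite /h /psi; have /andP[i0 i1] := inv1 y; have q := t0 y.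
  have -> : tot (n y) / (1 + tot (n y)) ^+ 2 = (1 + tot (n y))^-1 * (1 - (1 + tot (n y))^-1).
    by field; apply: lt0r_neq0; lra.
  rewrite ler_norml; nra.
have hk y b : `|k y b| <= 1.
  rewrite /k normrN -exprVn; have /andP[i0 i1] := inv1 y.
  by rewrite ger0_norm ?exprn_ge0 // exprn_ile1.
have := EA_lin hk; have := EA_const hh; rewrite !ler_norml => /andP[h1 _] /andP[h2 _].
have e : \sum_y pi y * psi (tot (n y)) = \sum_y pi y * h y + \sum_y pi y * \sum_b k y b * n y b.
  rewrite -big_split; apply: eq_bigr => y _ /=; rewrite /h /k sum_bool /tot; ring.
rewrite e; lra.
Qed.

(** [dual_breg] with P and Q the probabilities of label a at y before and after revealing x, and r
    the density at x after revealing y. Both readings come from the same symmetric pair masses N. *)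
Lemma prb_nx_nxa x y a : tot (n x) != 0 -> tot (n y) != 0 ->
  theta (tot (nx y x)) * (prb (nx x y) a - prb (n y) a) ^+ 2 <=
  prb (n y) a * breg (tot (nxa y a x)) (tot (nx y x)).
Proof.
move=> tx ty; have r0 := tot_ge0 (nx_ge0 y x).
have [e|ne] := eqVneq (n y a) 0.
  have -> : prb (nx x y) a = 0.
    rewrite /prb /nx big1 ?mul0r // => d _; rewrite (p_Nsym hp) (p_abs hp) //.
  by rewrite /prb e !mul0r subrr expr0n /= mulr0.
pose rr := \sum_a \sum_b N a b x y.
have e1 : tot (nx y x) = rr / tot (n y).
  rewrite /tot /nx -mulrDl -/(tot (n y)) /rr; congr (_ / _).
  rewrite !sum_bool !(p_Nsym hp _ _ y x); ring.
have e2 : tot (nx x y) = rr / tot (n x).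
  rewrite /tot /nx -mulrDl -/(tot (n x)) /rr; congr (_ / _).
  by rewrite !sum_bool; ring.
pose ra := \sum_d N d a x y.
have e3 : tot (nxa y a x) = ra / n y a.
  rewrite /tot /nxa -mulrDl /ra; congr (_ / _).
  by rewrite !(p_Nsym hp _ _ y x) sum_bool.
have raN : rr = 0 -> ra = 0.
  move=> h0; apply/eqP; rewrite -(andbT (_ == _)) eq_le; apply/andP; split=> //; apply/andP; split; last first.
    by rewrite /ra sumr_ge0 // => d _; exact: p_N hp _ _ _ _.
  rewrite -h0 /rr; apply: ler_sum => d _.
  by rewrite (bigD1 a) //= lerDl sumr_ge0 // => *; exact: p_N hp _ _ _ _.
have P0 : 0 < prb (n y) a <= 1.
  have /andP[_ ->] := prb01 a (p_n hp y); rewrite andbT /prb divr_gt0 // lt_def ?ne ?ty ?(p_n hp y a) //.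
  exact: tot_ge0 (p_n hp y).
have q := dual_breg P0 (prb01 a (nx_ge0 x y)) r0.
apply: le_trans q _; rewrite (_ : tot (nx y x) * _ / _ = tot (nxa y a x)) //.
rewrite e3 e1 /prb -/(tot (nx x y)) e2 /nx -/ra.
have [h0|h0] := eqVneq rr 0; first by rewrite h0 (raN h0) !mul0r.
by field; rewrite h0 tx ty ne.
Qed.

Lemma Bq_half : z * \sum_x \sum_y pi2 x y * M x *
    (\sum_a prb (n x) a * breg (tot (nxa x a y)) (tot (nx x y)) + breg (tot (nx x y)) (tot (n y))) <= Bq.
Proof.
have z0 := z_ge0; have z1 := z_le.
rewrite /Bq /EA -[leLHS]add0r; apply: lerD.
  apply: sumr_ge0 => y _; rewrite mulr_ge0 ?pi_ge0 //.
  have h0 := breg_ge0 (tot_ge0 (p_n0 hp y)) (tot_ge0 (p_n hp y)).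
  have h1 := breg_ge0 (tot_ge0 (p_n1 hp y)) (tot_ge0 (p_n hp y)).
  by rewrite addr_ge0 // mulr_ge0 // ?mulr_ge0 //; lra.
rewrite ler_wpM2l //; apply: ler_sum => x _; apply: ler_sum => y _.
have [->|ne] := eqVneq (M x) 0; first by rewrite mulr0 !mul0r.
rewrite ler_wpM2l ?mulr_ge0 ?M_ge0 ?(pl_ge0 hpi) //.
by rewrite (refine_breg (sum_prb (tot_nz ne)) (prb_nxa x y) (prb_ge0 x) (nxa_ge0 x ^~ y) (p_n hp y)).
Qed.

(** Revealing x shifts the labels of y only as far as revealing the label of y shifts the density at
    x ([prb_nx_nxa]). The factor [ob y] completes the cutoff at y to M y, and the cutoff at x is
    moved to the state after y is revealed; so the roles of x and y can be exchanged in the sum over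
    pairs, and the resulting divergences already occur in [Bq]. *)
Lemma coverage : z * \sum_x \sum_y pi2 x y * M x * (ob y * theta (tot (nx x y)) *
   \sum_b (prb (nx x y) b - prb (n y) b) ^+ 2) <= Bq.
Proof.
have z0 := z_ge0; have z1 := z_le; apply: le_trans Bq_half; rewrite ler_wpM2l //.
pose b1 x y := \sum_a prb (n x) a * breg (tot (nxa x a y)) (tot (nx x y)).
pose b2 x y := breg (tot (nx x y)) (tot (n y)).
have tn x := tot_ge0 (p_n hp x); have tx x y := tot_ge0 (nx_ge0 x y).
have b2_0 x y : 0 <= b2 x y by exact: breg_ge0.
have b1_0 x y : 0 <= b1 x y.
  apply: sumr_ge0 => a _; apply: mulr_ge0 (prb_ge0 x a) (breg_ge0 _ (tx x y)).
  exact: tot_ge0 (nxa_ge0 x a y).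
have M0 := M_ge0.
(* The right side mixes divergences of the pair (x, y) and of (y, x); the symmetry of [pi2] merges
   them after summation. *)
have key x y : M x * (ob y * theta (tot (nx x y)) *
   \sum_b (prb (nx x y) b - prb (n y) b) ^+ 2) <=
   (4^-1 * (M x * b2 x y)) + (2^-1 * (M y * b2 y x) + 4^-1 * (M y * b1 y x)).
  set D := \sum_b _.
  have hD : 0 <= D <= 2.
    rewrite /D sum_bool; have := prb01 true (nx_ge0 x y); have := prb01 false (nx_ge0 x y).
    have := prb01 true (p_n hp y); have := prb01 false (p_n hp y).
    move=> /andP[? ?] /andP[? ?] /andP[? ?] /andP[? ?].
    by rewrite addr_ge0 ?sqr_ge0 //=; nra.
  have /andP[D0 D2] := hD.
  have ox := p_ob hp x; have oy := p_ob hp y; move: ox oy => /andP[ox0 ox1] /andP[oy0 oy1].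
  have := p_M hp x; have := p_M hp y.
  set tA := theta (tot (n x)); set tB := theta (tot (n y)).
  have tA0 : 0 <= tA := theta_ge0 (tn x).
  have tB0 : 0 <= tB := theta_ge0 (tn y).
  move=> My Mx.
  have s1 := theta_breg (tx x y) (tn y); rewrite -/(b2 x y) -/tB in s1.
  have s2 := theta_breg' (tx y x) (tn x); rewrite -/(b2 y x) -/tA in s2.
  have t1 : M x * (ob y * theta (tot (nx x y)) * D) <=
     M x * (ob y * (2 * tB) * D) + 4^-1 * (M x * b2 x y).
    have -> : 4^-1 * (M x * b2 x y) = M x * (4^-1 * b2 x y) by ring.
    rewrite -mulrDr; apply: ler_wpM2l; first exact: M0.
    apply: le_trans (_ : ob y * (2 * tB + 2 * b2 x y) * D <= _).
      by apply: ler_wpM2r => //; apply: ler_wpM2l.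
    have : ob y * D <= 8^-1.
      have -> : 8^-1 = 16^-1 * 2 :> R by field.
      exact: ler_pM.
    move=> q; have := ler_wpM2r (b2_0 x y) q; lra.
  apply: (le_trans t1); rewrite addrC lerD2l.
  have -> : M x * (ob y * (2 * tB) * D) = 2 * (tA * ob x * (M y * D)) by rewrite Mx My; ring.
  have MD0 : 0 <= M y * D by rewrite mulr_ge0.
  have t2 : tA * ob x * (M y * D) <= (2 * theta (tot (nx y x)) + 2 * b2 y x) * ob x * (M y * D).
    by apply: ler_wpM2r => //; apply: ler_wpM2r.
  have t3 : theta (tot (nx y x)) * (M y * D) <= M y * b1 y x.
    have [->|My0] := eqVneq (M y) 0; first by rewrite !mul0r mulr0.
    have [tx0|tx0] := eqVneq (tot (n x)) 0.
      have nz a : n x a = 0.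
        by apply/eqP; rewrite eq_le; apply/andP; split; [rewrite -tx0; exact: le_tot a (p_n hp x) | exact: p_n hp x a].
      have -> : tot (nx y x) = 0.
        by rewrite /tot /nx !sum_bool !(p_Nsym hp _ _ y x) !(p_abs hp) // !addr0 !mul0r addr0.
      rewrite /theta expr0n /= !mul0r; exact: mulr_ge0 (M0 y) (b1_0 y x).
    rewrite mulrCA; apply: ler_wpM2l; first exact: M0.
    rewrite /D /b1 mulr_sumr; apply: ler_sum => a _.
    exact: prb_nx_nxa tx0 (tot_nz My0).
  have th0 : 0 <= theta (tot (nx y x)) := theta_ge0 (tx y x).
  have q1 : ob x * (theta (tot (nx y x)) * (M y * D)) <= 16^-1 * (M y * b1 y x).
    apply: ler_pM => //; exact: mulr_ge0 th0 MD0.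
  have q2 : ob x * (M y * D * b2 y x) <= 16^-1 * (M y * 2 * b2 y x).
    apply: ler_pM => //; first exact: mulr_ge0 MD0 (b2_0 y x).
    by apply: ler_wpM2r => //; apply: ler_wpM2l.
  lra.
apply: (@le_trans _ _ (\sum_x \sum_y (pi2 x y * (4^-1 * (M x * b2 x y)) +
   pi2 x y * (2^-1 * (M y * b2 y x) + 4^-1 * (M y * b1 y x))))).
  apply: ler_sum => x _; apply: ler_sum => y _; rewrite -mulrA -mulrDr.
  by apply: ler_wpM2l; rewrite ?(pl_ge0 hpi) ?key.
under eq_bigr do rewrite big_split /=.
rewrite big_split /= [X in _ + X]exchange_big /= -big_split /=.
apply: ler_sum => x _; rewrite -big_split /=; apply: ler_sum => y _.
rewrite -/(b1 x y) -/(b2 x y) (pl_sym hpi y x) -mulrDr -mulrA; apply: ler_wpM2l.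
  by rewrite (pl_ge0 hpi).
have := mulr_ge0 (M0 x) (b1_0 x y); have := mulr_ge0 (M0 x) (b2_0 x y); lra.
Qed.

Definition EAy y (f : (bool -> R) -> R) : R :=
  pi y * ((1 - z) * f (n0 y) + z * (1 - z) * f (n1 y)) +
  z * \sum_x pi2 x y * M x * \sum_a prb (n x) a * f (nxa x a y).

Lemma EA_y f : EA f = \sum_y EAy y (f y).
Proof. by rewrite /EA exchange_big mulr_sumr -big_split. Qed.

Lemma EA_sumb (f : bool -> I -> (bool -> R) -> R) :
  \sum_y \sum_b EAy y (f b y) = EA (fun y s => \sum_b f b y s).
Proof.
rewrite exchange_big /= sum_bool -!EA_y -EAD; apply: eq_EA => y s.
by rewrite sum_bool.
Qed.

Definition gx x y b : R := \sum_a prb (n x) a * gfun (nxa x a y) b.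
Definition lossf c b y s := c * dev b s (n y) + crem c * breg (tot s) (tot (n y)).

Lemma gx_bd x y b : 0 <= gx x y b <= 16^-1.
Proof.
have hh a := gfun_bd b (nxa_ge0 x a y); rewrite /gx.
apply/andP; split.
  by apply: sumr_ge0 => a _; apply: mulr_ge0 (prb_ge0 x a) _; have /andP[] := hh a.
apply: le_trans (_ : \sum_a prb (n x) a * 16^-1 <= _).
  by apply: ler_sum => a _; rewrite ler_wpM2l ?prb_ge0 //; have /andP[] := hh a.
rewrite -mulr_suml ler_piMl ?invr_ge0 //; by have /andP[] := sum_prb_le (p_n hp x).
Qed.

(** Bounds both first-order errors of [cross_step] at y. Expanding [gfun] at n y, the linear parts
    cancel by [p_mix] and [sel_diff]; Taylor remainders, the eps-discrepancy of the selection and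
    the drift of the weights remain. *)
Lemma rho_u c y b : 0 < c ->
  pi y * `|(1 - z) * gfun (n0 y) b + z * gfun (n1 y) b - gfun (n y) b| +
  z * `|\sum_x pi2 x y * M x * (gx x y b - gfun (n y) b) -
        pi y * z * (gfun (n1 y) b - gfun (n y) b)| <=
  2 * EAy y (lossf c b y) +
  z * (4 * eps * (\sum_x pi2 x y * M x * tot (nx x y) + pi y * M y)) +
  z * (4 * `|\sum_x pi2 x y * M x - pi y * z|).
Proof.
move=> c0; have z0 := z_ge0; have z1 := z_le; have p0 := pi_ge0 y.
have /andP[e0 _] := pl_eps hpi.
have ny := p_n hp y; have n0y := p_n0 hp y; have n1y := p_n1 hp y.
pose lo s := lossf c b y s.
have r0 := rema_le b c0 n0y ny; have r1 := rema_le b c0 n1y ny.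
rewrite -/(lo (n0 y)) -/(lo (n1 y)) in r0 r1.
have l0 : 0 <= lo (n0 y) by apply: le_trans r0.
have l1 : 0 <= lo (n1 y) by apply: le_trans r1.
pose w x := pi2 x y * M x.
have w0 x : 0 <= w x by rewrite mulr_ge0 ?(pl_ge0 hpi) ?M_ge0.
have st_grad s s' (k k' : R) : grad (n y) b (fun d => k * s d + k' * s' d) =
    k * grad (n y) b s + k' * grad (n y) b s' by rewrite /grad /tot; ring.
have rhoE : (1 - z) * gfun (n0 y) b + z * gfun (n1 y) b - gfun (n y) b =
    (1 - z) * rema b (n0 y) (n y) + z * rema b (n1 y) (n y).
  have g : grad (n y) b (n y) = (1 - z) * grad (n y) b (n0 y) + z * grad (n y) b (n1 y).
    rewrite -st_grad {2}/grad /tot -!(p_mix hp) //.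
  by rewrite (rema_taylor b (n0 y) (n y)) (rema_taylor b (n1 y) (n y)) g; ring.
have rho_le : pi y * `|(1 - z) * gfun (n0 y) b + z * gfun (n1 y) b - gfun (n y) b| <=
    pi y * ((1 - z) * lo (n0 y) + z * lo (n1 y)).
  apply: ler_wpM2l => //; rewrite rhoE; apply: le_trans (ler_normD _ _) _.
  rewrite !normrM (ger0_norm z0) ger0_norm; last lra.
  by apply: lerD; apply: ler_wpM2l => //; lra.
pose T := \sum_x w x * \sum_a prb (n x) a * lo (nxa x a y).
pose RR := \sum_x w x * \sum_a prb (n x) a * rema b (nxa x a y) (n y).
have RRT : `|RR| <= T.
  apply: le_trans (ler_norm_sum _ _ _) _; apply: ler_sum => x _.
  rewrite normrM (ger0_norm (w0 x)); apply: ler_wpM2l => //.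
  apply: le_trans (ler_norm_sum _ _ _) _; apply: ler_sum => a _.
  rewrite normrM (ger0_norm (prb_ge0 x a)); apply: ler_wpM2l; first exact: prb_ge0.
  exact: rema_le c0 (nxa_ge0 x a y) ny.
pose G1 := \sum_x w x * grad (n y) b (nx x y).
have wgx x : w x * (gx x y b - gfun (n y) b) =
    w x * grad (n y) b (nx x y) - w x * grad (n y) b (n y) +
    w x * \sum_a prb (n x) a * rema b (nxa x a y) (n y).
  have [M0|Mn] := eqVneq (M x) 0; first by rewrite /w M0 mulr0; ring.
  have P1 := sum_prb (tot_nz Mn).
  rewrite -!mulrBr -mulrDr; congr (_ * _); rewrite /gx.
  have -> : grad (n y) b (nx x y) = \sum_a prb (n x) a * grad (n y) b (nxa x a y).
    rewrite /grad /tot -!prb_nxa !sum_bool; ring.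
  have -> : gfun (n y) b = (\sum_a prb (n x) a) * gfun (n y) b by rewrite P1 mul1r.
  have -> : grad (n y) b (n y) = (\sum_a prb (n x) a) * grad (n y) b (n y) by rewrite P1 mul1r.
  rewrite !mulr_suml -!sumrB -big_split /=; apply: eq_bigr => a _.
  by rewrite (rema_taylor b (nxa x a y) (n y)); ring.
have uE : \sum_x pi2 x y * M x * (gx x y b - gfun (n y) b) -
        pi y * z * (gfun (n1 y) b - gfun (n y) b) =
   (G1 - pi y * z * grad (n y) b (n1 y)) - (\sum_x w x - pi y * z) * grad (n y) b (n y)
   + (RR - pi y * z * rema b (n1 y) (n y)).
  rewrite (eq_bigr _ (fun x _ => wgx x)) (rema_taylor b (n1 y) (n y)).
  by rewrite big_split sumrB /= -/RR -/G1 -mulr_suml; ring.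
have G1E : G1 = grad (n y) b (fun d => \sum_x w x * nx x y d).
  rewrite /grad /tot mulr_sumr -big_split /= mulr_sumr -big_split /=; apply: eq_bigr => x _.
  by rewrite /grad /tot; ring.
pose q d := \sum_x w x * nx x y d.
pose q' d := pi y * M y * prb (n y) d.
have q0 : st_ge0 q by move=> d; apply: sumr_ge0 => x _; apply: mulr_ge0 (w0 x) (nx_ge0 x y d).
have q'0 : st_ge0 q' by move=> d; exact: mulr_ge0 (mulr_ge0 p0 (M_ge0 y)) (prb_ge0 y d).
have Gd : G1 - pi y * z * grad (n y) b (n1 y) = eps * (grad (n y) b q - grad (n y) b q').
  have gs (f g : bool -> R) : (forall d, f d = g d) -> grad (n y) b f = grad (n y) b g.
    by move=> e; rewrite /grad /tot !e.
  have h := st_grad q (n1 y) 1 (- (pi y * z)).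
  have h2 := st_grad q q' eps (- eps).
  rewrite (gs _ (fun d => eps * q d + - eps * q' d)) in h; last first.
    by move=> d; have := sel_diff y d; rewrite -/(q d) -/(q' d) => hh; rewrite mul1r mulNr hh; ring.
  rewrite h2 in h; rewrite G1E; have -> : grad (n y) b (fun d => \sum_x w x * nx x y d) = grad (n y) b q by [].
  by rewrite mulrBr; move: h; rewrite mul1r !mulNr => <-.
have tq : tot q = \sum_x w x * tot (nx x y).
  by rewrite /tot /q -big_split /=; apply: eq_bigr => x _; rewrite mulrDr.
have tq' : tot q' <= pi y * M y.
  rewrite /tot /q' -mulrDr ler_piMr ?mulr_ge0 ?M_ge0 //.
  by have /andP[_] := sum_prb_le ny; rewrite sum_bool.
have nG : `|G1 - pi y * z * grad (n y) b (n1 y)| <=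
   4 * eps * (\sum_x w x * tot (nx x y) + pi y * M y).
  rewrite Gd normrM (ger0_norm e0).
  have h1 := grad_le b ny q0; have h2 := grad_le b ny q'0.
  have h3 := ler_normB (grad (n y) b q) (grad (n y) b q').
  rewrite [4 * eps]mulrC -mulrA; apply: ler_wpM2l => //; rewrite -tq; lra.
have nW : `|(\sum_x w x - pi y * z) * grad (n y) b (n y)| <= 4 * `|\sum_x w x - pi y * z|.
  by rewrite normrM mulrC; apply: ler_wpM2r => //; apply: grad_self.
have nR : `|RR - pi y * z * rema b (n1 y) (n y)| <= T + pi y * z * lo (n1 y).
  apply: le_trans (ler_normB _ _) _; apply: lerD => //.
  by rewrite normrM ger0_norm ?mulr_ge0 //; apply: ler_wpM2l => //; rewrite mulr_ge0.
have u_le : `|\sum_x pi2 x y * M x * (gx x y b - gfun (n y) b) -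
        pi y * z * (gfun (n1 y) b - gfun (n y) b)| <=
   4 * eps * (\sum_x pi2 x y * M x * tot (nx x y) + pi y * M y) + 4 * `|\sum_x pi2 x y * M x - pi y * z| +
   (T + pi y * z * lo (n1 y)).
  rewrite uE; apply: le_trans (ler_normD _ _) _; apply: lerD => //.
  by apply: le_trans (ler_normB _ _) _; apply: lerD.
have T0 : 0 <= T by apply: le_trans RRT.
have u2 := ler_wpM2l z0 u_le.
rewrite /EAy -/(lo (n0 y)) -/(lo (n1 y)).
have -> : \sum_x pi2 x y * M x * (\sum_a prb (n x) a * lossf c b y (nxa x a y)) = T by [].
have pl1 : 0 <= pi y * lo (n1 y) by rewrite mulr_ge0.
have pl0 : 0 <= pi y * lo (n0 y) by rewrite mulr_ge0.
have zT : 0 <= z * T by rewrite mulr_ge0.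
have a1 : z * (z * (pi y * lo (n1 y))) <= 256^-1 * (z * (pi y * lo (n1 y))).
  by apply: ler_wpM2r => //; rewrite mulr_ge0.
have a2 : z * (pi y * lo (n0 y)) <= 256^-1 * (pi y * lo (n0 y)) by apply: ler_wpM2r.
have a3 : 0 <= z * (pi y * lo (n1 y)) by rewrite mulr_ge0.
set Q1 := \sum_x _ * tot (nx x y) in u2 *; set Q2 := `|_ - pi y * z| in u2 *.
set uu := `|_ - pi y * z * (_ - _)| in u2 *; set rr := `|_ - gfun (n y) b| in rho_le *.
lra.
Qed.

Lemma rhou_sum c : 0 < c -> \sum_y \sum_b (
  pi y * `|(1 - z) * gfun (n0 y) b + z * gfun (n1 y) b - gfun (n y) b| +
  z * `|\sum_x pi2 x y * M x * (gx x y b - gfun (n y) b) -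
        pi y * z * (gfun (n1 y) b - gfun (n y) b)|) <=
  2 * c * Udev + 4 * crem c * Bq + (errM + eps).
Proof.
move=> c0; have z0 := z_ge0; have z1 := z_le; have /andP[e0 _] := pl_eps hpi.
apply: le_trans (ler_sum _ (fun y _ => ler_sum _ (fun b _ => rho_u y b c0))) _.
under eq_bigr do rewrite !big_split /= -mulr_sumr !sumr_const card_bool.
rewrite !big_split /= -mulr_sumr EA_sumb.
have -> : EA (fun y s => \sum_b lossf c b y s) = c * Udev + 2 * crem c * Bq.
  rewrite /Udev /Bq -!EAZ -EAD; apply: eq_EA => y s.
  by rewrite /lossf big_split /= -mulr_sumr !sum_bool; ring.
rewrite -!mulr_sumr -/errM.
have h1 := sum_sel; set s1 := \sum_y (_ + _) in h1 *.
have h2 : 0 <= errM by apply: sumr_ge0.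
have h3 : z * (4 * eps * s1) <= z * (4 * eps * (2 * z)).
  by rewrite ler_wpM2l // ler_wpM2l // mulr_ge0.
have h4 : z * z <= 256^-1 * 256^-1 by apply: ler_pM.
have h5 := ler_wpM2l e0 h4.
have h6 := ler_wpM2r h2 z1.
lra.
Qed.

(** The one-sided bound fed into [cross_step] for the product of increments. Its first term is the
    label shift handled by [coverage]; the others sum to [Udev], with the small coefficient c, and
    to [Bq]. *)
Definition acoef c y b x :=
  ob y * theta (tot (nx x y)) * (prb (nx x y) b - prb (n y) b) ^+ 2 +
  \sum_a prb (n x) a * (c * dev b (nxa x a y) (n y) +
     (cpair c + crem c) * breg (tot (nxa x a y)) (tot (n y))).

Lemma crem_ge0 (c : R) : 0 < c -> 0 <= crem c.
Proof. by move=> c0; rewrite /crem addr_ge0 // divr_ge0 // mulr_ge0 // ltW. Qed.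

Lemma cpair_ge0 (c : R) : 0 < c -> 0 <= cpair c.
Proof. by move=> c0; rewrite /cpair addr_ge0 // invr_ge0 mulr_ge0 // ltW. Qed.

Lemma acoef_split c x y b : 0 < c -> M x != 0 ->
  `|gx x y b - gfun (nx x y) b| +
  (theta (tot (nx x y)) * ob y * (prb (nx x y) b - prb (n y) b) ^+ 2
     + c * dev b (nx x y) (n y) + cpair c * breg (tot (nx x y)) (tot (n y))) <= acoef c y b x.
Proof.
move=> c0 Mx; have P1 := sum_prb (tot_nz Mx).
have Pn : forall a, 0 <= prb (n x) a by move=> a; exact: prb_ge0.
have h1 := refine_rem P1 (prb_nxa x y) Pn (nxa_ge0 x ^~ y) b c0.
have h2 := refine_dev (n y) (prb_nxa x y) Pn (nxa_ge0 x ^~ y) b.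
have h3 := refine_breg P1 (prb_nxa x y) Pn (nxa_ge0 x ^~ y) (p_n hp y).
have cr := crem_ge0 c0; have cp := cpair_ge0 c0.
rewrite /acoef.
have -> : \sum_a prb (n x) a * (c * dev b (nxa x a y) (n y) +
     (cpair c + crem c) * breg (tot (nxa x a y)) (tot (n y))) =
   c * (\sum_a prb (n x) a * dev b (nxa x a y) (n y)) +
   (cpair c + crem c) * (\sum_a prb (n x) a * breg (tot (nxa x a y)) (tot (n y))).
  by rewrite !sum_bool; ring.
rewrite h2 h3; set a1 := \sum_a _ * dev _ _ _ in h1 *; set a2 := \sum_a _ * breg _ _ in h1 *.
have a20 : 0 <= a2.
  apply: sumr_ge0 => a _; apply: mulr_ge0 (Pn a) (breg_ge0 _ _); first exact: tot_ge0 (nxa_ge0 x a y).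
  exact: tot_ge0 (nx_ge0 x y).
have b0 : 0 <= breg (tot (nx x y)) (tot (n y)).
  exact: breg_ge0 (tot_ge0 (nx_ge0 x y)) (tot_ge0 (p_n hp y)).
have m1 := mulr_ge0 cp a20; have m2 := mulr_ge0 cr b0.
rewrite -/(gx x y b) in h1.
rewrite [theta _ * ob y]mulrC; lra.
Qed.

Lemma acoef_ge0 c x y b : 0 < c -> 0 <= acoef c y b x.
Proof.
move=> c0; have /andP[v0 _] := p_ob hp y; rewrite /acoef; apply: addr_ge0.
  exact: mulr_ge0 (mulr_ge0 v0 (theta_ge0 (tot_ge0 (nx_ge0 x y)))) (sqr_ge0 _).
apply: sumr_ge0 => a _; apply: mulr_ge0 (prb_ge0 x a) _; apply: addr_ge0.
  exact: mulr_ge0 (ltW c0) (dev_ge0 b _ (nxa_ge0 x a y)).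
apply: mulr_ge0; first exact: addr_ge0 (cpair_ge0 c0) (crem_ge0 c0).
exact: breg_ge0 (tot_ge0 (nxa_ge0 x a y)) (tot_ge0 (p_n hp y)).
Qed.

Lemma acoef_sum c : 0 < c ->
  z * \sum_y \sum_b \sum_x pi2 x y * M x * acoef c y b x <=
  c * Udev + (2 * (cpair c + crem c) + 1) * Bq.
Proof.
move=> c0; have z0 := z_ge0; have z1 := z_le.
have cr := crem_ge0 c0; have cp := cpair_ge0 c0.
pose f y (s : bool -> R) := \sum_b (c * dev b s (n y) + (cpair c + crem c) * breg (tot s) (tot (n y))).
have fE : EA f = c * Udev + 2 * (cpair c + crem c) * Bq.
  rewrite /Udev /Bq -!EAZ -EAD; apply: eq_EA => y s.
  by rewrite /f !sum_bool; ring.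
have f0 y s : st_ge0 s -> 0 <= f y s.
  move=> s0; apply: sumr_ge0 => b _; apply: addr_ge0; first exact: mulr_ge0 (ltW c0) (dev_ge0 b _ s0).
  exact: mulr_ge0 (addr_ge0 cp cr) (breg_ge0 (tot_ge0 s0) (tot_ge0 (p_n hp y))).
have h1 : z * \sum_x \sum_y pi2 x y * M x * \sum_a prb (n x) a * f y (nxa x a y) <= EA f.
  rewrite /EA lerDr; apply: sumr_ge0 => y _; apply: mulr_ge0 (pi_ge0 y) _.
  have q0 := f0 y _ (p_n0 hp y); have q1 := f0 y _ (p_n1 hp y).
  by apply: addr_ge0; apply: mulr_ge0 => //; rewrite ?mulr_ge0 //; lra.
have -> : \sum_y \sum_b \sum_x pi2 x y * M x * acoef c y b x =
  \sum_x \sum_y pi2 x y * M x * (ob y * theta (tot (nx x y)) *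
   \sum_b (prb (nx x y) b - prb (n y) b) ^+ 2) +
  \sum_x \sum_y pi2 x y * M x * \sum_a prb (n x) a * f y (nxa x a y).
  rewrite [X in _ = X + _]exchange_big [X in _ = _ + X]exchange_big -big_split /=.
  apply: eq_bigr => y _; rewrite exchange_big -big_split /=; apply: eq_bigr => x _.
  by rewrite /acoef /f !sum_bool; ring.
have := coverage; rewrite mulrDr; lra.
Qed.

End Player.

(** * The coupled step of both sides *)

Section Star.
Variables (R : realFieldType) (I : finType).
Variables (pi : I -> R) (pi2 : I -> I -> R) (M : I -> R) (eps : R).
Variables (n n0 n1 : I -> bool -> R) (N : bool -> bool -> I -> I -> R).
Variables (m m0 m1 : I -> bool -> R) (L : bool -> bool -> I -> I -> R).
Local Notation z := (zetaM pi M).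
Local Notation er := (errM pi pi2 M).

Definition crossX (pi' : I -> R) (s t : I -> bool -> R) :=
  \sum_y pi' y * \sum_b gfun (s y) b * gfun (t y) (~~ b).

Definition crossEX : R :=
  (1 - z) ^+ 2 * crossX pi n0 m0 + (1 - z) * z * (crossX pi n0 m1 + crossX pi n1 m0) +
  z * \sum_x \sum_a \sum_b M x * (prb (n x) a * prb (m x) b) *
     crossX (pi2 x) (nxa n N x a) (nxa m L x b).

Hypotheses (hpi : pairlaw pi pi2 eps).
Hypotheses (hA : player pi pi2 M (fun x => theta (tot (m x))) eps n n0 n1 N).
Hypotheses (hB : player pi pi2 M (fun x => theta (tot (n x))) eps m m0 m1 L).
Local Notation EAA := (EA pi pi2 M n n0 n1 N).
Local Notation EAB := (EA pi pi2 M m m0 m1 L).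
Local Notation UA := (Udev pi pi2 M n n0 n1 N).
Local Notation UB := (Udev pi pi2 M m m0 m1 L).
Local Notation BA := (Bq pi pi2 M n n0 n1 N).
Local Notation BB := (Bq pi pi2 M m m0 m1 L).
Local Notation gA := (gx n N).
Local Notation gB := (gx m L).

Lemma cross_local c y b : 0 < c ->
  pi y * gfun (n y) b * gfun (m y) (~~ b)
  - pi y * (`|(1 - z) * gfun (n0 y) b + z * gfun (n1 y) b - gfun (n y) b| +
       `|(1 - z) * gfun (m0 y) (~~ b) + z * gfun (m1 y) (~~ b) - gfun (m y) (~~ b)|)
  - z * (`|\sum_x pi2 x y * M x * (gA x y b - gfun (n y) b) -
            pi y * z * (gfun (n1 y) b - gfun (n y) b)| +
         `|\sum_x pi2 x y * M x * (gB x y (~~ b) - gfun (m y) (~~ b)) -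
            pi y * z * (gfun (m1 y) (~~ b) - gfun (m y) (~~ b))|)
  - 3 * z * \sum_x pi2 x y * M x *
     (acoef (fun x => theta (tot (m x))) n N c y b x +
      acoef (fun x => theta (tot (n x))) m L c y (~~ b) x)
  - 3 * `|\sum_x pi2 x y * M x - pi y * z|
  <= pi y * ((1 - z) ^+ 2 * (gfun (n0 y) b * gfun (m0 y) (~~ b)) +
       (1 - z) * z * (gfun (n0 y) b * gfun (m1 y) (~~ b) + gfun (n1 y) b * gfun (m0 y) (~~ b)))
     + z * \sum_x pi2 x y * M x * (gA x y b * gB x y (~~ b)).
Proof.
move=> c0; have z0 := z_ge0 hpi hA; have z1 := z_le hpi hA.
have p0 := pi_ge0 hpi y.
have [py|pn] := eqVneq (pi y) 0.
  have p20 x : pi2 x y = 0.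
    apply/eqP; rewrite eq_le (pl_ge0 hpi) andbT -py -(marg_y hpi y) (bigD1 x) //= lerDl.
    by apply: sumr_ge0 => *; exact: (pl_ge0 hpi).
  rewrite py !mul0r add0r.
  rewrite !big1 /=; try (by move=> x _; rewrite p20 !mul0r).
  by rewrite !subr0 normr0 !(mulr0, addr0, subr0, add0r, oppr0).
have pp : 0 < pi y by rewrite lt_def pn.
apply: cross_step => //.
- by rewrite z0.
- exact: gfun_bd (p_n hA y).
- exact: gfun_bd (p_n0 hA y).
- exact: gfun_bd (p_n1 hA y).
- exact: gfun_bd (p_n hB y).
- exact: gfun_bd (p_n0 hB y).
- exact: gfun_bd (p_n1 hB y).
- by move=> x; exact: (gx_bd hA).
- by move=> x; exact: (gx_bd hB).
- by move=> x; rewrite mulr_ge0 ?(pl_ge0 hpi) ?(M_ge0 hA).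
- rewrite -(marg_y hpi y) mulr_suml; apply: ler_sum => x _.
  by rewrite ler_wpM2l ?(pl_ge0 hpi) ?(M_le hA).
- by move=> x; exact: (acoef_ge0 hA).
- by move=> x; exact: (acoef_ge0 hB).
move=> x x' wx wx'.
have Mx : M x != 0 by apply: contraTneq wx => ->; rewrite mulr0 ltxx.
have Mx' : M x' != 0 by apply: contraTneq wx' => ->; rewrite mulr0 ltxx.
(* Each increment goes through the state with x revealed but not its label. The part due to the
   label is second order and bounded alone; only the remaining parts need [gdiff_pair]. *)
have a1 := acoef_split hA y b c0 Mx; have a2 := acoef_split hB y (~~ b) c0 Mx'.
have gp := gdiff_pair b (~~ b) c0 (nx_ge0 hA x y) (p_n hA y) (nx_ge0 hB x' y) (p_n hB y).
set u := gA x y b in a1 *; set u' := gB x' y (~~ b) in a2 *.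
set v := gfun (nx n N x y) b in a1 gp; set v' := gfun (nx m L x' y) (~~ b) in a2 gp.
have bg := gfun_bd b (p_n hA y); have bh := gfun_bd (~~ b) (p_n hB y).
have bv := gfun_bd b (nx_ge0 hA x y); rewrite -/v in bv.
have bu' := gx_bd hB x' y (~~ b); rewrite -/u' in bu'.
set g := gfun (n y) b in bg gp *; set h := gfun (m y) (~~ b) in bh gp *.
have d1 : `|u' - h| <= 1 by move: bu' bh => /andP[? ?] /andP[? ?]; rewrite ler_norml; lra.
have d2 : `|v - g| <= 1 by move: bv bg => /andP[? ?] /andP[? ?]; rewrite ler_norml; lra.
have s1 : `|u - g| <= `|u - v| + `|v - g|.
  by apply: le_trans (ler_normD _ _); rewrite addrA subrK.
have s2 : `|u' - h| <= `|u' - v'| + `|v' - h|.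
  by apply: le_trans (ler_normD _ _); rewrite addrA subrK.
have s3 : `|u - g| * `|u' - h| <= (`|u - v| + `|v - g|) * `|u' - h| by rewrite ler_wpM2r.
have s4 : `|u - v| * `|u' - h| <= `|u - v| * 1 by rewrite ler_wpM2l.
have s5 : `|v - g| * `|u' - h| <= `|v - g| * (`|u' - v'| + `|v' - h|) by rewrite ler_wpM2l.
have s6 : `|v - g| * `|u' - v'| <= 1 * `|u' - v'| by rewrite ler_wpM2r.
lra.
Qed.

Definition Kst (c : R) := 10 * crem c + 6 * cpair c + 3.

Lemma cross_total c : 0 < c ->
  crossX pi n m - 5 * c * (UA + UB) - Kst c * (BA + BB) - 8 * (er + eps) <= crossEX.
Proof.
move=> c0; have z0 := z_ge0 hpi hA; have z1 := z_le hpi hA.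
have /andP[e0 _] := pl_eps hpi.
have er0 : 0 <= er by apply: sumr_ge0.
have -> : crossEX = \sum_y \sum_b (pi y * ((1 - z) ^+ 2 * (gfun (n0 y) b * gfun (m0 y) (~~ b)) +
       (1 - z) * z * (gfun (n0 y) b * gfun (m1 y) (~~ b) + gfun (n1 y) b * gfun (m0 y) (~~ b)))
     + z * \sum_x pi2 x y * M x * (gA x y b * gB x y (~~ b))).
  under [RHS]eq_bigr do rewrite big_split /=.
  rewrite big_split /=; congr (_ + _).
    rewrite /crossX [X in _ = X](_ : _ = \sum_y ((1 - z) ^+ 2 * (pi y * \sum_b gfun (n0 y) b * gfun (m0 y) (~~ b)) +
      (1 - z) * z * ((pi y * \sum_b gfun (n0 y) b * gfun (m1 y) (~~ b)) + (pi y * \sum_b gfun (n1 y) b * gfun (m0 y) (~~ b))))).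
      by rewrite big_split /= -!mulr_sumr big_split.
    by apply: eq_bigr => y _; rewrite !sum_bool; ring.
  under [RHS]eq_bigr do rewrite -mulr_sumr.
  rewrite -mulr_sumr; congr (_ * _).
  have -> : \sum_y \sum_b \sum_x pi2 x y * M x * (gA x y b * gB x y (~~ b)) =
    \sum_x \sum_y \sum_b pi2 x y * M x * (gA x y b * gB x y (~~ b)).
    by rewrite [RHS]exchange_big; apply: eq_bigr => y _; rewrite exchange_big.
  apply: eq_bigr => x _; rewrite /crossX !sum_bool !mulr_sumr -!big_split /=.
  by apply: eq_bigr => y _; rewrite /gx !sum_bool /=; ring.
apply: le_trans; last first.
  by apply: ler_sum => y _; apply: ler_sum => b _; exact: (cross_local y b c0).
pose rA := \sum_y \sum_b (
  pi y * `|(1 - z) * gfun (n0 y) b + z * gfun (n1 y) b - gfun (n y) b| +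
  z * `|\sum_x pi2 x y * M x * (gA x y b - gfun (n y) b) -
        pi y * z * (gfun (n1 y) b - gfun (n y) b)|).
pose rB := \sum_y \sum_b (
  pi y * `|(1 - z) * gfun (m0 y) b + z * gfun (m1 y) b - gfun (m y) b| +
  z * `|\sum_x pi2 x y * M x * (gB x y b - gfun (m y) b) -
        pi y * z * (gfun (m1 y) b - gfun (m y) b)|).
pose aA := z * \sum_y \sum_b \sum_x pi2 x y * M x * acoef (fun x => theta (tot (m x))) n N c y b x.
pose aB := z * \sum_y \sum_b \sum_x pi2 x y * M x * acoef (fun x => theta (tot (n x))) m L c y b x.
have hrA : rA <= _ := rhou_sum hpi hA c0; have hrB : rB <= _ := rhou_sum hpi hB c0.
have haA : aA <= _ := acoef_sum hpi hA c0; have haB : aB <= _ := acoef_sum hpi hB c0.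
apply: (@le_trans _ _ (crossX pi n m - (rA + rB) - 3 * (aA + aB) - 6 * er)).
  rewrite /Kst; lra.
rewrite le_eqVlt; apply/orP; left; apply/eqP.
have -> : aA + aB = \sum_y z * (\sum_b \sum_x pi2 x y * M x * acoef (fun x => theta (tot (m x))) n N c y b x +
  \sum_b \sum_x pi2 x y * M x * acoef (fun x => theta (tot (n x))) m L c y b x).
  by rewrite /aA /aB -mulrDr -big_split mulr_sumr.
rewrite /rA /rB /errM /crossX; move: (zetaM pi M) => zz.
rewrite !mulr_sumr -!sumrN -!big_split /= -!sumrN -!big_split /=.
apply: eq_bigr => y _; rewrite !sum_bool /=.
have e (f g : I -> R) : \sum_x pi2 x y * M x * (f x + g x) =
   \sum_x pi2 x y * M x * f x + \sum_x pi2 x y * M x * g x.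
  by rewrite -big_split; apply: eq_bigr => x _; rewrite mulrDr.
rewrite !e; ring.
Qed.

Definition CSt (c : R) := 8 + 40 * c + 4 * Kst c.

(** The losses 5 c times [Udev] and [Kst c] times [Bq] in [cross_total] are what [ener_gain] and
    [psi_gain] provide, so adding the potentials with these weights leaves only the errors in er and
    eps. *)
Theorem star c : 0 < c ->
  crossX pi n m + 5 * c * (\sum_y pi y * ener (n y) + \sum_y pi y * ener (m y))
   + Kst c * (\sum_y pi y * psi (tot (n y)) + \sum_y pi y * psi (tot (m y)))
   - CSt c * (er + eps) <=
  crossEX + 5 * c * (EAA (fun _ => @ener R) + EAB (fun _ => @ener R)) +
   Kst c * (EAA (fun _ s => psi (tot s)) + EAB (fun _ s => psi (tot s))).
Proof.
move=> c0; have h := cross_total c0.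
have /andP[e0 _] := pl_eps hpi.
have er0 : 0 <= er by apply: sumr_ge0.
have k0 : 0 <= Kst c by have := crem_ge0 c0; have := cpair_ge0 c0; rewrite /Kst; lra.
have g1 := ler_wpM2l (ltW c0) (ener_gain hpi hA).
have g2 := ler_wpM2l (ltW c0) (ener_gain hpi hB).
have g3 := ler_wpM2l k0 (psi_gain hpi hA).
have g4 := ler_wpM2l k0 (psi_gain hpi hB).
have c1 := mulr_ge0 (ltW c0) e0; have c2 := mulr_ge0 (ltW c0) er0.
have c3 := mulr_ge0 k0 e0; have c4 := mulr_ge0 k0 er0.
rewrite /CSt; lra.
Qed.

End Star.

From mathcomp Require Import all_classical all_reals all_analysis.
Import Order.TTheory GRing.Theory Num.Theory.
Local Open Scope ring_scope.

(** * Links of a weighted complex *)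

Section Links.
Variables (R : realType) (V : finType) (k : nat) (p : {set V} -> R).
Implicit Types (E S : {set V}) (A B : {set V} -> R) (x y : V).

Definition topw : Prop := (forall S, 0 <= p S) /\ (forall S, p S != 0 -> #|S| = k).

(** Conditioning on E is expressed inside the whole complex, with E kept in the faces, so that a
    recursion over E never forms a link. [piE E] and [pi2E E] are the laws of one and of two
    distinct uniform vertices of S outside E; all quotients are 0 when E has mass 0. *)
Definition sm A E : R := \sum_(S : {set V} | E \subset S) p S * A S.
Definition mu E A : R := sm A E / mass p E.
Definition dg E : nat := (k - #|E|)%N.
Definition piE E x : R :=
  if x \in E then 0 else mass p (x |: E) / ((dg E)%:R * mass p E).
Definition pi2E E x y : R := if [|| x \in E, y \in E | x == y] then 0
  else mass p (y |: (x |: E)) / ((dg E)%:R * (dg E).-1%:R * mass p E).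
Definition avgE E (al : V -> R) S : R := (dg E)%:R^-1 * \sum_(x in S :\: E) al x.

Hypothesis hp : topw.
Let p0 S : 0 <= p S. Proof. by case: hp. Qed.

Lemma sum_cover E (f : {set V} -> V -> R) :
  \sum_(x | x \notin E) \sum_(S : {set V} | x |: E \subset S) f S x =
  \sum_(S : {set V} | E \subset S) \sum_(x in S :\: E) f S x.
Proof.
rewrite (exchange_big_dep (fun S : {set V} => E \subset S)) /=; last first.
  by move=> x S _; rewrite finset.subUset => /andP[].
apply: eq_bigr => S ES; apply: eq_bigl => x.
by rewrite finset.subUset finset.sub1set ES andbT finset.in_setD.
Qed.

Lemma dgE E S : E \subset S -> p S != 0 -> #|S :\: E| = dg E.
Proof. by move=> ES pS; rewrite cardsDS // (hp.2 _ pS). Qed.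

Lemma sm_ge0 A E : (forall S, 0 <= A S) -> 0 <= sm A E.
Proof. by move=> A0; apply: sumr_ge0 => S _; rewrite mulr_ge0. Qed.

Lemma mass_ge0 E : 0 <= mass p E.
Proof. exact: sumr_ge0. Qed.

Lemma mass_sm E : mass p E = sm (fun _ => 1) E.
Proof. by apply: eq_bigr => S _; rewrite mulr1. Qed.

Lemma mu_ge0 E A : (forall S, 0 <= A S) -> 0 <= mu E A.
Proof. by move=> A0; rewrite divr_ge0 ?sm_ge0 ?mass_ge0. Qed.

Lemma le_sm A B E : (forall S, A S <= B S) -> sm A E <= sm B E.
Proof. by move=> h; apply: ler_sum => S _; rewrite ler_wpM2l. Qed.

Lemma eq_sm A B E : (forall S, E \subset S -> p S != 0 -> A S = B S) -> sm A E = sm B E.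
Proof.
move=> h; apply: eq_bigr => S ES; have [->|ne] := eqVneq (p S) 0; first by rewrite !mul0r.
by rewrite h.
Qed.

Lemma smD A B E : sm (fun S => A S + B S) E = sm A E + sm B E.
Proof. by rewrite /sm -big_split; apply: eq_bigr => S _; rewrite mulrDr. Qed.

Lemma muD E A B : mu E (fun S => A S + B S) = mu E A + mu E B.
Proof. by rewrite /mu smD mulrDl. Qed.

Lemma eq_mu E A B : (forall S, E \subset S -> p S != 0 -> A S = B S) -> mu E A = mu E B.
Proof. by move=> h; congr (_ / _); exact: eq_sm. Qed.

Lemma smZ c A E : sm (fun S => c * A S) E = c * sm A E.
Proof. by rewrite /sm mulr_sumr; apply: eq_bigr => S _; rewrite mulrCA. Qed.

Lemma sm_sum (I : finType) (f : I -> {set V} -> R) E :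
  sm (fun S => \sum_i f i S) E = \sum_i sm (f i) E.
Proof. by rewrite /sm exchange_big; apply: eq_bigr => S _; rewrite mulr_sumr. Qed.

Lemma sm_mass0 A E : mass p E = 0 -> sm A E = 0.
Proof.
move=> m0; apply: big1 => S ES; have /psumr_eq0P h := m0.
by rewrite h ?mul0r // => *; rewrite p0.
Qed.

Lemma smM_mass A E : mass p E * (sm A E / mass p E) = sm A E.
Proof.
have [e|ne] := eqVneq (mass p E) 0; first by rewrite e mul0r sm_mass0.
by rewrite mulrC divfK.
Qed.

Lemma sm_sub0 A E E' : (forall S, 0 <= A S) -> E \subset E' -> sm A E = 0 -> sm A E' = 0.
Proof.
move=> A0 EE' h; have /psumr_eq0P {}h := h; apply: big1 => S ES; apply: h.
  by move=> *; rewrite mulr_ge0.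
exact: fintype.subset_trans EE' ES.
Qed.

Lemma mass_sub0 E E' : E \subset E' -> mass p E = 0 -> mass p E' = 0.
Proof. by rewrite !mass_sm => h; apply: sm_sub0. Qed.

Lemma mass_le E E' : E \subset E' -> mass p E' <= mass p E.
Proof.
move=> h; rewrite /mass [leRHS](bigID (fun S => E' \subset S)) /= -[leLHS]addr0; apply: lerD.
  rewrite le_eqVlt; apply/orP; left; apply/eqP; apply: eq_bigl => S.
  by case: (boolP (E' \subset S)) => [/(fintype.subset_trans h) ->//|_]; rewrite andbF.
by apply: sumr_ge0.
Qed.

Lemma sum_ext A E (al : V -> R) : \sum_(x | x \notin E) al x * sm A (x |: E) =
  (dg E)%:R * sm (fun S => A S * avgE E al S) E.
Proof.
under eq_bigr do rewrite /sm mulr_sumr.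
rewrite sum_cover /sm mulr_sumr; apply: eq_bigr => S ES; rewrite /avgE.
have [e|ne] := eqVneq (dg E)%:R (0 : R).
  have [pe|pn] := eqVneq (p S) 0; first by rewrite pe big1 => [|x _]; rewrite ?(mul0r, mulr0).
  have c0 : #|S :\: E| = 0%N by rewrite dgE //; apply/eqP; rewrite -(pnatr_eq0 R) e.
  by rewrite e !mul0r (cards0_eq c0) big_set0.
have -> : (dg E)%:R * (p S * (A S * ((dg E)%:R^-1 * \sum_(x in S :\: E) al x))) =
   p S * A S * \sum_(x in S :\: E) al x by field.
by rewrite mulr_sumr; apply: eq_bigr => x _; rewrite mulrC.
Qed.

Lemma avgE1 E S : E \subset S -> p S != 0 -> dg E != 0%N -> avgE E (fun _ => 1) S = 1.
Proof.
move=> ES pS d0; rewrite /avgE sumr_const dgE // mulVf // pnatr_eq0 //.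
Qed.

Lemma sum_ext1 A E : \sum_(x | x \notin E) sm A (x |: E) = (dg E)%:R * sm A E.
Proof.
have := sum_ext A E (fun _ => 1); under eq_bigr do rewrite mul1r.
move=> ->; have [->|d0] := eqVneq (dg E) 0%N; first by rewrite !mul0r.
by congr (_ * _); apply: eq_sm => S ES pS; rewrite avgE1 // mulr1.
Qed.

Lemma dg_ext E x : x \notin E -> dg (x |: E) = (dg E).-1.
Proof. by move=> xE; rewrite /dg cardsU1 xE add1n subnS. Qed.

Lemma piE_ge0 E x : 0 <= piE E x.
Proof. by rewrite /piE; case: ifP => // _; rewrite divr_ge0 ?mulr_ge0 ?mass_ge0. Qed.

Lemma piE_sm E x A : x \notin E -> piE E x * mu (x |: E) A = sm A (x |: E) / ((dg E)%:R * mass p E).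
Proof. by move=> xE; rewrite /piE (negbTE xE) /mu mulrAC smM_mass. Qed.

Lemma sum_piE_al E A (al : V -> R) : 0 < mass p E -> (0 < dg E)%N ->
  \sum_x piE E x * (al x * mu (x |: E) A) = mu E (fun S => A S * avgE E al S).
Proof.
move=> mE dE; rewrite (bigID (fun x => x \in E)) /= big1 ?add0r; last first.
  by move=> x xE; rewrite /piE xE mul0r.
have dn : (dg E)%:R != 0 :> R by rewrite pnatr_eq0 -lt0n.
rewrite /mu -(mulKf dn (sm (fun S => _) E)) -sum_ext mulr_sumr mulr_suml; apply: eq_bigr => x xE.
rewrite mulrCA -/(mu (x |: E) A) piE_sm // invfM; ring.
Qed.

Lemma sum_piE_mu E A : 0 < mass p E -> (0 < dg E)%N -> \sum_x piE E x * mu (x |: E) A = mu E A.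
Proof.
move=> mE dE; have := sum_piE_al A (fun _ => 1) mE dE; under eq_bigr do rewrite mul1r.
move=> ->; congr (_ / _); apply: eq_sm => S ES pS; rewrite avgE1 ?mulr1 // -lt0n //.
Qed.

Lemma sum_piE E : 0 < mass p E -> (0 < dg E)%N -> \sum_x piE E x = 1.
Proof.
move=> mE dE; have := sum_piE_mu (fun _ => 1) mE dE.
have mu1 : mu E (fun _ => 1) = 1 by rewrite /mu -mass_sm divff ?gt_eqF.
rewrite mu1 => <-; apply: eq_bigr => x _.
have [xE|xE] := boolP (x \in E); first by rewrite /piE xE mul0r.
by rewrite piE_sm // -mass_sm /piE (negbTE xE).
Qed.

Lemma pi2E_sym E x y : pi2E E x y = pi2E E y x.
Proof. by rewrite /pi2E orbCA eq_sym finset.setUCA. Qed.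

Lemma pi2E_ge0 E x y : 0 <= pi2E E x y.
Proof. by rewrite /pi2E; case: ifP => // _; rewrite divr_ge0 ?mulr_ge0 ?mass_ge0. Qed.

Lemma pi2E_piE E x y : 0 < mass p E -> pi2E E x y = piE E x * piE (x |: E) y.
Proof.
move=> mE; rewrite /pi2E /piE; case: (boolP (x \in E)) => xE /=; first by rewrite mul0r.
rewrite finset.in_setU1 [y == x]eq_sym; case: (boolP (y \in E)) => yE /=; first by rewrite orbT mulr0.
rewrite orbF; case: (eqVneq x y) => [_|xy]; first by rewrite mulr0.
rewrite dg_ext //; have [e|ne] := eqVneq (mass p (x |: E)) 0.
  by rewrite e mul0r mul0r (mass_sub0 _ e) ?mul0r // subsetU1.
rewrite !invfM; set a := mass p (y |: _); set b := mass p (x |: E) in ne *.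
have -> : b * ((dg E)%:R^-1 / mass p E) * (a * ((dg E).-1%:R^-1 / b)) =
   a * ((dg E)%:R^-1 * (dg E).-1%:R^-1 / mass p E) * (b / b) by ring.
by rewrite divff // mulr1.
Qed.

Lemma pairlawE E : 0 < mass p E -> (1 < dg E)%N -> pairlaw (piE E) (pi2E E) ((dg E)%:R^-1).
Proof.
move=> mE dE; have d0 : (0 < dg E)%N by exact: ltnW.
split; [exact: pi2E_ge0 | exact: pi2E_sym | | exact: sum_piE |].
  move=> x; under eq_bigr do rewrite pi2E_piE //.
  rewrite -mulr_sumr; have [xE|xE] := boolP (x \in E); first by rewrite /piE xE mul0r.
  have [e|ne] := eqVneq (mass p (x |: E)) 0; first by rewrite {1 3}/piE (negbTE xE) e !mul0r.
  rewrite sum_piE ?mulr1 //; first by rewrite lt_def ne mass_ge0.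
  by rewrite dg_ext // -subn1 subn_gt0.
by rewrite invr_ge0 ler0n invf_le1 ?ltr0n // ler1n.
Qed.

Variables (T : finType) (lab : {set V} -> V -> T).
Definition cut A x (a : T) S : R := A S * (lab S x == a)%:R.

Lemma cut_ge0 A x a S : (forall S, 0 <= A S) -> 0 <= cut A x a S.
Proof. by move=> A0; rewrite mulr_ge0. Qed.

Lemma cut_le A x a S : (forall S, 0 <= A S) -> cut A x a S <= A S.
Proof. by move=> A0; rewrite ler_piMr // lern1 leq_b1. Qed.

Lemma sum_cut A x S : \sum_a cut A x a S = A S.
Proof. by rewrite -mulr_sumr (bigD1 (lab S x)) //= eqxx big1 ?addr0 ?mulr1 // => a /negbTE; rewrite eq_sym => ->. Qed.

(** Dividing by [mu E A] gives the total mass at x mean 1 under [piE E], and makes the states after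
    revealing x quotients of [NE] by [nE] ([nE_child]). *)
Definition nE E A x a : R := mu (x |: E) (cut A x a) / mu E A.
Definition NE E A a b x y : R := mu (y |: (x |: E)) (cut (cut A x a) y b) / mu E A.

Lemma nE_ge0 E A x a : (forall S, 0 <= A S) -> 0 <= nE E A x a.
Proof. by move=> A0; rewrite divr_ge0 ?mu_ge0 // => S; rewrite cut_ge0. Qed.

Lemma NE_ge0 E A a b x y : (forall S, 0 <= A S) -> 0 <= NE E A a b x y.
Proof. by move=> A0; rewrite divr_ge0 ?mu_ge0 // => S; rewrite !cut_ge0 // => *; rewrite cut_ge0. Qed.

Lemma NE_sym E A a b x y : NE E A a b x y = NE E A b a y x.
Proof.
rewrite /NE finset.setUCA; congr (_ / _ / _); apply: eq_sm => S _ _.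
by rewrite /cut mulrAC.
Qed.

Lemma NE_abs E A a b x y : (forall S, 0 <= A S) -> mu E A != 0 ->
  nE E A x a = 0 -> NE E A a b x y = 0.
Proof.
move=> A0 mA /eqP; rewrite mulf_eq0 invr_eq0 (negbTE mA) orbF => /eqP h.
rewrite /NE; have -> : mu (y |: (x |: E)) (cut (cut A x a) y b) = 0; last by rewrite mul0r.
rewrite /mu; have h0 : sm (cut A x a) (y |: (x |: E)) = 0.
  move: h; rewrite /mu => /eqP; rewrite mulf_eq0 invr_eq0 => /orP[/eqP h|/eqP h].
    by apply: sm_sub0 h; rewrite ?subsetU1 // => S; rewrite cut_ge0.
  by rewrite sm_mass0 // (mass_sub0 _ h) // subsetU1.
suff -> : sm (cut (cut A x a) y b) (y |: (x |: E)) = 0 by rewrite mul0r.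
apply/eqP; rewrite eq_le; apply/andP; split.
  rewrite -h0; apply: le_sm => S; apply: cut_le => S'; exact: cut_ge0.
by apply: sm_ge0 => S; apply: cut_ge0 => S'; exact: cut_ge0.
Qed.

Lemma sum_NE E A a x y : \sum_b NE E A a b x y = mu (y |: (x |: E)) (cut A x a) / mu E A.
Proof.
rewrite -mulr_suml -mulr_suml -sm_sum; congr (_ / _ / _); apply: eq_sm => S _ _.
by rewrite sum_cut.
Qed.

Lemma sum_nE E A x : \sum_a nE E A x a = mu (x |: E) A / mu E A.
Proof.
rewrite -mulr_suml -mulr_suml -sm_sum; congr (_ / _ / _); apply: eq_sm => S _ _.
by rewrite sum_cut.
Qed.

Lemma NE_marg E A x a : 0 < mass p E -> (1 < dg E)%N ->
  \sum_y pi2E E x y * \sum_b NE E A a b x y = piE E x * nE E A x a.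
Proof.
move=> mE dE; have [xE|xE] := boolP (x \in E).
  rewrite /piE xE mul0r big1 // => y _; by rewrite /pi2E xE mul0r.
rewrite (eq_bigr (fun y => piE E x / mu E A * (piE (x |: E) y * mu (y |: (x |: E)) (cut A x a)))); last first.
  by move=> y _; rewrite sum_NE pi2E_piE //; ring.
rewrite -mulr_sumr /nE mulrAC [RHS]mulrA; congr (_ / _).
have [e|ne] := eqVneq (mass p (x |: E)) 0; first by rewrite /piE (negbTE xE) e !mul0r.
by rewrite sum_piE_mu ?lt_def ?ne ?mass_ge0 // dg_ext // -subn1 subn_gt0.
Qed.

Lemma nE_child E A x a y b : mu E A != 0 ->
  nE (x |: E) (cut A x a) y b = NE E A a b x y / nE E A x a.
Proof.
move=> mA; have h (u v w : R) : w != 0 -> u / w / (v / w) = u / v.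
  by move=> wn; rewrite invfM invrK mulrACA mulVf ?mulr1.
by rewrite /NE [nE E A x a]/nE h.
Qed.

End Links.

Lemma tot_nE (R : realType) (V : finType) (p : {set V} -> R) (lab : {set V} -> V -> bool)
  (E : {set V}) (A : {set V} -> R) x : tot (nE p lab E A x) = mu p (x |: E) A / mu p E A.
Proof. by rewrite -(sum_nE _ lab) sum_bool. Qed.

(** * Splitting off the selected part of an event *)

Section Select.
Variables (R : realType) (V : finType) (k : nat) (p : {set V} -> R).
Variable (lab : {set V} -> V -> bool).
Implicit Types S : {set V}.
Hypothesis hp : topw k p.
Variables (E : {set V}) (A : {set V} -> R) (M ob : V -> R).
Hypotheses (mE : 0 < mass p E) (dE : (1 < dg k E)%N).
Hypotheses (A0 : forall S, 0 <= A S) (mA : 0 < mu p E A).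
Local Notation n := (nE p lab E A).
Local Notation pE := (piE k p).
Local Notation pE2 := (pi2E k p).
Local Notation mup := (mu p).
Local Notation smp := (sm p).
Local Notation z := (zetaM (pE E) M).
Local Notation d := (dg k E)%:R.
Hypothesis hob : forall x, 0 <= ob x <= 16^-1.
Hypothesis hM : forall x, M x = theta (tot (n x)) * ob x.

Definition alw x : R := M x / tot (n x).
(** A uniform vertex x of S outside E accepts with probability [alw x]. Under A the law of x is
    biased by [tot (n x)]; dividing M x by it gives the accepted vertex the weight [piE E x * M x],
    whence [mu_sel1]. The test on the support keeps [sel1] between 0 and A everywhere. *)
Definition sel1 (S : {set V}) : R :=
  if (E \subset S) && (p S != 0) then A S * avgE k E alw S else 0.
Definition sel0 (S : {set V}) : R := A S - sel1 S.

Let d0 : (0 < dg k E)%N. Proof. exact: ltnW. Qed.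
Let dn : d != 0 :> R. Proof. by rewrite pnatr_eq0 -lt0n. Qed.
Let n0 x : st_ge0 (n x). Proof. by move=> b; exact: (nE_ge0 hp). Qed.
Let t0 x : 0 <= tot (n x). Proof. exact: tot_ge0. Qed.

Lemma MM_ge0 x : 0 <= M x.
Proof. by rewrite hM; have /andP[u0 _] := hob x; exact: mulr_ge0 (theta_ge0 (t0 x)) u0. Qed.

Lemma MM_le x : M x <= 256^-1.
Proof.
rewrite hM; have /andP[u0 u1] := hob x.
have -> : 256^-1 = 16^-1 * 16^-1 :> R by field.
exact: ler_pM (theta_ge0 (t0 x)) u0 (theta_le (t0 x)) u1.
Qed.

Lemma zz_bd : 0 <= z <= 256^-1.
Proof.
apply/andP; split.
  by apply: sumr_ge0 => x _; apply: mulr_ge0 (MM_ge0 x); apply: (piE_ge0 hp).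
apply: le_trans (_ : \sum_x pE E x * 256^-1 <= _); last by rewrite -mulr_suml (sum_piE hp) ?mul1r.
by apply: ler_sum => x _; rewrite ler_wpM2l ?MM_le ?(piE_ge0 hp).
Qed.

Lemma alwM x : alw x * tot (n x) = M x.
Proof.
rewrite /alw; have [e|ne] := eqVneq (tot (n x)) 0; last by rewrite divfK.
by rewrite hM e mulr0 /theta expr0n /= !mul0r.
Qed.

Lemma alw_bd x : 0 <= alw x <= 16^-1.
Proof.
have /andP[u0 u1] := hob x; rewrite /alw hM thetaE; have k0 := kap_ge0 (t0 x).
have k1 := kap_le1 (t0 x).
have [e|ne] := eqVneq (tot (n x)) 0; first by rewrite e !mul0r lexx /= invr_ge0 ler0n.
have -> : tot (n x) * kap (tot (n x)) * ob x / tot (n x) = kap (tot (n x)) * ob x by field.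
rewrite mulr_ge0 //=; apply: le_trans u1; rewrite ler_piMl //.
Qed.

Lemma avg_alw S : E \subset S -> p S != 0 -> 0 <= avgE k E alw S <= 1.
Proof.
move=> ES pS; rewrite /avgE; apply/andP; split.
  by rewrite mulr_ge0 ?invr_ge0 // sumr_ge0 // => x _; have /andP[] := alw_bd x.
rewrite mulrC ler_pdivrMr ?ltr0n // mul1r -(dgE hp ES pS) -sumr_const big_mkcond /=.
rewrite [leRHS]big_mkcond; apply: ler_sum => x _; case: ifP => // _.
have /andP[] := alw_bd x; lra.
Qed.

Lemma sel1_bd S : 0 <= sel1 S <= A S.
Proof.
rewrite /sel1; case: ifP => [/andP[ES pS]|_]; last by rewrite lexx A0.
by have /andP[a0 a1] := avg_alw ES pS; rewrite mulr_ge0 ?ler_piMr.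
Qed.

Lemma sel1_ge0 S : 0 <= sel1 S. Proof. by have /andP[] := sel1_bd S. Qed.
Lemma sel0_ge0 S : 0 <= sel0 S. Proof. by have /andP[_ h] := sel1_bd S; rewrite subr_ge0. Qed.
Lemma sel0_le S : sel0 S <= A S. Proof. by rewrite gerBl sel1_ge0. Qed.
Lemma sel01 S : A S = sel0 S + sel1 S. Proof. by rewrite subrK. Qed.

Lemma mu_sel1 : mup E sel1 = z * mup E A.
Proof.
have -> : mup E sel1 = mup E (fun S => A S * avgE k E alw S).
  by congr (_ / _); apply: eq_sm => S ES pS; rewrite /sel1 ES pS.
rewrite -(sum_piE_al hp) // /zetaM mulr_suml; apply: eq_bigr => x _.
rewrite -mulrA; congr (_ * _); rewrite -alwM tot_nE -[RHS]mulrA; congr (_ * _).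
by rewrite divfK // gt_eqF.
Qed.

Lemma mu_sel0 : mup E sel0 = (1 - z) * mup E A.
Proof.
have : mup E A = mup E sel0 + mup E sel1.
  by rewrite -muD; apply: eq_mu => S _ _; exact: sel01.
by rewrite mu_sel1 => h; rewrite mulrBl mul1r {1}h; ring.
Qed.

Lemma cut_sel01 y b : mup (y |: E) (cut lab A y b) =
  mup (y |: E) (cut lab sel0 y b) + mup (y |: E) (cut lab sel1 y b).
Proof. by rewrite -muD; apply: eq_mu => S _ _; rewrite /cut -mulrDl -sel01. Qed.

Lemma z_n1 y b : z * nE p lab E sel1 y b = mup (y |: E) (cut lab sel1 y b) / mup E A.
Proof.
rewrite /nE mu_sel1; have [e|ne] := eqVneq z 0; last first.
  by have mn := lt0r_neq0 mA; field; rewrite mn ne.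
rewrite e !mul0r; have h : mup E sel1 = 0 by rewrite mu_sel1 e mul0r.
have h0 : smp sel1 E = 0.
  by move/eqP: h; rewrite mulf_eq0 invr_eq0 (gt_eqF mE) orbF => /eqP.
have h1 := sm_sub0 hp sel1_ge0 (subsetU1 y E) h0.
suff -> : mup (y |: E) (cut lab sel1 y b) = 0 by rewrite mul0r.
rewrite /mu; suff -> : smp (cut lab sel1 y b) (y |: E) = 0 by rewrite mul0r.
apply/eqP; rewrite eq_le; apply/andP; split.
  by rewrite -h1; apply: (le_sm hp) => S; apply: cut_le; exact: sel1_ge0.
by apply: (sm_ge0 hp) => S; apply: cut_ge0; exact: sel1_ge0.
Qed.

Lemma mixE y b : n y b = (1 - z) * nE p lab E sel0 y b + z * nE p lab E sel1 y b.
Proof.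
have /andP[z0 z1] := zz_bd; have zn : 1 - z != 0 by apply: lt0r_neq0; lra.
rewrite z_n1 /nE mu_sel0 cut_sel01; have mn := lt0r_neq0 mA; field; rewrite mn zn //.
Qed.

(** For a face through y, the accepting vertex is y with probability 1/d, d the number of vertices
    outside E, and a second vertex of the face otherwise. This is the source of eps = 1/d. *)
Lemma selE y b : z * pE E y * nE p lab E sel1 y b =
  d^-1 * (pE E y * M y * prb (n y) b) +
  (1 - d^-1) * \sum_x pE2 E x y * M x * nx n (NE p lab E A) x y b.
Proof.
have [yE|yE] := boolP (y \in E).
  rewrite /piE yE mulr0 !mul0r big1 ?mulr0 ?addr0 // => x _.
  by rewrite /pi2E yE orbT !mul0r.
rewrite -(mulrA z) mulrCA z_n1 mulrA (piE_sm hp) //.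
have -> : smp (cut lab sel1 y b) (y |: E) =
    d^-1 * alw y * smp (cut lab A y b) (y |: E) +
    d^-1 * \sum_(x | x \notin y |: E) alw x * smp (cut lab A y b) (x |: (y |: E)).
  rewrite (sum_ext hp) [d^-1 * (_ * _)]mulrA -!smZ -smD; apply: eq_sm => S; rewrite finset.subUset finset.sub1set => /andP[yS ES] pS.
  rewrite /cut /sel1 ES pS /= /avgE dg_ext // (bigD1 y) /=; last by rewrite finset.in_setD yE.
  have -> : \sum_(x in S :\: E | x != y) alw x = \sum_(x in S :\: (y |: E)) alw x.
    by apply: eq_bigl => x; rewrite !finset.in_setD finset.in_setU1 negb_or andbC andbA.
  have [e|ne] := eqVneq ((dg k E).-1%:R : R) 0; last first.
    have -> : d^-1 * M y / tot (n y) = d^-1 * alw y by rewrite /alw mulrA.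
    by move: (alw y) => al; field; rewrite ne dn.
  by exfalso; move/eqP: e; rewrite pnatr_eq0; move: dE; lia.
have dn1 : (dg k E).-1%:R != 0 :> R by rewrite pnatr_eq0; lia.
have dd : d = 1 + (dg k E).-1%:R :> R by rewrite -[1]/(1%:R) -natrD add1n prednK.
have mn := lt0r_neq0 mA; have En := lt0r_neq0 mE.
have -> : \sum_x pE2 E x y * M x * nx n (NE p lab E A) x y b =
   (d * (dg k E).-1%:R * mass p E)^-1 / mup E A *
   \sum_(x | x \notin y |: E) alw x * smp (cut lab A y b) (x |: (y |: E)).
  rewrite mulr_sumr [RHS]big_mkcond; apply: eq_bigr => x _.
  have nxE : nx n (NE p lab E A) x y b = mup (x |: (y |: E)) (cut lab A y b) / mup E A / tot (n x).
    by rewrite /nx -sum_NE //; congr (_ / _); apply: eq_bigr => a _; rewrite NE_sym.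
  rewrite nxE finset.in_setU1 negb_or pi2E_sym /pi2E (negbTE yE) /= orbC [y == x]eq_sym -negb_or.
  case: ifP => [_|_] /=; first by rewrite !mul0r.
  rewrite /alw -(smM_mass hp (cut lab A y b) (x |: (y |: E))) -/(mup _ _) !invfM; ring.
have e : pE E y * M y * prb (n y) b =
   alw y * (smp (cut lab A y b) (y |: E) / (d * mass p E)) / mup E A.
  rewrite -(piE_sm hp) // /alw /prb [nE p lab E A y b]/nE; ring.
rewrite e; set s1 := smp _ _; set s2 := \sum_(_ | _) _.
move: (alw y) => al; rewrite dd; field; rewrite -?dd ?dn ?dn1 ?En ?mn //.
Qed.

Lemma player_node :
  player (pE E) (pE2 E) M ob d^-1 n (nE p lab E sel0) (nE p lab E sel1) (NE p lab E A).
Proof.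
split => //.
- by move=> x b; apply: (nE_ge0 hp); exact: sel0_ge0.
- by move=> x b; apply: (nE_ge0 hp); exact: sel1_ge0.
- by move=> *; exact: (NE_ge0 hp).
- by move=> *; exact: NE_sym.
- by move=> *; exact: (NE_marg hp).
- by move=> *; apply: (NE_abs hp) => //; exact: lt0r_neq0.
- exact: mixE.
- exact: selE.
Qed.

End Select.

(** * The submartingale at a face of the complex *)

Section NodeStar.
Variables (R : realType) (V : finType) (k : nat) (p : {set V} -> R).
Variable (lab : {set V} -> V -> bool).
Implicit Types (E S : {set V}) (A B : {set V} -> R).

Definition XX E A B : R := crossX (piE k p E) (nE p lab E A) (nE p lab E B).
Definition EE E A : R := \sum_y piE k p E y * ener (nE p lab E A y).
Definition PP E A : R := \sum_y piE k p E y * psi (tot (nE p lab E A y)).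
Definition SS c E A B : R := XX E A B + 5 * c * (EE E A + EE E B) + Kst c * (PP E A + PP E B).

Definition MM E A B x : R := theta (tot (nE p lab E A x)) * theta (tot (nE p lab E B x)).
Definition zE E A B : R := zetaM (piE k p E) (MM E A B).
Definition A1 E A B := sel1 k p lab E A (MM E A B).
Definition A0 E A B := sel0 k p lab E A (MM E A B).

(** The coupled step on events instead of states. The branch weights add up to 1 ([Eout_cst]), so
    this is an expectation to which Jensen's inequality applies; its one-sided marginals
    ([Eout_left], [Eout_right]) are the laws behind [EA]. *)
Definition Eout E A B (Phi : {set V} -> ({set V} -> R) -> ({set V} -> R) -> R) : R :=
  let z := zE E A B in
  (1 - z) ^+ 2 * Phi E (A0 E A B) (A0 E B A) +
  (1 - z) * z * (Phi E (A0 E A B) (A1 E B A) + Phi E (A1 E A B) (A0 E B A)) +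
  z * \sum_x \sum_a \sum_b piE k p E x * MM E A B x *
     (prb (nE p lab E A x) a * prb (nE p lab E B x) b) *
     Phi (x |: E) (cut lab A x a) (cut lab B x b).

Lemma MMC E A B x : MM E A B x = MM E B A x.
Proof. by rewrite /MM mulrC. Qed.

Lemma zEC E A B : zE E A B = zE E B A.
Proof. by apply: eq_bigr => x _; rewrite MMC. Qed.

Hypothesis hp : topw k p.
Variables (E : {set V}) (A B : {set V} -> R).
Hypotheses (mE : 0 < mass p E) (dE : (1 < dg k E)%N).
Hypotheses (A0' : forall S, 0 <= A S) (mA : 0 < mu p E A).
Hypotheses (B0' : forall S, 0 <= B S) (mB : 0 < mu p E B).
Local Notation z := (zE E A B).
Local Notation M := (MM E A B).
Local Notation d := (dg k E)%:R.
Local Notation n := (nE p lab E A).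
Local Notation m := (nE p lab E B).

Let ob_bd (C : {set V} -> R) : (forall S, 0 <= C S) ->
  forall x, 0 <= theta (tot (nE p lab E C x)) <= 16^-1.
Proof.
move=> C0 x; have t0 : 0 <= tot (nE p lab E C x).
  by apply: tot_ge0 => b; exact: (nE_ge0 hp).
by rewrite theta_ge0 ?theta_le.
Qed.

Lemma playerA : player (piE k p E) (pi2E k p E) M (fun x => theta (tot (m x))) d^-1
  n (nE p lab E (A0 E A B)) (nE p lab E (A1 E A B)) (NE p lab E A).
Proof. by apply: player_node => //; exact: ob_bd. Qed.

Lemma MM_funC : MM E B A = M. Proof. by apply: funext => x; rewrite MMC. Qed.

Lemma playerB : player (piE k p E) (pi2E k p E) M (fun x => theta (tot (n x))) d^-1
  m (nE p lab E (A0 E B A)) (nE p lab E (A1 E B A)) (NE p lab E B).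
Proof.
rewrite /A0 /A1 MM_funC; apply: player_node => //; first exact: ob_bd.
by move=> x; rewrite mulrC.
Qed.

Let hpi := pairlawE hp mE dE.

Lemma MMprbA x : M x * \sum_a prb (n x) a = M x. Proof. exact: (M_prb playerA). Qed.
Lemma MMprbB x : M x * \sum_a prb (m x) a = M x. Proof. exact: (M_prb playerB). Qed.

Lemma zE_bd : 0 <= z <= 256^-1.
Proof. by rewrite /zE (z_ge0 hpi playerA) (z_le hpi playerA). Qed.

Lemma EoutD F G : Eout E A B (fun E A B => F E A B + G E A B) = Eout E A B F + Eout E A B G.
Proof.
rewrite /Eout; move: (zE E A B) => w.
have -> : \sum_x \sum_a \sum_b piE k p E x * M x * (prb (n x) a * prb (m x) b) *
    (F (x |: E) (cut lab A x a) (cut lab B x b) + G (x |: E) (cut lab A x a) (cut lab B x b)) =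
  \sum_x \sum_a \sum_b piE k p E x * M x * (prb (n x) a * prb (m x) b) *
    F (x |: E) (cut lab A x a) (cut lab B x b) +
  \sum_x \sum_a \sum_b piE k p E x * M x * (prb (n x) a * prb (m x) b) *
    G (x |: E) (cut lab A x a) (cut lab B x b).
  rewrite -big_split; apply: eq_bigr => x _; rewrite -big_split; apply: eq_bigr => a _.
  by rewrite -big_split; apply: eq_bigr => b _; rewrite mulrDr.
by ring.
Qed.

Lemma EoutZ c F : Eout E A B (fun E A B => c * F E A B) = c * Eout E A B F.
Proof.
rewrite /Eout; move: (zE E A B) => w.
have -> : \sum_x \sum_a \sum_b piE k p E x * M x * (prb (n x) a * prb (m x) b) *
    (c * F (x |: E) (cut lab A x a) (cut lab B x b)) =
  c * \sum_x \sum_a \sum_b piE k p E x * M x * (prb (n x) a * prb (m x) b) *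
    F (x |: E) (cut lab A x a) (cut lab B x b).
  rewrite mulr_sumr; apply: eq_bigr => x _; rewrite mulr_sumr; apply: eq_bigr => a _.
  by rewrite mulr_sumr; apply: eq_bigr => b _; ring.
by ring.
Qed.

Lemma eq_Eout F G : (forall E A B, F E A B = G E A B) -> Eout E A B F = Eout E A B G.
Proof.
move=> h; rewrite /Eout !h; congr (_ + _ * _).
by apply: eq_bigr => x _; apply: eq_bigr => a _; apply: eq_bigr => b _; rewrite h.
Qed.

Lemma Eout_left F : Eout E A B (fun E A _ => F E A) =
  (1 - z) * F E (A0 E A B) + z * (1 - z) * F E (A1 E A B) +
  z * \sum_x \sum_a piE k p E x * M x * prb (n x) a * F (x |: E) (cut lab A x a).
Proof.
rewrite /Eout.
have -> : \sum_x \sum_a \sum_b piE k p E x * M x * (prb (n x) a * prb (m x) b) *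
    F (x |: E) (cut lab A x a) =
  \sum_x \sum_a piE k p E x * M x * prb (n x) a * F (x |: E) (cut lab A x a).
  apply: eq_bigr => x _; apply: eq_bigr => a _.
  rewrite -{2}MMprbB !sum_bool; ring.
ring.
Qed.

Lemma Eout_right F : Eout E A B (fun E _ B => F E B) =
  (1 - z) * F E (A0 E B A) + z * (1 - z) * F E (A1 E B A) +
  z * \sum_x \sum_b piE k p E x * M x * prb (m x) b * F (x |: E) (cut lab B x b).
Proof.
rewrite /Eout.
have -> : \sum_x \sum_a \sum_b piE k p E x * M x * (prb (n x) a * prb (m x) b) *
    F (x |: E) (cut lab B x b) =
  \sum_x \sum_b piE k p E x * M x * prb (m x) b * F (x |: E) (cut lab B x b).
  apply: eq_bigr => x _; rewrite exchange_big; apply: eq_bigr => b _.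
  rewrite -{2}MMprbA !sum_bool; ring.
ring.
Qed.

Lemma Eout_cst c : Eout E A B (fun _ _ _ => c) = c.
Proof.
rewrite (Eout_left (fun _ _ => c)).
have -> : \sum_x \sum_a piE k p E x * M x * prb (n x) a * c = c * z.
  rewrite /zE /zetaM mulr_sumr; apply: eq_bigr => x _.
  rewrite -{2}MMprbA !sum_bool; ring.
ring.
Qed.

Lemma EA_node (C D : {set V} -> R) (f : (bool -> R) -> R) : (forall S, 0 <= C S) -> 0 < mu p E C ->
  EA (piE k p E) (pi2E k p E) M (nE p lab E C) (nE p lab E (A0 E C D)) (nE p lab E (A1 E C D))
     (NE p lab E C) (fun _ => f) =
  (1 - z) * (\sum_y piE k p E y * f (nE p lab E (A0 E C D) y)) +
  z * (1 - z) * (\sum_y piE k p E y * f (nE p lab E (A1 E C D) y)) +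
  z * \sum_x \sum_a piE k p E x * M x * prb (nE p lab E C x) a *
     (\sum_y piE k p (x |: E) y * f (nE p lab (x |: E) (cut lab C x a) y)).
Proof.
move=> C0 mC; rewrite /EA -/z; congr (_ + _ * _).
  rewrite !mulr_sumr -big_split; apply: eq_bigr => y _ /=; ring.
apply: eq_bigr => x _.
under [RHS]eq_bigr do rewrite mulr_sumr.
rewrite exchange_big; apply: eq_bigr => y _; rewrite mulr_sumr; apply: eq_bigr => a _.
rewrite (pi2E_piE hp _ _ mE) -[nE p lab (x |: E) (cut lab C x a) y](_ : nxa (nE p lab E C) (NE p lab E C) x a y = _).
  ring.
by apply: funext => b; rewrite nE_child // gt_eqF.
Qed.

Theorem node_star c : 0 < c ->
  SS c E A B - CSt c * (errM (piE k p E) (pi2E k p E) M + d^-1) <= Eout E A B (SS c).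
Proof.
move=> c0; have := star hpi playerA playerB c0.
have -> : crossEX (piE k p E) (pi2E k p E) M n (nE p lab E (A0 E A B)) (nE p lab E (A1 E A B))
   (NE p lab E A) m (nE p lab E (A0 E B A)) (nE p lab E (A1 E B A)) (NE p lab E B) =
   Eout E A B XX.
  rewrite /crossEX /Eout -/z; congr (_ + _ * _); apply: eq_bigr => x _; apply: eq_bigr => a _.
  apply: eq_bigr => b _; rewrite /XX /crossX !mulr_sumr; apply: eq_bigr => y _.
  rewrite (pi2E_piE hp _ _ mE).
  have eA : nE p lab (x |: E) (cut lab A x a) y = nxa n (NE p lab E A) x a y.
    by apply: funext => e; rewrite nE_child // gt_eqF.
  have eB : nE p lab (x |: E) (cut lab B x b) y = nxa m (NE p lab E B) x b y.
    by apply: funext => e; rewrite nE_child // gt_eqF.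
  rewrite eA eB; ring.
rewrite (EA_node B (@ener R) A0' mA) (EA_node B (fun s => psi (tot s)) A0' mA).
rewrite (EA_node A (@ener R) B0' mB) (EA_node A (fun s => psi (tot s)) B0' mB).
have -> : Eout E A B (SS c) = Eout E A B XX +
    5 * c * (Eout E A B (fun E A _ => EE E A) + Eout E A B (fun E _ B => EE E B)) +
    Kst c * (Eout E A B (fun E A _ => PP E A) + Eout E A B (fun E _ B => PP E B)).
  by rewrite -!EoutD -!EoutZ -!EoutD.
by rewrite !Eout_left !Eout_right.
Qed.

End NodeStar.

(** * Exchange sums *)

Section PairSum.
Variables (R : realType) (V : finType) (k : nat) (p : {set V} -> R).
Hypothesis hp : topw k p.
Variable (Lam : R).
Hypothesis Lam1 : 1 <= Lam.
Implicit Types (E S : {set V}) (A B : {set V} -> R).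

Definition dis (T : finType) (lab : {set V} -> V -> T) (E' E S S' : {set V}) : nat :=
  #|[set x in E' :\: E | lab S x != lab S' x]|.

(** The prefactor is the probability of E' divided by the square of [mass p E'], which turns the
    double sum into an expectation over independent S and S' above E'. *)
Definition Zex (T : finType) (lab : {set V} -> V -> T) l E A B : R :=
  \sum_(E' : {set V} | (E \subset E') && (#|E'| == #|E| + l)%N)
    ('C(k - #|E|, l)%:R * mass p E * mass p E')^-1 *
    \sum_(S : {set V} | E' \subset S) \sum_(S' : {set V} | E' \subset S')
      p S * A S * (p S' * B S') * Lam ^+ dis lab E' E S S'.

Definition GG (T : finType) (lab : {set V} -> V -> T) h E A B : R :=
  \sum_(l < h.+1) Zex lab l E A B.

Let p0 S : 0 <= p S. Proof. by case: hp. Qed.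
Let L0 : 0 <= Lam. Proof. exact: le_trans Lam1. Qed.

(** Coarser labels disagree less often and Lam >= 1. This transfers an upper bound for labels in
    [Sigma] to every two-valued labelling derived from them. *)
Lemma Zex_le (T T' : finType) (lab : {set V} -> V -> T) (lab' : {set V} -> V -> T') l E A B A' B' :
  (forall S, 0 <= A S <= A' S) -> (forall S, 0 <= B S <= B' S) ->
  (forall S S' x, lab' S x = lab' S' x -> lab S x = lab S' x) ->
  Zex lab l E A B <= Zex lab' l E A' B'.
Proof.
move=> hA hB hl; apply: ler_sum => E' _; apply: ler_wpM2l.
  by rewrite invr_ge0 !mulr_ge0 ?(mass_ge0 hp).
apply: ler_sum => S _; apply: ler_sum => S' _.
have /andP[a0 a1] := hA S; have /andP[b0 b1] := hB S'.
apply: ler_pM; rewrite ?mulr_ge0 ?exprn_ge0 //.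
  by apply: ler_pM; rewrite ?mulr_ge0 //; apply: ler_wpM2l.
rewrite ler_weXn2l // subset_leq_card //; apply/fintype.subsetP => x; rewrite !inE => /andP[-> h].
by apply: contraNneq h => /hl ->.
Qed.

Lemma Zex_ge0 (T : finType) (lab : {set V} -> V -> T) l E A B :
  (forall S, 0 <= A S) -> (forall S, 0 <= B S) -> 0 <= Zex lab l E A B.
Proof.
move=> hA hB; apply: sumr_ge0 => E' _; apply: mulr_ge0.
  by rewrite invr_ge0 !mulr_ge0 ?(mass_ge0 hp).
by apply: sumr_ge0 => S _; apply: sumr_ge0 => S' _; rewrite !mulr_ge0 ?exprn_ge0.
Qed.

Variables (T : finType) (lab : {set V} -> V -> T).
Local Notation Z := (Zex lab).
Local Notation G := (GG lab).

Lemma ZexDl l E A A' B : Z l E (fun S => A S + A' S) B = Z l E A B + Z l E A' B.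
Proof.
rewrite -big_split; apply: eq_bigr => E' _ /=; rewrite -mulrDr; congr (_ * _).
rewrite -big_split; apply: eq_bigr => S _ /=; rewrite -big_split; apply: eq_bigr => S' _ /=; ring.
Qed.

Lemma ZexDr l E A B B' : Z l E A (fun S => B S + B' S) = Z l E A B + Z l E A B'.
Proof.
rewrite -big_split; apply: eq_bigr => E' _ /=; rewrite -mulrDr; congr (_ * _).
rewrite -big_split; apply: eq_bigr => S _ /=; rewrite -big_split; apply: eq_bigr => S' _ /=; ring.
Qed.

Lemma GGDl h E A A' B : G h E (fun S => A S + A' S) B = G h E A B + G h E A' B.
Proof. by rewrite -big_split; apply: eq_bigr => l _; rewrite ZexDl. Qed.

Lemma GGDr h E A B B' : G h E A (fun S => B S + B' S) = G h E A B + G h E A B'.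
Proof. by rewrite -big_split; apply: eq_bigr => l _; rewrite ZexDr. Qed.

Lemma GG_ge0 h E A B : (forall S, 0 <= A S) -> (forall S, 0 <= B S) -> 0 <= G h E A B.
Proof. by move=> hA hB; apply: sumr_ge0 => l _; exact: Zex_ge0. Qed.

Lemma Zex0 E A B : Z 0 E A B = mu p E A * mu p E B.
Proof.
rewrite /Zex (big_pred1 E); last first.
  move=> E' /=; rewrite addn0; apply/andP/eqP => [[h1 /eqP h2]|->]; last by rewrite eqxx.
  by apply/esym/eqP; rewrite eqEcard h1 h2 leqnn.
rewrite bin0 mul1r invfM /mu mulrACA mulrC; congr (_ * _).
rewrite /sm mulr_suml; apply: eq_bigr => S _; rewrite mulr_sumr; apply: eq_bigr => S' _.
have -> : dis lab E E S S' = 0%N.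
  by rewrite /dis finset.setDv; apply/eqP; rewrite cards_eq0; apply/eqP/setP => x; rewrite !inE.
by rewrite expr0 mulr1.
Qed.

Lemma sum_labels S S' x A B : \sum_a \sum_b Lam ^+ (a != b) * (cut lab A x a S * cut lab B x b S') =
  Lam ^+ (lab S x != lab S' x) * (A S * B S').
Proof.
rewrite (bigD1 (lab S x)) //= [X in _ + X]big1 ?addr0; last first.
  by move=> a ne; rewrite big1 // => b _; rewrite /cut [lab S x == a]eq_sym (negbTE ne) mulr0 mul0r mulr0.
rewrite (bigD1 (lab S' x)) //= [X in _ + X]big1 ?addr0; last first.
  by move=> b ne; rewrite /cut [lab S' x == b]eq_sym (negbTE ne) !mulr0.
by rewrite /cut !eqxx !mulr1.
Qed.

(** x is the first revealed vertex of E' outside E. Each E' then occurs l + 1 times, matched by (l +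
    1) C(d, l + 1) = d C(d - 1, l). *)
Lemma ZexS l E A B : 0 < mass p E -> Z l.+1 E A B =
  \sum_x piE k p E x * \sum_a \sum_b Lam ^+ (a != b) * Z l (x |: E) (cut lab A x a) (cut lab B x b).
Proof.
move=> mE.
pose W (E' : {set V}) : R := \sum_(S : {set V} | E' \subset S) \sum_(S' : {set V} | E' \subset S')
      p S * A S * (p S' * B S') * Lam ^+ dis lab E' E S S'.
pose w (E' : {set V}) : R := ((dg k E)%:R * 'C((dg k E).-1, l)%:R * mass p E * mass p E')^-1 * W E'.
have step x : x \notin E -> piE k p E x * (\sum_a \sum_b Lam ^+ (a != b) *
     Z l (x |: E) (cut lab A x a) (cut lab B x b)) =
   \sum_(E' : {set V} | (x |: E \subset E') && (#|E'| == #|E| + l.+1)%N) w E'.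
  move=> xE; pose u (E' : {set V}) : R := ('C((dg k E).-1, l)%:R * mass p (x |: E) * mass p E')^-1.
  have -> : \sum_a \sum_b Lam ^+ (a != b) * Z l (x |: E) (cut lab A x a) (cut lab B x b) =
    \sum_(E' : {set V} | (x |: E \subset E') && (#|E'| == #|E| + l.+1)%N) u E' * W E'.
    have cE : (#|x |: E| + l = #|E| + l.+1)%N by rewrite cardsU1 xE addnS.
    have dgx := dg_ext k xE; rewrite /dg in dgx.
    rewrite /Zex cE dgx -/(dg k E).
    transitivity (\sum_(E' : {set V} | (x |: E \subset E') && (#|E'| == #|E| + l.+1)%N) u E' *
      \sum_a \sum_b Lam ^+ (a != b) * \sum_(S : {set V} | E' \subset S) \sum_(S' : {set V} | E' \subset S')
      p S * cut lab A x a S * (p S' * cut lab B x b S') * Lam ^+ dis lab E' (x |: E) S S').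
      under eq_bigr do under eq_bigr do rewrite mulr_sumr.
      under eq_bigr do rewrite exchange_big.
      rewrite exchange_big; apply: eq_bigr => E' _; rewrite [RHS]mulr_sumr; apply: eq_bigr => a _.
      by rewrite [RHS]mulr_sumr; apply: eq_bigr => b _; rewrite mulrCA.
    apply: eq_bigr => E' /andP[xE' _]; congr (_ * _).
    have xin : x \in E' by apply: (fintype.subsetP xE'); rewrite setU11.
    under eq_bigr do under eq_bigr do rewrite mulr_sumr.
    under eq_bigr do rewrite exchange_big.
    rewrite exchange_big; apply: eq_bigr => S _.
    under eq_bigr do under eq_bigr do rewrite mulr_sumr.
    under eq_bigr do rewrite exchange_big.
    rewrite exchange_big; apply: eq_bigr => S' _.
    have -> : dis lab E' E S S' = ((lab S x != lab S' x) + dis lab E' (x |: E) S S')%N.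
      rewrite /dis (cardsD1 x) !inE xE xin /=; congr (_ + _)%N.
      apply: eq_card => y; rewrite !inE negb_or; case: (y == x) => //=.
    rewrite exprD.
    transitivity (p S * p S' * Lam ^+ dis lab E' (x |: E) S S' *
      \sum_a \sum_b Lam ^+ (a != b) * (cut lab A x a S * cut lab B x b S')).
      rewrite mulr_sumr; apply: eq_bigr => a _; rewrite mulr_sumr; apply: eq_bigr => b _; ring.
    by rewrite sum_labels; ring.
  rewrite mulr_sumr; apply: eq_bigr => E' /andP[xE' _]; rewrite mulrA; congr (_ * _).
  rewrite /piE (negbTE xE) /u.
  have [e|ne] := eqVneq (mass p (x |: E)) 0.
    by rewrite (mass_sub0 hp xE' e) e !(mul0r, mulr0, invr0).
  rewrite !invfM; set q := mass p (x |: E) in ne *.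
  have -> : q * ((dg k E)%:R^-1 / mass p E) * ('C((dg k E).-1, l)%:R^-1 / q / mass p E') =
    (dg k E)%:R^-1 / 'C((dg k E).-1, l)%:R / mass p E / mass p E' * (q / q) by ring.
  by rewrite divff ?mulr1.
rewrite [RHS](bigID (fun x => x \in E)) /= [X in _ = X + _]big1 ?add0r; last first.
  by move=> x xE; rewrite /piE xE mul0r.
rewrite (eq_bigr _ step) (exchange_big_dep (fun E' : {set V} => (E \subset E') && (#|E'| == #|E| + l.+1)%N)) /=; last first.
  by move=> x E' _ /andP[h ->]; rewrite andbT; apply: fintype.subset_trans h; exact: subsetU1.
apply: eq_bigr => E' /andP[EE' /eqP cE'].
rewrite sumr_const.
have -> : #|[pred x | (x \notin E) && ((x |: E \subset E') && (#|E'| == #|E| + l.+1)%N)]| = l.+1.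
  transitivity #|E' :\: E|; last by rewrite cardsDS // cE' addKn.
  apply: eq_card => x; rewrite !inE finset.subUset finset.sub1set EE' cE' eqxx !andbT //.
rewrite /w -mulrnAl -[X in _ = X * _]mulr_natl; congr (_ * _).
have e : ((dg k E)%:R * 'C((dg k E).-1, l)%:R = l.+1%:R * 'C(dg k E, l.+1)%:R :> R).
  by rewrite -!natrM mul_bin_diag.
have ln : l.+1%:R != 0 :> R by rewrite pnatr_eq0.
by rewrite e -/(dg k E) -!mulrA [X in _ = _ * X]invfM [RHS]mulrA divff // mul1r.
Qed.

Lemma GGS h E A B : 0 < mass p E -> G h.+1 E A B = mu p E A * mu p E B +
  \sum_x piE k p E x * \sum_a \sum_b Lam ^+ (a != b) * G h (x |: E) (cut lab A x a) (cut lab B x b).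
Proof.
move=> mE; rewrite /GG big_ord_recl Zex0; congr (_ + _).
under eq_bigr do rewrite lift0 ZexS //.
rewrite exchange_big; apply: eq_bigr => x _; rewrite -mulr_sumr; congr (_ * _).
rewrite exchange_big; apply: eq_bigr => a _; rewrite exchange_big; apply: eq_bigr => b _.
by rewrite mulr_sumr.
Qed.

Lemma GG_incr h E A B : (forall S, 0 <= A S) -> (forall S, 0 <= B S) -> G h E A B <= G h.+1 E A B.
Proof. by move=> hA hB; rewrite /GG [leRHS]big_ord_recr /= lerDl Zex_ge0. Qed.

Lemma GG_mu h E A B : (forall S, 0 <= A S) -> (forall S, 0 <= B S) -> mu p E A * mu p E B <= G h E A B.
Proof.
by move=> hA hB; rewrite /GG big_ord_recl Zex0 lerDl sumr_ge0 // => l _; exact: Zex_ge0.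
Qed.

End PairSum.

(** * Scalar estimates for the recursions *)

Section Bounds.
Variables (R : realType).

Lemma ln_ge (t : R) : 0 < t -> - ln t <= t^-1 - 1.
Proof.
move=> t0; have := expR_ge1Dx (- ln t); rewrite expRN lnK ?posrE //; lra.
Qed.

(** Jensen's inequality in disguise: with Y the mean of the exponents, the tangent lines of exp at Y
    add up to exp Y. *)
Lemma expR_tangent (y Y : R) : expR Y * (1 + y - Y) <= expR y.
Proof.
have -> : expR y = expR Y * expR (y - Y) by rewrite -expRD addrC subrK.
rewrite ler_wpM2l ?expR_ge0 //; have := expR_ge1Dx (y - Y); lra.
Qed.

Lemma theta_near (r : R) : 0 <= r -> 16^-1 - `|r - 1| / 8 <= theta r.
Proof.
move=> r0; have h : 0 < 1 + r by lra.
(* In this variable r / (1 + r)^2 is (1 - x^2) / 4, with maximum at r = 1. *)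
pose x := (r - 1) / (1 + r).
have -> : theta r = (4^-1 - x ^+ 2 / 4) ^+ 2 by rewrite /theta /x; field; rewrite gt_eqF.
have x1 : `|x| <= `|r - 1|.
  rewrite normrM normfV (gtr0_norm h) ler_pdivrMr // ler_peMr //; lra.
have x2 : x ^+ 2 <= `|x|.
  have : `|x| <= 1.
    rewrite normrM normfV (gtr0_norm h) ler_pdivrMr // mul1r ler_norml; lra.
  by rewrite -real_normK ?num_real // expr2 => ?; rewrite ler_piMl.
have x0 := sqr_ge0 x.
set q := x ^+ 2 in x2 x0 *; have : q <= `|r - 1| by apply: le_trans x2 x1.
have := sqr_ge0 q; nra.
Qed.

Lemma psi_near (r : R) : 0 <= r -> psi r <= 2^-1 + `|r - 1| / 2.
Proof.
move=> r0; rewrite /psi; have h : 0 < 1 + r by lra.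
rewrite -[leLHS]mul1r ler_pdivrMr //; have [?|?] := ler0P (r - 1); nra.
Qed.

Lemma psi_ge (r : R) : 0 <= r -> 3 / 4 - r / 4 <= psi r.
Proof.
move=> r0; rewrite /psi; have h : 0 < 1 + r by lra.
rewrite -[leRHS]mul1r ler_pdivlMr //; have := sqr_ge0 (r - 1); nra.
Qed.

Lemma psi_le1 (r : R) : 0 <= r -> psi r <= 1.
Proof. by move=> r0; rewrite /psi invf_le1; lra. Qed.

Lemma theta_self (r : R) : 0 <= r -> theta r <= r.
Proof. by move=> r0; rewrite thetaE ler_piMr ?kap_le1. Qed.

Lemma ener_le (s : bool -> R) : st_ge0 s -> ener s <= tot s.
Proof.
move=> s0; have h b : s b ^+ 2 / tot s <= s b.
  by have /andP[_ h] := prb01 b s0; rewrite expr2 -mulrA ler_piMr ?s0.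
by rewrite /ener sum_bool [leRHS]/tot lerD.
Qed.
End Bounds.

(** * First recursion: the mean disagreement is small *)

Section Weak.
Variables (R : realType) (V : finType) (k : nat) (p : {set V} -> R).
Hypothesis hp : topw k p.
Implicit Types (E S : {set V}) (A B : {set V} -> R).

Definition decorr (CV : R) (r : nat) : Prop := forall E, 0 < mass p E -> (#|E| <= r)%N ->
  forall M : V -> R, (forall x, 0 <= M x <= 1) -> errM (piE k p E) (pi2E k p E) M <= CV.
Definition dense_regular (cb beta : R) (r : nat) : Prop := forall E, 0 < mass p E -> (#|E| <= r)%N ->
  forall A, (forall S, 0 <= A S <= 1) -> expR (- cb) <= mu p E A ->
  \sum_x piE k p E x * `|mu p (x |: E) A / mu p E A - 1| <= beta.

Definition lw E A : R := - ln (mu p E A).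

Lemma mu_le1 E A : (forall S, A S <= 1) -> mu p E A <= 1.
Proof.
move=> A1; rewrite /mu; have [->|ne] := eqVneq (mass p E) 0; first by rewrite invr0 mulr0 ler01.
rewrite ler_pdivrMr ?mul1r; last by rewrite lt_def ne (mass_ge0 hp).
by rewrite mass_sm; apply: (le_sm hp).
Qed.

Lemma lw_ge0 E A : (forall S, A S <= 1) -> 0 <= lw E A.
Proof. by move=> A1; rewrite oppr_ge0 ln_le0 // mu_le1. Qed.

Lemma dg_ge r E : (#|E| <= r)%N -> (r.+2 <= k)%N -> (1 < dg k E)%N.
Proof. by rewrite /dg; lia. Qed.

Lemma dg_inv r E : (#|E| <= r)%N -> (r.+2 <= k)%N -> (dg k E)%:R^-1 <= (k - r)%:R^-1 :> R.
Proof. by move=> h1 h2; rewrite lef_pV2 ?posrE ?ltr0n ?ler_nat /dg; lia. Qed.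

Variables (lab : {set V} -> V -> bool).
Local Notation n E A := (nE p lab E A).

Lemma sum_pi_tot E A : 0 < mass p E -> (0 < dg k E)%N -> 0 < mu p E A ->
  \sum_x piE k p E x * tot (n E A x) = 1.
Proof.
move=> mE dE mA; under eq_bigr do rewrite tot_nE mulrA.
by rewrite -mulr_suml (sum_piE_mu hp) // divff ?gt_eqF.
Qed.

Lemma XX_bd E A B : 0 < mass p E -> (0 < dg k E)%N ->
  (forall S, 0 <= A S) -> (forall S, 0 <= B S) -> 0 <= XX k p lab E A B <= 1.
Proof.
move=> mE dE A0 B0; have p0 x := piE_ge0 hp E x.
have g0 C x b : (forall S, 0 <= C S) -> 0 <= gfun (n E C x) b <= 16^-1.
  by move=> C0; apply: gfun_bd => a; exact: (nE_ge0 hp).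
rewrite /XX /crossX; apply/andP; split.
  apply: sumr_ge0 => x _; apply: mulr_ge0 => //; apply: sumr_ge0 => b _; apply: mulr_ge0.
    by have /andP[] := g0 A x b A0.
  by have /andP[] := g0 B x (~~ b) B0.
rewrite -(sum_piE hp mE dE); apply: ler_sum => x _; rewrite ler_piMr // sum_bool /=.
have /andP[a1 a2] := g0 A x true A0; have /andP[a3 a4] := g0 A x false A0.
have /andP[b1 b2] := g0 B x true B0; have /andP[b3 b4] := g0 B x false B0.
have := ler_pM a1 b3 a2 b4; have := ler_pM a3 b1 a4 b2; lra.
Qed.

Lemma EE_le E A : 0 < mass p E -> (0 < dg k E)%N -> (forall S, 0 <= A S) -> 0 < mu p E A ->
  0 <= EE k p lab E A <= 1.
Proof.
move=> mE dE A0 mA; have s0 x : st_ge0 (n E A x) by move=> b; exact: (nE_ge0 hp).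
apply/andP; split.
  apply: sumr_ge0 => x _; apply: mulr_ge0 (piE_ge0 hp _ _) _; apply: sumr_ge0 => b _.
  exact: divr_ge0 (sqr_ge0 _) (tot_ge0 (s0 x)).
rewrite -(sum_pi_tot mE dE mA); apply: ler_sum => x _.
by rewrite ler_wpM2l ?(piE_ge0 hp) ?ener_le.
Qed.

Lemma PP_le1 E A : 0 < mass p E -> (0 < dg k E)%N -> (forall S, 0 <= A S) -> PP k p lab E A <= 1.
Proof.
move=> mE dE A0; have s0 x : st_ge0 (n E A x) by move=> b; exact: (nE_ge0 hp).
rewrite -(sum_piE hp mE dE); apply: ler_sum => x _; rewrite ler_piMr ?(piE_ge0 hp) // psi_le1 //.
exact: tot_ge0.
Qed.

(** [psi] lies above its tangent 3/4 - r/4 at r = 1, and the densities have mean 1. *)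
Lemma PP_ge E A : 0 < mass p E -> (0 < dg k E)%N -> (forall S, 0 <= A S) -> 0 < mu p E A ->
  2^-1 <= PP k p lab E A.
Proof.
move=> mE dE A0 mA; have s0 x : st_ge0 (n E A x) by move=> b; exact: (nE_ge0 hp).
have -> : 2^-1 = \sum_x piE k p E x * (3 / 4 - tot (n E A x) / 4) :> R.
  under eq_bigr do rewrite mulrBr mulrA.
  rewrite sumrB; under [X in _ - X]eq_bigr do rewrite mulrA.
  by rewrite -!mulr_suml sum_pi_tot // (sum_piE hp) //; field.
by apply: ler_sum => x _; rewrite ler_wpM2l ?(piE_ge0 hp) ?psi_ge //; exact: tot_ge0.
Qed.

Lemma sum_dist E A beta : \sum_x piE k p E x * `|mu p (x |: E) A / mu p E A - 1| <= beta ->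
  \sum_x piE k p E x * `|tot (n E A x) - 1| <= beta.
Proof. by move=> h; under eq_bigr do rewrite tot_nE. Qed.

Lemma PP_near E A beta : 0 < mass p E -> (0 < dg k E)%N -> (forall S, 0 <= A S) ->
  \sum_x piE k p E x * `|mu p (x |: E) A / mu p E A - 1| <= beta ->
  PP k p lab E A <= 2^-1 + beta / 2.
Proof.
move=> mE dE A0 /sum_dist hb; have s0 x : st_ge0 (n E A x) by move=> b; exact: (nE_ge0 hp).
apply: le_trans (_ : \sum_x piE k p E x * (2^-1 + `|tot (n E A x) - 1| / 2) <= _).
  by apply: ler_sum => x _; rewrite ler_wpM2l ?(piE_ge0 hp) ?psi_near //; exact: tot_ge0.
under eq_bigr do rewrite mulrDr mulrA.
rewrite big_split /= -!mulr_suml (sum_piE hp) //; lra.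
Qed.

(** With all densities equal to 1 the acceptance would be 1/16 on each side, hence 1/256.
    Fluctuations of mean at most 1/8 on both sides cost at most half of it; this is the 512 in the
    relation between a and Lam. *)
Lemma zE_near E A B beta : 0 < mass p E -> (0 < dg k E)%N ->
  (forall S, 0 <= A S) -> (forall S, 0 <= B S) -> beta <= 8^-1 ->
  \sum_x piE k p E x * `|mu p (x |: E) A / mu p E A - 1| <= beta ->
  \sum_x piE k p E x * `|mu p (x |: E) B / mu p E B - 1| <= beta ->
  512^-1 <= zE k p lab E A B.
Proof.
move=> mE dE A0 B0 b8 /sum_dist hA /sum_dist hB.
have sA x : 0 <= tot (n E A x) by apply: tot_ge0 => b; exact: (nE_ge0 hp).
have sB x : 0 <= tot (n E B x) by apply: tot_ge0 => b; exact: (nE_ge0 hp).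
apply: le_trans (_ : \sum_x piE k p E x * (256^-1 - `|tot (n E A x) - 1| / 128 - `|tot (n E B x) - 1| / 128) <= _).
  under eq_bigr do rewrite !mulrBr !mulrA.
  rewrite !sumrB -!mulr_suml (sum_piE hp) //; lra.
apply: ler_sum => x _; rewrite ler_wpM2l ?(piE_ge0 hp) //.
have := theta_near (sA x); have := theta_near (sB x).
have := theta_le (sA x); have := theta_le (sB x); rewrite /MM.
set a := theta _; set b := theta _; set u := `|_|; set v := `|_| => h1 h2 h3 h4.
have := mulr_ge0 (_ : 0 <= 16^-1 - a) (_ : 0 <= 16^-1 - b); rewrite !subr_ge0 => /(_ h1 h2); lra.
Qed.

(** A branch of relative weight t raises the log weight by - ln t, and t times - ln t is at most 1.
    In the revealing branch the factor 1 / tot left by this bound is absorbed by M x, as [alw] is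
    bounded. *)
Lemma Eout_lw E A B : 0 < mass p E -> (1 < dg k E)%N ->
  (forall S, 0 <= A S) -> 0 < mu p E A -> (forall S, 0 <= B S) -> 0 < mu p E B ->
  0 < zE k p lab E A B ->
  (1 - zE k p lab E A B) * lw E (A0 k p lab E A B) +
  zE k p lab E A B * (1 - zE k p lab E A B) * lw E (A1 k p lab E A B) +
  zE k p lab E A B * (\sum_x \sum_a piE k p E x * MM p lab E A B x * prb (n E A x) a *
     lw (x |: E) (cut lab A x a)) <= lw E A + 3.
Proof.
move=> mE dE A0' mA B0' mB; set z := zE k p lab E A B => z0.
have [/andP[_ z1] hA] := (zE_bd lab hp mE dE A0' mA B0', playerA lab hp mE dE A0' mA B0').
have hob x : 0 <= theta (tot (n E B x)) <= 16^-1 := p_ob hA x.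
have hM x : MM p lab E A B x = theta (tot (n E A x)) * theta (tot (n E B x)) by [].
rewrite -/z in z1.
have m0 : mu p E (A0 k p lab E A B) = (1 - z) * mu p E A by exact: (mu_sel0 hp mE dE mA hM).
have m1 : mu p E (A1 k p lab E A B) = z * mu p E A by exact: (mu_sel1 hp mE dE mA hM).
have l0 : (1 - z) * lw E (A0 k p lab E A B) <= (1 - z) * lw E A + 1.
  rewrite /lw m0 lnM ?posrE //; last lra.
  have := @ln_ge R (1 - z); have q : 0 < 1 - z by lra.
  move=> /(_ q) /(ler_wpM2l (ltW q)); rewrite mulrBr divff ?gt_eqF //; lra.
have l1 : z * lw E (A1 k p lab E A B) <= z * lw E A + 1.
  rewrite /lw m1 lnM ?posrE //.
  have := ln_ge z0 => /(ler_wpM2l (ltW z0)); rewrite mulrBr divff ?gt_eqF //; lra.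
have l1' : z * (1 - z) * lw E (A1 k p lab E A B) <= z * (1 - z) * lw E A + 1.
  have -> : z * (1 - z) * lw E (A1 k p lab E A B) = (1 - z) * (z * lw E (A1 k p lab E A B)) by ring.
  have q : 0 <= 1 - z by lra.
  by have := ler_wpM2l q l1; lra.
have lx x a : piE k p E x * MM p lab E A B x * prb (n E A x) a * lw (x |: E) (cut lab A x a) <=
   piE k p E x * MM p lab E A B x * prb (n E A x) a * lw E A + piE k p E x * 16^-1.
  have pi0 := piE_ge0 hp E x.
  have s0 : st_ge0 (n E A x) by move=> b; exact: (nE_ge0 hp).
  have /andP[P0 P1] := prb01 a s0.
  have M0 := M_ge0 hA x.
  have [na|na] := eqVneq (n E A x a) 0.
    by rewrite /prb na !(mul0r, mulr0) add0r mulr_ge0.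
  have nap : 0 < n E A x a by rewrite lt_def na s0.
  have -> : lw (x |: E) (cut lab A x a) = lw E A - ln (n E A x a).
    rewrite /lw (_ : mu p (x |: E) (cut lab A x a) = n E A x a * mu p E A); last by rewrite divfK ?gt_eqF.
    by rewrite lnM ?posrE //; ring.
  have h := ln_ge nap.
  have h2 : prb (n E A x) a * - ln (n E A x a) <= (tot (n E A x))^-1.
    apply: le_trans (ler_wpM2l P0 h) _; rewrite mulrBr mulr1 {1}/prb mulrAC mulfV // mul1r gerBl.
    exact: P0.
  have h3 := ler_wpM2l M0 h2; have /andP[_ h4] := alw_bd hp A0' hob hM x.
  have h5 := ler_wpM2l pi0 (le_trans h3 h4).
  move: h5; move: (prb _ _) (MM _ _ _ _ _ _) (piE _ _ _ _) (ln _) (lw _ _) => u1 u2 u3 u4 u5 h5.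
  lra.
have sx : \sum_x \sum_a piE k p E x * MM p lab E A B x * prb (n E A x) a * lw (x |: E) (cut lab A x a) <=
   z * lw E A + 1.
  apply: le_trans (ler_sum _ (fun x _ => ler_sum _ (fun a _ => lx x a))) _.
  apply: le_trans (_ : \sum_x (piE k p E x * MM p lab E A B x * lw E A + piE k p E x * 8^-1) <= _).
    apply: ler_sum => x _; rewrite -[X in _ * X * _ + _](MMprbA lab hp mE dE A0' mA B0') !sum_bool.
    by rewrite le_eqVlt; apply/orP; left; apply/eqP; field.
  rewrite big_split /= -!mulr_suml (sum_piE hp) //; last exact: ltnW.
  have -> : \sum_x piE k p E x * MM p lab E A B x = z by [].
  lra.
have := ler_wpM2l (ltW z0) sx; have : 0 <= lw E A -> True by [].
have -> : lw E A + 3 = (1 - z) * lw E A + z * (1 - z) * lw E A + z * (z * lw E A + 1) + (3 - z) by ring.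
lra.
Qed.

Variables (c a e d cb beta CV epsb Lam : R) (r : nat).
Hypotheses (c0 : 0 < c) (Lam1 : 1 <= Lam) (aE : a = ln Lam / 512).
Hypotheses (beta8 : 0 <= beta <= 8^-1) (e0 : 0 <= e) (CV0 : 0 <= CV).
Hypothesis ecb : a * (1 + 10 * c + 2 * Kst c) <= e * cb.
Hypothesis d_ge : 6 * e + a * CSt c * (CV + epsb) <= d.
Hypotheses (kr : (r.+2 <= k)%N) (hepsb : (k - r)%:R^-1 <= epsb).
Hypotheses (HV : decorr CV r) (HS : dense_regular cb beta r).

(** Exponent guaranteed with h levels left. The subtracted constant bounds both potentials on heavy
    events, so at most a times the disagreement is claimed per level. The term in e makes the claim
    void once an event is lighter than exp (- cb), where [dense_regular] gives nothing ([Rh_light]);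
    d collects the errors of one step over the levels left. *)
Definition Rh h E A B : R := h%:R * (a * (SS k p lab c E A B - (10 * c + Kst c * (1 + beta)))
  - ln 2 - d * h%:R - e * (lw E A + lw E B)).

Let K0 : 0 <= Kst c.
Proof. by have := crem_ge0 c0; have := cpair_ge0 c0; rewrite /Kst; lra. Qed.
Let lnL0 : 0 <= ln Lam. Proof. by rewrite ln_ge0. Qed.
Let a0 : 0 <= a. Proof. by rewrite aE; apply: divr_ge0 lnL0 (ler0n _ _). Qed.
Let epsb0 : 0 <= epsb. Proof. by apply: le_trans hepsb; rewrite invr_ge0. Qed.
Let d0 : 0 <= d.
Proof.
have CS0 : 0 <= CSt c by have := K0; have := c0; rewrite /CSt; lra.
apply: le_trans d_ge; apply: addr_ge0; first exact: mulr_ge0 (ler0n _ _) e0.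
exact: mulr_ge0 (mulr_ge0 a0 CS0) (addr_ge0 CV0 epsb0).
Qed.
Let ln20 : 0 <= ln 2 :> R. Proof. by rewrite ln_ge0 //; lra. Qed.

Lemma Rh_light h E A B : 0 < mass p E -> (1 < dg k E)%N ->
  (forall S, 0 <= A S <= 1) -> (forall S, 0 <= B S <= 1) -> 0 < mu p E A -> 0 < mu p E B ->
  mu p E A < expR (- cb) \/ mu p E B < expR (- cb) -> Rh h E A B <= 0.
Proof.
move=> mE dE hA hB mA mB light.
have A0' S : 0 <= A S by have /andP[] := hA S.
have B0' S : 0 <= B S by have /andP[] := hB S.
have lA : 0 <= lw E A by apply: lw_ge0 => S; have /andP[] := hA S.
have lB : 0 <= lw E B by apply: lw_ge0 => S; have /andP[] := hB S.
have dE' : (0 < dg k E)%N by exact: ltnW.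
have hl C : 0 < mu p E C -> mu p E C < expR (- cb) -> cb <= lw E C.
  by move=> mC hC; rewrite /lw lerNr -[leRHS]expRK ler_ln ?posrE ?expR_gt0 // ltW.
have cbl : cb <= lw E A + lw E B.
  by case: light => hC; [have := hl A mA hC | have := hl B mB hC]; lra.
rewrite /Rh mulr_ge0_le0 //.
have /andP[_ x1] := XX_bd mE dE' A0' B0'.
have /andP[_ ea] := EE_le mE dE' A0' mA; have /andP[_ eb] := EE_le mE dE' B0' mB.
have pa := PP_le1 mE dE' A0'; have pb := PP_le1 mE dE' B0'.
have s1 : SS k p lab c E A B <= 1 + 10 * c + 2 * Kst c.
  have q1 := ler_wpM2l (ltW c0) (lerD ea eb); have q2 := ler_wpM2l K0 (lerD pa pb).
  by rewrite /SS; lra.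
have /andP[b0 _] := beta8.
have s2 : SS k p lab c E A B - (10 * c + Kst c * (1 + beta)) <= 1 + 10 * c + 2 * Kst c.
  have := mulr_ge0 K0 b0; have := c0; have := K0; lra.
have s3 := ler_wpM2l a0 s2; have s4 := ler_wpM2l e0 cbl.
have s5 : 0 <= d * h%:R by rewrite mulr_ge0.
have := ecb; have := ln20; lra.
Qed.

(** The level that is used up is worth a (SS - constant) <= a XX <= ln Lam z XX, since z >= 1/512.
    The other h levels are conserved by [node_star]; their loss of at most d each is absorbed by the
    term of [Rh] that is quadratic in h. *)
Lemma Eout_Rh h E A B : 0 < mass p E -> (1 < dg k E)%N -> (#|E| <= r)%N ->
  (forall S, 0 <= A S <= 1) -> (forall S, 0 <= B S <= 1) -> 0 < mu p E A -> 0 < mu p E B ->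
  expR (- cb) <= mu p E A -> expR (- cb) <= mu p E B ->
  Rh h.+1 E A B <= Eout k p lab E A B (Rh h) + ln Lam * (zE k p lab E A B * XX k p lab E A B) - ln 2.
Proof.
move=> mE dE Er hA hB mA mB heavyA heavyB.
have A0' S : 0 <= A S by have /andP[] := hA S.
have B0' S : 0 <= B S by have /andP[] := hB S.
have lA : 0 <= lw E A by apply: lw_ge0 => S; have /andP[] := hA S.
have lB : 0 <= lw E B by apply: lw_ge0 => S; have /andP[] := hB S.
have dE' : (0 < dg k E)%N by exact: ltnW.
have /andP[b0 b8] := beta8.
have nA := HS mE Er hA heavyA; have nB := HS mE Er hB heavyB.
have z5 := zE_near mE dE' A0' B0' b8 nA nB.
have [/andP[z0 z1] hPA] := (zE_bd lab hp mE dE A0' mA B0', playerA lab hp mE dE A0' mA B0').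
set z := zE k p lab E A B in z5 z0 z1 *.
have zp : 0 < z by lra.
have star := node_star lab hp mE dE A0' mA B0' mB c0.
have er1 : errM (piE k p E) (pi2E k p E) (MM p lab E A B) <= CV.
  apply: HV => // x; have := M_ge0 hPA x; have := M_le hPA x; lra.
have ep1 : (dg k E)%:R^-1 <= epsb.
  exact: le_trans (dg_inv Er kr) hepsb.
have /andP[x0 _] := XX_bd mE dE' A0' B0'.
have /andP[_ ea] := EE_le mE dE' A0' mA; have /andP[_ eb] := EE_le mE dE' B0' mB.
have pa := PP_near mE dE' A0' nA; have pb := PP_near mE dE' B0' nB.
set cst := 10 * c + Kst c * (1 + beta).
have s1 : SS k p lab c E A B - cst <= XX k p lab E A B.
  have q1 := ler_wpM2l (ltW c0) (lerD ea eb); have q2 := ler_wpM2l K0 (lerD pa pb).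
  by rewrite /SS /cst; lra.
have s2 : a * (SS k p lab c E A B - cst) <= ln Lam * (z * XX k p lab E A B).
  apply: le_trans (ler_wpM2l a0 s1) _; rewrite aE -mulrA ler_wpM2l // ler_wpM2r //.
have lwA := Eout_lw mE dE A0' mA B0' mB zp.
have lwB : Eout k p lab E A B (fun E _ B => lw E B) <= lw E B + 3.
  rewrite (Eout_right lab hp mE dE A0' mA B0').
  have := @Eout_lw E B A mE dE B0' mB A0' mA; rewrite zEC -/z => /(_ zp).
  by rewrite /A0 /A1 MM_funC.
rewrite -(Eout_left lab hp mE dE A0' B0' mB lw) in lwA.
have RhE : Eout k p lab E A B (Rh h) = h%:R * (a * (Eout k p lab E A B (SS k p lab c) - cst) - ln 2 - d * h%:R
   - e * (Eout k p lab E A B (fun E A _ => lw E A) + Eout k p lab E A B (fun E _ B => lw E B))).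
  have cs q := Eout_cst lab hp mE dE A0' mA B0' mB q.
  rewrite -(cs (- cst)) -EoutD -EoutZ -(cs (- ln 2)) -EoutD -(cs (- (d * h%:R))) -EoutD.
  by rewrite -EoutD -(mulNr e) -EoutZ -EoutD -EoutZ; apply: eq_Eout => E' A' B'; rewrite /Rh mulNr.
set ES := Eout k p lab E A B (SS k p lab c) in star RhE.
set l1 := Eout k p lab E A B (fun E A _ => lw E A) in lwA RhE.
set l2 := Eout k p lab E A B (fun E _ B => lw E B) in lwB RhE.
have CS0 : 0 <= CSt c by have := K0; have := c0; rewrite /CSt; lra.
have t1 : a * (SS k p lab c E A B - CSt c * (CV + epsb)) <= a * ES.
  apply: ler_wpM2l => //; apply: le_trans star; rewrite lerD2l lerN2 ler_wpM2l //.
  exact: lerD.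
have t2 : e * (l1 + l2) <= e * (lw E A + lw E B + 6) by apply: ler_wpM2l => //; lra.
rewrite RhE /Rh -/cst.
have h0 : 0 <= h%:R :> R by [].
have t3 : h%:R * (a * (SS k p lab c E A B - CSt c * (CV + epsb) - cst) - ln 2 - d * h%:R
   - e * (lw E A + lw E B + 6)) <= h%:R * (a * (ES - cst) - ln 2 - d * h%:R - e * (l1 + l2)).
  apply: ler_wpM2l => //; lra.
have t4 := ler_wpM2l h0 d_ge.
have t5 : 0 <= d * h%:R by rewrite mulr_ge0.
have t6 : 0 <= e * (lw E A + lw E B) by rewrite mulr_ge0 ?addr_ge0.
rewrite -natr1; have := d0; lra.
Qed.

Lemma sum_cross E A B : (forall S, 0 <= A S) -> (forall S, 0 <= B S) ->
  \sum_x \sum_a \sum_b piE k p E x * MM p lab E A B x * (prb (n E A x) a * prb (n E B x) b) * (a != b)%:R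
  = XX k p lab E A B.
Proof.
move=> A0' B0'; apply: eq_bigr => x _.
have sA : st_ge0 (n E A x) by move=> b; exact: (nE_ge0 hp).
have sB : st_ge0 (n E B x) by move=> b; exact: (nE_ge0 hp).
by rewrite !sum_bool /= !gfunE // /MM; ring.
Qed.

Theorem weak_GG h : forall E A B, 0 < mass p E -> (#|E| + h <= r)%N ->
  (forall S, 0 <= A S <= 1) -> (forall S, 0 <= B S <= 1) ->
  mu p E A * mu p E B * expR (Rh h E A B) <= GG k p Lam lab h E A B.
Proof.
elim: h => [|h IH] E A B mE hr hA hB.
all: have A0' S : 0 <= A S by have /andP[] := hA S.
all: have B0' S : 0 <= B S by have /andP[] := hB S.
  by rewrite /Rh mul0r expR0 mulr1; exact: (GG_mu hp).
have [mA|mA] := eqVneq (mu p E A) 0; first by rewrite mA !mul0r (GG_ge0 hp).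
have [mB|mB] := eqVneq (mu p E B) 0; first by rewrite mB mulr0 mul0r (GG_ge0 hp).
have {}mA : 0 < mu p E A by rewrite lt_def mA (mu_ge0 hp).
have {}mB : 0 < mu p E B by rewrite lt_def mB (mu_ge0 hp).
have mm0 : 0 <= mu p E A * mu p E B by rewrite mulr_ge0 // ltW.
have Er : (#|E| <= r)%N by apply: leq_trans hr; rewrite leq_addr.
have dE := dg_ge Er kr.
have light : mu p E A < expR (- cb) \/ mu p E B < expR (- cb) ->
    mu p E A * mu p E B * expR (Rh h.+1 E A B) <= GG k p Lam lab h.+1 E A B.
  move=> hl; apply: le_trans (GG_mu hp Lam1 _ h.+1 _ A0' B0'); rewrite ler_piMr //.
  by rewrite -expR0 ler_expR Rh_light.
have [hvA|ltA] := leP (expR (- cb)) (mu p E A); last by apply: light; left.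
have [hvB|ltB] := leP (expR (- cb)) (mu p E B); last by apply: light; right.
set z := zE k p lab E A B.
pose Y := Eout k p lab E A B (Rh h) + ln Lam * (z * XX k p lab E A B).
have cl1 : Rh h.+1 E A B <= Y - ln 2 by exact: Eout_Rh.
have [/andP[z0 z1] hPA] := (zE_bd lab hp mE dE A0' mA B0', playerA lab hp mE dE A0' mA B0').
have hPB := playerB lab hp mE dE A0' B0' mB.
rewrite -/z in z0 z1.
have LamE q : Lam ^+ nat_of_bool q = expR (ln Lam * q%:R).
  by case: q; rewrite ?mulr1 ?mulr0 ?expR0 // lnK // posrE (lt_le_trans ltr01).
(* The sum at level h + 1 dominates the splitting branches, which stay at E ([GG_incr]), and
   separately the revealing branch ([GGS]). Only together do they have total weight 1, hence the
   factor 2 and the loss of ln 2 per level. *)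
have cl2 : mu p E A * mu p E B * expR Y <= 2 * GG k p Lam lab h.+1 E A B.
  set mm := mu p E A * mu p E B in mm0 *.
  have stp : mm * (z * \sum_x \sum_a0 \sum_b piE k p E x * MM p lab E A B x *
     (prb (n E A x) a0 * prb (n E B x) b) * (expR Y *
       (1 + Rh h (x |: E) (cut lab A x a0) (cut lab B x b) - Y + ln Lam * (a0 != b)%:R)))
     <= GG k p Lam lab h.+1 E A B.
    rewrite (GGS hp) // -[leLHS]add0r lerD // !mulr_sumr; apply: ler_sum => x _.
    have pi0 := piE_ge0 hp E x.
    have [pe|pn] := eqVneq (piE k p E x) 0.
      rewrite pe [leRHS]mul0r big1 ?mulr0 // => a1 _; rewrite big1 // => b1 _; by rewrite !mul0r.
    have xE : x \notin E by apply: contraNN pn => xE; rewrite /piE xE.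
    have mx : 0 < mass p (x |: E).
      rewrite lt_def (mass_ge0 hp) andbT; apply: contraNneq pn => e1.
      by rewrite /piE (negbTE xE) e1 mul0r.
    rewrite !mulr_sumr; apply: ler_sum => a1 _; rewrite !mulr_sumr; apply: ler_sum => b1 _.
    have cA S : 0 <= cut lab A x a1 S <= 1.
      by rewrite cut_ge0 //=; apply: le_trans (cut_le _ _ _ _ A0') _; have /andP[] := hA S.
    have cB S : 0 <= cut lab B x b1 S <= 1.
      by rewrite cut_ge0 //=; apply: le_trans (cut_le _ _ _ _ B0') _; have /andP[] := hB S.
    have hr' : (#|x |: E| + h <= r)%N by rewrite cardsU1 xE add1n addSnnS.
    have ih := IH _ _ _ mx hr' cA cB.
    have nA : mu p (x |: E) (cut lab A x a1) = n E A x a1 * mu p E A by rewrite divfK ?gt_eqF.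
    have nB : mu p (x |: E) (cut lab B x b1) = n E B x b1 * mu p E B by rewrite divfK ?gt_eqF.
    have sA : st_ge0 (n E A x) by move=> b; exact: (nE_ge0 hp).
    have sB : st_ge0 (n E B x) by move=> b; exact: (nE_ge0 hp).
    have /andP[PA0 PA1] := prb01 a1 sA; have /andP[PB0 PB1] := prb01 b1 sB.
    have gA : theta (tot (n E A x)) * prb (n E A x) a1 <= n E A x a1.
      by rewrite -(prbM a1 sA) mulrC ler_wpM2l ?theta_self ?tot_ge0.
    have gB : theta (tot (n E B x)) * prb (n E B x) b1 <= n E B x b1.
      by rewrite -(prbM b1 sB) mulrC ler_wpM2l ?theta_self ?tot_ge0.
    have tA0 := theta_ge0 (tot_ge0 sA); have tB0 := theta_ge0 (tot_ge0 sB).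
    have M0 := M_ge0 hPA x.
    (* As [theta r] is at most r, the revealing branch asks for no more weight than the cut events
       have. *)
    have gg : z * (MM p lab E A B x * (prb (n E A x) a1 * prb (n E B x) b1)) <= n E A x a1 * n E B x b1.
      apply: le_trans (_ : MM p lab E A B x * (prb (n E A x) a1 * prb (n E B x) b1) <= _).
        apply: ler_piMl; [exact: mulr_ge0 M0 (mulr_ge0 PA0 PB0) | lra].
      have -> : MM p lab E A B x * (prb (n E A x) a1 * prb (n E B x) b1) =
        theta (tot (n E A x)) * prb (n E A x) a1 * (theta (tot (n E B x)) * prb (n E B x) b1).
        by rewrite /MM; ring.
      by apply: ler_pM => //; exact: mulr_ge0.
    set Rc := Rh h _ _ _ in ih *.
    have tg : expR Y * (1 + Rc - Y + ln Lam * (a1 != b1)%:R) <= Lam ^+ (a1 != b1) * expR Rc.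
      rewrite LamE -expRD; apply: le_trans (expR_tangent _ Y); rewrite ler_wpM2l ?expR_ge0 //; lra.
    have W0 : 0 <= z * (MM p lab E A B x * (prb (n E A x) a1 * prb (n E B x) b1)).
      by exact: mulr_ge0 z0 (mulr_ge0 M0 (mulr_ge0 PA0 PB0)).
    have X0 : 0 <= Lam ^+ (a1 != b1) * expR Rc.
      by rewrite mulr_ge0 ?expR_ge0 // exprn_ge0 // (le_trans ler01).
    have q1 := ler_wpM2l W0 tg; have q2 := ler_wpM2r X0 gg.
    have q3 := le_trans q1 q2.
    have pm0 : 0 <= piE k p E x * mm by rewrite mulr_ge0.
    have q4 := ler_wpM2l pm0 q3.
    have Lp : 0 <= Lam ^+ (a1 != b1) by rewrite exprn_ge0 // (le_trans ler01).
    have q5 := ler_wpM2l pi0 (ler_wpM2l Lp ih); rewrite nA nB in q5.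
    apply: le_trans q5; apply: le_trans (_ : _ <= piE k p E x * mm * (n E A x a1 * n E B x b1 * (Lam ^+ (a1 != b1) * expR Rc))) _.
      by apply: le_trans q4; rewrite le_eqVlt; apply/orP; left; apply/eqP; ring.
    by rewrite /mm le_eqVlt; apply/orP; left; apply/eqP; ring.
  have hob C x : (forall S, 0 <= C S) -> 0 <= theta (tot (n E C x)) <= 16^-1.
    move=> C0; have t0 : 0 <= tot (n E C x) by apply: tot_ge0 => b; exact: (nE_ge0 hp).
    by rewrite theta_ge0 ?theta_le.
  (* Bilinearity splits [GG] into four parts; the one where both sides select is only used to be
     nonnegative, the revealing branch taking its place. *)
  have spl : mm * ((1 - z) ^+ 2 * (expR Y * (1 + Rh h E (A0 k p lab E A B) (A0 k p lab E B A) - Y)) +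
     (1 - z) * z * (expR Y * (1 + Rh h E (A0 k p lab E A B) (A1 k p lab E B A) - Y) +
                    expR Y * (1 + Rh h E (A1 k p lab E A B) (A0 k p lab E B A) - Y)))
     <= GG k p Lam lab h.+1 E A B.
    apply: le_trans (GG_incr hp Lam1 _ _ _ A0' B0').
    have hMA x : MM p lab E A B x = theta (tot (n E A x)) * theta (tot (n E B x)) by [].
    have hMB x : MM p lab E B A x = theta (tot (n E B x)) * theta (tot (n E A x)) by [].
    have eA : A = fun S => A0 k p lab E A B S + A1 k p lab E A B S.
      by apply: funext => S; rewrite /A0 /A1 -sel01.
    have eB : B = fun S => A0 k p lab E B A S + A1 k p lab E B A S.
      by apply: funext => S; rewrite /A0 /A1 -sel01.
    have obA x := hob A x A0'; have obB x := hob B x B0'.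
    have a00 S : 0 <= A0 k p lab E A B S <= 1.
      rewrite (sel0_ge0 hp dE A0' obB hMA) /=.
      by apply: le_trans (sel0_le hp dE A0' obB hMA S) _; have /andP[] := hA S.
    have a11 S : 0 <= A1 k p lab E A B S <= 1.
      have /andP[u1 u2] := sel1_bd hp dE A0' obB hMA S; rewrite u1 /=.
      by apply: le_trans u2 _; have /andP[] := hA S.
    have b00 S : 0 <= A0 k p lab E B A S <= 1.
      rewrite (sel0_ge0 hp dE B0' obA hMB) /=.
      by apply: le_trans (sel0_le hp dE B0' obA hMB S) _; have /andP[] := hB S.
    have b11 S : 0 <= A1 k p lab E B A S <= 1.
      have /andP[u1 u2] := sel1_bd hp dE B0' obA hMB S; rewrite u1 /=.
      by apply: le_trans u2 _; have /andP[] := hB S.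
    have gp C : (forall S, 0 <= C S <= 1) -> forall S, 0 <= C S by move=> hC S; have /andP[] := hC S.
    have -> : GG k p Lam lab h E A B =
      GG k p Lam lab h E (A0 k p lab E A B) (A0 k p lab E B A) +
      (GG k p Lam lab h E (A0 k p lab E A B) (A1 k p lab E B A) +
       GG k p Lam lab h E (A1 k p lab E A B) (A0 k p lab E B A)) +
      GG k p Lam lab h E (A1 k p lab E A B) (A1 k p lab E B A).
      have GG4 A2 A3 B2 B3 : GG k p Lam lab h E (fun S => A2 S + A3 S) (fun S => B2 S + B3 S) =
          GG k p Lam lab h E A2 B2 + (GG k p Lam lab h E A2 B3 + GG k p Lam lab h E A3 B2) +
          GG k p Lam lab h E A3 B3 by rewrite GGDl !GGDr; ring.
      by rewrite -GG4 -eA -eB.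
    have hr' : (#|E| + h <= r)%N by apply: leq_trans hr; rewrite leq_add2l.
    have i00 := IH _ _ _ mE hr' a00 b00; have i01 := IH _ _ _ mE hr' a00 b11.
    have i10 := IH _ _ _ mE hr' a11 b00.
    have i11 : 0 <= GG k p Lam lab h E (A1 k p lab E A B) (A1 k p lab E B A).
      by apply: (GG_ge0 hp) => //; exact: gp.
    have mA0 : mu p E (A0 k p lab E A B) = (1 - z) * mu p E A by exact: (mu_sel0 hp mE dE mA hMA).
    have mA1 : mu p E (A1 k p lab E A B) = z * mu p E A by exact: (mu_sel1 hp mE dE mA hMA).
    have mB0 : mu p E (A0 k p lab E B A) = (1 - z) * mu p E B.
      by rewrite /z zEC; exact: (mu_sel0 hp mE dE mB hMB).
    have mB1 : mu p E (A1 k p lab E B A) = z * mu p E B.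
      by rewrite /z zEC; exact: (mu_sel1 hp mE dE mB hMB).
    rewrite mA0 mB0 in i00; rewrite mA0 mB1 in i01; rewrite mA1 mB0 in i10.
    have zz : 0 <= 1 - z by lra.
    have key w1 w2 (g : R) : 0 <= w1 -> 0 <= w2 -> forall Rx, w1 * mu p E A * (w2 * mu p E B) * expR Rx <= g ->
       mm * (w1 * w2 * (expR Y * (1 + Rx - Y))) <= g.
      move=> w10 w20 Rx; apply: le_trans.
      have -> : w1 * mu p E A * (w2 * mu p E B) * expR Rx = mm * (w1 * w2 * expR Rx) by rewrite /mm; ring.
      by rewrite ler_wpM2l // ler_wpM2l ?mulr_ge0 // expR_tangent.
    have j00 := key _ _ _ zz zz _ i00; have j01 := key _ _ _ zz z0 _ i01; have j10 := key _ _ _ z0 zz _ i10.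
    rewrite expr2; lra.
  (* Y is the mean over all branches of the exponent, including ln Lam for a revealed disagreement,
     so the linear terms of the tangents cancel. *)
  have fin : mm * expR Y = mm * ((1 - z) ^+ 2 * (expR Y * (1 + Rh h E (A0 k p lab E A B) (A0 k p lab E B A) - Y)) +
     (1 - z) * z * (expR Y * (1 + Rh h E (A0 k p lab E A B) (A1 k p lab E B A) - Y) +
                    expR Y * (1 + Rh h E (A1 k p lab E A B) (A0 k p lab E B A) - Y))) +
     mm * (z * \sum_x \sum_a0 \sum_b piE k p E x * MM p lab E A B x *
     (prb (n E A x) a0 * prb (n E B x) b) * (expR Y *
       (1 + Rh h (x |: E) (cut lab A x a0) (cut lab B x b) - Y + ln Lam * (a0 != b)%:R))).
    have spl2 : \sum_x \sum_a0 \sum_b piE k p E x * MM p lab E A B x *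
     (prb (n E A x) a0 * prb (n E B x) b) * (expR Y *
       (1 + Rh h (x |: E) (cut lab A x a0) (cut lab B x b) - Y + ln Lam * (a0 != b)%:R)) =
     expR Y * (\sum_x \sum_a0 \sum_b piE k p E x * MM p lab E A B x *
     (prb (n E A x) a0 * prb (n E B x) b) * (1 - Y + Rh h (x |: E) (cut lab A x a0) (cut lab B x b))
      + ln Lam * XX k p lab E A B).
      rewrite -sum_cross // mulr_sumr -big_split mulr_sumr; apply: eq_bigr => x _ /=.
      rewrite mulr_sumr -big_split mulr_sumr; apply: eq_bigr => a1 _ /=.
      rewrite mulr_sumr -big_split mulr_sumr; apply: eq_bigr => b1 _ /=; ring.
    have one : Eout k p lab E A B (fun E A B => (1 - Y) + Rh h E A B) = 1 - ln Lam * (z * XX k p lab E A B).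
      by rewrite EoutD (Eout_cst lab hp mE dE A0' mA B0' mB) /Y; ring.
    rewrite spl2; move: one; rewrite /Eout -/z.
    set sg := \sum_x _; move=> one.
    have -> : z * (expR Y * (sg + ln Lam * XX k p lab E A B)) = expR Y * (z * sg + ln Lam * (z * XX k p lab E A B)) by ring.
    have {}one : z * sg = 1 - ln Lam * (z * XX k p lab E A B) -
      ((1 - z) ^+ 2 * (1 - Y + Rh h E (A0 k p lab E A B) (A0 k p lab E B A)) +
       (1 - z) * z * (1 - Y + Rh h E (A0 k p lab E A B) (A1 k p lab E B A) + (1 - Y + Rh h E (A1 k p lab E A B) (A0 k p lab E B A)))).
      by rewrite -one; ring.
    by rewrite one; ring.
  rewrite fin; lra.
have := expR_gt0 Y => Y0.
apply: le_trans (_ : mu p E A * mu p E B * (expR Y / 2) <= _); last lra.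
rewrite ler_wpM2l //; apply: le_trans (_ : expR (Y - ln 2) <= _); first by rewrite ler_expR.
by rewrite expRD expRN lnK ?posrE // ltr0n.
Qed.

(** Logarithm of [weak_GG]. By [PP_ge] the two [psi] potentials give back [Kst c], so only
    [Kst c * beta] of the large constant survives, and beta can be chosen after c. *)
Lemma weak_cross h E A Gam x1 : 0 < mass p E -> (#|E| + h <= r)%N -> (0 < h)%N -> 0 < a ->
  (forall S, 0 <= A S <= 1) -> 0 < mu p E A -> 0 < Gam -> GG k p Lam lab h E A A <= Gam ->
  ln 2 + d * h%:R + 2 * e * lw E A + (ln Gam + 2 * lw E A) / h%:R <= a * x1 ->
  XX k p lab E A A <= 10 * c + Kst c * beta + x1.
Proof.
move=> mE hr h0 ap hA mA G0 hG hx.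
have A0' S : 0 <= A S by have /andP[] := hA S.
have Er : (#|E| <= r)%N by apply: leq_trans hr; rewrite leq_addr.
have dE := ltnW (dg_ge Er kr).
have q := le_trans (weak_GG mE hr hA hA) hG.
have mm : 0 < mu p E A * mu p E A by rewrite mulr_gt0.
have : ln (mu p E A * mu p E A * expR (Rh h E A A)) <= ln Gam.
  by rewrite ler_ln // ?posrE // mulr_gt0 ?expR_gt0.
rewrite lnM ?posrE ?expR_gt0 // expRK (@lnM _ (mu p E A) (mu p E A)) ?posrE // => q2.
have {}q2 : Rh h E A A <= ln Gam + 2 * lw E A by rewrite /lw; lra.
have hp0 : 0 < h%:R :> R by rewrite ltr0n.
rewrite /Rh mulrC -ler_pdivlMr // in q2.
have pp := PP_ge mE dE A0' mA; have /andP[ee _] := EE_le mE dE A0' mA.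
set s := SS k p lab c E A A in q2.
have sx : XX k p lab E A A + Kst c <= s.
  have q3 := ler_wpM2l K0 (lerD pp pp); have q4 := mulr_ge0 (ltW c0) ee.
  by rewrite /s /SS; lra.
have q5 : a * (s - (10 * c + Kst c * (1 + beta))) <= a * x1 by lra.
rewrite ler_pM2l // in q5; lra.
Qed.

End Weak.

Lemma bin_trinomial k n l : (n + l <= k)%N -> ('C(k, n + l) * 'C(n + l, n) = 'C(k, n) * 'C(k - n, l))%N.
Proof.
move=> h.
have h1 := bin_fact h; have h2 := @bin_fact (n + l) n (leq_addr _ _).
have h3 := @bin_fact k n (leq_trans (leq_addr l n) h).
have hl : (l <= k - n)%N by lia.
have h4 := bin_fact hl.
rewrite addKn in h2; rewrite subnDA in h1.
have pos : (0 < n`! * l`! * (k - n - l)`!)%N by rewrite !muln_gt0 !fact_gt0.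
apply/eqP; rewrite -(eqn_pmul2r pos); apply/eqP.
transitivity (k`!); first by rewrite -h1 -h2; ring.
by rewrite -h3 -h4; ring.
Qed.

(** Passing from N <= n + l to N - 1 multiplies C(N, n) by (N - n) / N <= l / (n + l), which is at
    most 1 / Lam when Lam is positive. *)
Lemma bin_decay (R : realType) (Lam : R) n l D : 0 <= Lam -> Lam * l%:R <= (n + l)%:R ->
  (D <= n + l)%N -> 'C(n + l - D, n)%:R * Lam ^+ D <= 'C(n + l, n)%:R.
Proof.
move=> L0 hL; elim: D => [|D IH] hD; first by rewrite subn0 expr0 mulr1.
apply: le_trans (IH (ltnW hD)); rewrite exprS mulrA ler_wpM2r ?exprn_ge0 //.
set N := (n + l - D)%N; have -> : (n + l - D.+1 = N.-1)%N by rewrite /N; lia.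
have N0 : (0 < N)%N by rewrite /N; lia.
have e : N%:R * 'C(N.-1, n)%:R = (N - n)%:R * 'C(N, n)%:R :> R by rewrite -!natrM mul_bin_down.
have Np : 0 < N%:R :> R by rewrite ltr0n.
rewrite -(ler_pM2l Np) mulrA e mulrAC [leRHS]mulrC [leLHS]mulrC ler_wpM2l //.
have [le|gt] := leqP N n; first by rewrite (eqP le) mul0r.
rewrite natrB; last exact: ltnW.
have Nl : N%:R <= (n + l)%:R :> R by rewrite ler_nat leq_subr.
rewrite natrD in hL Nl.
have n0 : 0 <= n%:R :> R by []. have l0 : 0 <= l%:R :> R by [].
have [L1|L1] := lerP Lam 1.
  have : 0 <= N%:R - n%:R :> R by rewrite subr_ge0 ler_nat ltnW.
  nra.
nra.
Qed.

(** * Averaging the exchange sum over random restrictions *)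

Section PairBound.
Variables (R : realType) (V : finType) (k : nat) (p : {set V} -> R).
Hypothesis hp : topw k p.
Hypothesis p1 : \sum_S p S = 1.
Variables (Sigma : finType) (f : {set V} -> V -> Sigma) (Lam : R).
Hypothesis Lam1 : 1 <= Lam.
Implicit Types (E S t : {set V}).

Definition agr t S S' : bool := [forall x in t, f S x == f S' x].
Definition VV t S0 : {set V} -> R := fun S => (agr t S S0)%:R.

Let p0 S : 0 <= p S. Proof. by case: hp. Qed.

Lemma sum_mass j : \sum_(E : {set V} | #|E| == j) mass p E = 'C(k, j)%:R.
Proof.
rewrite /mass (exchange_big_dep predT) //=.
transitivity (\sum_S p S * 'C(k, j)%:R); last by rewrite -mulr_suml p1 mul1r.
apply: eq_bigr => S _; have [->|ne] := eqVneq (p S) 0; first by rewrite mul0r big1.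
rewrite sumr_const mulr_natr; congr (_ *+ _); rewrite -(hp.2 _ ne) -cards_draws.
by apply: eq_card => E; rewrite !inE andbC.
Qed.

Lemma agr_trans t S0 S S' : agr t S S0 -> agr t S' S0 -> agr t S S'.
Proof.
move=> /'forall_implyP h1 /'forall_implyP h2; apply/'forall_implyP => x xt.
by rewrite (eqP (h1 x xt)) (eqP (h2 x xt)).
Qed.

(** If S and S' both agree with S0 on t, they agree with each other there; this bound is free of S0,
    which is then summed out. *)
Lemma pair_avg t l : \sum_(S0 : {set V} | t \subset S0) p S0 / mass p t * Zex k p Lam f l t (VV t S0) (VV t S0)
  <= \sum_(E' : {set V} | (t \subset E') && (#|E'| == #|t| + l)%N)
    ('C(k - #|t|, l)%:R * mass p t * mass p E')^-1 *
    \sum_(S : {set V} | E' \subset S) \sum_(S' : {set V} | E' \subset S')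
      p S * p S' * ((agr t S S')%:R * Lam ^+ dis f E' t S S').
Proof.
rewrite /Zex; under eq_bigr do rewrite mulr_sumr.
rewrite exchange_big; apply: ler_sum => E' _.
under eq_bigr do rewrite mulrCA.
rewrite -mulr_sumr; apply: ler_wpM2l; first by rewrite invr_ge0 !mulr_ge0 ?(mass_ge0 hp).
under eq_bigr do rewrite mulr_sumr.
rewrite exchange_big; apply: ler_sum => S _.
under eq_bigr do rewrite mulr_sumr.
rewrite exchange_big; apply: ler_sum => S' _.
have L0 : 0 <= Lam ^+ dis f E' t S S' by rewrite exprn_ge0 // (le_trans ler01).
apply: le_trans (_ : \sum_(S0 : {set V} | t \subset S0) p S0 / mass p t *
   (p S * p S' * ((agr t S S')%:R * Lam ^+ dis f E' t S S')) <= _).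
  apply: ler_sum => S0 _; apply: ler_wpM2l; first by rewrite divr_ge0 ?(mass_ge0 hp).
  have -> : p S * VV t S0 S * (p S' * VV t S0 S') * Lam ^+ dis f E' t S S' =
    p S * p S' * (VV t S0 S * VV t S0 S' * Lam ^+ dis f E' t S S') by ring.
  apply: ler_wpM2l; first by rewrite mulr_ge0.
  rewrite ler_wpM2r // /VV -natrM mulnb ler_nat.
  by case: (boolP (agr t S S0)) => //= h1; case: (boolP (agr t S' S0)) => //= h2; rewrite (agr_trans h1 h2).
rewrite -!mulr_suml -/(mass p t) ler_piMl //; first by rewrite !mulr_ge0.
by have [->|ne] := eqVneq (mass p t) 0; rewrite ?mul0r ?ler01 ?divff.
Qed.

(** With E' chosen first, t is a uniform n-subset of E'. For fixed S and S' with D disagreements in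
    E', agreement on t means avoiding them, of probability C(n + l - D, n) / C(n + l, n);
    [bin_decay] says that Lam^D does not outweigh this. *)
Lemma pair_bound n l : (n + l <= k)%N -> Lam * l%:R <= (n + l)%:R ->
  \sum_(t : {set V} | #|t| == n) mass p t / 'C(k, n)%:R *
    (\sum_(S0 : {set V} | t \subset S0) p S0 / mass p t * Zex k p Lam f l t (VV t S0) (VV t S0)) <= 1.
Proof.
move=> nlk hL.
have L0 : 0 <= Lam by exact: le_trans Lam1.
pose cc : R := ('C(k, n)%:R * 'C(k - n, l)%:R)^-1.
have cc0 : 0 <= cc by rewrite invr_ge0 mulr_ge0.
apply: le_trans (_ : \sum_(t : {set V} | #|t| == n) \sum_(E' : {set V} | (t \subset E') && (#|E'| == n + l)%N)
    cc / mass p E' * \sum_(S : {set V} | E' \subset S) \sum_(S' : {set V} | E' \subset S')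
      p S * p S' * ((agr t S S')%:R * Lam ^+ dis f E' t S S') <= _).
  apply: ler_sum => t /eqP tn.
  apply: le_trans (ler_wpM2l _ (pair_avg t l)) _; first by rewrite divr_ge0 ?(mass_ge0 hp).
  rewrite tn mulr_sumr; apply: ler_sum => E' /andP[tE' _]; rewrite mulrA ler_wpM2r //.
    by apply: sumr_ge0 => S _; apply: sumr_ge0 => S' _; rewrite !mulr_ge0 ?exprn_ge0.
  have [e|ne] := eqVneq (mass p t) 0.
    by rewrite e (mass_sub0 hp tE' e) !(mul0r, mulr0, invr0).
  rewrite le_eqVlt; apply/orP; left; apply/eqP; rewrite /cc !invfM.
  set q := mass p t in ne *.
  have -> : q / 'C(k, n)%:R * ('C(k - n, l)%:R^-1 / q / mass p E') =
     'C(k, n)%:R^-1 / 'C(k - n, l)%:R / mass p E' * (q / q) by ring.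
  by rewrite divff ?mulr1.
rewrite (exchange_big_dep (fun E' : {set V} => #|E'| == n + l)%N) /=; last by move=> ? ? _ /andP[].
apply: le_trans (_ : \sum_(E' : {set V} | #|E'| == (n + l)%N) cc * 'C(n + l, n)%:R * mass p E' <= _); last first.
  have e1 : 'C(n + l, n)%:R * 'C(k, n + l)%:R = 'C(k, n)%:R * 'C(k - n, l)%:R :> R.
    by rewrite -!natrM mulnC bin_trinomial.
  rewrite -mulr_sumr sum_mass /cc -mulrA e1.
  have : 'C(k, n)%:R * 'C(k - n, l)%:R != 0 :> R.
    by rewrite mulf_neq0 ?pnatr_eq0 -?lt0n ?bin_gt0; lia.
  by move=> ne; rewrite mulVf.
apply: ler_sum => E' /eqP cE'.
rewrite -mulr_sumr.
have -> : \sum_(t : {set V} | (#|t| == n) && ((t \subset E') && (#|E'| == (n + l)%N)))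
     \sum_(S : {set V} | E' \subset S) \sum_(S' : {set V} | E' \subset S')
      p S * p S' * ((agr t S S')%:R * Lam ^+ dis f E' t S S') =
  \sum_(S : {set V} | E' \subset S) \sum_(S' : {set V} | E' \subset S') p S * p S' *
   \sum_(t : {set V} | (#|t| == n) && (t \subset E')) ((agr t S S')%:R * Lam ^+ dis f E' t S S').
  under eq_bigl do rewrite cE' eqxx andbT.
  rewrite exchange_big; apply: eq_bigr => S _; rewrite exchange_big; apply: eq_bigr => S' _.
  by rewrite mulr_sumr.
have inner S S' : \sum_(t : {set V} | (#|t| == n) && (t \subset E')) ((agr t S S')%:R * Lam ^+ dis f E' t S S')
    <= 'C(n + l, n)%:R.
  pose Ds := [set x in E' | f S x != f S' x].
  have DE : Ds \subset E' by apply/fintype.subsetP => x; rewrite inE => /andP[].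
  have Dc : (#|Ds| <= n + l)%N by rewrite -cE' subset_leq_card.
  apply: le_trans (bin_decay L0 hL Dc).
  have cD : #|E' :\: Ds| = (n + l - #|Ds|)%N by rewrite cardsDS // cE'.
  rewrite -cD -cards_draws -sum1_card natr_sum mulr_suml.
  rewrite [leLHS](bigID (fun t : {set V} => agr t S S')) /= [X in _ + X]big1 ?addr0; last first.
    by move=> t /andP[_ /negbTE->]; rewrite mul0r.
  rewrite le_eqVlt; apply/orP; left; apply/eqP; apply: eq_big => [t|t /andP[/andP[_ tE] at_]].
    rewrite inE [RHS]andbC -andbA; congr (_ && _).
    rewrite finset.subsetD; case: (boolP (t \subset E')) => //= tE.
    apply/'forall_implyP/pred0P => [h x|h x xt].
      rewrite !inE; case: (boolP (x \in t)) => //= xt; rewrite (h x xt) andbF //.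
    have := h x; rewrite !inE xt (fintype.subsetP tE) //= => /negbFE ->//.
  rewrite at_ !mul1r; congr (_ ^+ _); apply: eq_card => x; rewrite !inE.
  case: (boolP (x \in t)) => //= xt; rewrite (fintype.subsetP tE) //=.
  by have /'forall_implyP/(_ x xt) -> := at_.
apply: le_trans (_ : cc / mass p E' * (\sum_(S : {set V} | E' \subset S) \sum_(S' : {set V} | E' \subset S') p S * p S' * 'C(n + l, n)%:R) <= _).
  rewrite ler_wpM2l ?divr_ge0 ?(mass_ge0 hp) //; apply: ler_sum => S _; apply: ler_sum => S' _.
  by rewrite ler_wpM2l ?mulr_ge0.
have -> : \sum_(S : {set V} | E' \subset S) \sum_(S' : {set V} | E' \subset S') p S * p S' * 'C(n + l, n)%:R =
   mass p E' * mass p E' * 'C(n + l, n)%:R.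
  rewrite /mass -mulrA mulr_suml; apply: eq_bigr => S _; rewrite mulr_suml mulr_sumr; apply: eq_bigr => S' _.
  by rewrite mulrA.
have [->|ne] := eqVneq (mass p E') 0; first by rewrite !(mul0r, mulr0).
rewrite le_eqVlt; apply/orP; left; apply/eqP; field; exact: ne.
Qed.

Theorem GG_avg n h : (n + h <= k)%N -> Lam * h%:R <= n%:R ->
  \sum_(t : {set V} | #|t| == n) mass p t / 'C(k, n)%:R *
    (\sum_(S0 : {set V} | t \subset S0) p S0 / mass p t * GG k p Lam f h t (VV t S0) (VV t S0)) <= h.+1%:R.
Proof.
move=> nh hL.
have -> : \sum_(t : {set V} | #|t| == n) mass p t / 'C(k, n)%:R *
    (\sum_(S0 : {set V} | t \subset S0) p S0 / mass p t * GG k p Lam f h t (VV t S0) (VV t S0)) =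
  \sum_(l < h.+1) \sum_(t : {set V} | #|t| == n) mass p t / 'C(k, n)%:R *
    (\sum_(S0 : {set V} | t \subset S0) p S0 / mass p t * Zex k p Lam f l t (VV t S0) (VV t S0)).
  rewrite exchange_big; apply: eq_bigr => t _; rewrite -mulr_sumr; congr (_ * _).
  by rewrite exchange_big; apply: eq_bigr => S0 _; rewrite -mulr_sumr.
have -> : h.+1%:R = \sum_(l < h.+1) 1 :> R by rewrite sumr_const card_ord.
apply: ler_sum => l _; apply: pair_bound.
  by apply: leq_trans nh; rewrite leq_add2l -ltnS.
apply: le_trans (_ : Lam * h%:R <= _); first by apply: ler_wpM2l; [exact: le_trans ler01 Lam1 | rewrite ler_nat -ltnS; exact: ltn_ord].
by apply: le_trans hL _; rewrite ler_nat leq_addr.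
Qed.

End PairBound.

(** * From weak to strong agreement *)

Section Boost.
Variables (R : realType) (V : finType) (k : nat) (p : {set V} -> R).
Hypothesis hp : topw k p.
Implicit Types (E S : {set V}) (A B : {set V} -> R).

Lemma sum_piE_gen E (C : {set V} -> V -> R) : 0 < mass p E ->
  \sum_x piE k p E x * mu p (x |: E) (fun S => C S x) =
  mu p E (fun S => (dg k E)%:R^-1 * \sum_(x in S :\: E) C S x).
Proof.
move=> mE; rewrite (bigID (fun x => x \in E)) /= big1 ?add0r; last first.
  by move=> x xE; rewrite /piE xE mul0r.
rewrite (eq_bigr (fun x => ((dg k E)%:R * mass p E)^-1 * sm p (fun S => C S x) (x |: E))); last first.
  by move=> x xE; rewrite (piE_sm hp) // mulrC.
rewrite -mulr_sumr sum_cover /mu smZ invfM [RHS]mulrAC; congr (_ * _).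
by rewrite /sm; apply: eq_bigr => S _; rewrite mulr_sumr.
Qed.

Lemma mu_scale E A c : mu p E (fun S => A S * c) = c * mu p E A.
Proof. by rewrite /mu mulrA -smZ; congr (_ / _); apply: eq_sm => S _ _; rewrite mulrC. Qed.

Variables (lab : {set V} -> V -> bool).
Local Notation n E A := (nE p lab E A).

Definition wrong E S : nat := #|[set x in S :\: E | ~~ lab S x]|.

Lemma sum_wrong E A : 0 < mass p E -> \sum_x piE k p E x * n E A x false =
  mu p E (fun S => A S * ((wrong E S)%:R / (dg k E)%:R)) / mu p E A.
Proof.
move=> mE; rewrite /nE; under eq_bigr do rewrite mulrA.
rewrite -mulr_suml; congr (_ / _); rewrite (sum_piE_gen (fun S x => cut lab A x false S)) //.
apply: eq_mu => S ES pS; rewrite /cut -mulr_sumr mulrCA; congr (_ * _).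
rewrite mulrC; congr (_ / _); rewrite /wrong -sum1_card natr_sum big_mkcond [RHS]big_mkcond.
apply: eq_bigr => x _; rewrite !inE; case: (_ && _) => //=.
by case: (lab S x).
Qed.

Variables (e d cb beta eta Lam g0 wa wb N0 : R) (r : nat).
Hypotheses (Lam1 : 1 <= Lam) (eta0 : 0 < eta) (beta0 : 0 <= beta) (betaeta : beta <= eta / 240).
Hypotheses (e0 : 0 <= e) (ecb : g0 <= e * cb) (d_ge : 16 * e / eta <= d) (g0_ge0 : 0 <= g0).
Hypotheses (g0_le : expR g0 <= Lam * (eta / 8)).
Hypotheses (kr : (r.+2 <= k)%N).
Hypothesis HS : dense_regular k p cb beta r.
Hypotheses (wa_ge : eta / 5 * N0 <= wa) (wb_le : wb <= eta / 15 * (k - r)%:R).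

(** Analogue of [Rh] with a fixed gain g0 per level and no potential: the difference between A and B
    is now built into the two events and survives every reveal. *)
Definition Bh h E A B : R := h%:R * (g0 - d * h%:R - e * (lw p E A + lw p E B)).

Let d0 : 0 <= d.
Proof. by apply: le_trans d_ge; apply: divr_ge0 (ltW eta0); apply: mulr_ge0 (ler0n _ _) e0. Qed.

Lemma Bh_light h E A B :
  (forall S, 0 <= A S <= 1) -> (forall S, 0 <= B S <= 1) -> 0 < mu p E A -> 0 < mu p E B ->
  mu p E A < expR (- cb) \/ mu p E B < expR (- cb) -> Bh h E A B <= 0.
Proof.
move=> hA hB mA mB light.
have lA : 0 <= lw p E A by apply: (lw_ge0 hp) => S; have /andP[] := hA S.
have lB : 0 <= lw p E B by apply: (lw_ge0 hp) => S; have /andP[] := hB S.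
have hl C : 0 < mu p E C -> mu p E C < expR (- cb) -> cb <= lw p E C.
  by move=> mC hC; rewrite /lw lerNr -[leRHS]expRK ler_ln ?posrE ?expR_gt0 // ltW.
have cbl : cb <= lw p E A + lw p E B.
  by case: light => hC; [have := hl A mA hC | have := hl B mB hC]; lra.
rewrite /Bh mulr_ge0_le0 //.
have s4 := ler_wpM2l e0 cbl; have s5 : 0 <= d * h%:R by rewrite mulr_ge0.
have := ecb; lra.
Qed.

Lemma xlnx_ge (t : R) : 0 <= t -> -1 <= t * ln t.
Proof.
rewrite le0r => /orP[/eqP->|t0]; first by rewrite mul0r; lra.
have := ler_wpM2l (ltW t0) (ln_ge t0); rewrite mulrBr divff ?gt_eqF // mulr1 mulrN; lra.
Qed.

(** Only vertices that are wrong for A and right for B are revealed, each giving a factor Lam. A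
    reveal removes at most one wrong vertex from the faces of A and adds none to those of B, so A
    starts with [h%:R] wrong vertices to spare. *)
Theorem boost_GG h : forall E A B, 0 < mass p E -> (#|E| + h <= r)%N -> (dg k E)%:R <= N0 ->
  (forall S, 0 <= A S <= 1) -> (forall S, 0 <= B S <= 1) ->
  (forall S, A S != 0 -> E \subset S -> p S != 0 -> wa + h%:R <= (wrong E S)%:R) ->
  (forall S, B S != 0 -> E \subset S -> p S != 0 -> (wrong E S)%:R <= wb) ->
  mu p E A * mu p E B * expR (Bh h E A B) <= GG k p Lam lab h E A B.
Proof.
elim: h => [|h IH] E A B mE hr hN hA hB hwA hwB.
all: have A0' S : 0 <= A S by have /andP[] := hA S.
all: have B0' S : 0 <= B S by have /andP[] := hB S.
  by rewrite /Bh mul0r expR0 mulr1; exact: (GG_mu hp).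
have [mA|mA] := eqVneq (mu p E A) 0; first by rewrite mA !mul0r (GG_ge0 hp).
have [mB|mB] := eqVneq (mu p E B) 0; first by rewrite mB mulr0 mul0r (GG_ge0 hp).
have {}mA : 0 < mu p E A by rewrite lt_def mA (mu_ge0 hp).
have {}mB : 0 < mu p E B by rewrite lt_def mB (mu_ge0 hp).
have mm0 : 0 <= mu p E A * mu p E B by rewrite mulr_ge0 // ltW.
have Er : (#|E| <= r)%N by apply: leq_trans hr; rewrite leq_addr.
have dE := ltnW (dg_ge Er kr).
have light : mu p E A < expR (- cb) \/ mu p E B < expR (- cb) ->
    mu p E A * mu p E B * expR (Bh h.+1 E A B) <= GG k p Lam lab h.+1 E A B.
  move=> hl; apply: le_trans (GG_mu hp Lam1 _ h.+1 _ A0' B0'); rewrite ler_piMr //.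
  by rewrite -expR0 ler_expR Bh_light.
have [hvA|ltA] := leP (expR (- cb)) (mu p E A); last by apply: light; left.
have [hvB|ltB] := leP (expR (- cb)) (mu p E B); last by apply: light; right.
have nA := sum_dist lab (HS mE Er hA hvA); have nB := sum_dist lab (HS mE Er hB hvB).
have lA : 0 <= lw p E A by apply: (lw_ge0 hp) => S; have /andP[] := hA S.
have lB : 0 <= lw p E B by apply: (lw_ge0 hp) => S; have /andP[] := hB S.
pose a x := n E A x false; pose b x := n E B x true.
have a_ge0 x : 0 <= a x by exact: (nE_ge0 hp).
have b_ge0 x : 0 <= b x by exact: (nE_ge0 hp).
have pi0 x := piE_ge0 hp E x.
have dgp : 0 < (dg k E)%:R :> R by rewrite ltr0n.
have Ea : eta / 5 <= \sum_x piE k p E x * a x.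
  rewrite sum_wrong // ler_pdivlMr //.
  rewrite -mu_scale.
  rewrite /mu ler_pM2r ?invr_gt0 // /sm; apply: ler_sum => S ES.
  have [->|pS] := eqVneq (p S) 0; first by rewrite !mul0r.
  have [->|AS] := eqVneq (A S) 0; first by rewrite !mul0r.
  rewrite !ler_wpM2l //; first by case: hp.
  rewrite ler_pdivlMr //; apply: le_trans (hwA S AS ES pS).
  have q : eta / 5 * (dg k E)%:R <= eta / 5 * N0 by apply: ler_wpM2l => //; have := eta0; lra.
  have : 0 <= h.+1%:R :> R by exact: ler0n.
  have := wa_ge; lra.
have Eb : \sum_x piE k p E x * n E B x false <= eta / 15.
  rewrite sum_wrong // ler_pdivrMr //.
  rewrite -mu_scale.
  rewrite /mu ler_pM2r ?invr_gt0 // /sm; apply: ler_sum => S ES.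
  have [->|pS] := eqVneq (p S) 0; first by rewrite !mul0r.
  have [->|BS] := eqVneq (B S) 0; first by rewrite !mul0r.
  rewrite !ler_wpM2l //; first by case: hp.
  rewrite ler_pdivrMr //; apply: le_trans (hwB S BS ES pS) _; apply: le_trans wb_le _.
  apply: ler_wpM2l; first by have := eta0; lra.
  by rewrite ler_nat /dg leq_sub2l.
pose Z := \sum_x piE k p E x * (a x * b x).
(* Where the densities are near 1, a b is at least a minus the wrong mass of B. Altogether eta/5 -
   eta/15 - 2 eta/240 = eta/8. *)
have Z8 : eta / 8 <= Z.
  have key x : a x - `|tot (n E A x) - 1| - `|tot (n E B x) - 1| - n E B x false <= a x * b x.
    have ar : a x <= tot (n E A x) by apply: le_tot => q; exact: (nE_ge0 hp).
    have br : b x = tot (n E B x) - n E B x false by rewrite /b /tot; ring.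
    have nf : 0 <= n E B x false by exact: (nE_ge0 hp).
    have := ler_norm (tot (n E A x) - 1).
    have := ler_norm (- (tot (n E B x) - 1)); rewrite normrN.
    set u := `|_|; set v := `|_| => h1 h2.
    have u0 : 0 <= u by exact: normr_ge0. have v0 : 0 <= v by exact: normr_ge0.
    have [b1|b1] := lerP 1 (b x).
      have : a x * 1 <= a x * b x by apply: ler_wpM2l. lra.
    have q1 : a x * (1 - b x) <= (1 + v) * (1 - b x) by apply: ler_wpM2r; [lra | lra].
    have q2 : v * (1 - b x) <= v * 1 by apply: ler_wpM2l => //; have := b_ge0 x; lra.
    lra.
  apply: le_trans (_ : \sum_x piE k p E x * (a x - `|tot (n E A x) - 1| - `|tot (n E B x) - 1| - n E B x false) <= _).
    under eq_bigr do rewrite !mulrBr.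
    rewrite !sumrB; have := Ea; have := Eb; have := nA; have := nB; have := betaeta; lra.
  by apply: ler_sum => x _; apply: ler_wpM2l.
have Zp : 0 < Z by apply: lt_le_trans Z8; have := eta0; lra.
have Sb : \sum_x piE k p E x * b x <= 1.
  rewrite -(sum_pi_tot hp lab mE dE mB); apply: ler_sum => x _; apply: ler_wpM2l => //.
  by apply: le_tot => q; exact: (nE_ge0 hp).
have Sa : \sum_x piE k p E x * a x <= 1.
  rewrite -(sum_pi_tot hp lab mE dE mA); apply: ler_sum => x _; apply: ler_wpM2l => //.
  by apply: le_tot => q; exact: (nE_ge0 hp).
pose Rx x := h%:R * (g0 - d * h%:R - e * (lw p E A + lw p E B) + e * (ln (a x) + ln (b x))).
pose T := \sum_x piE k p E x * (a x * b x * Rx x).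
(* The mean of the child exponents under the weights [piE k p E x * (a x * b x) / Z], the point at
   which exp is linearised. *)
pose Y := T / Z.
have TE : T = h%:R * ((g0 - d * h%:R - e * (lw p E A + lw p E B)) * Z +
    e * \sum_x piE k p E x * (a x * b x * (ln (a x) + ln (b x)))).
  rewrite /T /Z !mulr_sumr -big_split mulr_sumr; apply: eq_bigr => x _ /=; rewrite /Rx; ring.
(* The mean change of the log weights: t ln t >= -1 for each factor, and [a], [b] have mean at most
   1. Divided by Z >= eta/8 this gives the 16 e / eta required of d. *)
have lnS : -2 <= \sum_x piE k p E x * (a x * b x * (ln (a x) + ln (b x))).
  apply: le_trans (_ : \sum_x (- (piE k p E x * b x) - piE k p E x * a x) <= _).
    by rewrite sumrB sumrN; have := Sa; have := Sb; lra.
  apply: ler_sum => x _.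
  have -> : - (piE k p E x * b x) - piE k p E x * a x = piE k p E x * (- b x - a x) by ring.
  apply: ler_wpM2l => //.
  have q1 := ler_wpM2l (b_ge0 x) (xlnx_ge (a_ge0 x)).
  have q2 := ler_wpM2l (a_ge0 x) (xlnx_ge (b_ge0 x)).
  lra.
have h0 : 0 <= h%:R :> R by [].
have Yge : h%:R * (g0 - d * h%:R - e * (lw p E A + lw p E B)) - h%:R * d <= Y.
  rewrite /Y ler_pdivlMr // TE.
  have q1 : - (d * Z) <= e * \sum_x piE k p E x * (a x * b x * (ln (a x) + ln (b x))).
    have q2 := ler_wpM2l e0 lnS.
    have q3 : 2 * e <= d * Z.
      apply: le_trans (_ : 16 * e / eta * (eta / 8) <= _).
        rewrite le_eqVlt; apply/orP; left; apply/eqP; field; exact: lt0r_neq0.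
      apply: ler_pM => //; last by apply: divr_ge0 (ler0n _ _); exact: ltW.
      by apply: divr_ge0 (ltW eta0); apply: mulr_ge0 (ler0n _ _) e0.
    lra.
  have q4 := ler_wpM2l h0 q1; lra.
have cl1 : Bh h.+1 E A B <= Y + g0.
  rewrite /Bh -natr1; have q5 : 0 <= d * h%:R by rewrite mulr_ge0.
  have q6 : 0 <= e * (lw p E A + lw p E B) by rewrite mulr_ge0 ?addr_ge0.
  have := d0; lra.
apply: le_trans (_ : mu p E A * mu p E B * (Lam * Z * expR Y) <= _).
  rewrite ler_wpM2l //; apply: le_trans (_ : expR (Y + g0) <= _); first by rewrite ler_expR.
  rewrite expRD mulrC ler_wpM2r ?expR_ge0 //; apply: le_trans g0_le _; apply: ler_wpM2l Z8.
  exact: le_trans ler01 Lam1.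
have L0 : 0 <= Lam by exact: le_trans ler01 Lam1.
have stp : mu p E A * mu p E B * (Lam * \sum_x piE k p E x * (a x * b x * (expR Y * (1 + Rx x - Y)))) <=
   GG k p Lam lab h.+1 E A B.
  rewrite (GGS hp) // -[leLHS]add0r lerD // !mulr_sumr; apply: ler_sum => x _.
  have rhs0 : 0 <= Lam * GG k p Lam lab h (x |: E) (cut lab A x false) (cut lab B x true).
    by rewrite mulr_ge0 // (GG_ge0 hp) // => S; exact: cut_ge0.
  apply: le_trans (_ : piE k p E x * (Lam * GG k p Lam lab h (x |: E) (cut lab A x false) (cut lab B x true)) <= _); last first.
    rewrite ler_wpM2l // (bigD1 false) //= (bigD1 true) //= expr1 -addrA lerDl addr_ge0 ?sumr_ge0 // => u _.
      by rewrite mulr_ge0 ?exprn_ge0 // (GG_ge0 hp) // => S; exact: cut_ge0.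
    by apply: sumr_ge0 => v _; rewrite mulr_ge0 ?exprn_ge0 // (GG_ge0 hp) // => S; exact: cut_ge0.
  have [pe|pn] := eqVneq (piE k p E x) 0; first by rewrite pe !(mul0r, mulr0).
  have [ab0|ab0] := eqVneq (a x * b x) 0.
    by rewrite ab0 !(mul0r, mulr0); apply: mulr_ge0.
  have ap : 0 < a x by rewrite lt_def a_ge0 andbT; apply: contraNneq ab0 => ->; rewrite mul0r.
  have bp : 0 < b x by rewrite lt_def b_ge0 andbT; apply: contraNneq ab0 => ->; rewrite mulr0.
  have xE : x \notin E by apply: contraNN pn => xE; rewrite /piE xE.
  have mx : 0 < mass p (x |: E).
    rewrite lt_def (mass_ge0 hp) andbT; apply: contraNneq pn => e1.
    by rewrite /piE (negbTE xE) e1 mul0r.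
  have cA S : 0 <= cut lab A x false S <= 1.
    by rewrite cut_ge0 //=; apply: le_trans (cut_le _ _ _ _ A0') _; have /andP[] := hA S.
  have cB S : 0 <= cut lab B x true S <= 1.
    by rewrite cut_ge0 //=; apply: le_trans (cut_le _ _ _ _ B0') _; have /andP[] := hB S.
  have hr' : (#|x |: E| + h <= r)%N by rewrite cardsU1 xE add1n addSnnS.
  have hN' : (dg k (x |: E))%:R <= N0.
    by apply: le_trans hN; rewrite ler_nat dg_ext // leq_pred.
  have wr S : (wrong E S <= (wrong (x |: E) S).+1)%N.
    rewrite /wrong (cardsD1 x) -add1n leq_add ?leq_b1 //; apply: subset_leq_card.
    apply/fintype.subsetP => y; rewrite !inE negb_or => /andP[-> /andP[/andP[-> ->] ->]] //.
  have wr2 S : (wrong (x |: E) S <= wrong E S)%N.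
    apply: subset_leq_card; apply/fintype.subsetP => y; rewrite !inE negb_or.
    by move=> /andP[/andP[/andP[_ ->] ->] ->].
  have hwA' S : cut lab A x false S != 0 -> x |: E \subset S -> p S != 0 -> wa + h%:R <= (wrong (x |: E) S)%:R.
    rewrite /cut mulf_eq0 negb_or => /andP[AS _]; rewrite finset.subUset => /andP[_ ES] pS.
    have := hwA S AS ES pS; have := wr S; rewrite -(ler_nat R) -natr1 => q1 q2.
    by move: q2; rewrite -natr1; lra.
  have hwB' S : cut lab B x true S != 0 -> x |: E \subset S -> p S != 0 -> (wrong (x |: E) S)%:R <= wb.
    rewrite /cut mulf_eq0 negb_or => /andP[BS _]; rewrite finset.subUset => /andP[_ ES] pS.
    by apply: le_trans (hwB S BS ES pS); rewrite ler_nat.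
  have ih := IH _ _ _ mx hr' hN' cA cB hwA' hwB'.
  have nA' : mu p (x |: E) (cut lab A x false) = a x * mu p E A by rewrite /a divfK ?gt_eqF.
  have nB' : mu p (x |: E) (cut lab B x true) = b x * mu p E B by rewrite /b divfK ?gt_eqF.
  have RE : Bh h (x |: E) (cut lab A x false) (cut lab B x true) = Rx x.
    rewrite /Bh /Rx /lw nA' nB' (@lnM _ (a x) (mu p E A)) ?posrE // (@lnM _ (b x) (mu p E B)) ?posrE //; ring.
  rewrite RE nA' nB' in ih.
  have tg := expR_tangent (Rx x) Y.
  have c0 : 0 <= Lam * (a x * mu p E A * (b x * mu p E B)).
    apply: mulr_ge0 L0 (mulr_ge0 (mulr_ge0 _ _) (mulr_ge0 _ _)); exact: ltW.
  have q1 := ler_wpM2l c0 tg; have q2 := ler_wpM2l L0 ih.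
  apply: le_trans (_ : piE k p E x * (Lam * (a x * mu p E A * (b x * mu p E B)) * (expR Y * (1 + Rx x - Y))) <= _).
    rewrite le_eqVlt; apply/orP; left; apply/eqP; ring.
  rewrite ler_wpM2l //; apply: le_trans q1 _; apply: le_trans q2.
  rewrite le_eqVlt; apply/orP; left; apply/eqP; ring.
apply: le_trans stp; rewrite ler_wpM2l // -mulrA ler_wpM2l //.
have -> : \sum_x piE k p E x * (a x * b x * (expR Y * (1 + Rx x - Y))) = expR Y * (Z + T - Z * Y).
  transitivity (\sum_x (expR Y * (piE k p E x * (a x * b x)) + expR Y * (piE k p E x * (a x * b x * Rx x))
      - expR Y * Y * (piE k p E x * (a x * b x)))); first by apply: eq_bigr => x _; ring.
  by rewrite sumrB big_split /= -!mulr_sumr -/Z -/T; ring.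
by rewrite /Y mulrCA divff ?gt_eqF // mulr1 addrK mulrC.
Qed.

Lemma boost_ln h E A B Gam : 0 < mass p E -> (#|E| + h <= r)%N -> (dg k E)%:R <= N0 ->
  (forall S, 0 <= A S <= 1) -> (forall S, 0 <= B S <= 1) ->
  (forall S, A S != 0 -> E \subset S -> p S != 0 -> wa + h%:R <= (wrong E S)%:R) ->
  (forall S, B S != 0 -> E \subset S -> p S != 0 -> (wrong E S)%:R <= wb) ->
  0 < mu p E A -> 0 < mu p E B -> 0 < Gam -> GG k p Lam lab h E A B <= Gam ->
  h%:R * (g0 - d * h%:R - e * (lw p E A + lw p E B)) <= ln Gam + (lw p E A + lw p E B).
Proof.
move=> mE hr hN hA hB wA wB mA mB G0 hG.
have q := le_trans (boost_GG mE hr hN hA hB wA wB) hG.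
have mm : 0 < mu p E A * mu p E B by rewrite mulr_gt0.
have : ln (mu p E A * mu p E B * expR (Bh h E A B)) <= ln Gam.
  by rewrite ler_ln // ?posrE // mulr_gt0 ?expR_gt0.
rewrite lnM ?posrE ?expR_gt0 // expRK (@lnM _ (mu p E A) (mu p E B)) ?posrE // -/(Bh h E A B) /lw.
lra.
Qed.

End Boost.

(** Within 1/8 of 1 the factor [kap r ^+ 2 * r] is at least 1/512; farther away r itself is at most
    9 |r - 1|. This removes the cutoff from a disagreement bound. *)
Lemma kap_dist (R : realType) (r m : R) : 0 <= m <= r ->
  r - m <= 512 * (kap r ^+ 2 * (r * (r - m))) + 9 * `|r - 1|.
Proof.
move=> /andP[m0 mr]; have r0 : 0 <= r by exact: le_trans mr.
have d0 : 0 <= r - m by lra.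
have [near|far] := lerP `|r - 1| 8^-1; last first.
  have : 0 <= kap r ^+ 2 * (r * (r - m)) by rewrite mulr_ge0 ?sqr_ge0 // mulr_ge0.
  have : r <= 9 * `|r - 1| by have := ler_norm (r - 1); lra.
  lra.
have th := theta_near r0; rewrite thetaE in th.
have th3 : 3 / 64 <= r * kap r by lra.
have r9 : r <= 9 / 8 by have := ler_norm (r - 1); lra.
have rp : 0 < r by move: near; rewrite ler_norml => /andP[]; lra.
have k2 : 9 / 4096 <= (r * kap r) ^+ 2.
  have -> : 9 / 4096 = (3 / 64) ^+ 2 :> R by field.
  by rewrite ler_sqr ?nnegrE //; lra.
have k3 : 512^-1 <= kap r ^+ 2 * r.
  rewrite -(ler_pM2l rp); have -> : r * (kap r ^+ 2 * r) = (r * kap r) ^+ 2 by ring.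
  by lra.
have := ler_wpM2r d0 k3; have := normr_ge0 (r - 1); lra.
Qed.

(** Flipping the colour of s alone is an involution exchanging the colourings that separate s from
    s' with those that do not. Random two-colourings thus reduce any alphabet to the two labels of
    the recursion, at a loss of a factor 2. *)
Lemma half_colorings (R : realType) (Sigma : finType) (s s' : Sigma) : s != s' ->
  \sum_(phi : {ffun Sigma -> bool}) (phi s != phi s')%:R = #|{ffun Sigma -> bool}|%:R / 2 :> R.
Proof.
move=> ne; pose fl (phi : {ffun Sigma -> bool}) : {ffun Sigma -> bool} :=
  [ffun x => if x == s then ~~ phi x else phi x].
have flK : involutive fl.
  by move=> phi; apply/ffunP => x; rewrite !ffunE; case: (x == s); rewrite ?negbK.
have e1 : \sum_(phi : {ffun Sigma -> bool}) (phi s != phi s')%:R =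
    \sum_(phi : {ffun Sigma -> bool}) (phi s == phi s')%:R :> R.
  rewrite (reindex_inj (inv_inj flK)) /=; apply: eq_bigr => phi _; rewrite !ffunE eqxx.
  by rewrite eq_sym in ne; rewrite (negbTE ne); case: (phi s); case: (phi s').
have e2 : \sum_(phi : {ffun Sigma -> bool}) (phi s != phi s')%:R +
    \sum_(phi : {ffun Sigma -> bool}) (phi s == phi s')%:R = #|{ffun Sigma -> bool}|%:R :> R.
  rewrite -big_split /= -sum1_card natr_sum; apply: eq_bigr => phi _.
  by case: (_ == _); rewrite /= ?addr0 ?add0r.
by rewrite -e2 -e1; field.
Qed.

(** * Plurality decoding over an arbitrary alphabet *)

Section Plurality.
Variables (R : realType) (V : finType) (k : nat) (p : {set V} -> R).
Hypothesis hp : topw k p.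
Variables (Sigma : finType) (f : {set V} -> V -> Sigma).
Implicit Types (E S : {set V}) (A B : {set V} -> R).
Variables (E : {set V}) (A : {set V} -> R).
Hypotheses (mE : 0 < mass p E) (dE : (0 < dg k E)%N).
Hypotheses (A0' : forall S, 0 <= A S) (mA : 0 < mu p E A).
Local Notation nu := (nE p f E A).
Local Notation r x := (\sum_s nu x s).

Let nu0 x s : 0 <= nu x s. Proof. exact: (nE_ge0 hp). Qed.

Lemma color_n (phi : V -> Sigma -> bool) x b :
  nE p (fun S x => phi x (f S x)) E A x b = \sum_(s | phi x s == b) nu x s.
Proof.
rewrite /nE -mulr_suml /mu -mulr_suml; congr (_ / _ / _).
rewrite /sm [RHS]exchange_big /=; apply: eq_bigr => S _; rewrite /cut -!mulr_sumr; congr (_ * (_ * _)).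
rewrite big_mkcond (bigD1 (f S x)) //= eqxx big1 ?addr0; last first.
  by move=> s ne; rewrite [f S x == s]eq_sym (negbTE ne); case: ifP.
by case: ifP.
Qed.

Lemma color_tot (phi : V -> Sigma -> bool) x :
  tot (nE p (fun S x => phi x (f S x)) E A x) = r x.
Proof. by rewrite tot_nE sum_nE. Qed.

Definition offd x : R := \sum_s \sum_(s' | s != s') nu x s * nu x s'.

(** The bound holds for every two-colouring, hence on average, where each pair of distinct symbols
    is separated half of the time. *)
Lemma color_avg x0 :
  (forall phi : {ffun Sigma -> bool}, XX k p (fun S x => phi (f S x)) E A A <= x0) ->
  \sum_x piE k p E x * (kap (r x) ^+ 2 * offd x) <= 2 * x0.
Proof.
move=> h; pose N : R := #|{ffun Sigma -> bool}|%:R.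
have N0 : 0 < N by rewrite ltr0n; apply/card_gt0P; exists [ffun=> true].
have Xphi (phi : {ffun Sigma -> bool}) : XX k p (fun S x => phi (f S x)) E A A =
    \sum_x piE k p E x * (kap (r x) ^+ 2 * \sum_s \sum_s' nu x s * nu x s' * (phi s != phi s')%:R).
  apply: eq_bigr => x _; congr (_ * _); rewrite /gfun (color_tot (fun _ => phi)) sum_bool /=.
  rewrite !(color_n (fun _ => phi)).
  set nt := \sum_(s | phi s == true) _; set nf := \sum_(s | phi s == false) _.
  have -> : \sum_s \sum_s' nu x s * nu x s' * (phi s != phi s')%:R = nt * nf + nf * nt.
    have inn s : \sum_s' nu x s * nu x s' * (phi s != phi s')%:R = nu x s * (if phi s then nf else nt).
      under eq_bigr do rewrite -mulrA.
      rewrite -mulr_sumr; congr (_ * _); case ps: (phi s).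
        by rewrite /nf [RHS]big_mkcond; apply: eq_bigr => s' _; case: (phi s'); rewrite ?mulr0 ?mulr1.
      by rewrite /nt [RHS]big_mkcond; apply: eq_bigr => s' _; case: (phi s'); rewrite ?mulr0 ?mulr1.
    under eq_bigr do rewrite inn.
    rewrite (bigID (fun s => phi s == true)) /=; congr (_ + _).
      by rewrite /nt mulr_suml; apply: eq_bigr => s /eqP->.
    rewrite /nf mulr_suml; apply: eq_big => [s|s]; first by case: (phi s).
    by case: (phi s).
  ring.
have S1 : \sum_(phi : {ffun Sigma -> bool}) XX k p (fun S x => phi (f S x)) E A A =
    N / 2 * \sum_x piE k p E x * (kap (r x) ^+ 2 * offd x).
  under eq_bigr do rewrite Xphi.
  rewrite exchange_big mulr_sumr; apply: eq_bigr => x _; rewrite -mulr_sumr -mulr_sumr.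
  rewrite [RHS]mulrCA; congr (_ * _); rewrite [RHS]mulrCA; congr (_ * _).
  rewrite exchange_big /offd mulr_sumr; apply: eq_bigr => s _.
  rewrite exchange_big mulr_sumr [RHS]big_mkcond; apply: eq_bigr => s' _.
  rewrite -mulr_sumr; case: (eqVneq s s') => [->|ne].
    by rewrite big1 ?mulr0 // => phi _; rewrite eqxx.
  by rewrite half_colorings // mulrC.
have S2 : \sum_(phi : {ffun Sigma -> bool}) XX k p (fun S x => phi (f S x)) E A A <= N * x0.
  apply: le_trans (ler_sum _ (fun phi _ => h phi)) _; by rewrite sumr_const mulr_natl.
rewrite S1 in S2.
have : N * (2^-1 * \sum_x piE k p E x * (kap (r x) ^+ 2 * offd x)) <= N * x0 by rewrite mulrA.
by rewrite ler_pM2l //; lra.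
Qed.

(** No symbol is heavier than the plurality symbol, so r times the mass off it is at most the mass
    [offd] of pairs of distinct symbols; [kap_dist] then converts the damped bound. [s0] is only the
    starting value that the arg max needs. *)
Lemma plurality x0 beta (s0 : V -> Sigma) :
  (forall phi : {ffun Sigma -> bool}, XX k p (fun S x => phi (f S x)) E A A <= x0) ->
  \sum_x piE k p E x * `|mu p (x |: E) A / mu p E A - 1| <= beta ->
  exists g : {ffun V -> Sigma},
    mu p E (fun S => A S * ((wrong (fun S x => f S x == g x) E S)%:R / (dg k E)%:R))
    <= (1024 * x0 + 9 * beta) * mu p E A.
Proof.
move=> hx hb; have hc := color_avg hx.
pose g : {ffun V -> Sigma} := [ffun x => [arg max_(s > s0 x) nu x s]%O].
have gmax x s : nu x s <= nu x (g x) by rewrite ffunE; case: Order.TotalTheory.arg_maxP => // i _; apply.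
exists g; rewrite -ler_pdivrMr // -(sum_wrong hp) //.
have nf x : nE p (fun S x => f S x == g x) E A x false = r x - nu x (g x).
  have := color_tot (fun x s => s == g x) x; rewrite /tot (color_n (fun x s => s == g x) x true).
  by rewrite (big_pred1 (g x)) => [<-|s]; [ring | rewrite eqb_id].
have pt x : r x - nu x (g x) <= 512 * (kap (r x) ^+ 2 * offd x) + 9 * `|r x - 1|.
  have gr : 0 <= nu x (g x) <= r x.
    by rewrite nu0 /= (bigD1 (g x)) //= lerDl sumr_ge0.
  have key : r x * (r x - nu x (g x)) <= offd x.
    have -> : offd x = \sum_s nu x s * (r x - nu x s).
      apply: eq_bigr => s _; rewrite -mulr_sumr; congr (_ * _).
      by rewrite [X in _ = X - _](bigD1 s) //= [RHS]addrC addKr; apply: eq_bigl => s'; rewrite eq_sym.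
    rewrite mulr_suml; apply: ler_sum => s _; apply: ler_wpM2l => //; have := gmax x s; lra.
  have := ler_wpM2l (sqr_ge0 (kap (r x))) key; have := kap_dist gr; lra.
under eq_bigr do rewrite nf.
apply: le_trans (_ : \sum_x (512 * (piE k p E x * (kap (r x) ^+ 2 * offd x)) + 9 * (piE k p E x * `|r x - 1|)) <= _).
  apply: ler_sum => x _; have := ler_wpM2l (piE_ge0 hp E x) (pt x); lra.
rewrite big_split /= -!mulr_sumr.
have : \sum_x piE k p E x * `|r x - 1| <= beta by under eq_bigr do rewrite sum_nE.
lra.
Qed.

End Plurality.

(** * From the mean to the tail for one restriction *)

Section Restriction.
Variables (R : realType) (V : finType) (k : nat) (p : {set V} -> R).
Hypothesis hp : topw k p.
Variables (Sigma : finType) (f : {set V} -> V -> Sigma).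
Variables (c a e d cb beta CV epsb Lam : R) (r : nat).
Hypotheses (c0 : 0 < c) (Lam1 : 1 <= Lam) (aE : a = ln Lam / 512) (a_gt0 : 0 < a).
Hypotheses (beta8 : 0 <= beta <= 8^-1) (e0 : 0 <= e) (CV0 : 0 <= CV).
Hypothesis ecb : a * (1 + 10 * c + 2 * Kst c) <= e * cb.
Hypothesis d_ge : 6 * e + a * CSt c * (CV + epsb) <= d.
Hypotheses (kr : (r.+2 <= k)%N) (hepsb : (k - r)%:R^-1 <= epsb).
Hypotheses (HV : decorr k p CV r) (HS : dense_regular k p cb beta r).
Variables (e2 d2 eta g0 : R).
Hypotheses (eta0 : 0 < eta) (betaeta : beta <= eta / 240).
Hypotheses (e20 : 0 <= e2) (ecb2 : g0 <= e2 * cb) (d2_ge : 16 * e2 / eta <= d2).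
Hypothesis g0_le : expR g0 <= Lam * (eta / 8).
Variables (t S0 : {set V}) (h : nat) (delta Gam x1 l1 : R).
Hypotheses (mt : 0 < mass p t) (thr : (#|t| + h <= r)%N) (h0 : (0 < h)%N).
Local Notation Vt := (VV R f t S0).
Hypotheses (delta01 : 0 < delta <= 1) (mV : expR (- l1) <= mu p t Vt) (l1cb : l1 <= cb).
Hypotheses (Gam0 : 0 < Gam) (hG : GG k p Lam f h t Vt Vt <= Gam).
Hypothesis num1 : ln 2 + d * h%:R + 2 * e * l1 + (ln Gam + 2 * l1) / h%:R <= a * x1.
Hypothesis num2 : 1024 * (10 * c + Kst c * beta + x1) + 9 * beta <= eta / 32.
Hypotheses (numh : h%:R <= eta / 20 * (dg k t)%:R).
Hypotheses (numr : eta / 16 * (dg k t)%:R <= eta / 15 * (k - r)%:R).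
Local Notation l2 := (- 2 * ln delta + 2 * l1 + ln 2).
Hypothesis num3 : ln Gam + l2 < h%:R * (g0 - d2 * h%:R - e2 * l2).

(** If the faces far from the plurality function g weighed more than delta^2 of V_tau, the log
    weights of the far and close parts would add up to at most l2, and [boost_ln] would force the
    exchange sum above Gam, against [num3]. *)
Theorem restriction_DP : exists g : {ffun V -> Sigma},
  mu p t (fun S => Vt S * (eta / 4 * (dg k t)%:R < (wrong (fun S x => f S x == g x) t S)%:R)%R%:R)
  <= delta ^+ 2 * mu p t Vt.
Proof.
have V01 S : 0 <= Vt S <= 1 by rewrite /VV ler0n lern1 leq_b1.
have V0 S : 0 <= Vt S by have /andP[] := V01 S.
have mVp : 0 < mu p t Vt by exact: lt_le_trans (expR_gt0 _) mV.
have lwV : lw p t Vt <= l1.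
  by rewrite /lw lerNl -[leLHS]expRK ler_ln ?posrE ?expR_gt0.
have lwV0 : 0 <= lw p t Vt by apply: (lw_ge0 hp) => S; have /andP[] := V01 S.
have tr : (#|t| <= r)%N by apply: leq_trans thr; rewrite leq_addr.
have dE := ltnW (dg_ge tr kr).
have dgp : 0 < (dg k t)%:R :> R by rewrite ltr0n.
have hh : 0 < h%:R :> R by rewrite ltr0n.
have hvV : expR (- cb) <= mu p t Vt by apply: le_trans mV; rewrite ler_expR lerN2.
(* A two-colouring only merges symbols, so its exchange sum is bounded by that of f, and the first
   recursion applies to every colouring. *)
have cross (phi : {ffun Sigma -> bool}) :
    XX k p (fun S x => phi (f S x)) t Vt Vt <= 10 * c + Kst c * beta + x1.
  apply: (weak_cross hp c0 Lam1 aE beta8 e0 CV0 ecb d_ge kr hepsb HV HS mt thr h0 a_gt0 V01 mVp Gam0).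
    apply: le_trans hG; apply: ler_sum => l _.
    by apply: (Zex_le hp Lam1) => S //; rewrite ?V0 ?lexx // => S' x ->.
  apply: le_trans num1.
  have q1 : 2 * e * lw p t Vt <= 2 * e * l1 by apply: ler_wpM2l => //; rewrite mulr_ge0.
  have q2 : (ln Gam + 2 * lw p t Vt) / h%:R <= (ln Gam + 2 * l1) / h%:R.
    by apply: ler_wpM2r; [rewrite invr_ge0 | lra].
  lra.
have nV := HS mt tr V01 hvV.
have [g hg] := plurality hp mt V0 mVp (fun x => f S0 x) cross nV.
exists g; pose lab S x := f S x == g x.
rewrite -/lab in hg.
have {}hg : mu p t (fun S => Vt S * ((wrong lab t S)%:R / (dg k t)%:R)) <= eta / 32 * mu p t Vt.
  by apply: le_trans hg _; apply: ler_wpM2r => //; exact: ltW.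
(* Far faces: eta/4 = eta/5 + eta/20 leaves room for h reveals by [numh]. Close faces, below: the
   threshold eta/16 is twice the mean bound eta/32, so Markov's inequality leaves at least half of
   V_tau. *)
pose A S := Vt S * (eta / 4 * (dg k t)%:R < (wrong lab t S)%:R)%R%:R.
pose B S := Vt S * ((wrong lab t S)%:R <= eta / 16 * (dg k t)%:R)%R%:R.
have A01 S : 0 <= A S <= 1.
  by rewrite mulr_ge0 //= mulr_ile1 ?ler0n ?lern1 ?leq_b1 //; have /andP[] := V01 S.
have B01 S : 0 <= B S <= 1.
  by rewrite mulr_ge0 //= mulr_ile1 ?ler0n ?lern1 ?leq_b1 //; have /andP[] := V01 S.
have A0' S : 0 <= A S by have /andP[] := A01 S.
have B0' S : 0 <= B S by have /andP[] := B01 S.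
have AV S : A S <= Vt S by rewrite ler_piMr // lern1 leq_b1.
have BV S : B S <= Vt S by rewrite ler_piMr // lern1 leq_b1.
have muB : mu p t Vt / 2 <= mu p t B.
  have q1 : mu p t Vt <= mu p t B + 16 / eta * mu p t (fun S => Vt S * ((wrong lab t S)%:R / (dg k t)%:R)).
    rewrite -mu_scale -muD /mu ler_pM2r ?invr_gt0 //; apply: (le_sm hp) => S /=; rewrite /B -(mulrA (Vt S) (_ / _)) -(mulrDr (Vt S)).
    apply: ler_peMr; first exact: V0.
    have en : 0 <= 16 / eta by apply: divr_ge0 (ler0n _ _) (ltW eta0).
    case: (lerP (wrong lab t S)%:R (eta / 16 * (dg k t)%:R)) => hw /=.
      by rewrite lerDl; apply: mulr_ge0 en; apply: divr_ge0; exact: ler0n.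
    rewrite add0r -(@ler_pM2r _ (eta / 16 * (dg k t)%:R)); last by rewrite mulr_gt0 // divr_gt0.
    have -> : (wrong lab t S)%:R / (dg k t)%:R * (16 / eta) * (eta / 16 * (dg k t)%:R) = (wrong lab t S)%:R :> R.
      by field; rewrite !gt_eqF.
    by rewrite mul1r ltW.
  have en : 0 <= 16 / eta by rewrite divr_ge0 // ltW.
  have q2 := ler_wpM2l en hg.
  have q3 : 16 / eta * (eta / 32 * mu p t Vt) = mu p t Vt / 2 by field; exact: lt0r_neq0.
  rewrite q3 in q2; lra.
have mB : 0 < mu p t B by apply: lt_le_trans muB; rewrite divr_gt0.
have [//|gt] := lerP (mu p t A) (delta ^+ 2 * mu p t Vt).
have /andP[de0 de1] := delta01.
have mA : 0 < mu p t A by apply: lt_trans gt; rewrite mulr_gt0 ?exprn_gt0.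
have lwB : lw p t B <= l1 + ln 2.
  rewrite /lw; have : ln (mu p t Vt / 2) <= ln (mu p t B) by rewrite ler_ln ?posrE // divr_gt0.
  rewrite ln_div ?posrE //; move: lwV; rewrite /lw; lra.
have lwA : lw p t A <= - 2 * ln delta + l1.
  rewrite /lw; have : ln (delta ^+ 2 * mu p t Vt) <= ln (mu p t A).
    have pos : 0 < delta ^+ 2 * mu p t Vt by apply: mulr_gt0 => //; exact: exprn_gt0.
    by rewrite ler_ln ?posrE // ltW.
  rewrite (@lnM _ (delta ^+ 2) (mu p t Vt)) ?posrE ?exprn_gt0 // lnXn //; move: lwV; rewrite /lw -mulr_natl; lra.
have /andP[b0 _] := beta8.
have wa_ge : eta / 5 * (dg k t)%:R <= eta / 5 * (dg k t)%:R by [].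
have GAB : GG k p Lam lab h t A B <= Gam.
  apply: le_trans hG; apply: ler_sum => l _.
  apply: (Zex_le hp Lam1) => [S|S|S S' x e']; rewrite ?A0' ?B0' ?AV ?BV //.
  by rewrite /lab e'.
have hwA S : A S != 0 -> t \subset S -> p S != 0 -> eta / 5 * (dg k t)%:R + h%:R <= (wrong lab t S)%:R.
  rewrite /A mulf_eq0 negb_or => /andP[_]; case: (ltrP _ (wrong lab t S)%:R) => [hw _|_]; last by rewrite eqxx.
  by move=> _ _; have := numh; lra.
have hwB S : B S != 0 -> t \subset S -> p S != 0 -> (wrong lab t S)%:R <= eta / 16 * (dg k t)%:R.
  by rewrite /B mulf_eq0 negb_or => /andP[_]; case: lerP => // _; rewrite eqxx.
have := boost_ln hp Lam1 eta0 betaeta e20 ecb2 d2_ge g0_le kr HS wa_ge numr mt thr (lexx _)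
   A01 B01 hwA hwB mA mB Gam0 GAB.
have ll : lw p t A + lw p t B <= l2 by lra.
have q4 := ler_wpM2l e20 ll.
have q5 : h%:R * (g0 - d2 * h%:R - e2 * l2) <= h%:R * (g0 - d2 * h%:R - e2 * (lw p t A + lw p t B)).
  by apply: ler_wpM2l; [exact: ltW | lra].
by have := num3; lra.
Qed.

End Restriction.

(** * Spectral gaps *)

Section SpectralGap.
Import numFieldNormedType.Exports.

Lemma continuous_bigsum (R : realType) (T : topologicalType) (I : finType) (F : I -> T -> R) :
  (forall i, continuous (F i)) -> continuous (fun x => \sum_i F i x).
Proof.
move=> h; suff H (s : seq I) : continuous (fun x => \sum_(i <- s) F i x) by exact: H.
elim: s => [|i s IH].
  rewrite (_ : (fun _ => _) = fun=> 0); first exact: cst_continuous.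
  by apply: funext => x; rewrite big_nil.
rewrite (_ : (fun _ => _) = (fun x => F i x + \sum_(j <- s) F j x)); last first.
  by apply: funext => x; rewrite big_cons.
by move=> x; apply: cvgD; [exact: h | exact: IH].
Qed.

(** The first-order condition at a maximum; t = b / (|c| + 1) is small enough for the linear term to
    dominate. *)
Lemma quad_le0 (R : realType) (b c : R) : (forall t, 2 * t * b + t ^+ 2 * c <= 0) -> b = 0.
Proof.
move=> h; have := h (b / (`|c| + 1)); have c1 : 0 < `|c| + 1 by have := normr_ge0 c; lra.
have -> : 2 * (b / (`|c| + 1)) * b + (b / (`|c| + 1)) ^+ 2 * c =
   b ^+ 2 * (2 * (`|c| + 1) + c) / (`|c| + 1) ^+ 2 by field; rewrite gt_eqF.
rewrite ler_pdivrMr ?exprn_gt0 // mul0r => h2.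
have c2 : 0 < 2 * (`|c| + 1) + c by have := ler_norm (- c); rewrite normrN; have := normr_ge0 c; lra.
have : b ^+ 2 <= 0 by rewrite -(ler_pM2r c2) mul0r.
by move=> h3; apply/eqP; rewrite -sqrf_eq0 eq_le h3 sqr_ge0.
Qed.

Section Rayleigh.
Variables (R : realType) (N : nat) (w : 'I_N -> R) (K : 'M[R]_N) (lam : R).
Hypotheses (w0 : forall i, 0 < w i) (wK : forall i j, w i * K i j = w j * K j i).
Hypothesis K1 : forall i, \sum_j K i j = 1.
Hypothesis gap : forall a, eigenvalue K a -> lam < a -> a = 1 /\ \rank (eigenspace K a) = 1%N.
Implicit Types u v : 'rV[R]_N.

Let ip u v : R := \sum_i w i * (u ord0 i * v ord0 i).
Let bf u v : R := \sum_i \sum_j w i * K i j * (u ord0 i * v ord0 j).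
Let me u : R := \sum_i w i * u ord0 i.

Let ipC u v : ip u v = ip v u.
Proof. by apply: eq_bigr => i _; rewrite (mulrC (u _ _)). Qed.
Let bfC u v : bf u v = bf v u.
Proof.
rewrite /bf exchange_big; apply: eq_bigr => i _; apply: eq_bigr => j _.
by rewrite wK (mulrC (u _ _)).
Qed.
Let ipD a u v z : ip (u + a *: v) z = ip u z + a * ip v z.
Proof. by rewrite /ip mulr_sumr -big_split; apply: eq_bigr => i _ /=; rewrite !mxE; ring. Qed.
Let bfD a u v z : bf (u + a *: v) z = bf u z + a * bf v z.
Proof.
rewrite /bf mulr_sumr -big_split; apply: eq_bigr => i _ /=; rewrite mulr_sumr -big_split.
by apply: eq_bigr => j _ /=; rewrite !mxE; ring.
Qed.
Let meD a u v : me (u + a *: v) = me u + a * me v.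
Proof. by rewrite /me mulr_sumr -big_split; apply: eq_bigr => i _ /=; rewrite !mxE; ring. Qed.
Let ip_ge0 u : 0 <= ip u u.
Proof. by apply: sumr_ge0 => i _; rewrite mulr_ge0 ?(ltW (w0 i)) // -expr2 sqr_ge0. Qed.
Let ip_eq0 u : ip u u = 0 -> u = 0.
Proof.
move=> /psumr_eq0P h; apply/rowP => i; rewrite mxE; apply/eqP.
have := h _ i isT; rewrite -expr2 => h1.
have {}h1 : w i * u ord0 i ^+ 2 = 0 by apply: h1 => j _; rewrite mulr_ge0 ?(ltW (w0 j)) // -expr2 sqr_ge0.
by move/eqP: h1; rewrite mulf_eq0 gt_eqF //= sqrf_eq0.
Qed.
Let ip_scale a u : ip (a *: u) (a *: u) = a ^+ 2 * ip u u.
Proof. by rewrite /ip mulr_sumr; apply: eq_bigr => i _; rewrite !mxE; ring. Qed.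
Let bf_scale a u : bf (a *: u) (a *: u) = a ^+ 2 * bf u u.
Proof.
rewrite /bf mulr_sumr; apply: eq_bigr => i _; rewrite mulr_sumr; apply: eq_bigr => j _.
by rewrite !mxE; ring.
Qed.
Let me_scale a u : me (a *: u) = a * me u.
Proof. by rewrite /me mulr_sumr; apply: eq_bigr => i _; rewrite !mxE; ring. Qed.

Let coordc i : continuous (fun u : 'rV[R]_N => u ord0 i).
Proof. exact: coord_continuous. Qed.
Let mulc (f g : 'rV[R]_N -> R) : continuous f -> continuous g -> continuous (fun u => f u * g u).
Proof. by move=> hf hg u; exact: (cvgM (hf u) (hg u)). Qed.
Let me_cont : continuous me.
Proof. by apply: continuous_bigsum => i; apply: mulc => //; exact: cst_continuous. Qed.
Let ip_cont : continuous (fun u => ip u u).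
Proof.
apply: continuous_bigsum => i; apply: mulc; first exact: cst_continuous.
exact: mulc.
Qed.
Let bf_cont : continuous (fun u => bf u u).
Proof.
apply: continuous_bigsum => i; apply: continuous_bigsum => j; apply: mulc; first exact: cst_continuous.
exact: mulc.
Qed.

Let sphere : set 'rV[R]_N := (me @^-1` [set x | x = 0] `&` (fun u => ip u u) @^-1` [set x | x = 1])%classic.

Let sphere_compact : compact sphere.
Proof.
have cl : closed sphere.
  apply: closedI; apply: preimage_closed; try exact: closed_eq.
    by move=> u _; exact: me_cont.
  by move=> u _; exact: ip_cont.
pose B i : R := (w i)^-1 + 1.
have cc : compact [set v : 'rV[R]_N | forall i, (`[- B i, B i]%classic) (v ord0 i)]%classic.
  by apply: (rV_compact (A := fun i => `[- B i, B i]%classic)) => i; exact: segment_compact.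
apply: subclosed_compact cl cc _ => u [_ /= hu] i /=; rewrite in_itv /= -ler_norml.
have wi : w i * (u ord0 i * u ord0 i) <= 1.
  rewrite -hu /ip (bigD1 i) //= lerDl; apply: sumr_ge0 => j _.
  by rewrite mulr_ge0 ?(ltW (w0 j)) // -expr2 sqr_ge0.
have B0 : 0 <= B i by rewrite addr_ge0 // invr_ge0 ltW.
rewrite -(ler_sqr (x := `|_|)) ?nnegrE // real_normK ?num_real //.
have h1 : u ord0 i ^+ 2 <= (w i)^-1.
  by rewrite -(ler_pM2l (w0 i)) divff ?gt_eqF // expr2.
apply: le_trans h1 _; rewrite /B; have := invr_gt0 (w i); rewrite w0 => v0.
by have := sqr_ge0 (w i)^-1; lra.
Qed.

(** The hypothesis concerns eigenvalues and ranks of eigenspaces, the conclusion a quadratic form.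
    By compactness the form has a maximiser u on the mean-zero unit sphere, and u yields an
    eigenvector. An eigenvalue above lam would be the simple eigenvalue 1, whose eigenvectors come
    from constants, which contradicts mean zero and norm 1. *)
Theorem rayleigh (f : 'I_N -> R) : \sum_i w i * f i = 0 ->
  \sum_i \sum_j w i * K i j * (f i * f j) <= lam * \sum_i w i * f i ^+ 2.
Proof.
move=> f0; pose v := \row_i f i : 'rV[R]_N.
have -> : \sum_i \sum_j w i * K i j * (f i * f j) = bf v v.
  by apply: eq_bigr => i _; apply: eq_bigr => j _; rewrite !mxE.
have -> : \sum_i w i * f i ^+ 2 = ip v v by apply: eq_bigr => i _; rewrite !mxE.
have mv : me v = 0 by rewrite -f0; apply: eq_bigr => i _; rewrite mxE.
have bf0 : bf 0 0 = 0.
  by apply: big1 => i _; apply: big1 => j _; rewrite !mxE mul0r mulr0.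
have [v0|vn] := eqVneq (ip v v) 0; first by rewrite v0 (ip_eq0 v0) bf0 mulr0.
have norm_in u : me u = 0 -> ip u u != 0 -> sphere ((Num.sqrt (ip u u))^-1 *: u).
  move=> mu un; split => /=; first by rewrite me_scale mu mulr0.
  by rewrite ip_scale exprVn sqr_sqrtr ?ip_ge0 // mulVf.
have sn0 : (sphere !=set0)%classic by exists ((Num.sqrt (ip v v))^-1 *: v); exact: norm_in.
have [u] := EVT_max_rV sn0 sphere_compact (continuous_subspaceT bf_cont).
rewrite inE => -[/= mu0 iu1] umax.
pose m := bf u u.
have hom z : me z = 0 -> bf z z <= m * ip z z.
  move=> mz; have [z0|zn] := eqVneq (ip z z) 0; first by rewrite z0 (ip_eq0 z0) bf0 mulr0.
  have := umax ((Num.sqrt (ip z z))^-1 *: z); rewrite inE => /(_ (norm_in z mz zn)).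
  rewrite bf_scale exprVn sqr_sqrtr ?ip_ge0 // -/m mulrC ler_pdivrMr //.
  by rewrite lt_def zn ip_ge0.
have orth z : me z = 0 -> bf u z = m * ip u z.
  move=> mz; apply/eqP; rewrite -subr_eq0; apply/eqP.
  apply: (@quad_le0 _ _ (bf z z - m * ip z z)) => a.
  have := hom (u + a *: z); rewrite meD mu0 mz mulr0 addr0 => /(_ erefl).
  rewrite bfD ![bf _ (u + _)]bfC !bfD ipD ![ip _ (u + _)]ipC !ipD (bfC z u) (ipC z u) iu1 -/m => h.
  have -> : 2 * a * (bf u z - m * ip u z) + a ^+ 2 * (bf z z - m * ip z z) =
    (m + a * bf u z + a * (bf u z + a * bf z z)) - m * (1 + a * ip u z + a * (ip u z + a * ip z z)) by ring.
  by rewrite subr_le0.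
pose one := const_mx 1 : 'rV[R]_N.
have bfu1 : bf u one = 0.
  rewrite -mu0; apply: eq_bigr => i _.
  rewrite -[RHS]mulr1 -(K1 i) mulr_sumr; apply: eq_bigr => j _; rewrite !mxE; ring.
have ipu1 : ip u one = 0 by rewrite -mu0; apply: eq_bigr => i _; rewrite !mxE mulr1.
have W0 : 0 < me one.
  case: (pickP 'I_N) => [i _|none]; last first.
    by case/eqP: vn; apply: big1 => i; have := none i.
  rewrite /me (bigD1 i) //= mxE mulr1 ltr_wpDr //; apply: sumr_ge0 => j _.
  by rewrite mxE mulr1 ltW.
have orthA z : bf u z = m * ip u z.
  pose a := - (me z / me one).
  have := orth (z + a *: one); rewrite meD /a mulNr divfK ?gt_eqF // subrr => /(_ erefl).
  by rewrite bfC bfD bfC (bfC one) bfu1 mulr0 addr0 ipC ipD ipC (ipC one) ipu1 mulr0 addr0.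
(* Eigenvectors are rows here, so the function u must be multiplied by the stationary weights. *)
pose vv := \row_i (w i * u ord0 i) : 'rV[R]_N.
have eig : vv *m K = m *: vv.
  apply/rowP => j; rewrite !mxE; have := orthA (delta_mx ord0 j).
  have -> : bf u (delta_mx ord0 j) = \sum_i w i * K i j * u ord0 i.
    apply: eq_bigr => i _; rewrite (bigD1 j) //= big1 ?addr0 => [|j' ne].
      by rewrite !mxE !eqxx mulr1.
    by rewrite !mxE (negbTE ne) andbF !mulr0.
  have -> : ip u (delta_mx ord0 j) = w j * u ord0 j.
    rewrite /ip (bigD1 j) //= big1 ?addr0 => [|j' ne]; first by rewrite !mxE !eqxx mulr1.
    by rewrite !mxE (negbTE ne) andbF !mulr0.
  by move=> <-; apply: eq_bigr => i _; rewrite !mxE; ring.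
have vvn : vv != 0.
  apply/eqP => e; have un : u = 0.
    apply/rowP => i; have := congr1 (fun M : 'rV[R]_N => M ord0 i) e; rewrite !mxE => /eqP.
    by rewrite mulf_eq0 gt_eqF //= => /eqP.
  move: iu1; rewrite un /ip big1 => [/esym/eqP|i _]; first by rewrite oner_eq0.
  by rewrite mxE mul0r mulr0.
have ev : eigenvalue K m by apply/eigenvalueP; exists vv.
have mlam : m <= lam.
  rewrite leNgt; apply/negP => lt; have [m1 rk] := gap ev lt.
  pose wv := \row_i w i : 'rV[R]_N.
  have wvE : (wv <= eigenspace K m)%MS.
    apply/eigenspaceP; rewrite m1 scale1r; apply/rowP => j; rewrite !mxE.
    rewrite -[RHS]mulr1 -(K1 j) mulr_sumr; apply: eq_bigr => i _; by rewrite !mxE wK.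
  have vvE : (vv <= eigenspace K m)%MS by apply/eigenspaceP.
  have wvn : wv != 0.
    apply/eqP => e; move: W0; rewrite /me big1 ?ltxx // => i _.
    by have := congr1 (fun M : 'rV[R]_N => M ord0 i) e; rewrite !mxE => ->; rewrite mul0r.
  have eqs : (eigenspace K m <= wv)%MS.
    have := mxrank_leqif_sup wvE; rewrite rk => -[_ /esym]; rewrite rank_rV wvn eqxx => ->//.
  have /sub_rVP[a ea] := submx_trans vvE eqs.
  have ua i : u ord0 i = a.
    have := congr1 (fun M : 'rV[R]_N => M ord0 i) ea; rewrite !mxE mulrC => /mulIf; apply.
    by rewrite gt_eqF.
  have a0 : a = 0.
    have : me u = a * me one by rewrite /me mulr_sumr; apply: eq_bigr => i _; rewrite ua mxE; ring.
    by rewrite mu0 => /esym/eqP; rewrite mulf_eq0 (gt_eqF W0) orbF => /eqP.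
  by case/eqP: vvn; rewrite ea a0 scale0r.
apply: le_trans (hom v mv) _; exact: ler_wpM2r.
Qed.

End Rayleigh.

Lemma reversible_gap (R : realType) (T : finType) (X : {set T}) (w : T -> R) (K : T -> T -> R) (lam : R) :
  (forall x, x \in X -> 0 < w x) ->
  (forall x y, x \in X -> y \in X -> w x * K x y = w y * K y x) ->
  (forall x, x \in X -> \sum_(y in X) K x y = 1) ->
  (forall a, eigenvalue (\matrix_(i < #|X|, j < #|X|) K (enum_val i) (enum_val j)) a -> lam < a ->
    a = 1 /\ \rank (eigenspace (\matrix_(i < #|X|, j < #|X|) K (enum_val i) (enum_val j)) a) = 1%N) ->
  forall f : T -> R, \sum_(x in X) w x * f x = 0 ->
  \sum_(x in X) \sum_(y in X) w x * K x y * (f x * f y) <= lam * \sum_(x in X) w x * f x ^+ 2.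
Proof.
move=> w0 wK K1 gap f f0.
have := @rayleigh R #|X| (fun i => w (enum_val i)) _ lam _ _ _ gap (fun i => f (enum_val i)).
rewrite -(big_enum_val (fun x => w x * f x)) -(big_enum_val (fun x => w x * f x ^+ 2)).
move=> /(_ _ _ _ f0) h.
have e : \sum_(x in X) \sum_(y in X) w x * K x y * (f x * f y) =
   \sum_(i < #|X|) \sum_(j < #|X|) w (enum_val i) *
     (\matrix_(i < #|X|, j < #|X|) K (enum_val i) (enum_val j)) i j * (f (enum_val i) * f (enum_val j)).
  rewrite big_enum_val; apply: eq_bigr => i _; rewrite big_enum_val; apply: eq_bigr => j _.
  by rewrite mxE.
rewrite e; apply: h.
- by move=> i; apply: w0; exact: enum_valP.
- by move=> i j; rewrite !mxE wK ?enum_valP.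
- move=> i; rewrite -[RHS](K1 _ (enum_valP i)) [RHS]big_enum_val; apply: eq_bigr => j _; by rewrite mxE.
Qed.

End SpectralGap.

(** * Links as weighted complexes *)

Section LinkReduction.
Variables (R : realType) (V : finType).
Implicit Types (F G : {set {set V}}) (p q : {set V} -> R) (E S s t u : {set V}) (A : {set V} -> R).

(** Faces are read off from the weight, so statements about the complex become statements about
    masses, which are easily transported to links and skeletons. *)
Definition supp k F p : Prop := topw k p /\ forall t, (t \in F) = (0 < mass p t).

Lemma wcomplex_supp k F p : wcomplex k F p -> supp k F p.
Proof.
case=> dc up pos out _; have p0 S : 0 <= p S.
  have [h|h] := boolP ((S \in F) && (#|S| == k)); first exact: ltW (pos _ h).
  by rewrite out.
have hp : topw k p.
  split=> // S; apply: contraNeq => h; rewrite out // negb_and h orbT //.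
split=> // t; apply/idP/idP => [tF|].
  have [S SF /andP[tS kS]] := up t tF; rewrite /mass (bigD1 S) //=.
  by apply: ltr_wpDr; [exact: sumr_ge0 | apply: pos; rewrite SF].
apply: contraTT => tF; rewrite -leNgt (_ : mass p t = 0) //; apply: big1 => S tS.
by rewrite out //; apply: contraNN tF => /andP[SF _]; exact: dc SF tS.
Qed.

Lemma wcomplex_mass1 k F p : wcomplex k F p -> \sum_S p S = 1.
Proof.
case=> _ _ _ out <-; rewrite [LHS](bigID (fun S => (S \in F) && (#|S| == k))) /= [X in _ + X]big1 ?addr0 //.
Qed.

Lemma sum_link E (g : {set V} -> R) :
  \sum_(u : {set V} | [disjoint u & E]) g u = \sum_(S : {set V} | E \subset S) g (S :\: E).
Proof.
rewrite (reindex_onto (fun S => S :\: E) (fun u => u :|: E)) /=; last first.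
  by move=> u dE; rewrite finset.setDUl finset.setDv finset.setU0; apply/finset.setDidPl.
apply: eq_bigl => S; rewrite finset.setUC finset.setDE; apply/andP/idP => [[_ /eqP <-]|ES].
  exact: finset.subsetUl.
split; first by rewrite -finset.setDE -setI_eq0 finset.setIDAC finset.setDE -finset.setIA finset.setICr finset.setI0.
by rewrite -finset.setDE -{2}(finset.setID S E) (finset.setIidPr ES).
Qed.

Variables (k : nat) (p : {set V} -> R) (E : {set V}).
Hypotheses (hp : topw k p) (mE : 0 < mass p E).
Local Notation q := (link_p p E).
Local Notation m := (k - #|E|)%N.

Lemma link_topw : topw m q.
Proof.
split=> [u|u]; rewrite /link_p; case: ifP => [dj|]; rewrite ?eqxx //.
  by rewrite divr_ge0 ?(mass_ge0 hp) //; case: hp.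
rewrite mulf_eq0 negb_or => /andP[pu _].
by rewrite -(hp.2 _ pu) cardsU (_ : u :&: E = finset.set0) ?cards0 ?subn0 ?addnK //; apply/eqP; rewrite setI_eq0.
Qed.

Lemma disj_link S : [disjoint S :\: E & E].
Proof. by rewrite -finset.setI_eq0 finset.setIDAC finset.setDE -finset.setIA finset.setICr finset.setI0. Qed.

Lemma setDKU S : E \subset S -> (S :\: E) :|: E = S.
Proof. by move=> ES; rewrite -{2}(finset.setID S E) (finset.setIidPr ES) finset.setUC. Qed.

Lemma setUKD u : [disjoint u & E] -> (u :|: E) :\: E = u.
Proof. by move=> dE; rewrite finset.setDUl finset.setDv finset.setU0; apply/finset.setDidPl. Qed.

Lemma link_sum (g : {set V} -> R) : \sum_u q u * g u = \sum_(S : {set V} | E \subset S) p S / mass p E * g (S :\: E).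
Proof.
rewrite (bigID (fun u => [disjoint u & E])) /= [X in _ + X]big1 ?addr0; last first.
  by move=> u /negbTE h; rewrite /link_p h mul0r.
rewrite sum_link; apply: eq_bigr => S ES; by rewrite /link_p disj_link setDKU.
Qed.

Lemma link_sm s A : [disjoint s & E] ->
  sm q (fun u => A (u :|: E)) s = sm p A (s :|: E) / mass p E.
Proof.
move=> dj; rewrite /sm big_mkcond /=.
rewrite (eq_bigr (fun u => q u * (if s \subset u then A (u :|: E) else 0))); last first.
  by move=> u _; case: ifP; rewrite ?mulr0.
rewrite link_sum mulr_suml [RHS]big_mkcond [LHS]big_mkcond /=; apply: eq_bigr => S _.
rewrite finset.subUset; case: (boolP (E \subset S)) => ES; rewrite ?andbF // andbT.
rewrite finset.subsetD dj andbT setDKU //; case: ifP => _; first by ring.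
by rewrite mulr0.
Qed.

Lemma link_mass s : [disjoint s & E] -> mass q s = mass p (s :|: E) / mass p E.
Proof. by move=> dj; rewrite (mass_sm q) (mass_sm p) -(link_sm (fun _ => 1)). Qed.

Lemma link_mass0 s : ~~ [disjoint s & E] -> mass q s = 0.
Proof.
move=> dj; apply: big1 => u su; rewrite /link_p ifN //; apply: contra dj => du.
exact: disjointWl su du.
Qed.

Lemma link_mass1 : mass q finset.set0 = 1.
Proof. by rewrite link_mass ?finset.set0U ?divff ?gt_eqF // -finset.setI_eq0 finset.set0I. Qed.

Lemma disjU1 x s : [disjoint s & E] -> x \notin E -> [disjoint x |: s & E].
Proof.
rewrite -!finset.setI_eq0 finset.setIUl => /eqP -> xE; rewrite finset.setU0 finset.setI_eq0.
by rewrite disjoints1.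
Qed.

Lemma link_mu s A : [disjoint s & E] -> mu q s (fun u => A (u :|: E)) = mu p (s :|: E) A.
Proof.
move=> dj; rewrite /mu link_sm // link_mass //.
have [->|ne] := eqVneq (mass p (s :|: E)) 0; first by rewrite mul0r invr0 !mulr0.
by field; rewrite ne gt_eqF.
Qed.

Lemma link_dg s : [disjoint s & E] -> dg m s = dg k (s :|: E).
Proof. by move=> /disjoint_setI0 h; rewrite /dg cardsU h cards0 subn0 addnC subnDA. Qed.

Lemma link_piE s x : [disjoint s & E] -> 0 < mass p (s :|: E) -> piE m q s x = piE k p (s :|: E) x.
Proof.
move=> dj ms; rewrite /piE finset.in_setU; case: (boolP (x \in s)) => //= xs; case: (boolP (x \in E)) => xE.
  by rewrite link_mass0 ?mul0r //; apply: contraL xE => dj'; rewrite (disjointFr dj') //; exact: finset.setU11.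
rewrite link_mass ?link_mass //; last exact: disjU1.
rewrite -finset.setUA link_dg //; have := mE; have [->|ne] := eqVneq (dg k (s :|: E))%:R (0 : R).
  by rewrite !mul0r invr0 !mulr0.
by move=> m0; field; rewrite ne !gt_eqF.
Qed.

Lemma link_pi2E s x y : [disjoint s & E] -> 0 < mass p (s :|: E) -> pi2E m q s x y = pi2E k p (s :|: E) x y.
Proof.
move=> dj ms; have mqs : 0 < mass q s by rewrite link_mass // divr_gt0.
rewrite !pi2E_piE //; last exact: link_topw.
rewrite (link_piE x dj ms).
have [->|nz] := eqVneq (piE k p (s :|: E) x) 0; first by rewrite !mul0r.
have xs : x \notin s :|: E by apply: contra nz; rewrite /piE => ->.
have mx : 0 < mass p (x |: (s :|: E)).
  rewrite lt_def (mass_ge0 hp) andbT; apply: contra nz; rewrite /piE (negbTE xs) => /eqP ->.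
  by rewrite mul0r.
move: xs; rewrite finset.in_setU negb_or => /andP[xs xE].
rewrite link_piE ?finset.setUA //; first by exact: disjU1.
by rewrite -finset.setUA.
Qed.

Lemma link_supp F : (forall t, (t \in F) = (0 < mass p t)) ->
  forall t, (t \in link_faces F E) = (0 < mass q t).
Proof.
move=> hF t; have [dj|dj] := boolP [disjoint t & E].
  rewrite link_mass // pmulr_lgt0 ?invr_gt0 // -hF; apply/imsetP/idP => [[S]|tF].
    by rewrite inE => /andP[SF ES ->]; rewrite setDKU.
  by exists (t :|: E); rewrite ?inE ?tF ?finset.subsetUr // setUKD.
rewrite link_mass0 // ltxx; apply: contraNF dj => /imsetP[S _ ->]; exact: disj_link.
Qed.

End LinkReduction.

(** * Spectral gap and decorrelation of vertex pairs *)

Section GraphGap.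
Variables (R : realType) (V : finType).
Implicit Types (F G : {set {set V}}) (p q : {set V} -> R) (E S s t u : {set V}) (A : {set V} -> R).

Definition qgap k p s (lam : R) : Prop := forall f : V -> R, \sum_x piE k p s x * f x = 0 ->
  \sum_x \sum_y pi2E k p s x y * (f x * f y) <= lam * \sum_x piE k p s x * f x ^+ 2.

(** [adj] is the transition kernel pi2E / piE: its factor 2 and C(n, 2) combine to n (n - 1), the
    count of ordered pairs. It is reversible for [piE], so [reversible_gap] applies. *)
Lemma graph_gap n F q lam : topw n q -> (forall t, (t \in F) = (0 < mass q t)) -> (1 < n)%N ->
  0 < mass q finset.set0 ->
  (forall a, eigenvalue (adjmx n F q) a -> lam < a -> a = 1 /\ \rank (eigenspace (adjmx n F q) a) = 1%N) ->
  qgap n q finset.set0 lam.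
Proof.
move=> hq hF n2 m0 gap f f0.
have wX x : x \in vertices F -> 0 < piE n q finset.set0 x.
  rewrite inE hF /piE finset.in_set0 finset.setU0 => mx; rewrite divr_gt0 // mulr_gt0 // ltr0n /dg cards0 subn0.
  exact: ltn_trans n2.
have wX0 x : x \notin vertices F -> piE n q finset.set0 x = 0.
  rewrite inE hF -leNgt => mx; have e : mass q [set x] = 0 by apply/eqP; rewrite eq_le mx (mass_ge0 hq).
  by rewrite /piE finset.in_set0 finset.setU0 e mul0r.
have wK x y : x \in vertices F -> piE n q finset.set0 x * adj n q x y = pi2E n q finset.set0 x y.
  rewrite inE hF => mx; rewrite /piE /pi2E /adj /pij !finset.in_set0 /= finset.setU0; case: eqVneq => // xy; first by rewrite mulr0.
  rewrite (_ : [set x; y] = y |: [set x]); last by rewrite finset.setUC.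
  rewrite /dg cards0 subn0 bin1 bin2 -divn2; have n0 : (n%:R : R) != 0 by rewrite pnatr_eq0; lia.
  have n1 : (n.-1%:R : R) != 0 by rewrite pnatr_eq0; lia.
  have -> : ((n * n.-1) %/ 2)%:R = (n%:R * n.-1%:R) / 2 :> R.
    rewrite -natrM -[in RHS](@divnK 2 (n * n.-1)) ?natrM ?mulfK ?pnatr_eq0 //.
    by rewrite dvdn2 oddM; case: (n) => //= n'; case: (odd n').
  by field; rewrite n0 n1 !gt_eqF //.
have K0 x y : y \notin vertices F -> pi2E n q finset.set0 x y = 0.
  move=> /wX0 e; rewrite pi2E_sym pi2E_piE // e mul0r //.
have K0' x y : x \notin vertices F -> pi2E n q finset.set0 x y = 0 by move=> h; rewrite pi2E_sym K0.
have restr (g : V -> R) : (forall x, x \notin vertices F -> g x = 0) -> \sum_x g x = \sum_(x in vertices F) g x.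
  move=> g0; rewrite (bigID (mem (vertices F))) /= [X in _ + X]big1 ?addr0 // => x; exact: g0.
rewrite restr; last by move=> x xF; apply: big1 => y _; rewrite K0' // mul0r.
rewrite [in leRHS]restr; last by move=> x xF; rewrite wX0 // mul0r.
rewrite restr in f0; last by move=> x xF; rewrite wX0 // mul0r.
apply: le_trans (reversible_gap wX _ _ gap f0).
- by rewrite le_eqVlt; apply/orP; left; apply/eqP; apply: eq_bigr => x xF; rewrite restr;
   [apply: eq_bigr => y yF; rewrite wK | move=> y yF; rewrite K0 // mul0r].
- by move=> x y xF yF; rewrite !wK // pi2E_sym.
- move=> x xF; apply: (mulfI (lt0r_neq0 (wX x xF))); rewrite mulr1 mulr_sumr.
  rewrite (eq_bigr (fun y => pi2E n q finset.set0 x y)); last by move=> y _; rewrite wK.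
  rewrite -restr; last by move=> y; exact: K0.
  rewrite (eq_bigr (fun y => piE n q finset.set0 x * piE n q (x |: finset.set0) y)); last by move=> y _; rewrite pi2E_piE.
  rewrite -mulr_sumr sum_piE ?mulr1 //; first by move: xF; rewrite inE hF finset.setU0.
  by rewrite dg_ext ?finset.in_set0 // /dg cards0; lia.
Qed.

Lemma lse_qgap k F p lam : supp k F p -> lse_one lam k F p ->
  forall s, 0 < mass p s -> (#|s| + 2 <= k)%N -> qgap k p s lam.
Proof.
move=> [hp hF] h s ms sk f.
have sF : s \in F by rewrite hF.
have d0 : [disjoint finset.set0 & s] by rewrite -finset.setI_eq0 finset.set0I.
have g0 := graph_gap (link_topw s hp) (link_supp ms hF) _ _ (h s sF sk).
have := g0 _ _ f; rewrite (link_mass1 ms).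
have e1 x : piE (k - #|s|) (link_p p s) finset.set0 x = piE k p s x by rewrite link_piE ?finset.set0U.
have e2 x y : pi2E (k - #|s|) (link_p p s) finset.set0 x y = pi2E k p s x y by rewrite link_pi2E ?finset.set0U.
under eq_bigr do rewrite e1; under [in X in _ -> X <= _]eq_bigr do under eq_bigr do rewrite e2.
under [in X in _ -> _ <= X]eq_bigr do rewrite e1; by apply => //; lia.
Qed.

Lemma lse_two_one k F p lam : lse_two lam k F p -> lse_one lam k F p.
Proof. by move=> h s sF sk a ea la; apply: h => //; exact: lt_le_trans (ler_norm _). Qed.

Section Skeleton.
Variables (m D : nat) (q Q : {set V} -> R).
Hypotheses (hq : topw m q) (hQ : topw D Q) (mD : (m <= D)%N).
Hypothesis sk : forall t, #|t| = m -> q t = pij D Q m t.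

(** Masses in the skeleton are proportional to those above, with a factor depending only on the
    size, by descending from size m with [sum_ext1]. Its value is irrelevant: the vertex laws are
    normalised. *)
Lemma skel_mass d : (d <= m)%N -> exists2 K : R, 0 < K & forall s, (#|s| + d)%N = m -> mass q s = K * mass Q s.
Proof.
elim: d => [_|d IH dm].
  exists ('C(D, m)%:R^-1); first by rewrite invr_gt0 ltr0n bin_gt0.
  move=> s; rewrite addn0 => ks; rewrite /mass (bigD1 s) //= sk // /pij mulrC big1 ?addr0 // => u /andP[su us].
  apply/eqP; apply: contraNT us => /(hq.2) um; by rewrite eq_sym eqEcard su um ks leqnn.
have [K K0 h] := IH (ltnW dm).
exists (K * (D - (m - d.+1))%:R / d.+1%:R); first by rewrite divr_gt0 // mulr_gt0 // ltr0n; lia.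
move=> s ks; have := sum_ext1 hq (fun _ => 1) s; have := sum_ext1 hQ (fun _ => 1) s; rewrite -!mass_sm.
have ds : dg m s = d.+1 by rewrite /dg; lia.
have dS : dg D s = (D - (m - d.+1))%N by rewrite /dg; lia.
rewrite ds dS => e1 e2.
have e3 : \sum_(x | x \notin s) sm q (fun _ => 1) (x |: s) = K * \sum_(x | x \notin s) sm Q (fun _ => 1) (x |: s).
  rewrite mulr_sumr; apply: eq_bigr => x xs; rewrite -!mass_sm h // cardsU1 xs; lia.
have n0 : (d.+1%:R : R) != 0 by rewrite pnatr_eq0.
apply: (mulfI n0); rewrite -e2 e3 e1; move: n0; move: (d.+1%:R : R) => N n0; by field.
Qed.

Lemma skel_pos s : (#|s| <= m)%N -> (0 < mass q s) = (0 < mass Q s).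
Proof. by move=> ks; have [K K0 ->] := skel_mass (leq_subr #|s| m); rewrite ?pmulr_rgt0 //; lia. Qed.

Lemma skel_piE s x : (#|s| < m)%N -> 0 < mass q s -> piE m q s x = piE D Q s x.
Proof.
move=> ks ms; have mQ : 0 < mass Q s by rewrite -skel_pos // ltnW.
rewrite /piE; case: ifP => // /negbT xs.
have [K K0 h] := skel_mass (leq_subr #|s| m).
have [K' K0' h'] := skel_mass (leq_subr #|s|.+1 m).
have es : mass q s = K * mass Q s by apply: h; lia.
have e y : y \notin s -> mass q (y |: s) = K' * mass Q (y |: s) by move=> ys; apply: h'; rewrite cardsU1 ys; lia.
have := sum_ext1 hq (fun _ => 1) s; have := sum_ext1 hQ (fun _ => 1) s; rewrite -!mass_sm => e1 e2.
have e3 : \sum_(x | x \notin s) sm q (fun _ => 1) (x |: s) = K' * \sum_(x | x \notin s) sm Q (fun _ => 1) (x |: s).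
  by rewrite mulr_sumr; apply: eq_bigr => y ys; rewrite -!mass_sm e.
have dm0 : (dg m s)%:R != 0 :> R by rewrite pnatr_eq0 /dg; lia.
have dD0 : (dg D s)%:R != 0 :> R by rewrite pnatr_eq0 /dg; lia.
have rel : (dg m s)%:R * K = K' * (dg D s)%:R.
  by apply: (mulIf (lt0r_neq0 mQ)); rewrite -mulrA -es -e2 e3 e1 mulrA.
rewrite e // es mulrA rel; field; rewrite dD0 !gt_eqF //.
Qed.

Lemma skel_pi2E s x y : (#|s| + 2 <= m)%N -> 0 < mass q s -> pi2E m q s x y = pi2E D Q s x y.
Proof.
move=> ks ms; rewrite !pi2E_piE //; last by rewrite -skel_pos //; lia.
rewrite skel_piE //; last by lia.
have [->|nz] := eqVneq (piE D Q s x) 0; first by rewrite !mul0r.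
have xs : x \notin s by apply: contra nz; rewrite /piE => ->.
have cx : #|x |: s| = #|s|.+1 by rewrite cardsU1 xs.
rewrite skel_piE //; first by rewrite cx; lia.
rewrite skel_pos; last by rewrite cx; lia.
rewrite lt_def (mass_ge0 hQ) andbT; apply: contra nz; rewrite /piE (negbTE xs) => /eqP ->.
by rewrite mul0r.
Qed.

Lemma skel_qgap s lam : (#|s| + 2 <= m)%N -> 0 < mass q s -> qgap D Q s lam -> qgap m q s lam.
Proof.
move=> ks ms h f.
under eq_bigr do rewrite skel_piE ?ms // ?(leq_trans _ ks) ?addn2 //.
under [in X in _ -> X <= _]eq_bigr do under eq_bigr do rewrite skel_pi2E //.
under [in X in _ -> _ <= X]eq_bigr do rewrite skel_piE ?ms // ?(leq_trans _ ks) ?addn2 //.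
exact: h.
Qed.

End Skeleton.

Section PairForm.
Variables (m : nat) (q : {set V} -> R).
Hypotheses (hq : topw m q) (m2 : (1 < m)%N) (q1 : mass q finset.set0 = 1).
Local Notation pi := (piE m q finset.set0).
Local Notation pi2 := (pi2E m q finset.set0).

Lemma sum_set0 (g : {set V} -> R) : \sum_(S : {set V} | finset.set0 \subset S) g S = \sum_S g S.
Proof. by apply: eq_bigl => S; rewrite finset.sub0set. Qed.

Lemma one_form (g : V -> R) : \sum_x pi x * g x = m%:R^-1 * \sum_S q S * \sum_(x in S) g x.
Proof.
under [X in _ * X]eq_bigr do rewrite mulr_sumr.
rewrite (exchange_big_dep predT) //= mulr_sumr; apply: eq_bigr => x _.
rewrite /piE finset.in_set0 finset.setU0 /dg cards0 subn0 q1 mulr1 -mulr_suml.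
rewrite (_ : \sum_(i : {set V} | x \in i) q i = mass q [set x]); first by ring.
by apply: eq_bigl => S; rewrite finset.sub1set.
Qed.

(** The square of the sum over S expands into ordered pairs plus a diagonal. As squares are
    nonnegative, the form is at least - 1 / (m - 1) times the norm: a lower spectral bound comes for
    free. *)
Lemma pair_form (u : V -> R) : \sum_x \sum_y pi2 x y * (u x * u y) =
  (m%:R * m.-1%:R)^-1 * (\sum_S q S * (\sum_(x in S) u x) ^+ 2) - m.-1%:R^-1 * \sum_x pi x * u x ^+ 2.
Proof.
have n0 : (m%:R : R) != 0 by rewrite pnatr_eq0; lia.
have n1 : (m.-1%:R : R) != 0 by rewrite pnatr_eq0; lia.
pose c : R := (m%:R * m.-1%:R)^-1.
have e x y : pi2 x y * (u x * u y) = c * (\sum_(S : {set V}) q S * ((x \in S)%:R * (y \in S)%:R)) * (u x * u y)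
   - (x == y)%:R * (m.-1%:R^-1 * (pi x * u x ^+ 2)).
  have mxy : mass q (y |: (x |: finset.set0)) = \sum_(S : {set V}) q S * ((x \in S)%:R * (y \in S)%:R).
    rewrite /mass big_mkcond; apply: eq_bigr => S _; rewrite finset.setU0 finset.subUset !finset.sub1set.
    by case: (x \in S); case: (y \in S); rewrite /= ?mulr1 ?mulr0 ?mul0r.
  rewrite -mxy /pi2E /piE !finset.in_set0 /= /dg cards0 subn0 q1; case: eqVneq => [<-|xy].
    by rewrite /= mul1r finset.setUA finset.setUid mul0r /c; field; rewrite n0.
  by rewrite /= mul0r subr0 mulr1 /c; congr (_ * _); rewrite mulrC.
under eq_bigr do under eq_bigr do rewrite e.
under eq_bigr do rewrite big_split /=.
rewrite big_split /=; congr (_ + _); last first.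
  rewrite mulr_sumr -sumrN; apply: eq_bigr => x _; rewrite (bigD1 x) //= eqxx mul1r big1 ?addr0 // => y yx.
  by rewrite eq_sym (negbTE yx) mul0r oppr0.
rewrite -/c mulr_sumr.
under eq_bigr do under eq_bigr do rewrite mulr_sumr mulr_suml.
under eq_bigr do rewrite exchange_big /=.
rewrite exchange_big /=; apply: eq_bigr => S _.
rewrite expr2 big_distrlr /= !mulr_sumr [RHS]big_mkcond /=; apply: eq_bigr => x _.
case: (x \in S) => /=; last by rewrite big1 // => y _; ring.
rewrite [in RHS]big_mkcond !mulr_sumr /=; apply: eq_bigr => y _.
by case: (y \in S) => /=; ring.
Qed.

(** [errM] is the pair form of M - z against a centred sign function. Polarisation makes it a
    difference of two quadratic forms, the first bounded above by the gap and the second below by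
    [pair_form], so a one-sided gap is enough. *)
Lemma decorr_gap (C : R) : 0 <= C -> qgap m q finset.set0 (C / m%:R) ->
  forall M : V -> R, (forall x, 0 <= M x <= 1) -> errM pi pi2 M <= C / m%:R + m.-1%:R^-1.
Proof.
move=> C0 gap M M01.
have dg0 : dg m (finset.set0 : {set V}) = m by rewrite /dg cards0 subn0.
have m0 : 0 < mass q finset.set0 by rewrite q1.
have s1 : \sum_x pi x = 1 by apply: sum_piE; rewrite ?dg0 //; lia.
have pi0 x : 0 <= pi x by apply: piE_ge0.
have mr x : \sum_y pi2 x y = pi x.
  have [e|ne] := eqVneq (pi x) 0.
    by rewrite e; apply: big1 => y _; rewrite pi2E_piE // e mul0r.
  rewrite (eq_bigr (fun y => pi x * piE m q (x |: finset.set0) y)); last by move=> y _; rewrite pi2E_piE.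
  rewrite -mulr_sumr sum_piE ?mulr1 //.
    rewrite lt_def (mass_ge0 hq) andbT; apply: contra ne; rewrite /piE finset.in_set0 => /eqP ->.
    by rewrite mul0r.
  by rewrite dg_ext ?finset.in_set0 // dg0; lia.
pose z := \sum_x pi x * M x; pose F x := M x - z.
pose hh y := \sum_x pi2 x y * F x; pose sg y : R := Num.sg (hh y).
pose es := \sum_x pi x * sg x; pose g y := sg y - es.
have F0 : \sum_x pi x * F x = 0.
  by under eq_bigr do rewrite mulrBr; rewrite sumrB -mulr_suml s1 mul1r subrr.
have g0 : \sum_x pi x * g x = 0.
  by under eq_bigr do rewrite mulrBr; rewrite sumrB -mulr_suml s1 mul1r subrr.
have var (a : V -> R) : \sum_x pi x * (a x - \sum_x pi x * a x) ^+ 2 <= \sum_x pi x * a x ^+ 2.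
  set b := \sum_x pi x * a x.
  rewrite (eq_bigr (fun x => pi x * a x ^+ 2 - 2 * b * (pi x * a x) + b ^+ 2 * pi x)); last by move=> x _; ring.
  rewrite big_split /= sumrB -!mulr_sumr s1 -/b; have := sqr_ge0 b; lra.
have nF : \sum_x pi x * F x ^+ 2 <= 1.
  apply: le_trans (var M) _; rewrite -s1; apply: ler_sum => x _; rewrite ler_piMr //.
  by have /andP[a b] := M01 x; rewrite expr_le1.
have ng : \sum_x pi x * g x ^+ 2 <= 1.
  apply: le_trans (var sg) _; rewrite -s1; apply: ler_sum => x _; rewrite ler_piMr // /sg.
  by case: sgrP => _; rewrite ?expr0n ?expr1n ?sqrrN ?expr1n.
have -> : errM pi pi2 M = \sum_x \sum_y pi2 x y * (F x * g y).
  rewrite exchange_big /=; transitivity (\sum_y hh y * g y); last first.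
    by apply: eq_bigr => y _; rewrite mulr_suml; apply: eq_bigr => x _; rewrite mulrA.
  transitivity (\sum_y hh y * sg y - es * \sum_y hh y); last first.
    rewrite mulr_sumr -sumrB; apply: eq_bigr => y _; rewrite /g; ring.
  have -> : \sum_y hh y = 0.
    rewrite exchange_big /=; under eq_bigr do rewrite -mulr_suml mr; exact: F0.
  rewrite mulr0 subr0; apply: eq_bigr => y _; rewrite [RHS]mulrC /sg -normrEsg; congr `|_|.
  rewrite /hh /F; under [RHS]eq_bigr do rewrite mulrBr; rewrite sumrB -mulr_suml; congr (_ - _ * _).
  by under eq_bigr do rewrite pi2E_sym; rewrite mr.
pose B (a : V -> R) := \sum_x \sum_y pi2 x y * (a x * a y).
have pol : \sum_x \sum_y pi2 x y * (F x * g y) = (B (fun x => F x + g x) - B (fun x => F x - g x)) / 4.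
  have sy : \sum_x \sum_y pi2 x y * (g x * F y) = \sum_x \sum_y pi2 x y * (F x * g y).
    by rewrite exchange_big /=; apply: eq_bigr => x _; apply: eq_bigr => y _; rewrite pi2E_sym; ring.
  have -> : B (fun x => F x + g x) - B (fun x => F x - g x) =
     2 * (\sum_x \sum_y pi2 x y * (F x * g y)) + 2 * (\sum_x \sum_y pi2 x y * (g x * F y)).
    rewrite /B -sumrB !mulr_sumr -big_split; apply: eq_bigr => x _; rewrite /= -sumrB !mulr_sumr -big_split.
    by apply: eq_bigr => y _ /=; ring.
  by rewrite sy; field.
have up : B (fun x => F x + g x) <= C / m%:R * \sum_x pi x * (F x + g x) ^+ 2.
  by apply: gap; under eq_bigr do rewrite mulrDr; rewrite big_split /= F0 g0 addr0.
have low : - (m.-1%:R^-1 * \sum_x pi x * (F x - g x) ^+ 2) <= B (fun x => F x - g x).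
  rewrite /B pair_form lerDr mulr_ge0 ?invr_ge0 ?mulr_ge0 //; apply: sumr_ge0 => S _.
  by rewrite mulr_ge0 ?sqr_ge0 //; case: hq.
have sq4 (e : R) : e ^+ 2 = 1 -> \sum_x pi x * (F x + e * g x) ^+ 2 <= 4.
  move=> e1; apply: (@le_trans _ _ (2 * (\sum_x pi x * F x ^+ 2) + 2 * (\sum_x pi x * g x ^+ 2))); last by lra.
  rewrite !mulr_sumr -big_split; apply: ler_sum => x _ /=.
  have := mulr_ge0 (pi0 x) (sqr_ge0 (F x - e * g x)).
  have -> : (F x + e * g x) ^+ 2 = F x ^+ 2 + 2 * e * F x * g x + e ^+ 2 * g x ^+ 2 by ring.
  have -> : (F x - e * g x) ^+ 2 = F x ^+ 2 - 2 * e * F x * g x + e ^+ 2 * g x ^+ 2 by ring.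
  rewrite e1; set a := 2 * e * F x * g x; nra.
have p4 : \sum_x pi x * (F x + g x) ^+ 2 <= 4.
  by have := sq4 1; rewrite expr1n => /(_ erefl); under eq_bigr do rewrite mul1r.
have n4 : \sum_x pi x * (F x - g x) ^+ 2 <= 4.
  by have := sq4 (-1); rewrite sqrrN expr1n => /(_ erefl); under eq_bigr do rewrite mulN1r.
have i1 : C / m%:R * (\sum_x pi x * (F x + g x) ^+ 2) <= C / m%:R * 4 by rewrite ler_wpM2l // divr_ge0.
have i2 : m.-1%:R^-1 * (\sum_x pi x * (F x - g x) ^+ 2) <= m.-1%:R^-1 * 4 by rewrite ler_wpM2l // invr_ge0.
rewrite pol; lra.
Qed.

End PairForm.
End GraphGap.

(** * Density regularity *)

Section Bounds.
Variable R : realType.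

Lemma expR_quad (a : R) : 0 <= a <= 2^-1 -> expR a <= 1 + a + 2 * a ^+ 2.
Proof.
move=> /andP[a0 a1]; have h := expR_ge1Dx (- a); have e0 := expR_gt0 a.
have e1 : expR a * expR (- a) = 1 by rewrite -expRD subrr expR0.
have h2 : expR a * (1 - a) <= 1 by have := ler_wpM2l (ltW e0) h; rewrite e1.
rewrite -(@ler_pM2r _ (1 - a)); last by lra.
apply: le_trans h2 _; have := sqr_ge0 a; nra.
Qed.

Lemma expRN_quad (a : R) : 0 <= a -> expR (- a) <= 1 - a + a ^+ 2.
Proof.
move=> a0; have h := expR_ge1Dx a; have e0 := expR_gt0 (- a).
have e1 : expR (- a) * expR a = 1 by rewrite -expRD addNr expR0.
have h2 : expR (- a) * (1 + a) <= 1 by have := ler_wpM2l (ltW e0) h; rewrite e1.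
rewrite -(@ler_pM2r _ (1 + a)); last by lra.
apply: le_trans h2 _; have : 0 <= a ^+ 3 by rewrite exprn_ge0.
by rewrite !exprS expr0; nra.
Qed.

Lemma fenchel (t l : R) : 0 <= t -> t * l <= t * ln t - t + expR l.
Proof.
rewrite le_eqVlt => /orP[/eqP <-|t0]; first by rewrite !mul0r subrr add0r expR_ge0.
have := expR_ge1Dx (l - ln t); rewrite expRD expRN lnK ?posrE // => h.
have := ler_wpM2l (ltW t0) h; rewrite mulrCA mulfV ?gt_eqF // mulr1; lra.
Qed.

(** Fenchel's inequality at the slopes a and - a. With a left free, it replaces Pinsker's
    inequality. *)
Lemma dist1_entropy (t a : R) : 0 <= t -> 0 < a <= 2^-1 ->
  `|t - 1| <= (t * ln t - t + 1) / a + 2 * a.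
Proof.
move=> t0 /andP[a0 a1]; have h1 := fenchel a t0; have h2 := fenchel (- a) t0.
have e1 : expR a <= 1 + a + 2 * a ^+ 2 by apply: expR_quad; rewrite ltW.
have e2 := expRN_quad (ltW a0); have a2 := sqr_ge0 a.
rewrite -(@ler_pM2r _ a) // mulrDl divfK ?gt_eqF // -mulrA -expr2.
have [h|h] := lerP 0 (t - 1); [rewrite ger0_norm // | rewrite ltr0_norm //]; nra.
Qed.

Lemma ln_sub (f g : R) : 0 < f -> 0 < g -> f - g <= f * (ln f - ln g).
Proof.
move=> f0 g0; have := expR_ge1Dx (ln g - ln f); rewrite expRD expRN !lnK ?posrE // => h.
have := ler_wpM2l (ltW f0) h; rewrite mulrCA mulfV ?gt_eqF // mulr1; lra.
Qed.

Lemma ln_mul_div (u v w : R) : 0 < u -> 0 < v -> 0 < w -> ln (u * v / w) = ln u + ln v - ln w.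
Proof. by move=> u0 v0 w0; rewrite ln_div ?posrE ?mulr_gt0 // lnM ?posrE. Qed.

Lemma psum_eq0 (I : finType) (F : I -> R) : (forall i, 0 <= F i) -> \sum_i F i = 0 -> forall i, F i = 0.
Proof. by move=> F0 /psumr_eq0P h i; apply: h. Qed.

End Bounds.

(** * Entropy along flags under local spectral expansion *)

Section Entropy.
Variables (R : realType) (V : finType) (m : nat) (q : {set V} -> R) (lam : R) (A : {set V} -> R).
Hypotheses (hq : topw m q) (lam0 : 0 <= lam) (A01 : forall S, 0 <= A S <= 1).
Hypothesis gap : forall s : {set V}, 0 < mass q s -> (#|s| + 2 <= m)%N -> qgap m q s lam.
Implicit Types s : {set V}.
Local Notation a s := (mu q s A).
Let phi s : R := a s * ln (a s).
Let H s : R := \sum_x piE m q s x * phi (x |: s) - phi s.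

Let A0 S : 0 <= A S. Proof. by have /andP[] := A01 S. Qed.
Let A1 S : A S <= 1. Proof. by have /andP[] := A01 S. Qed.
Let a0 s : 0 <= a s. Proof. exact: (mu_ge0 hq). Qed.
Let a1 s : a s <= 1. Proof. exact: (mu_le1 hq). Qed.

Lemma phi_le0 s : phi s <= 0.
Proof.
have [e|ne] := eqVneq (a s) 0; first by rewrite /phi e mul0r.
by apply: mulr_ge0_le0 => //; exact: ln_le0.
Qed.

Lemma piE_mass s x : piE m q s x != 0 -> x \notin s /\ 0 < mass q (x |: s).
Proof.
rewrite /piE; case: ifP => [_|/negbT xs]; first by rewrite eqxx.
move=> h; split=> //; rewrite lt_def (mass_ge0 hq) andbT; apply: contra h => /eqP ->; by rewrite mul0r.
Qed.

Lemma sum_pi2E (s : {set V}) (g : V -> V -> R) : 0 < mass q s ->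
  \sum_x \sum_y pi2E m q s x y * g x y = \sum_x piE m q s x * \sum_y piE m q (x |: s) y * g x y.
Proof.
move=> ms; apply: eq_bigr => x _; rewrite mulr_sumr; apply: eq_bigr => y _.
by rewrite pi2E_piE // mulrA.
Qed.

Lemma child_mu (s : {set V}) x : 0 < mass q s -> (#|s| + 2 <= m)%N -> piE m q s x != 0 ->
  \sum_y piE m q (x |: s) y * a (y |: (x |: s)) = a (x |: s).
Proof.
move=> ms sm /piE_mass[xs mx]; apply: sum_piE_mu => //; by rewrite dg_ext // /dg; lia.
Qed.

(** The second difference of [phi] is the relative entropy of the pair density W against b x b y / a
    s, at least the difference of their total masses by [ln_sub]. That difference is minus the
    covariance of b over a random pair divided by a s; the gap bounds it, as the variance of b is at
    most a s. *)
Lemma entropy_step (s : {set V}) : 0 < mass q s -> (#|s| + 2 <= m)%N ->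
  H s - lam <= \sum_x piE m q s x * H (x |: s).
Proof.
move=> ms sm.
have dg0 : (0 < dg m s)%N by rewrite /dg; lia.
have dg1 : (1 < dg m s)%N by rewrite /dg; lia.
have sa : \sum_x piE m q s x * a (x |: s) = a s by exact: sum_piE_mu.
have s1 : \sum_x piE m q s x = 1 by exact: sum_piE.
have [az|az] := eqVneq (a s) 0.
  have z x : piE m q s x * a (x |: s) = 0.
    by move: x; apply: psum_eq0; rewrite ?sa // => x; exact: mulr_ge0 (piE_ge0 hq _ _) (a0 _).
  have zp x : piE m q s x * phi (x |: s) = 0 by rewrite /phi mulrA z mul0r.
  have -> : H s = 0 by rewrite /H /phi az mul0r subr0; apply: big1 => x _; exact: zp.
  rewrite sub0r; apply: le_trans (_ : 0 <= _); first by rewrite oppr_le0.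
  apply: sumr_ge0 => x _; have [->|nz] := eqVneq (piE m q s x) 0; first by rewrite mul0r.
  apply: mulr_ge0; first exact: piE_ge0.
  have ax : a (x |: s) = 0 by apply/eqP; have /eqP := z x; rewrite mulf_eq0 (negbTE nz).
  rewrite /H {2}/phi ax mul0r subr0; apply: sumr_ge0 => y _.
  have cm := child_mu ms sm nz; rewrite ax in cm.
  have zy : piE m q (x |: s) y * a (y |: (x |: s)) = 0.
    by move: y; apply: psum_eq0 => // y; exact: mulr_ge0 (piE_ge0 hq _ _) (a0 _).
  by rewrite /phi mulrA zy mul0r.
have as0 : 0 < a s by rewrite lt_def az a0.
pose W x y : R := a (y |: (x |: s)).
have Wsym x y : W x y = W y x by rewrite /W finset.setUCA.
have eW x : piE m q s x * \sum_y piE m q (x |: s) y * W x y = piE m q s x * a (x |: s).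
  have [->|nz] := eqVneq (piE m q s x) 0; first by rewrite !mul0r.
  by rewrite child_mu.
have eP : \sum_x \sum_y pi2E m q s x y * (W x y * ln (a (x |: s))) = \sum_x piE m q s x * phi (x |: s).
  rewrite (sum_pi2E (fun x y => W x y * ln (a (x |: s)))) //; apply: eq_bigr => x _.
  rewrite /phi [RHS]mulrA -eW -mulrA mulr_suml; congr (_ * _); apply: eq_bigr => y _; by rewrite mulrA.
have eP' : \sum_x \sum_y pi2E m q s x y * (W x y * ln (a (y |: s))) = \sum_x piE m q s x * phi (x |: s).
  rewrite -eP exchange_big /=; apply: eq_bigr => x _; apply: eq_bigr => y _; by rewrite pi2E_sym Wsym.
have eW2 : \sum_x \sum_y pi2E m q s x y * W x y = a s.
  by rewrite sum_pi2E // -[RHS]sa; apply: eq_bigr => x _; exact: eW.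
have e0 : \sum_x \sum_y pi2E m q s x y * (W x y * ln (a s)) = phi s.
  rewrite /phi -eW2 mulr_suml; apply: eq_bigr => x _; rewrite mulr_suml; apply: eq_bigr => y _; by rewrite mulrA.
have ePH : \sum_x piE m q s x * H (x |: s) =
    \sum_x \sum_y pi2E m q s x y * phi (y |: (x |: s)) - \sum_x piE m q s x * phi (x |: s).
  by rewrite (sum_pi2E (fun x y => phi (y |: (x |: s)))) // -sumrB; apply: eq_bigr => x _; rewrite /H mulrBr.
pose b x := a (x |: s).
have key : \sum_x \sum_y pi2E m q s x y * (W x y - b x * b y / a s) <=
   \sum_x \sum_y pi2E m q s x y * phi (y |: (x |: s)) - 2 * (\sum_x piE m q s x * phi (x |: s)) + phi s.
  rewrite mulr_natl mulr2n opprD addrA -{1}eP -eP' -e0 -!sumrB -big_split; apply: ler_sum => x _ /=.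
  rewrite -!sumrB -big_split; apply: ler_sum => y _ /=.
  have -> : pi2E m q s x y * phi (y |: (x |: s)) - pi2E m q s x y * (W x y * ln (a (x |: s)))
     - pi2E m q s x y * (W x y * ln (a (y |: s))) + pi2E m q s x y * (W x y * ln (a s)) =
     pi2E m q s x y * (W x y * (ln (W x y) - ln (a (x |: s)) - ln (a (y |: s)) + ln (a s))).
    by rewrite /phi -/(W x y); ring.
  have [->|nz] := eqVneq (pi2E m q s x y) 0; first by rewrite !mul0r.
  apply: ler_wpM2l; first exact: pi2E_ge0.
  have [wz|wz] := eqVneq (W x y) 0.
    by rewrite wz mul0r sub0r oppr_le0; apply: divr_ge0 => //; exact: mulr_ge0 (a0 _) (a0 _).
  have w0 : 0 < W x y by rewrite lt_def wz a0.
  have pos x' y' : pi2E m q s x' y' != 0 -> W x' y' != 0 -> 0 < a (x' |: s).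
    rewrite pi2E_piE // mulf_eq0 negb_or => /andP[n1 n2] wn; rewrite lt_def a0 andbT.
    apply: contra wn => /eqP z; have cm := child_mu ms sm n1; rewrite z in cm.
    have h := psum_eq0 (fun y => mulr_ge0 (piE_ge0 hq (x' |: s) y) (a0 (y |: (x' |: s)))) cm y'.
    by move/eqP: h; rewrite mulf_eq0 (negbTE n2).
  have px := pos _ _ nz wz; have py : 0 < a (y |: s) by apply: (pos y x); rewrite ?(pi2E_sym _ _ _ y) // Wsym.
  have g0 : 0 < b x * b y / a s by rewrite divr_gt0 // mulr_gt0.
  have lg : ln (b x * b y / a s) = ln (b x) + ln (b y) - ln (a s).
    exact: ln_mul_div.
  have := ln_sub w0 g0; rewrite lg /b.
  move=> h; apply: le_trans h _; rewrite le_eqVlt; apply/orP; left; apply/eqP; ring.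
have gp : \sum_x \sum_y pi2E m q s x y * ((b x - a s) * (b y - a s)) <= lam * \sum_x piE m q s x * (b x - a s) ^+ 2.
  by apply: gap => //; under eq_bigr do rewrite mulrBr; rewrite sumrB -mulr_suml s1 mul1r sa subrr.
have s2 : \sum_x \sum_y pi2E m q s x y * 1 = 1.
  rewrite sum_pi2E // -[RHS]s1; apply: eq_bigr => x _; have [->|nz] := eqVneq (piE m q s x) 0; first by rewrite mul0r.
  have [xs mx] := piE_mass nz; under eq_bigr do rewrite mulr1.
  by rewrite sum_piE ?mulr1 // dg_ext // -ltnS prednK.
have sx : \sum_x \sum_y pi2E m q s x y * b x = a s.
  rewrite (sum_pi2E (fun x y => b x)) // -[RHS]sa; apply: eq_bigr => x _; have [->|nz] := eqVneq (piE m q s x) 0; first by rewrite !mul0r.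
  have [xs mx] := piE_mass nz; by rewrite -mulr_suml sum_piE ?mul1r // dg_ext // -ltnS prednK.
have sy : \sum_x \sum_y pi2E m q s x y * b y = a s.
  by rewrite exchange_big /= -sx; apply: eq_bigr => x _; apply: eq_bigr => y _; rewrite pi2E_sym.
have bb : \sum_x \sum_y pi2E m q s x y * (b x * b y) = a s ^+ 2 +
   \sum_x \sum_y pi2E m q s x y * ((b x - a s) * (b y - a s)).
  have -> : \sum_x \sum_y pi2E m q s x y * ((b x - a s) * (b y - a s)) =
     \sum_x \sum_y pi2E m q s x y * (b x * b y) - a s * (\sum_x \sum_y pi2E m q s x y * b x)
     - a s * (\sum_x \sum_y pi2E m q s x y * b y) + a s ^+ 2 * (\sum_x \sum_y pi2E m q s x y * 1).
    rewrite !mulr_sumr -!sumrB -big_split; apply: eq_bigr => x _ /=.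
    rewrite !mulr_sumr -!sumrB -big_split; apply: eq_bigr => y _ /=; ring.
  rewrite s2 sx sy; ring.
have var : \sum_x piE m q s x * (b x - a s) ^+ 2 <= a s.
  rewrite (eq_bigr (fun x => piE m q s x * b x ^+ 2 - 2 * a s * (piE m q s x * b x) + a s ^+ 2 * piE m q s x)); last by move=> x _; ring.
  rewrite big_split /= sumrB -!mulr_sumr s1 sa.
  have h : \sum_x piE m q s x * b x ^+ 2 <= a s.
    rewrite -[leRHS]sa; apply: ler_sum => x _; apply: ler_wpM2l; first exact: piE_ge0.
    by rewrite expr2; apply: ler_piMr; [exact: a0 | exact: a1].
  have := sqr_ge0 (a s); nra.
have lhs : \sum_x \sum_y pi2E m q s x y * (W x y - b x * b y / a s) =
    a s - (\sum_x \sum_y pi2E m q s x y * (b x * b y)) / a s.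
  rewrite (_ : a s - _ = (\sum_x \sum_y pi2E m q s x y * W x y) - (\sum_x \sum_y pi2E m q s x y * (b x * b y)) / a s); last by rewrite eW2.
  rewrite mulr_suml -sumrB; apply: eq_bigr => x _; rewrite mulr_suml -sumrB; apply: eq_bigr => y _; ring.
have fin : - lam <= a s - (\sum_x \sum_y pi2E m q s x y * (b x * b y)) / a s.
  rewrite bb mulrDl expr2 mulfK // opprD addrA subrr sub0r lerN2 ler_pdivrMr //.
  by apply: le_trans gp _; exact: ler_wpM2l.
rewrite ePH /H; rewrite lhs in key; lra.
Qed.

(** Along a random flag the expected entropy gains decrease by at most lam per level, and they
    telescope to at most - phi s because phi is never positive at the end. So d times the first gain
    obeys nearly the same bound. *)
Lemma entropy_levels d : forall s : {set V}, 0 < mass q s -> (#|s| + d)%N = m ->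
  d%:R * H s <= - phi s + d%:R ^+ 2 * lam.
Proof.
elim: d => [|d IH] s ms sm.
  by rewrite mul0r expr0n /= mul0r addr0 oppr_ge0 phi_le0.
have dg0 : (0 < dg m s)%N by rewrite /dg; lia.
have s1 : \sum_x piE m q s x = 1 by exact: sum_piE.
have IH' x : piE m q s x * (d%:R * H (x |: s)) <= piE m q s x * (- phi (x |: s) + d%:R ^+ 2 * lam).
  have [->|nz] := eqVneq (piE m q s x) 0; first by rewrite !mul0r.
  have [xs mx] := piE_mass nz; apply: ler_wpM2l; first exact: piE_ge0.
  by apply: IH; rewrite // cardsU1 xs; lia.
have sIH : d%:R * (\sum_x piE m q s x * H (x |: s)) <= - (\sum_x piE m q s x * phi (x |: s)) + d%:R ^+ 2 * lam.
  have -> : d%:R ^+ 2 * lam = \sum_x d%:R ^+ 2 * lam * piE m q s x by rewrite -mulr_sumr s1 mulr1.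
  rewrite mulr_sumr -sumrN -big_split /=; apply: ler_sum => x _.
  have := IH' x; have -> : d%:R * (piE m q s x * H (x |: s)) = piE m q s x * (d%:R * H (x |: s)) by ring.
  by move=> h; apply: le_trans h _; rewrite le_eqVlt; apply/orP; left; apply/eqP; ring.
have st : d%:R * (H s - lam) <= d%:R * (\sum_x piE m q s x * H (x |: s)).
  have [->|d1] := posnP d; first by rewrite !mul0r.
  by apply: ler_wpM2l => //; apply: entropy_step; rewrite // -sm; lia.
have d0 : (0 : R) <= d%:R by [].
have eH : \sum_x piE m q s x * phi (x |: s) = H s + phi s by rewrite /H subrK.
rewrite eH in sIH; have := le_trans st sIH; rewrite mulrBr -natr1.
have -> : (d%:R + 1) ^+ 2 * lam = d%:R ^+ 2 * lam + 2 * (d%:R * lam) + lam by ring.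
by rewrite mulrDl mul1r; have := mulr_ge0 d0 lam0; have := lam0; lra.
Qed.

(** The first entropy gain, divided by the density of A, is the divergence of the vertex marginals.
    The division turns the spectral error into m lam exp cb; this is where lam has to be
    exponentially small in m. *)
Lemma dense_gap cb al : (0 < m)%N -> mass q finset.set0 = 1 -> expR (- cb) <= a finset.set0 -> 0 < al <= 2^-1 ->
  \sum_x piE m q finset.set0 x * `|a (x |: finset.set0) / a finset.set0 - 1| <=
  2 * al + (cb / m%:R + m%:R * lam * expR cb) / al.
Proof.
move=> m0 q1 ha al01; have as0 : 0 < a finset.set0 by apply: lt_le_trans ha; exact: expR_gt0.
have ms : 0 < mass q finset.set0 by rewrite q1.
have dg0 : (0 < dg m (finset.set0 : {set V}))%N by rewrite /dg cards0; lia.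
set s := finset.set0 in as0 ms dg0 ha *.
have s1 : \sum_x piE m q s x = 1 by exact: sum_piE.
have sa : \sum_x piE m q s x * a (x |: s) = a s by exact: sum_piE_mu.
have lv := @entropy_levels m s ms; rewrite cards0 add0n in lv; have {}lv := lv erefl.
pose t x := a (x |: s) / a s.
(* As t has mean 1, the terms - t x + 1 add up to 0; they bring the entropy into the form of
   [dist1_entropy]. *)
have Ht : H s = a s * \sum_x piE m q s x * (t x * ln (t x) - t x + 1).
  have -> : \sum_x piE m q s x * (t x * ln (t x) - t x + 1) = \sum_x piE m q s x * (t x * ln (t x)).
    rewrite (eq_bigr (fun x => piE m q s x * (t x * ln (t x)) - (piE m q s x * a (x |: s)) / a s + piE m q s x)); last by move=> x _; rewrite /t; ring.
    by rewrite big_split /= sumrB -mulr_suml sa divff ?gt_eqF // s1; ring.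
  have -> : H s = \sum_x piE m q s x * phi (x |: s) - \sum_x piE m q s x * a (x |: s) * ln (a s).
    by rewrite -mulr_suml sa.
  rewrite /phi -sumrB mulr_sumr; apply: eq_bigr => x _.
  have [z|nz] := eqVneq (a (x |: s)) 0; first by rewrite /t z !mul0r !mulr0 mul0r subrr.
  have ax : 0 < a (x |: s) by rewrite lt_def nz a0.
  rewrite /t ln_div ?posrE //; field; exact: lt0r_neq0.
have al0 : 0 < al by have /andP[] := al01.
apply: (@le_trans _ _ (\sum_x piE m q s x * ((t x * ln (t x) - t x + 1) / al + 2 * al))).
  apply: ler_sum => x _; apply: ler_wpM2l; first exact: piE_ge0.
  by apply: dist1_entropy => //; rewrite divr_ge0.
have -> : \sum_x piE m q s x * ((t x * ln (t x) - t x + 1) / al + 2 * al) =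
   (\sum_x piE m q s x * (t x * ln (t x) - t x + 1)) / al + 2 * al.
  have e2 : 2 * al = \sum_x 2 * al * piE m q s x by rewrite -mulr_sumr s1 mulr1.
  rewrite [X in _ = _ + X]e2 mulr_suml -big_split; apply: eq_bigr => x _ /=; ring.
rewrite addrC lerD2l ler_pM2r ?invr_gt0 //.
set X := \sum_x _ in Ht *.
have m0R : (0 : R) < m%:R by rewrite ltr0n.
have lna : - ln (a s) <= cb.
  by rewrite lerNl -(expRK (- cb)) ler_ln ?posrE // expR_gt0.
have ia : (a s)^-1 <= expR cb.
  by rewrite -[expR cb]invrK -expRN lef_pV2 ?posrE // expR_gt0.
rewrite Ht /phi in lv.
have lv2 : m%:R * X <= - ln (a s) + m%:R ^+ 2 * lam / a s.
  rewrite -(ler_pM2r as0) mulrDl divfK ?gt_eqF //; move: lv; lra.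
have p1 : m%:R ^+ 2 * lam / a s <= m%:R ^+ 2 * lam * expR cb.
  by apply: ler_wpM2l => //; rewrite mulr_ge0 ?sqr_ge0.
rewrite -(ler_pM2l m0R); apply: le_trans lv2 _.
have -> : m%:R * (cb / m%:R + m%:R * lam * expR cb) = cb + m%:R ^+ 2 * lam * expR cb by field; rewrite gt_eqF.
lra.
Qed.

End Entropy.

(** * Exponential moments from the down-up walk *)

Section DownUp.
Variables (R : realType) (V : finType).
Implicit Types (S T u s : {set V}) (Q : {set V} -> R).

Lemma sum_facets D S (g : {set V} -> R) : #|S| = D -> (0 < D)%N ->
  \sum_(u : {set V} | (#|u| == D.-1) && (u \subset S)) g u = \sum_(v in S) g (S :\ v).
Proof.
move=> SD D0; rewrite -(big_imset g (h := fun v => S :\ v) (A := mem S)) /=; last first.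
  move=> v w vS wS /setP /(_ v); rewrite !finset.in_setD1 vS eqxx andbT /=.
  by rewrite andbT => /esym/negbFE/eqP.
apply: eq_bigl => u; apply/andP/imsetP => [[/eqP cu uS]|[v vS ->]].
  have : #|S :\: u| == 1%N by rewrite cardsDS // SD cu; lia.
  case/cards1P => v e; exists v.
    have : v \in S :\: u by rewrite e finset.set11.
    by rewrite finset.in_setD => /andP[].
  by rewrite -e finset.setDDr finset.setDv finset.set0U (finset.setIidPr uS).
split; last exact: subD1set.
have vS' : v \in S by [].
by move: SD; rewrite (cardsD1 v S) vS' => <-.
Qed.

Section Gap.
Variables (D : nat) (Q : {set V} -> R) (G : {set {set V}}) (c : R).
Hypotheses (hQ : topw D Q) (hG : forall t, (t \in G) = (0 < mass Q t)) (D2 : (1 < D)%N).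
Hypotheses (Q1 : \sum_S Q S = 1) (c0 : 0 < c).
Hypothesis gap : forall a : R, eigenvalue (downupmx D G Q) a -> 1 - c / D%:R < a ->
  a = 1 /\ \rank (eigenspace (downupmx D G Q) a) = 1%N.

Let Q0 S : 0 <= Q S. Proof. by case: hQ. Qed.
Let D0 : (0 : R) < D%:R. Proof. by rewrite ltr0n; lia. Qed.
Let QD S : Q S != 0 -> #|S| = D. Proof. exact: hQ.2. Qed.

Lemma top_mem S : Q S != 0 -> S \in top G D.
Proof.
move=> QS; rewrite inE hG (QD QS) eqxx andbT /mass (bigD1 S) //=.
by apply: ltr_wpDr; [exact: sumr_ge0 | rewrite lt_def QS Q0].
Qed.

Lemma facet_sum (g : {set V} -> {set V} -> R) :
  \sum_(u : {set V} | #|u| == D.-1) \sum_(S : {set V} | u \subset S) Q S * g u S =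
  \sum_S Q S * \sum_(v in S) g (S :\ v) S.
Proof.
rewrite (exchange_big_dep predT) //=; apply: eq_bigr => S _.
have [->|QS] := eqVneq (Q S) 0; first by rewrite mul0r big1 // => u _; rewrite mul0r.
rewrite -mulr_sumr -(sum_facets (fun u => g u S) (QD QS)) //; lia.
Qed.

(** D times the Dirichlet form of the down-up walk, written as conditional variances given a
    facet. *)
Definition Loc (f : {set V} -> R) : R :=
  \sum_(u : {set V} | #|u| == D.-1) (sm Q (fun S => f S ^+ 2) u - sm Q f u ^+ 2 / mass Q u).

Lemma restrict_top (g : {set V} -> R) : (forall S, Q S = 0 -> g S = 0) -> \sum_(S in top G D) g S = \sum_S g S.
Proof.
move=> g0; rewrite [RHS](bigID (mem (top G D))) /= [X in _ + X]big1 ?addr0 // => S nS.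
by apply: g0; apply: contraNeq nS; exact: top_mem.
Qed.

Lemma top_pos S : S \in top G D -> 0 < Q S.
Proof.
rewrite inE hG => /andP[mS /eqP cS]; rewrite lt_def Q0 andbT; apply: contraTN mS => /eqP e.
rewrite -leNgt /mass (bigD1 S) //= e add0r big1 // => T /andP[ST TS].
apply/eqP; apply: contraNT TS => /QD cT; by rewrite eq_sym eqEcard ST cT cS leqnn.
Qed.

Lemma du_sym S T : S \in top G D -> T \in top G D -> Q S * du D Q S T = Q T * du D Q T S.
Proof.
rewrite !inE => /andP[_ /eqP cS] /andP[_ /eqP cT]; rewrite /du.
have e S' T' : #|S'| = D -> Q S' * (D%:R^-1 * \sum_(v in S') (if S' :\ v \subset T' then Q T' / mass Q (S' :\ v) else 0)) =
   Q S' * Q T' / D%:R * \sum_(u : {set V} | (#|u| == D.-1) && (u \subset S')) (if u \subset T' then (mass Q u)^-1 else 0).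
  move=> c'; rewrite (sum_facets (fun u => if u \subset T' then (mass Q u)^-1 else 0) c'); last by lia.
  rewrite !mulr_sumr; apply: eq_bigr => v _; case: ifP => _; [ring | by rewrite !mulr0].
rewrite !e // (mulrC (Q T)); congr (_ * _).
rewrite big_mkcond [RHS]big_mkcond /=; apply: eq_bigr => u _.
by case: (#|u| == _); case: (u \subset S); case: (u \subset T).
Qed.

Lemma facet_pos S v : Q S != 0 -> 0 < mass Q (S :\ v).
Proof.
move=> QS; apply: lt_le_trans (mass_le hQ (subD1set S v)).
by rewrite -hG; have := top_mem QS; rewrite inE => /andP[].
Qed.

Lemma du_row S : S \in top G D -> \sum_(T in top G D) du D Q S T = 1.
Proof.
move=> SX; have QS : Q S != 0 by rewrite gt_eqF // top_pos.
rewrite restrict_top; last first.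
  by move=> T e; rewrite /du big1 ?mulr0 // => v _; rewrite e mul0r if_same.
rewrite /du -mulr_sumr exchange_big /=.
rewrite (eq_bigr (fun _ => 1)) => [|v vS].
  by rewrite sumr_const (QD QS) mulVf // gt_eqF.
rewrite -big_mkcond /= -mulr_suml divff // gt_eqF //; exact: facet_pos.
Qed.

Lemma poincare0 f : \sum_S Q S * f S = 0 -> c * (\sum_S Q S * f S ^+ 2) <= Loc f.
Proof.
move=> f0; have zero g S : Q S = 0 -> Q S * g = 0 by move=> ->; rewrite mul0r.
have := reversible_gap top_pos du_sym du_row gap (f := f).
rewrite !restrict_top //; try by move=> S; exact: zero.
  move=> /(_ f0).
  have e1 S : \sum_(T in top G D) Q S * du D Q S T * (f S * f T) =
     Q S * \sum_(v in S) D%:R^-1 * (f S * (sm Q f (S :\ v) / mass Q (S :\ v))).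
    rewrite restrict_top; last by move=> T e; rewrite /du big1 ?mulr0 ?mul0r // => v _; rewrite e mul0r if_same.
    rewrite (eq_bigr (fun T => \sum_(v in S) Q S * (D%:R^-1 * (f S * ((if S :\ v \subset T then Q T * f T else 0) / mass Q (S :\ v)))))).
      rewrite exchange_big /= mulr_sumr; apply: eq_bigr => v _.
      rewrite -!mulr_sumr -mulr_suml; congr (_ * (_ * (_ * (_ / _)))).
      by rewrite /sm [RHS]big_mkcond.
    move=> T _; rewrite /du (mulrA (Q S)) mulr_sumr mulr_suml; apply: eq_bigr => v _.
    case: ifP => _; [ring | by rewrite mul0r !mulr0 mul0r].
  under eq_bigr do rewrite e1.
  rewrite -(facet_sum (fun u S => D%:R^-1 * (f S * (sm Q f u / mass Q u)))).
  have e2 : \sum_(u : {set V} | #|u| == D.-1) \sum_(S : {set V} | u \subset S) Q S * (D%:R^-1 * (f S * (sm Q f u / mass Q u)))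
    = D%:R^-1 * \sum_(u : {set V} | #|u| == D.-1) sm Q f u ^+ 2 / mass Q u.
    rewrite mulr_sumr; apply: eq_bigr => u _; 
    have := erefl (sm Q f u); rewrite [in LHS]/sm; move: (sm Q f u) => X eX.
    rewrite (_ : X ^+ 2 / mass Q u = X * (X / mass Q u)); last by rewrite expr2 -mulrA.
    rewrite -[X in _ = _ * (X * _)]eX mulr_suml mulr_sumr; apply: eq_bigr => S _; ring.
  have e3 : \sum_(u : {set V} | #|u| == D.-1) sm Q (fun S => f S ^+ 2) u = D%:R * \sum_S Q S * f S ^+ 2.
    rewrite /sm (facet_sum (fun u S => f S ^+ 2)) mulr_sumr; apply: eq_bigr => S _.
    have [->|QS] := eqVneq (Q S) 0; first by rewrite !mul0r mulr0.
    by rewrite sumr_const (QD QS) -mulr_natl; ring.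
  rewrite e2 /Loc sumrB e3; set X := \sum_(u : {set V} | _) _; set Y := \sum_S _ => h.
  have := ler_wpM2l (ltW D0) h; rewrite mulVKf ?gt_eqF //.
  have -> : D%:R * ((1 - c / D%:R) * Y) = D%:R * Y - c * Y by field; rewrite gt_eqF.
  lra.
by move=> S e; apply: big1 => T _; rewrite e !mul0r.
Qed.

Lemma Loc_shift f b : Loc (fun S => f S - b) = Loc f.
Proof.
apply: eq_bigr => u _.
have e1 : sm Q (fun S => f S - b) u = sm Q f u - b * mass Q u.
  rewrite /sm /mass mulr_sumr -sumrB; apply: eq_bigr => S _; ring.
have e2 : sm Q (fun S => (f S - b) ^+ 2) u = sm Q (fun S => f S ^+ 2) u - 2 * b * sm Q f u + b ^+ 2 * mass Q u.
  rewrite /sm /mass !mulr_sumr -sumrB -big_split; apply: eq_bigr => S _ /=; ring.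
rewrite e1 e2; have [z|z] := eqVneq (mass Q u) 0; last by field.
by rewrite z !(sm_mass0 hQ) //; ring.
Qed.

Lemma poincare f : c * (\sum_S Q S * f S ^+ 2 - (\sum_S Q S * f S) ^+ 2) <= Loc f.
Proof.
have gen (b : R) : \sum_S Q S * (f S - b) ^+ 2 = \sum_S Q S * f S ^+ 2 - 2 * b * (\sum_S Q S * f S) + b ^+ 2 * \sum_S Q S.
  rewrite !mulr_sumr -sumrB -big_split; apply: eq_bigr => S _ /=; ring.
set M := \sum_S Q S * f S; rewrite -(Loc_shift f M); apply: le_trans (poincare0 _).
  rewrite gen.
  by rewrite Q1 -/M le_eqVlt; apply/orP; left; apply/eqP; ring.
by under eq_bigr do rewrite mulrBr; rewrite sumrB -mulr_suml Q1 mul1r subrr.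
Qed.

(** The conditional mean is the best predictor from the facet, so any other predictor b gives an
    upper bound. In the applications b is f itself at the smaller set. *)
Lemma Loc_le f b : Loc f <= \sum_S Q S * \sum_(v in S) (f S - b (S :\ v)) ^+ 2.
Proof.
rewrite -(facet_sum (fun u S => (f S - b u) ^+ 2)); apply: ler_sum => u _.
have -> : \sum_(S : {set V} | u \subset S) Q S * (f S - b u) ^+ 2 =
   sm Q (fun S => f S ^+ 2) u - 2 * b u * sm Q f u + b u ^+ 2 * mass Q u.
  rewrite /sm /mass !mulr_sumr -sumrB -big_split; apply: eq_bigr => S _ /=; ring.
have [z|z] := eqVneq (mass Q u) 0.
  by rewrite z !(sm_mass0 hQ) // expr0n /= !mul0r !mulr0 !subr0 addr0.
have mu0 : 0 < mass Q u by rewrite lt_def z (mass_ge0 hQ).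
have : 0 <= (sm Q f u - b u * mass Q u) ^+ 2 / mass Q u by rewrite divr_ge0 ?sqr_ge0 // ltW.
have -> : (sm Q f u - b u * mass Q u) ^+ 2 / mass Q u =
  sm Q f u ^+ 2 / mass Q u - 2 * b u * sm Q f u + b u ^+ 2 * mass Q u by field.
lra.
Qed.

Let massQ : mass Q finset.set0 = 1. Proof. by rewrite -Q1 /mass sum_set0. Qed.
Local Notation pi := (piE D Q finset.set0).

(** The Poincare inequality for the additive function summing f over S: deleting v changes it by
    exactly f v. [pair_form] translates its second moment into the pair form. *)
Lemma du_qgap : qgap D Q finset.set0 ((c * D.-1%:R)^-1).
Proof.
move=> f f0; rewrite (pair_form D2 massQ).
have D1 : (0 : R) < D.-1%:R by rewrite ltr0n; lia.
pose P S := \sum_(x in S) f x.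
have P0 : \sum_S Q S * P S = 0.
  have := one_form D massQ f; rewrite f0 => /esym/eqP; rewrite mulf_eq0 invr_eq0 gt_eqF //=.
  by move/eqP.
have h := le_trans (poincare P) (Loc_le P P).
have e : \sum_S Q S * \sum_(v in S) (P S - P (S :\ v)) ^+ 2 = D%:R * \sum_x pi x * f x ^+ 2.
  rewrite (one_form D massQ) mulrA mulfV ?gt_eqF // mul1r; apply: eq_bigr => S _; congr (_ * _).
  apply: eq_bigr => v vS; rewrite /P (big_setD1 v) //=; congr (_ ^+ 2); ring.
rewrite e P0 expr0n /= subr0 in h.
have n0 : 0 <= \sum_x pi x * f x ^+ 2 by apply: sumr_ge0 => x _; rewrite mulr_ge0 ?sqr_ge0 ?(piE_ge0 hQ).
have i1 : (D%:R * D.-1%:R)^-1 * \sum_S Q S * (\sum_(x in S) f x) ^+ 2 <= (c * D.-1%:R)^-1 * \sum_x pi x * f x ^+ 2.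
  have cc : 0 < c * D.-1%:R * D%:R by rewrite !mulr_gt0.
  rewrite -(ler_pM2l cc).
  have -> : c * D.-1%:R * D%:R * ((D%:R * D.-1%:R)^-1 * \sum_S Q S * (\sum_(x in S) f x) ^+ 2) = c * \sum_S Q S * P S ^+ 2.
    by rewrite /P; field; rewrite !gt_eqF.
  have -> : c * D.-1%:R * D%:R * ((c * D.-1%:R)^-1 * \sum_x pi x * f x ^+ 2) = D%:R * \sum_x pi x * f x ^+ 2.
    by field; rewrite !gt_eqF.
  exact: h.
apply: le_trans i1; rewrite gerBl mulr_ge0 // invr_ge0 ltW //.
Qed.

Variable Z : {set V}.
Definition cz S : R := #|S :&: Z|%:R.
Definition mgf (t : R) : R := \sum_S Q S * expR (t * cz S).
Let EX : R := \sum_S Q S * cz S.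

Lemma cz_leD S : Q S != 0 -> cz S <= D%:R.
Proof. by move=> QS; rewrite ler_nat -(QD QS) subset_leq_card // finset.subsetIl. Qed.

Lemma cz_del S v : v \in S -> cz S = cz (S :\ v) + (v \in Z)%:R.
Proof.
move=> vS; rewrite /cz (cardsD1 v (S :&: Z)) finset.in_setI vS /= natrD addrC; congr (_%:R + _).
by apply: eq_card => x; rewrite !inE andbA.
Qed.

Lemma mgf_ge1 (t : R) : 0 <= t -> 1 <= mgf t.
Proof.
move=> t0; rewrite -Q1; apply: ler_sum => S _; rewrite ler_peMr // -expR0 ler_expR.
by rewrite mulr_ge0.
Qed.

(** The Poincare inequality for exp (t/2 |S :&: Z|), whose square has mean [mgf t]. Deleting one
    vertex lowers this function by at most the fraction t of its value. *)
Lemma mgf_step (t : R) : 0 <= t <= 1 -> mgf t * (1 - D%:R * t ^+ 2 / c) <= mgf (t / 2) ^+ 2.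
Proof.
move=> /andP[t0 t1]; pose f S := expR (t / 2 * cz S).
have f2 S : f S ^+ 2 = expR (t * cz S) by rewrite /f expr2 -expRD; congr expR; field.
have h := le_trans (poincare f) (Loc_le f f).
have e1 : \sum_S Q S * f S ^+ 2 = mgf t by apply: eq_bigr => S _; rewrite f2.
have qd : expR (t / 2) - 1 <= t.
  have : expR (t / 2) <= 1 + t / 2 + 2 * (t / 2) ^+ 2 by apply: expR_quad; lra.
  have : t ^+ 2 <= t by rewrite expr2 ler_piMr.
  have -> : (t / 2) ^+ 2 = t ^+ 2 / 4 by field.
  lra.
have i1 : \sum_S Q S * \sum_(v in S) (f S - f (S :\ v)) ^+ 2 <= D%:R * t ^+ 2 * mgf t.
  rewrite /mgf mulr_sumr; apply: ler_sum => S _; have [->|QS] := eqVneq (Q S) 0; first by rewrite !mul0r mulr0.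
  rewrite mulrCA; apply: ler_wpM2l => //.
  apply: (@le_trans _ _ (\sum_(v in S) t ^+ 2 * expR (t * cz S))); last first.
    by rewrite sumr_const (QD QS) -[X in X <= _]mulr_natl mulrA.
  apply: ler_sum => v vS; rewrite -f2; have cv := cz_del vS.
  have fp : 0 <= f (S :\ v) by exact: expR_ge0.
  have fe : f S = f (S :\ v) * expR (t / 2 * (v \in Z)%:R) by rewrite /f cv mulrDr expRD.
  have fm : f (S :\ v) <= f S.
    by rewrite /f ler_expR cv mulrDr lerDl mulr_ge0 //; lra.
  have dif : f S - f (S :\ v) <= t * f S.
    apply: (@le_trans _ _ (t * f (S :\ v))); last exact: ler_wpM2l.
    rewrite fe; case: (v \in Z); rewrite ?mulr1 ?mulr0 ?expR0 ?mulr1.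
      have := ler_wpM2r fp qd; lra.
    by rewrite subrr mulr_ge0.
  by rewrite -exprMn; apply: lerXn2r; rewrite ?nnegrE ?subr_ge0 // mulr_ge0 // (le_trans fp).
have {}h := le_trans h i1; rewrite e1 -/(mgf (t / 2)) in h.
rewrite -(ler_pM2l c0).
have -> : c * (mgf t * (1 - D%:R * t ^+ 2 / c)) = c * mgf t - D%:R * t ^+ 2 * mgf t by field; rewrite gt_eqF.
lra.
Qed.

(** After N halvings the exponent is at most 1/2 and a second-order expansion suffices. Each halving
    divides the error x = D t^2 / c by 4 and doubles the logarithm, so 4 x reproduces itself: 2 (4 x
    / 4) + 2 x = 4 x. *)
Lemma mgf_ln N : forall t : R, 0 <= t <= 1 -> t * D%:R <= 2 ^+ N / 2 -> D%:R * t ^+ 2 / c <= 2^-1 ->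
  ln (mgf t) <= t * EX + 2 * (t * D%:R) ^+ 2 / 2 ^+ N + 4 * (D%:R * t ^+ 2 / c).
Proof.
elim: N => [|N IH] t t01 tN tc; have /andP[t0 t1] := t01; have F1 := mgf_ge1 t0.
  have F0 : 0 < mgf t by apply: lt_le_trans F1.
  have tc0 : 0 <= D%:R * t ^+ 2 / c by rewrite divr_ge0 ?mulr_ge0 ?sqr_ge0 // ltW.
  rewrite expr0 divr1; apply: (@le_trans _ _ (t * EX + 2 * (t * D%:R) ^+ 2)); last by rewrite lerDl; lra.
  apply: (@le_trans _ _ (mgf t - 1)); first by have := le_ln1Dx (x := mgf t - 1); rewrite addrCA subrr addr0; apply; lra.
  have e : 1 + (t * EX + 2 * (t * D%:R) ^+ 2) = \sum_S Q S * (1 + t * cz S + 2 * (t * D%:R) ^+ 2).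
    rewrite [RHS](eq_bigr (fun S => Q S + t * (Q S * cz S) + 2 * (t * D%:R) ^+ 2 * Q S)); last by move=> S _; ring.
    by rewrite !big_split /= -!mulr_sumr Q1 -/EX; ring.
  suff : mgf t <= 1 + (t * EX + 2 * (t * D%:R) ^+ 2) by lra.
  rewrite e; apply: ler_sum => S _; have [->|QS] := eqVneq (Q S) 0; first by rewrite !mul0r.
  apply: ler_wpM2l => //.
  have y0 : 0 <= t * cz S by rewrite mulr_ge0.
  have yD : t * cz S <= t * D%:R by apply: ler_wpM2l => //; exact: cz_leD.
  have : expR (t * cz S) <= 1 + t * cz S + 2 * (t * cz S) ^+ 2 by apply: expR_quad; move: tN; rewrite expr0; lra.
  have : (t * cz S) ^+ 2 <= (t * D%:R) ^+ 2 by apply: lerXn2r; rewrite ?nnegrE // (le_trans y0).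
  lra.
have t2 : 0 <= t / 2 <= 1 by lra.
have x2 : D%:R * (t / 2) ^+ 2 / c = (D%:R * t ^+ 2 / c) / 4 by field; rewrite gt_eqF.
have tc0 : 0 <= D%:R * t ^+ 2 / c by rewrite divr_ge0 ?mulr_ge0 ?sqr_ge0 // ltW.
have IH2 : ln (mgf (t / 2)) <= t / 2 * EX + 2 * (t / 2 * D%:R) ^+ 2 / 2 ^+ N + 4 * (D%:R * (t / 2) ^+ 2 / c).
  by apply: IH => //; [move: tN; rewrite exprS; lra | rewrite x2; lra].
rewrite x2 in IH2.
have st := mgf_step t01; set x := D%:R * t ^+ 2 / c in tc tc0 IH2 st *.
have F0 : 0 < mgf t by apply: lt_le_trans F1.
have F20 : 0 < mgf (t / 2) by apply: lt_le_trans (mgf_ge1 _); lra.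
have x1 : 0 < 1 - x by lra.
have : ln (mgf t * (1 - x)) <= ln (mgf (t / 2) ^+ 2) by rewrite ler_ln ?posrE ?mulr_gt0 ?exprn_gt0.
rewrite lnM ?posrE // lnXn // => hl.
have l2 := ln_ge x1.
have i2 : (1 - x)^-1 - 1 <= 2 * x.
  rewrite lerBlDr -[leLHS]div1r ler_pdivrMr //; nra.
have e2 : 2 * (t / 2 * D%:R) ^+ 2 / 2 ^+ N = 2 * (t * D%:R) ^+ 2 / 2 ^+ N.+1 / 2.
  have n0 : (2 ^+ N : R) != 0 by rewrite expf_neq0 // pnatr_eq0.
  by rewrite (exprS (2 : R) N); field.
rewrite e2 in IH2; move: hl; rewrite mulr2n; lra.
Qed.

Lemma mgf_bound (t : R) : 0 <= t <= 1 -> D%:R * t ^+ 2 / c <= 2^-1 ->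
  mgf t <= expR (t * EX + 1 + 4 * (D%:R * t ^+ 2 / c)).
Proof.
move=> t01 tc; have /andP[t0 t1] := t01; pose N := (4 * D ^ 2)%N.
have big : 4 * D%:R ^+ 2 <= 2 ^+ N :> R.
  by rewrite -natrX -natrM -[2 ^+ N]natrX ler_nat ltnW // ltn_expl.
have D1 : (1 : R) <= D%:R by rewrite ler1n; lia.
have DD : D%:R <= D%:R ^+ 2 :> R by rewrite expr2 ler_peMr.
have tD : t * D%:R <= D%:R by rewrite ler_piMl.
have tD2 : (t * D%:R) ^+ 2 <= D%:R ^+ 2 by apply: lerXn2r; rewrite ?nnegrE ?mulr_ge0.
have F0 : 0 < mgf t by apply: lt_le_trans (mgf_ge1 t0).
rewrite -[mgf t]lnK ?posrE // ler_expR.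
have h := @mgf_ln N t t01 _ tc; apply: le_trans (h _) _; first by lra.
rewrite lerD2r lerD2l ler_pdivrMr ?exprn_gt0 // mul1r; lra.
Qed.

Lemma EX_pi : EX = D%:R * \sum_(x in Z) pi x.
Proof.
have := one_form D massQ (fun x => (x \in Z)%:R).
have -> : \sum_x pi x * (x \in Z)%:R = \sum_(x in Z) pi x.
  by rewrite [RHS]big_mkcond; apply: eq_bigr => x _; case: (x \in Z); rewrite ?mulr1 ?mulr0.
move=> ->; rewrite mulrA mulfV ?gt_eqF // mul1r; apply: eq_bigr => S _; congr (_ * _).
rewrite /cz -sum1_card natr_sum big_mkcond [RHS]big_mkcond; apply: eq_bigr => x _.
by rewrite finset.in_setI; case: (x \in S); case: (x \in Z).
Qed.

End Gap.

Lemma esym_step (T : {set V}) (h : V -> R) j : (forall x, 0 <= h x) ->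
  j.+1%:R * \sum_(S : {set V} | (#|S| == j.+1) && (S \subset T)) \prod_(x in S) h x <=
  (\sum_(S : {set V} | (#|S| == j) && (S \subset T)) \prod_(x in S) h x) * \sum_(x in T) h x.
Proof.
move=> h0.
have -> : j.+1%:R * \sum_(S : {set V} | (#|S| == j.+1) && (S \subset T)) \prod_(x in S) h x =
   \sum_(S : {set V} | (#|S| == j.+1) && (S \subset T)) \sum_(x in S) h x * \prod_(y in S :\ x) h y.
  rewrite mulr_sumr; apply: eq_bigr => S /andP[/eqP cS _].
  rewrite [RHS](eq_bigr (fun _ => \prod_(x in S) h x)) ?sumr_const ?cS ?mulr_natl // => x xS.
  by rewrite [RHS](big_setD1 x).
rewrite (exchange_big_dep (mem T)) /=; last by move=> S x /andP[_ /fintype.subsetP h1] xS; exact: h1.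
rewrite mulr_sumr; apply: ler_sum => x xT; rewrite -mulr_sumr mulrC; apply: ler_wpM2r => //.
rewrite (reindex_onto (fun S => x |: S) (fun S => S :\ x)) /=; last first.
  by move=> S /andP[_ xS]; exact: finset.setD1K.
rewrite big_mkcond [leRHS]big_mkcond; apply: ler_sum => S _.
case: ifP => [|_]; last by case: ifP => // _; exact: prodr_ge0.
move=> /andP[/andP[/andP[/eqP cS sT] _] /eqP e]; rewrite e.
have xS : x \notin S by rewrite -e finset.in_setD1 eqxx.
move: cS sT; rewrite cardsU1 xS add1n => -[->]; rewrite finset.subUset eqxx => /andP[_ ->] //.
Qed.

(** The left side sums over sequences without repetition, the right side over all sequences. *)
Lemma esym_le (T : {set V}) (h : V -> R) j : (forall x, 0 <= h x) ->
  j`!%:R * \sum_(S : {set V} | (#|S| == j) && (S \subset T)) \prod_(x in S) h x <= (\sum_(x in T) h x) ^+ j.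
Proof.
move=> h0; elim: j => [|j IH].
  rewrite fact0 mul1r expr0 (big_pred1 finset.set0) => [|S]; first by rewrite big_set0.
  by rewrite /= cards_eq0; case: eqVneq => //= ->; rewrite finset.sub0set.
rewrite factS natrM [j.+1%:R * _]mulrC exprSr.
have H0 : 0 <= \sum_(x in T) h x by exact: sumr_ge0.
apply: le_trans (ler_wpM2r H0 IH); rewrite -!mulrA; apply: ler_wpM2l => //.
exact: esym_step.
Qed.

(** The birthday estimate without denominators: j independent draws from D are distinct with
    probability at least 1 - j^2 / D. *)
Lemma ffact_ge (D j : nat) : (j ^ 2 <= D)%N -> (D ^ j * (D - j ^ 2) <= D * D ^_ j)%N.
Proof.
elim: j => [|j IH] h; first by rewrite expn0 ffactn0 exp0n // subn0; lia.
have hj : (j ^ 2 <= D)%N by apply: leq_trans h; rewrite leq_exp2r //.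
rewrite ffactnSr mulnA; apply: leq_trans (leq_mul (IH hj) (leqnn _)).
rewrite expnSr -!mulnA leq_mul2l; apply/orP; right.
move: h hj; rewrite -!mulnn; move: (j) => n; nia.
Qed.

(** S is a uniform m-subset of a random top face T. Drawing with replacement instead costs at most a
    factor 2, by [ffact_ge] and D >= 2 m^2; each draw then contributes 1 + (e^g - 1) |T :&: Z| / D,
    at most the exponential of the second summand. *)
Lemma skel_mgf m D (q Q : {set V} -> R) Z (g : R) : topw m q -> topw D Q -> (2 * m ^ 2 <= D)%N -> (0 < m)%N ->
  (forall t : {set V}, #|t| = m -> q t = pij D Q m t) -> 0 <= g ->
  \sum_S q S * expR (g * cz Z S) <= 2 * mgf Q Z ((expR g - 1) * m%:R / D%:R).
Proof.
move=> hq hQ mD m0 sk g0.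
have mlD : (m <= D)%N by apply: leq_trans mD; rewrite -mulnn; nia.
have D0 : (0 : R) < D%:R by rewrite ltr0n; lia.
have Q0 S : 0 <= Q S by case: hQ.
pose h x : R := if x \in Z then expR g else 1.
have h0 x : 0 <= h x by rewrite /h; case: ifP => // _; exact: expR_ge0.
have eh S : expR (g * cz Z S) = \prod_(x in S) h x.
  rewrite /h -big_mkcondr /= (eq_bigl (mem (S :&: Z))); last by move=> x; rewrite /= finset.in_setI.
  by rewrite prodr_const mulrC expRM_natl.
have sh (T : {set V}) : \sum_(x in T) h x = #|T|%:R + (expR g - 1) * cz Z T.
  have e x : h x = 1 + (expR g - 1) * (x \in Z)%:R by rewrite /h; case: (x \in Z) => /=; ring.
  under eq_bigr do rewrite e; rewrite big_split /= sumr_const -mulr_sumr; congr (_ + _ * _).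
  rewrite /cz -sum1_card natr_sum big_mkcond [RHS]big_mkcond; apply: eq_bigr => x _.
  by rewrite finset.in_setI; case: (x \in T); case: (x \in Z).
have e1 : \sum_S q S * expR (g * cz Z S) =
   'C(D, m)%:R^-1 * \sum_T Q T * \sum_(S : {set V} | (#|S| == m) && (S \subset T)) \prod_(x in S) h x.
  rewrite (bigID (fun S : {set V} => #|S| == m)) /= [X in _ + X]big1 ?addr0; last first.
    by move=> S cS; case: (eqVneq (q S) 0) => [->|/hq.2 e]; [rewrite mul0r | rewrite e eqxx in cS].
  rewrite mulr_sumr; under [RHS]eq_bigr do rewrite !mulr_sumr.
  rewrite [RHS](exchange_big_dep (fun S : {set V} => #|S| == m)) /=; last by move=> T S _ /andP[].
  apply: eq_bigr => S /eqP cS; rewrite sk // /pij /mass eh !mulr_suml.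
  apply: eq_big => [T|T _]; [by rewrite cS eqxx | ring].
have C0 : (0 : R) < 'C(D, m)%:R by rewrite ltr0n bin_gt0.
have f0 : (0 : R) < m`!%:R by rewrite ltr0n fact_gt0.
have ff : D%:R ^+ m <= 2 * ('C(D, m)%:R * m`!%:R) :> R.
  rewrite -natrM bin_ffact -natrX -natrM ler_nat.
  have hj : (m ^ 2 <= D)%N by apply: leq_trans mD; lia.
  have hf := ffact_ge hj; have DD : (0 < D)%N by lia.
  rewrite -(leq_pmul2l DD).
  have h2 : (D * D ^ m <= 2 * (D ^ m * (D - m ^ 2)))%N.
    by rewrite mulnCA [(D * _)%N]mulnC leq_mul2l; apply/orP; right; lia.
  by apply: leq_trans h2 _; rewrite [leqRHS]mulnCA leq_mul2l hf orbT.
have gp : 0 <= expR g - 1 by rewrite subr_ge0 -expR0 ler_expR.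
rewrite e1 /mgf !mulr_sumr; apply: ler_sum => T _.
have [->|QT] := eqVneq (Q T) 0; first by rewrite !mul0r !mulr0.
rewrite mulrCA [leRHS]mulrCA; apply: ler_wpM2l => //.
have := esym_le T m h0; rewrite sh (hQ.2 _ QT); set M := \sum_(S : {set V} | _) _ => hM.
have b1 : (D%:R + (expR g - 1) * cz Z T) ^+ m <= D%:R ^+ m * expR ((expR g - 1) * m%:R / D%:R * cz Z T).
  set y := (expR g - 1) * cz Z T / D%:R.
  have y0 : 0 <= y by rewrite divr_ge0 // ?mulr_ge0 // ltW.
  have -> : D%:R + (expR g - 1) * cz Z T = D%:R * (1 + y) by rewrite /y; field; rewrite gt_eqF.
  rewrite exprMn; apply: ler_wpM2l; first by rewrite exprn_ge0 // ltW.
  have -> : (expR g - 1) * m%:R / D%:R * cz Z T = m%:R * y by rewrite /y; ring.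
  by rewrite expRM_natl; apply: lerXn2r; rewrite ?nnegrE ?expR_ge0 ?expR_ge1Dx //; lra.
set Ex := expR (_ * cz Z T) in b1 *; have Ex0 : 0 <= Ex by exact: expR_ge0.
rewrite mulrC ler_pdivrMr // -(ler_pM2l f0); apply: le_trans hM _; apply: le_trans b1 _.
apply: le_trans (ler_wpM2r Ex0 ff) _; rewrite le_eqVlt; apply/orP; left; apply/eqP; ring.
Qed.

(** The deviation in L1 is twice the rise of the mean of |S :&: Z| / m under A, where Z is the set
    of vertices whose density rises. An event of probability exp (- cb) can raise a mean only as far
    as cb and the exponential moment of [g * cz Z S] permit. *)
Lemma dense_du m D (q Q : {set V} -> R) (G : {set {set V}}) (c g cb : R) (A : {set V} -> R) :
  topw m q -> topw D Q -> (forall t, (t \in G) = (0 < mass Q t)) ->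
  (2 * m ^ 2 <= D)%N -> (1 < m)%N -> (forall t : {set V}, #|t| = m -> q t = pij D Q m t) ->
  mass q finset.set0 = 1 -> \sum_S Q S = 1 -> 0 < c ->
  (forall a : R, eigenvalue (downupmx D G Q) a -> 1 - c / D%:R < a ->
     a = 1 /\ \rank (eigenspace (downupmx D G Q) a) = 1%N) ->
  0 < g <= 2^-1 -> 4 * g ^+ 2 <= c -> (forall S, 0 <= A S <= 1) -> expR (- cb) <= mu q finset.set0 A ->
  \sum_x piE m q finset.set0 x * `|mu q (x |: finset.set0) A / mu q finset.set0 A - 1| <=
  2 * (cb + 4) / (g * m%:R) + 4 * g.
Proof.
move=> hq hQ hG mD m2 sk q1 Q1 c0 gap /andP[g0 g1] gc A01 ha.
have m0 : (0 < m)%N by lia.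
have mR : (0 : R) < m%:R by rewrite ltr0n.
have mmD : (m * m * 2 <= D)%N by move: mD; rewrite -mulnn mulnC.
have mlD : (m <= D)%N by nia.
have D2 : (1 < D)%N by lia.
have D0 : (0 : R) < D%:R by rewrite ltr0n; lia.
set s := (finset.set0 : {set V}) in ha *; set a := mu q s A in ha *.
have a0 : 0 < a by apply: lt_le_trans ha; exact: expR_gt0.
have q0 S : 0 <= q S by case: hq.
have A0 S : 0 <= A S by have /andP[] := A01 S.
have ms : 0 < mass q s by rewrite q1.
have dg0 : dg m s = m by rewrite /dg cards0 subn0.
have dgp : (0 < dg m s)%N by rewrite dg0.
have s1 : \sum_x piE m q s x = 1 by exact: sum_piE.
have sa : \sum_x piE m q s x * mu q (x |: s) A = a by exact: sum_piE_mu.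
pose r x := mu q (x |: s) A / a - 1.
have r0 : \sum_x piE m q s x * r x = 0.
  under eq_bigr do rewrite mulrBr mulr1 mulrA.
  by rewrite sumrB -mulr_suml sa s1 divff ?gt_eqF // subrr.
pose Z := [set x | 0 < r x].
have e1 : \sum_x piE m q s x * `|r x| = 2 * \sum_(x in Z) piE m q s x * r x.
  have -> : \sum_x piE m q s x * `|r x| = \sum_x (2 * (if x \in Z then piE m q s x * r x else 0) - piE m q s x * r x).
    apply: eq_bigr => x _; rewrite inE; case: ltrP => h; first by rewrite gtr0_norm //; ring.
    by rewrite ler0_norm //; ring.
  by rewrite sumrB r0 subr0 -mulr_sumr -big_mkcond.
rewrite -/(r _) e1.
have e2 : m%:R * \sum_(x in Z) piE m q s x * mu q (x |: s) A = \sum_S q S * A S * cz Z S.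
  rewrite (eq_bigr (fun x => m%:R^-1 * \sum_(S : {set V} | x \in S) q S * A S)); last first.
    move=> x _; rewrite piE_sm ?finset.in_set0 // dg0 q1 mulr1 mulrC; congr (_ * _).
    by rewrite /sm finset.setU0; apply: eq_bigl => S; rewrite finset.sub1set.
  rewrite -mulr_sumr mulVKf ?gt_eqF // (exchange_big_dep predT) //=; apply: eq_bigr => S _.
  rewrite /cz -sum1_card natr_sum mulr_sumr; apply: eq_big => [x|x _]; last by rewrite mulr1.
  by rewrite finset.in_setI andbC.
pose nu := \sum_(x in Z) piE m q s x * mu q (x |: s) A / a.
pose pz := \sum_(x in Z) piE m q s x.
have e3 : \sum_(x in Z) piE m q s x * r x = nu - pz.
  by rewrite /nu /pz -sumrB; apply: eq_bigr => x _; rewrite /r; ring.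
pose t := (expR g - 1) * m%:R / D%:R.
have eg1 : expR g <= 1 + g + 2 * g ^+ 2 by apply: expR_quad; rewrite g1 ltW.
have gg : g ^+ 2 <= g / 2 by rewrite expr2; apply: ler_wpM2l; [exact: ltW | lra].
have ge1 : 0 <= expR g - 1 by rewrite subr_ge0 -expR0 ler_expR ltW.
have egg : expR g - 1 <= 2 * g by lra.
have mD2 : m%:R ^+ 2 * 2 <= D%:R :> R by rewrite expr2 -!natrM ler_nat.
have t0 : 0 <= t by rewrite divr_ge0 ?mulr_ge0 // ltW.
have t1 : t <= 1.
  rewrite ler_pdivrMr // mul1r; apply: (@le_trans _ _ m%:R); last by rewrite ler_nat.
  by apply: ler_piMl => //; lra.
have Dt : D%:R * t ^+ 2 <= 2 * g ^+ 2.
  have -> : D%:R * t ^+ 2 = (expR g - 1) ^+ 2 * (m%:R ^+ 2 / D%:R) by rewrite /t; field; rewrite gt_eqF.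
  have u1 : (expR g - 1) ^+ 2 <= 4 * g ^+ 2.
    have -> : 4 * g ^+ 2 = (2 * g) ^+ 2 by ring.
    by apply: lerXn2r; rewrite ?nnegrE //; lra.
  have u2 : m%:R ^+ 2 / D%:R <= 2^-1 :> R by rewrite ler_pdivrMr //; lra.
  apply: le_trans (ler_pM (sqr_ge0 _) _ u1 u2) _; first by rewrite divr_ge0 ?sqr_ge0 // ltW.
  by lra.
have Dc : D%:R * t ^+ 2 / c <= 2^-1 by rewrite ler_pdivrMr //; lra.
have t01 : 0 <= t <= 1 by rewrite t0 t1.
have mb := mgf_bound hQ hG D2 Q1 c0 gap Z t01 Dc.
rewrite (EX_pi D2 Q1 c0) in mb.
have pz' : \sum_(x in Z) piE D Q finset.set0 x = pz.
  by apply: eq_bigr => x _; rewrite (skel_piE hq hQ mlD sk) ?cards0 ?q1.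
have tE : t * (D%:R * pz) = (expR g - 1) * m%:R * pz by rewrite /t; field; rewrite gt_eqF.
rewrite pz' tE in mb.
have sg := skel_mgf Z hq hQ mD m0 sk (ltW g0).
pose L := cb + ln 2 + ((expR g - 1) * m%:R * pz + 1 + 4 * (D%:R * t ^+ 2 / c)).
have eL : \sum_S q S * A S * expR (g * cz Z S) <= a * expR L.
  apply: (@le_trans _ _ (\sum_S q S * expR (g * cz Z S))).
    apply: ler_sum => S _; apply: ler_wpM2r; first exact: expR_ge0.
    by rewrite ler_piMr //; have /andP[] := A01 S.
  apply: le_trans sg _; rewrite /L expRD expRD lnK ?posrE // mulrA mulrA.
  have x1 : 1 <= a * expR cb by have := ler_wpM2r (expR_ge0 cb) ha; rewrite -expRD addNr expR0.
  have x2 : 2 * mgf Q Z t <= 2 * expR ((expR g - 1) * m%:R * pz + 1 + 4 * (D%:R * t ^+ 2 / c)) by apply: ler_wpM2l.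
  apply: le_trans x2 _; rewrite -[a * _ * 2 * _]mulrA; apply: ler_peMl => //.
have sA : \sum_S q S * A S = a by rewrite /a /mu q1 divr1 /sm sum_set0.
(* Jensen's inequality under the law weighted by A: it bounds the mean of [g * cz Z S] by L. *)
have tan : expR L * (a * (1 - L) + g * \sum_S q S * A S * cz Z S) <= a * expR L.
  apply: le_trans eL; rewrite -sA !mulr_suml !mulr_sumr -big_split mulr_sumr; apply: ler_sum => S _ /=.
  have := ler_wpM2l (mulr_ge0 (q0 S) (A0 S)) (expR_tangent (g * cz Z S) L).
  by apply: le_trans; rewrite le_eqVlt; apply/orP; left; apply/eqP; ring.
have gn : g * (m%:R * nu) <= L.
  have e4 : \sum_S q S * A S * cz Z S = a * (m%:R * nu).
    rewrite -e2 /nu -mulr_suml; field; by rewrite gt_eqF.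
  move: tan; rewrite e4 mulrC ler_pM2r ?expR_gt0 // => h.
  rewrite -(ler_pM2l a0); move: h; clear; lra.
have l2 : ln 2 <= 1 :> R by have := @ln_sub R 1 2 ltr01 (ltr0n _ 2); rewrite ln1; clear; lra.
have p1 : pz <= 1.
  rewrite -s1 [leRHS](bigID (mem Z)) /= lerDl; apply: sumr_ge0 => x _; exact: piE_ge0.
have p0 : 0 <= pz by apply: sumr_ge0 => x _; exact: piE_ge0.
have Dc2 : 4 * (D%:R * t ^+ 2 / c) <= 2 by clear -Dc; lra.
have i1 : (expR g - 1) * m%:R * pz <= g * m%:R * pz + 2 * g ^+ 2 * m%:R.
  have k1 : (expR g - 1) * (m%:R * pz) <= (g + 2 * g ^+ 2) * (m%:R * pz) by apply: ler_wpM2r; [exact: mulr_ge0 | clear -eg1; lra].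
  have k2 : 2 * g ^+ 2 * (m%:R * pz) <= 2 * g ^+ 2 * m%:R.
    by apply: ler_wpM2l; [rewrite mulr_ge0 ?sqr_ge0 | rewrite ler_piMr].
  move: k1 k2; rewrite mulrDl; clear; lra.
rewrite e3; have gm : 0 < g * m%:R by exact: mulr_gt0.
have fin : (nu - pz) * (g * m%:R) <= cb + 4 + 2 * g * (g * m%:R) by rewrite /L in gn; clear -gn l2 Dc2 i1; lra.
have : nu - pz <= (cb + 4) / (g * m%:R) + 2 * g.
  by rewrite -(ler_pM2r gm) [leRHS]mulrDl divfK ?gt_eqF.
by rewrite -mulrA; clear; lra.
Qed.

End DownUp.

Lemma nat_above (R : realType) (x : R) : exists N : nat, x <= N%:R.
Proof. by exists (Num.bound `|x|); apply: le_trans (ler_norm x) _; apply: ltW; exact: archi_boundP. Qed.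

(** * Regularity of nice complexes *)

Section Regular.
Variables (R : realType).

Lemma qgap_le (V : finType) k (p : {set V} -> R) s (l l' : R) : topw k p -> l <= l' -> qgap k p s l -> qgap k p s l'.
Proof.
move=> hp ll h f f0; apply: le_trans (h f f0) _; apply: ler_wpM2r => //.
by apply: sumr_ge0 => x _; rewrite mulr_ge0 ?sqr_ge0 ?(piE_ge0 hp).
Qed.

Lemma expR_sq (y : R) : 0 <= y -> y ^+ 2 / 4 <= expR y.
Proof.
move=> y0; have -> : expR y = expR (y / 2) ^+ 2 by rewrite expr2 -expRD; congr expR; field.
have -> : y ^+ 2 / 4 = (y / 2) ^+ 2 by field.
apply: lerXn2r; rewrite ?nnegrE ?expR_ge0 //; first by lra.
by have := expR_ge1Dx (y / 2); lra.
Qed.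

Definition errs_le (V : finType) m (q : {set V} -> R) (C : R) : Prop :=
  forall M : V -> R, (forall x, 0 <= M x <= 1) ->
  errM (piE m q finset.set0) (pi2E m q finset.set0) M <= C / m%:R.

Definition dense_le (V : finType) m (q : {set V} -> R) (cb beta : R) : Prop :=
  forall A : {set V} -> R, (forall S, 0 <= A S <= 1) -> expR (- cb) <= mu q finset.set0 A ->
  \sum_x piE m q finset.set0 x * `|mu q (x |: finset.set0) A / mu q finset.set0 A - 1| <= beta.

Lemma errs_qgap (V : finType) m (q : {set V} -> R) (C : R) : topw m q -> (1 < m)%N -> mass q finset.set0 = 1 ->
  0 <= C -> qgap m q finset.set0 (C / m%:R) -> errs_le m q (C + 2).
Proof.
move=> hq m2 q1 C0 gap M M01; apply: le_trans (decorr_gap hq m2 q1 C0 gap M01) _.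
rewrite mulrDl lerD2l; have m1 : (0 : R) < m.-1%:R by rewrite ltr0n; lia.
have mR : (0 : R) < m%:R by rewrite ltr0n; lia.
rewrite -[leLHS]div1r ler_pdivrMr // mulrAC ler_pdivlMr // mul1r -natrM ler_nat; lia.
Qed.

(** The first two kinds of niceness give an exponentially small gap in every link and go through
    [dense_gap]. The third gives a Poincare inequality at the top and goes through [dense_du]. In
    all cases the vertex graph has gap at most C' / m, enough for the errors. *)
Lemma nice_regular (c beta : R) : 0 < c -> 0 < beta -> exists (kap C : R) (m0 : nat),
  [/\ 0 < kap, 0 <= C, (1 < m0)%N & forall (V : finType) m (F : {set {set V}}) (q : {set V} -> R),
   (m0 <= m)%N -> supp m F q -> mass q finset.set0 = 1 -> nice c m F q ->
   errs_le m q C /\ dense_le m q (kap * m%:R) beta].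
Proof.
move=> c0 beta0.
have l2 : 0 < ln 2 :> R by rewrite ln_gt0 // ltr1n.
pose K := c * ln 2 / 2; have K0 : 0 < K by rewrite divr_gt0 // mulr_gt0.
pose al := Num.min 2^-1 (Num.min (beta / 16) (c / 2)).
have al0 : 0 < al by rewrite !lt_min; apply/and3P; split; lra.
have al1 : al <= 2^-1 by rewrite ge_min lexx.
have al2 : al <= beta / 16 by rewrite !ge_min lexx orbT.
have al3 : al <= c / 2 by rewrite !ge_min lexx !orbT.
(* lam equals exp (- 2 K m), so kap <= K leaves exp (- K m) after the loss exp (kap m) in
   [dense_gap]; kap <= al^2 keeps the other error, kap / al, at most al. *)
pose kap := Num.min (al ^+ 2) K.
have kap0 : 0 < kap by rewrite lt_min exprn_gt0.
have kap1 : kap <= al ^+ 2 by rewrite ge_min lexx.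
have kap2 : kap <= K by rewrite ge_min lexx orbT.
have [N1 hN1] := nat_above (4 / (K ^+ 2 * al ^+ 2)).
have [N2 hN2] := nat_above (32 / (al * beta)).
pose C' := (c * ln 2)^-1 + c^-1.
have i1 : 0 < (c * ln 2)^-1 by rewrite invr_gt0 mulr_gt0.
have i2 : 0 < c^-1 by rewrite invr_gt0.
have C'0 : 0 <= C' by rewrite addr_ge0 // ltW.
exists kap, (C' + 2), (N1 + N2 + 2)%N; split; [exact: kap0 | by apply: addr_ge0 => //; exact: ler0n | by rewrite leq_addl |].
move=> V m F q mN [hq hF] q1 hn.
have m2 : (1 < m)%N by exact: leq_trans (leq_addl _ _) mN.
have mR : (0 : R) < m%:R by rewrite ltr0n; exact: ltnW.
have mN1 : 4 / (K ^+ 2 * al ^+ 2) <= m%:R by apply: le_trans hN1 _; rewrite ler_nat (leq_trans _ mN) // -addnA leq_addr.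
have mN2 : 32 / (al * beta) <= m%:R by apply: le_trans hN2 _; rewrite ler_nat (leq_trans _ mN) // addnAC leq_addl.
have K2 : 0 < K ^+ 2 by rewrite exprn_gt0.
have A2 : 0 < al ^+ 2 by rewrite exprn_gt0.
pose lam : R := 2 `^ (- (c * m%:R)).
have lamE : lam = expR (- (2 * K * m%:R)).
  rewrite /lam /powR ifF; last by rewrite pnatr_eq0.
  by congr expR; rewrite /K; field.
have lam0 : 0 <= lam by rewrite lamE expR_ge0.
have lam1 : lam <= C' / m%:R.
  have y0 : 0 < 2 * K * m%:R by rewrite !mulr_gt0.
  rewrite lamE expRN; apply: (@le_trans _ _ ((2 * K * m%:R)^-1)).
    by rewrite lef_pV2 ?posrE ?expR_gt0 //; have := expR_ge1Dx (2 * K * m%:R); lra.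
  rewrite invfM; apply: ler_wpM2r; first by rewrite invr_ge0 ltW.
  have -> : 2 * K = c * ln 2 by rewrite /K; field.
  by rewrite /C' lerDl ltW.
have ab : (forall s : {set V}, 0 < mass q s -> (#|s| + 2 <= m)%N -> qgap m q s lam) ->
    errs_le m q (C' + 2) /\ dense_le m q (kap * m%:R) beta.
  move=> gap; split.
    apply: errs_qgap => //; apply: qgap_le lam1 _ => //; apply: gap; by rewrite ?q1 ?cards0.
  move=> A A01 hA; have al01 : 0 < al <= 2^-1 by rewrite al0 al1.
  apply: le_trans (dense_gap hq lam0 A01 gap _ q1 hA al01) _; first exact: ltnW.
  have e1 : kap * m%:R / m%:R = kap by rewrite mulfK // gt_eqF.
  have e2 : m%:R * lam * expR (kap * m%:R) <= al ^+ 2.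
    have u1 : expR (kap * m%:R) <= expR (K * m%:R) by rewrite ler_expR ler_wpM2r // ltW.
    apply: (@le_trans _ _ (m%:R * lam * expR (K * m%:R))); first by apply: ler_wpM2l => //; rewrite mulr_ge0 // ltW.
    rewrite lamE -mulrA -expRD (_ : - (2 * K * m%:R) + K * m%:R = - (K * m%:R)); last by ring.
    have km0 : 0 < K * m%:R by rewrite mulr_gt0.
    have sq := expR_sq (ltW km0).
    rewrite expRN ler_pdivrMr ?expR_gt0 //.
    apply: le_trans (_ : al ^+ 2 * ((K * m%:R) ^+ 2 / 4) <= _); last by apply: ler_wpM2l => //; exact: ltW.
    move: mN1; rewrite ler_pdivrMr ?mulr_gt0 // => h4.
    have -> : al ^+ 2 * ((K * m%:R) ^+ 2 / 4) = m%:R * (m%:R * (K ^+ 2 * al ^+ 2)) / 4 by field.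
    by have := ler_wpM2l (ltW mR) h4; lra.
  rewrite e1; apply: (@le_trans _ _ (2 * al + (al ^+ 2 + al ^+ 2) / al)).
    by rewrite lerD2l ler_pM2r ?invr_gt0 //; lra.
  have -> : (al ^+ 2 + al ^+ 2) / al = 2 * al by field; rewrite gt_eqF.
  lra.
case: hn => [h|[D [G [Q [mD wQ _ h [_ sk]]]]]|[D [G [Q [mD wQ h [_ sk]]]]]].
- by apply: ab; apply: (lse_qgap (F := F)) => //; exact: lse_two_one.
- have [hQ hG] := wcomplex_supp wQ; apply: ab => s ms sm.
  apply: (skel_qgap hq hQ mD sk sm ms); apply: (lse_qgap (conj hQ hG) h); last exact: leq_trans mD.
  by rewrite -(skel_pos hq hQ mD sk) //; exact: leq_trans (leq_addr 2 _) sm.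
have [hQ hG] := wcomplex_supp wQ; have Q1 := wcomplex_mass1 wQ.
have mmD : (m * m * 2 <= D)%N by move: mD; rewrite -mulnn mulnC.
have mlD : (m < D)%N by clear -mmD m2; nia.
have D2 : (1 < D)%N by exact: ltn_trans mlD.
split.
  apply: errs_qgap => //.
  apply: (skel_qgap hq hQ (ltnW mlD) sk); rewrite ?cards0 ?q1 //.
  apply: qgap_le (du_qgap hQ hG D2 Q1 c0 h) => //.
  rewrite invfM; apply: ler_pM; rewrite ?invr_ge0 //; [exact: ltW | by rewrite /C' lerDr ltW |].
  by rewrite lef_pV2 ?posrE ?ltr0n ?ler_nat //; clear -mlD m2; lia.
move=> A A01 hA.
have al01 : 0 < al <= 2^-1 by rewrite al0 al1.
have aa : al ^+ 2 <= al / 2 by rewrite expr2; apply: ler_wpM2l => //; exact: ltW.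
have a4 : 4 * al ^+ 2 <= c by clear -aa al3; lra.
apply: le_trans (dense_du hq hQ hG mD m2 sk q1 Q1 c0 h al01 a4 A01 hA) _.
have am : 0 < al * m%:R by exact: mulr_gt0.
have e : 2 * (kap * m%:R + 4) / (al * m%:R) = 2 * kap / al + 8 / (al * m%:R) by field; rewrite !gt_eqF.
have b1 : 2 * kap / al <= 2 * al by rewrite ler_pdivrMr // -mulrA -expr2; clear -kap1; lra.
have b2 : 8 / (al * m%:R) <= beta / 4.
  rewrite ler_pdivrMr //; move: mN2; rewrite ler_pdivrMr ?mulr_gt0 //; clear; lra.
rewrite e; clear -b1 b2 al2 beta0; lra.
Qed.

Lemma locally_nice_regular (c beta : R) : 0 < c -> 0 < beta -> exists (kap C : R) (m0 : nat),
  [/\ 0 < kap, 0 <= C, (1 < m0)%N & forall (V : finType) k r (F : {set {set V}}) (p : {set V} -> R),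
   (m0 + r <= k)%N -> wcomplex k F p -> locally_nice c k F p ->
   decorr k p (C / (k - r)%:R) r /\ dense_regular k p (kap * (k - r)%:R) beta r].
Proof.
move=> c0 beta0; have [kap [C [m0 [kap0 C0 m02 H]]]] := nice_regular c0 beta0.
exists kap, C, m0; split=> // V k r F p rk wc ln.
have [hp hF] := wcomplex_supp wc.
have kr0 : (0 : R) < (k - r)%:R by rewrite ltr0n; lia.
have base E : 0 < mass p E -> (#|E| <= r)%N ->
   [/\ errs_le (k - #|E|) (link_p p E) C, dense_le (k - #|E|) (link_p p E) (kap * (k - #|E|)%:R) beta,
    (k - r)%:R <= (k - #|E|)%:R :> R,
    forall x, piE (k - #|E|) (link_p p E) finset.set0 x = piE k p E x &
    forall x y, pi2E (k - #|E|) (link_p p E) finset.set0 x y = pi2E k p E x y].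
  move=> mE Er; have EF : E \in F by rewrite hF.
  have d0 : [disjoint finset.set0 & E] by rewrite -finset.setI_eq0 finset.set0I.
  have [||||h1 h2] := H V (k - #|E|)%N (link_faces F E) (link_p p E).
  - by lia.
  - by split; [exact: link_topw | exact: link_supp].
  - exact: link_mass1.
  - exact: ln.
  by split=> //; [rewrite ler_nat; lia | move=> x; rewrite link_piE ?finset.set0U | move=> x y; rewrite link_pi2E ?finset.set0U].
split=> E mE Er.
  move=> M M01; have [h1 _ le e1 e2] := base E mE Er.
  have := h1 M M01; rewrite (_ : piE _ _ finset.set0 = piE k p E); last exact/funext.
  rewrite (_ : pi2E _ _ finset.set0 = pi2E k p E); last by apply/funext => x; apply/funext => y.
  move=> h; apply: le_trans h _; apply: ler_wpM2l => //; rewrite lef_pV2 ?posrE //.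
  exact: lt_le_trans le.
move=> A A01 hA; have [_ h2 le e1 _] := base E mE Er.
have d0 : [disjoint finset.set0 & E] by rewrite -finset.setI_eq0 finset.set0I.
have eA : mu (link_p p E) finset.set0 (fun u => A (u :|: E)) = mu p E A by rewrite link_mu // finset.set0U.
have := h2 (fun u => A (u :|: E)) (fun u => A01 _); rewrite eA => hh.
have {}hh := hh (le_trans _ hA).
apply: le_trans (hh _); last by rewrite ler_expR lerN2 ler_wpM2l // ltW.
rewrite le_eqVlt; apply/orP; left; apply/eqP; apply: eq_bigr => x _; rewrite e1.
have [xE|xE] := boolP (x \in E); first by rewrite /piE xE !mul0r.
rewrite finset.setU0 link_mu //; by rewrite disjoints1.
Qed.

End Regular.

(** * The main theorem *)

Section Params.
Variable R : realType.

Lemma floor_half (x : R) : 2 <= x -> exists h : nat, [/\ (0 < h)%N, h%:R <= x & x / 2 <= h%:R].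
Proof.
move=> x2; have x0 : 0 <= x by lra.
have /andP[h1 h2] := truncn_itv x0; exists (Num.truncn x); split=> //.
  by rewrite -(ltr0n R); have := h2; rewrite -natr1; clear -x2; lra.
by have := h2; rewrite -natr1; clear -x2; lra.
Qed.

Lemma ln_small (y e : R) : 0 < y -> 0 < e -> ln y <= e * y - ln e.
Proof.
move=> y0 e0; have : ln (e * y) <= e * y - 1.
  by have := le_ln1Dx (x := e * y - 1); rewrite addrCA subrr addr0; apply; have := mulr_gt0 e0 y0; lra.
rewrite lnM ?posrE //; lra.
Qed.

Lemma expR1_le4 : expR 1 <= 4 :> R.
Proof.
have q : expR 2^-1 <= 2 :> R by apply: le_trans (@expR_quad R 2^-1 _) _; [lra | rewrite expr2; lra].
have -> : expR 1 = expR 2^-1 ^+ 2 :> R by rewrite expr2 -expRD; congr expR; field.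
have -> : 4 = 2 ^+ 2 :> R by rewrite expr2; lra.
by apply: lerXn2r; rewrite ?nnegrE ?expR_ge0 ?ler0n.
Qed.

Lemma divn_gt0R (x : R) n : 0 < x -> (0 < n)%N -> 0 < x / n%:R.
Proof. by move=> x0 n0; rewrite divr_gt0 // ltr0n. Qed.

Lemma min_exists (l : seq R) : all (fun x => 0 < x) l -> exists2 y : R, 0 < y & {in l, forall x, y <= x}.
Proof.
elim: l => [|x l IH] /=; first by exists 1.
case/andP=> x0 /IH[y y0 hy]; exists (Num.min x y); first by rewrite lt_min x0.
by move=> z; rewrite inE => /orP[/eqP ->|/hy yz]; rewrite ge_min ?lexx ?yz ?orbT.
Qed.

(** [Kst cs] grows like 1 / cs, so cs is fixed first and beta is taken small against it. In units of
    z = eta / 1024, the last left side is at most 13 z, and eta / 32 is 32 z. *)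
Lemma star_params (eta : R) : 0 < eta -> exists cs beta x1 : R, [/\ 0 < cs, 0 < beta, 0 < x1,
  beta <= 8^-1 /\ beta <= eta / 240 & 1024 * (10 * cs + Kst cs * beta + x1) + 9 * beta <= eta / 32].
Proof.
move=> eta0; pose z := eta / 1024.
have z0 : 0 < z by rewrite /z; apply: divn_gt0R.
have ze : eta = 1024 * z by rewrite /z mulrC divfK ?pnatr_eq0.
have [|cs cs0 hcs] := min_exists (l := [:: z / 1024]); first by rewrite /= andbT; apply: divn_gt0R.
have K1p : 0 < `|Kst cs| + 1 by rewrite ltr_wpDl.
have Kle : Kst cs <= `|Kst cs| + 1 by apply: le_trans (ler_norm _) _; rewrite lerDl.
have [|beta b0 hb] := min_exists (l := [:: 8^-1; z / 9; eta / 240; z / 1024 / (`|Kst cs| + 1)]).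
  rewrite /= andbT; apply/and4P; split; [by rewrite invr_gt0 ltr0n | by apply: divn_gt0R | by apply: divn_gt0R |].
  by apply: divr_gt0 K1p; apply: divn_gt0R.
have := hcs (z / 1024); have := hb (z / 9); have := hb 8^-1; have := hb (eta / 240); have := hb (z / 1024 / (`|Kst cs| + 1)).
rewrite !inE !eqxx ?orbT => /(_ isT) u1 /(_ isT) u2 /(_ isT) u3 /(_ isT) u4 /(_ isT) u5.
have x0 : 0 < z / 1024 by apply: divn_gt0R.
exists cs, beta, (z / 1024); split=> //.
rewrite ler_pdivlMr // in u1.
have v1 : Kst cs * beta <= z / 1024.
  by apply: le_trans u1; rewrite mulrC; apply: ler_wpM2l => //; exact: ltW.
have w (y : R) : y <= z / 1024 -> 1024 * y <= z by rewrite ler_pdivlMr ?ltr0n // mulrC.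
have w1 := w _ v1; have w2 := w _ u5; have w3 : 1024 * (z / 1024) <= z by exact: w.
have -> : eta / 32 = 32 * z by rewrite ze; field.
rewrite !mulrDr; have -> : 1024 * (10 * cs) = 10 * (1024 * cs) by ring.
clear -w1 w2 w3 u4 z0 u2; move: w1 w2 w3 u4 z0 u2; generalize (1024 * cs) (1024 * (Kst cs * beta)) (1024 * (z / 1024)) => *; lra.
Qed.

(** One large Lam serves both recursions: a x1 >= 4 outweighs ln 2 and the error terms of the first,
    and Lam eta / 8 >= e gives the second the gain g0 = 1 per vertex. *)
Lemma base_params (eta x1 : R) : 0 < eta -> 0 < x1 -> exists a Lam : R,
  [/\ a = ln Lam / 512, 1 <= Lam, 0 < a, 4 <= a * x1 & expR 1 <= Lam * (eta / 8)].
Proof.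
move=> eta0 x10; pose a := 4 / x1 + ln (1 + 32 / eta).
have e24 : 0 < 32 / eta by rewrite divr_gt0 // ltr0n.
have la0 : 0 <= ln (1 + 32 / eta) by apply: ln_ge0; rewrite lerDl ltW.
have fx : 0 < 4 / x1 by rewrite divr_gt0 // ltr0n.
have a0 : 0 < a by rewrite /a ltr_pwDl.
have m0 : 0 < 512 * a by rewrite pmulr_rgt0 ?ltr0n.
exists a, (expR (512 * a)); split; [| | exact: a0 | |].
- by rewrite expRK [512 * a]mulrC mulfK ?pnatr_eq0.
- by apply: le_trans (expR_ge1Dx _); rewrite lerDl ltW.
- by rewrite /a mulrDl divfK ?gt_eqF // lerDl mulr_ge0 // ltW.
have L : 32 / eta <= expR (512 * a).
  apply: (@le_trans _ _ (1 + 32 / eta)); first by rewrite lerDr.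
  have z : 0 < 1 + 32 / eta by rewrite ltr_pwDl // ltW.
  rewrite -[1 + 32 / eta]lnK ?posrE // ler_expR.
  apply: (@le_trans _ _ a); first by rewrite /a lerDr ltW.
  by rewrite ler_peMl ?ler1n // ltW.
apply: le_trans expR1_le4 _; move: L; generalize (expR (512 * a)) => X; rewrite ler_pdivrMr //; clear; lra.
Qed.

(** The depth h is a constant fraction of n, while the logarithms of 1/delta and of the allowed
    exchange sum are O(th n) with th chosen much smaller than that fraction. The threshold 2 (h + 1)
    / delta^3 is the one that Markov's inequality affords later. *)
Theorem restriction_params (cn eta : R) : 0 < cn -> 0 < eta -> exists (th : R) (n0 : nat), 0 < th /\
  forall n, (n0 <= n)%N -> exists (h : nat) (Lam : R), [/\ (n + h <= 2 * n)%N, 1 <= Lam, Lam * h%:R <= n%:R &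
  forall (V : finType) (F : {set {set V}}) (p : {set V} -> R),
  wcomplex (2 * n) F p -> locally_nice cn (2 * n) F p ->
  forall (Sigma : finType) (f : {set V} -> V -> Sigma) (delta : R) (t S0 : {set V}),
  expR (- (th * n%:R)) < delta -> delta <= 1 -> #|t| = n -> 0 < mass p t ->
  delta / 2 <= mu p t (VV R f t S0) ->
  GG (2 * n) p Lam f h t (VV R f t S0) (VV R f t S0) <= 2 * h.+1%:R / delta ^+ 3 ->
  exists g : {ffun V -> Sigma},
  mu p t (fun S => VV R f t S0 S * (eta / 4 * (dg (2 * n) t)%:R < (wrong (fun S x => f S x == g x) t S)%:R)%R%:R)
  <= delta ^+ 2 * mu p t (VV R f t S0)].
Proof.
move=> cn0 eta0.
have [cs [beta [x1 [cs0 b0 x10 [b8 betaeta] num2]]]] := star_params eta0.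
have [a [Lam [aE Lam1 a0 ax g0_le]]] := base_params eta0 x10.
have Lam0 : 0 < Lam by exact: lt_le_trans Lam1.
have [kap [C [m0 [kap0 C0 m02 HR]]]] := locally_nice_regular cn0 b0.
have [P P0 PK] : exists2 P : R, 0 < P & 1 + 10 * cs + 2 * Kst cs <= P.
  exists (`|1 + 10 * cs + 2 * Kst cs| + 1); first by rewrite ltr_wpDl.
  by apply: le_trans (ler_norm _) _; rewrite lerDl.
have Pk : 0 < P / kap by rewrite divr_gt0.
have [Qc Qc0 QcK] : exists2 Qc : R, 0 < Qc & 6 * (P / kap) + CSt cs * (C + 1) <= Qc.
  exists (`|6 * (P / kap) + CSt cs * (C + 1)| + 1); first by rewrite ltr_wpDl.
  by apply: le_trans (ler_norm _) _; rewrite lerDl.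
(* h will be about thh n. The five bounds give, in order, Lam h <= n, the spare wrong vertices, h <=
   n / 16, and the smallness of d h and of d2 h. *)
have [thh thh0 [t1 t2 t3 t4 t5]] : exists2 thh : R, 0 < thh &
   [/\ thh <= Lam^-1, thh <= eta / 20, thh <= 16^-1, thh <= x1 / (8 * Qc) & thh <= eta * kap / 128].
  have [|y y0 hy] := min_exists (l := [:: Lam^-1; eta / 20; 16^-1; x1 / (8 * Qc); eta * kap / 128]).
    by rewrite /= !invr_gt0 !divr_gt0 ?mulr_gt0 ?ltr0n ?Lam0.
  by exists y => //; split; apply: hy; rewrite !inE eqxx ?orbT.
(* 112: the left side of [num3] is at most 19 th n, while h / 2 >= thh n / 4 >= 28 th n. 88: l2 <=
   11 th n and cb >= kap n / 2 >= 44 th n, so e2 l2 <= 1/4. *)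
have [th th0 [s1 s2 s3]] : exists2 th : R, 0 < th &
   [/\ th <= x1 * kap / (48 * P), th <= thh / 112 & th <= kap / 88].
  have [|y y0 hy] := min_exists (l := [:: x1 * kap / (48 * P); thh / 112; kap / 88]).
    by rewrite /= !divr_gt0 ?mulr_gt0 ?ltr0n.
  by exists y => //; split; apply: hy; rewrite !inE eqxx ?orbT.
have [N1 hN1] := nat_above (2 / thh).
have [N2 hN2] := nat_above (`|ln (th / 2)| / th).
have [N3 hN3] := nat_above (1 / th).
exists (2 * th), (N1 + N2 + N3 + 2 * m0 + 4)%N; split; first by rewrite mulr_gt0 // ltr0n.
move=> n nN.
have nN1 : 2 / thh <= n%:R by apply: le_trans hN1 _; rewrite ler_nat; clear -nN; lia.
have nN2 : `|ln (th / 2)| / th <= n%:R by apply: le_trans hN2 _; rewrite ler_nat; clear -nN; lia.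
have nN3 : 1 / th <= n%:R by apply: le_trans hN3 _; rewrite ler_nat; clear -nN; lia.
have nm0 : (2 * m0 + 4 <= n)%N by clear -nN; lia.
have n0R : (0 : R) < n%:R by rewrite ltr0n; clear -nm0; lia.
have th1 : 1 <= th * n%:R by move: nN3; rewrite ler_pdivrMr // mulrC.
have thl : - ln (th / 2) <= th * n%:R.
  move: nN2; rewrite ler_pdivrMr // [n%:R * _]mulrC => u; apply: le_trans u.
  by rewrite -normrN ler_norm.
have thn2 : 2 <= thh * n%:R by move: nN1; rewrite ler_pdivrMr // mulrC.
have [h [h0 hle hge]] := floor_half thn2.
have hR : (0 : R) < h%:R by rewrite ltr0n.
have hb (z : R) : thh <= z -> h%:R <= z * n%:R by move=> tz; apply: le_trans hle _; apply: ler_wpM2r => //; exact: ltW.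
have h16 : 16 * h%:R <= n%:R :> R by have := hb _ t3; clear; lra.
have h16n : (16 * h <= n)%N by rewrite -(ler_nat R) natrM.
exists h, Lam; split => //; [by clear -h16n; lia | |].
  by have := hb _ t1; rewrite mulrC ler_pdivlMr // mulrC.
move=> V F p wc ln_ Sigma f delta t S0 dth d1 tn mt mV hG.
pose k := (2 * n)%N; pose r := (n + h)%N.
have krE : (k - r = n - h)%N by rewrite /k /r; clear; lia.
have mr : (m0 + r <= k)%N by rewrite /k /r; clear -nm0 h16n; lia.
have [HV HS] := HR V k r F p mr wc ln_.
have NE : (k - r)%:R = n%:R - h%:R :> R by rewrite krE natrB //; clear -h16n; lia.
set N' : R := (k - r)%:R in HV HS NE.
have N'1 : n%:R / 2 <= N' by rewrite NE; clear -h16 n0R hR; lra.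
have N'0 : 0 < N' by clear -N'1 n0R; lra.
have [hp hF] := wcomplex_supp wc.
pose cb := kap * N'; have cb0 : 0 < cb by exact: mulr_gt0.
have cbn : kap * n%:R / 2 <= cb by rewrite /cb -mulrA; apply: ler_wpM2l => //; exact: ltW.
(* Just large enough for [ecb]. Being O(1 / n), it charges log weights of order th n only a small
   constant. *)
pose e := a * P / cb; have e0 : 0 <= e by rewrite divr_ge0 ?mulr_ge0 // ltW.
pose CV := C / N'; have CV0 : 0 <= CV by rewrite divr_ge0 // ltW.
pose epsb := N'^-1.
pose d := a * Qc / N'.
have ecb : a * (1 + 10 * cs + 2 * Kst cs) <= e * cb.
  rewrite /e divfK ?gt_eqF //; apply: ler_wpM2l; [exact: ltW | exact: PK].
have d_ge : 6 * e + a * CSt cs * (CV + epsb) <= d.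
  have -> : 6 * e = a * (6 * (P / kap)) / N' by rewrite /e /cb; field; rewrite !gt_eqF.
  have -> : a * CSt cs * (CV + epsb) = a * (CSt cs * (C + 1)) / N' by rewrite /CV /epsb; field; rewrite !gt_eqF.
  rewrite -mulrDl -mulrDr /d; apply: ler_wpM2r; first by rewrite invr_ge0 ltW.
  apply: ler_wpM2l; first exact: ltW.
  exact: QcK.
have kr : (r.+2 <= k)%N by rewrite /k /r; clear -nm0 h16n; lia.
have beta8 : 0 <= beta <= 8^-1 by rewrite ltW.
pose e2 := cb^-1; have e20 : 0 <= e2 by rewrite invr_ge0 ltW.
have ecb2 : 1 <= e2 * cb by rewrite /e2 mulVf ?gt_eqF.
pose d2 := 16 * e2 / eta; have d2_ge : 16 * e2 / eta <= d2 by [].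
have thr : (#|t| + h <= r)%N by rewrite tn.
have de0 : 0 < delta by apply: lt_trans dth; exact: expR_gt0.
have lde : - ln delta <= 2 * th * n%:R.
  by rewrite lerNl -[leLHS]expRK ler_ln ?posrE ?expR_gt0 // ltW.
have ldp : 0 <= - ln delta by rewrite oppr_ge0 ln_le0.
have l21 : ln 2 <= 1 :> R by have := @ln_sub R 1 2 ltr01 (ltr0n _ 2); rewrite ln1; clear; lra.
have l20 : 0 <= ln 2 :> R by apply: ln_ge0; rewrite ler1n.
pose l1 := ln 2 - ln delta.
have l1b : l1 <= 3 * (th * n%:R) by rewrite /l1; clear -lde l21 th1; lra.
have l10 : 0 <= l1 by rewrite /l1; clear -ldp l20; lra.
have mV' : expR (- l1) <= mu p t (VV R f t S0).
  by rewrite /l1 opprB expRD expRN !lnK ?posrE ?ltr0n.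
have kth : 88 * (th * n%:R) <= kap * n%:R.
  by rewrite mulrA; apply: ler_wpM2r; [exact: ltW | move: s3; clear; lra].
have thn0 : 0 < th * n%:R by exact: mulr_gt0.
have l1cb : l1 <= cb by clear -l1b kth cbn thn0; lra.
pose Gam := 2 * h.+1%:R / delta ^+ 3.
have hS0 : (0 : R) < 2 * h.+1%:R by rewrite mulr_gt0 ?ltr0n.
have Gam0 : 0 < Gam by apply: divr_gt0 => //; exact: exprn_gt0.
have lG : ln Gam <= 8 * (th * n%:R).
  rewrite /Gam ln_div ?posrE ?exprn_gt0 // lnXn//.
  have th2 : 0 < th / 2 by clear -th0; lra.
  have := ln_small hS0 th2; have hS : 2 * h.+1%:R <= 2 * n%:R :> R.
    by apply: ler_wpM2l => //; rewrite ler_nat; clear -h16n h0; lia.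
  have := ler_wpM2l (ltW th2) hS; rewrite -(mulr_natl (ln delta) 3); clear -lde thl; lra.
have num1 : ln 2 + d * h%:R + 2 * e * l1 + (ln Gam + 2 * l1) / h%:R <= a * x1.
  have q1 : d * h%:R <= a * x1 / 4.
    have : h%:R <= x1 / (8 * Qc) * n%:R by exact: hb.
    rewrite mulrAC ler_pdivlMr ?mulr_gt0 ?ltr0n // => u.
    have -> : d * h%:R = a * (Qc * h%:R) / N' by rewrite /d; ring.
    rewrite ler_pdivrMr // -!mulrA; apply: ler_wpM2l; first exact: ltW.
    have := ler_wpM2l (ltW x10) N'1; clear -u; lra.
  have q2 : 2 * e * l1 <= a * x1 / 4.
    have : th <= x1 * kap / (48 * P) by []; rewrite ler_pdivlMr ?mulr_gt0 ?ltr0n // => u.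
    have -> : 2 * e * l1 = a * (2 * P * l1) / cb by rewrite /e; ring.
    rewrite ler_pdivrMr // -!mulrA; apply: ler_wpM2l; first exact: ltW.
    have v1 := ler_wpM2l (ltW P0) l1b; have v2 := ler_wpM2l (ltW x10) cbn.
    have v3 := ler_wpM2r (ltW n0R) u; clear -v1 v2 v3; lra.
  have q3 : (ln Gam + 2 * l1) / h%:R <= 1.
    rewrite ler_pdivrMr // mul1r; have := ler_wpM2r (ltW n0R) s2; clear -lG l1b hge hR; lra.
  clear -q1 q2 q3 ax l21; lra.
have numh : h%:R <= eta / 20 * (dg k t)%:R.
  by rewrite /dg tn /k (_ : (2 * n - n = n)%N); [exact: hb | clear; lia].
have dgn : (dg k t)%:R = n%:R :> R by rewrite /dg tn /k (_ : (2 * n - n = n)%N) //; clear; lia.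
have numr : eta / 16 * (dg k t)%:R <= eta / 15 * (k - r)%:R.
  rewrite dgn -/N' NE; have := ler_wpM2l (ltW eta0) h16; clear; lra.
have num3 : ln Gam + (- 2 * ln delta + 2 * l1 + ln 2) < h%:R * (1 - d2 * h%:R - e2 * (- 2 * ln delta + 2 * l1 + ln 2)).
  set l2 := - 2 * ln delta + 2 * l1 + ln 2.
  have l2b : l2 <= 11 * (th * n%:R) by rewrite /l2; clear -lde l1b l21 th1; lra.
  have w1 : d2 * h%:R <= 4^-1.
    have -> : d2 * h%:R = 16 * h%:R / (eta * cb) by rewrite /d2 /e2; field; rewrite !gt_eqF.
    rewrite ler_pdivrMr ?mulr_gt0 //; have := ler_wpM2l (ltW eta0) cbn; have := hb _ t5; clear; lra.
  have w2 : e2 * l2 <= 4^-1.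
    rewrite /e2 mulrC ler_pdivrMr //; clear -l2b cbn kth thn0; lra.
  have w3 : h%:R * 2^-1 <= h%:R * (1 - d2 * h%:R - e2 * l2) by apply: ler_wpM2l; [exact: ltW | clear -w1 w2; lra].
  apply: lt_le_trans w3; have := ler_wpM2r (ltW n0R) s2; clear -lG l2b hge thn0; lra.
have de01 : 0 < delta <= 1 by rewrite de0.
exact: (@restriction_DP R V k p hp Sigma f cs a e d cb beta CV epsb Lam r cs0 Lam1 aE a0 beta8 e0 CV0 ecb d_ge kr
  (lexx _) HV HS e2 d2 eta 1 eta0 betaeta e20 ecb2 d2_ge g0_le t S0 h delta Gam x1 l1 mt thr h0 de01 mV' l1cb Gam0 hG
  num1 num2 numh numr num3).
Qed.

End Params.

(** * Averages over random restrictions *)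

Section TauAverage.
Variables (R : realType) (V : finType) (k n : nat) (p : {set V} -> R).
Hypotheses (hp : topw k p) (p1 : \sum_S p S = 1) (nk : (n <= k)%N).
Implicit Types (phi psi : {set V} -> {set V} -> R).

Definition tau_avg phi : R :=
  \sum_(t : {set V} | #|t| == n) pij k p n t * \sum_s link_p p t s * phi t s.

Lemma pij_ge0 t : 0 <= pij k p n t.
Proof. by rewrite divr_ge0 // (mass_ge0 hp). Qed.

Lemma link_p_ge0 t s : 0 <= link_p p t s.
Proof. by case: (link_topw t hp). Qed.

Lemma tau_avg_le phi psi :
  (forall t s : {set V}, #|t| = n -> 0 < mass p t -> phi t s <= psi t s) -> tau_avg phi <= tau_avg psi.
Proof.
move=> h; apply: ler_sum => t /eqP tn; have [z|z] := eqVneq (mass p t) 0.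
  by rewrite /pij z mul0r !mul0r.
have mt : 0 < mass p t by rewrite lt_def z (mass_ge0 hp).
apply: ler_wpM2l; first exact: pij_ge0.
by apply: ler_sum => s _; apply: ler_wpM2l; [exact: link_p_ge0 | exact: h].
Qed.

Lemma tau_avgD phi psi : tau_avg (fun t s => phi t s + psi t s) = tau_avg phi + tau_avg psi.
Proof.
rewrite /tau_avg -big_split /=; apply: eq_bigr => t _; rewrite -mulrDr -big_split /=; congr (_ * _).
by apply: eq_bigr => s _; rewrite mulrDr.
Qed.

Lemma tau_avgZ a phi : tau_avg (fun t s => a * phi t s) = a * tau_avg phi.
Proof.
rewrite /tau_avg mulr_sumr; apply: eq_bigr => t _; rewrite !mulr_sumr; apply: eq_bigr => s _; ring.
Qed.

Lemma sum_link_p t : 0 < mass p t -> \sum_s link_p p t s = 1.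
Proof. by move=> mt; rewrite -(sum_set0 (link_p p t)); exact: link_mass1. Qed.

Lemma tau_avg1 : tau_avg (fun _ _ => 1) = 1.
Proof.
rewrite /tau_avg (eq_bigr (fun t => mass p t / 'C(k, n)%:R)) => [|t _].
  by rewrite -mulr_suml (sum_mass hp p1) divff // pnatr_eq0 -lt0n bin_gt0.
have [z|z] := eqVneq (mass p t) 0; first by rewrite /pij z !mul0r.
have mt : 0 < mass p t by rewrite lt_def z (mass_ge0 hp).
by under eq_bigr do rewrite mulr1; rewrite sum_link_p ?mulr1.
Qed.

Lemma tau_avg_top phi : tau_avg phi = \sum_(t : {set V} | #|t| == n) mass p t / 'C(k, n)%:R *
  \sum_(S : {set V} | t \subset S) p S / mass p t * phi t (S :\: t).
Proof. by apply: eq_bigr => t _; rewrite link_sum. Qed.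

End TauAverage.

Section Restrictions.
Variables (R : realType) (V Sigma : finType) (n : nat) (p : {set V} -> R) (f : {set V} -> V -> Sigma).
Hypothesis hp : topw (2 * n) p.
Implicit Types t s S : {set V}.

Lemma setDKUC t S : t \subset S -> t :|: (S :\: t) = S.
Proof. by move=> tS; rewrite finset.setUC setDKU. Qed.

Lemma mu_link t (A : {set V} -> R) : mu p t A = \sum_s link_p p t s * A (t :|: s).
Proof.
rewrite link_sum /mu /sm mulr_suml; apply: eq_bigr => S tS; rewrite setDKUC //; ring.
Qed.

Lemma weightV_mu t s : weightV p f t s = mu p t (VV R f t (t :|: s)).
Proof. by rewrite mu_link. Qed.

Lemma weightV_le1 t s : 0 < mass p t -> weightV p f t s <= 1.
Proof.
move=> mt; rewrite -(sum_link_p mt); apply: ler_sum => u _.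
by rewrite ler_piMr ?(link_p_ge0 hp) // lern1 leq_b1.
Qed.

Lemma isDP_mu eta delta t s (g : {ffun V -> Sigma}) : #|t| = n -> 0 < weightV p f t s ->
  mu p t (fun S => VV R f t (t :|: s) S * (eta / 4 * (dg (2 * n) t)%:R < (wrong (fun S x => f S x == g x) t S)%:R)%R%:R)
    <= delta ^+ 2 * mu p t (VV R f t (t :|: s)) ->
  isDP p f eta delta t s.
Proof.
move=> tn w0 h; apply/existsP; exists g; rewrite ler_pdivrMr // weightV_mu; apply: le_trans h.
rewrite /mu /sm mulr_suml le_eqVlt; apply/orP; left; apply/eqP.
under eq_bigr do rewrite -mulrA; rewrite link_sum; apply: eq_bigr => S tS; rewrite /inV setDKUC //.
have [->|pS] := eqVneq (p S) 0; first by rewrite !mul0r.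
rewrite /VV /agr /wrong (dgE hp tS pS); ring.
Qed.

(** Given tau, the second face of the test is independent of the first and agrees with probability
    [weightV]. *)
Lemma agreeV_tau : agreeV (2 * n) p f = tau_avg (2 * n) n p (fun t s => weightV p f t s).
Proof.
rewrite /agreeV /tau_avg mul2n doubleK; apply: eq_bigr => t _; congr (_ * _).
rewrite exchange_big; apply: eq_bigr => s _ /=; rewrite /weightV mulr_sumr; apply: eq_bigr => u _.
rewrite /inV; ring.
Qed.

Lemma prob_tau_avg (P : {set V} -> {set V} -> bool) :
  prob_tau (2 * n) p P = tau_avg (2 * n) n p (fun t s => (P t s)%:R).
Proof. by rewrite /prob_tau /tau_avg mul2n doubleK. Qed.

End Restrictions.

Theorem mainTheorem16 (R : realType) (c eta : R) :
  0 < c -> 0 < eta ->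
  exists c' : R, 0 < c' /\
  exists k0 : nat, forall k : nat, ~~ odd k -> (k0 <= k)%N ->
  forall (V : finType) (F : {set {set V}}) (p : {set V} -> R),
    wcomplex k F p -> locally_nice c k F p ->
  forall (Sigma : finType) (f : {set V} -> V -> Sigma) (delta : R),
    expR (- (c' * eta * k%:R)) < delta ->
    delta <= agreeV k p f ->
    delta / 2 <= prob_tau k p (good p f delta) /\
    1 - delta ^+ 2 <=
      prob_tau k p (fun t s0 => isDP p f eta delta t s0 && good p f delta t s0)
        / prob_tau k p (good p f delta).
Proof.
move=> c0 eta0; have [th [n0 [th0 H]]] := restriction_params c0 eta0.
exists (th / (2 * eta)); split; first by rewrite divr_gt0 // mulr_gt0 // ltr0n.
exists (2 * n0)%N => k ek k0 V F p; have [n kE] : exists n, k = (2 * n)%N.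
  by exists k./2; rewrite mul2n even_halfK.
subst k; have nn : (n0 <= n)%N by rewrite -(leq_pmul2l (m := 2)).
have [h [Lam [nh Lam1 Lh HH]]] := H n nn.
move=> wc ln Sigma f delta dth dag.
have [hp hF] := wcomplex_supp wc; have p1 := wcomplex_mass1 wc.
have nk : (n <= 2 * n)%N by rewrite leq_pmull.
have {}dth : expR (- (th * n%:R)) < delta.
  by move: dth; rewrite natrM (_ : th / (2 * eta) * eta * (2 * n%:R) = th * n%:R) //; field; rewrite gt_eqF.
have de0 : 0 < delta by apply: lt_trans dth; exact: expR_gt0.
rewrite agreeV_tau in dag; rewrite !prob_tau_avg.
set Pg := tau_avg _ _ _ (fun t s => (good p f delta t s)%:R).
have avg1 := tau_avg1 hp p1 nk.
have de1 : delta <= 1.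
  apply: le_trans dag _; rewrite -[leRHS]avg1; apply: (tau_avg_le hp) => t s _ mt.
  exact: (weightV_le1 f hp s mt).
(* Pointwise, [weightV] is at most delta / 2 plus the indicator of being good; averaging gives the
   claim. *)
have pg : delta / 2 <= Pg.
  have : delta <= delta / 2 * 1 + Pg.
    have -> : delta / 2 * 1 + Pg = tau_avg (2 * n) n p (fun t s => delta / 2 * 1 + (good p f delta t s)%:R).
      by rewrite tau_avgD (tau_avgZ (2 * n) n p (delta / 2) (fun _ _ => 1)) avg1.
    apply: le_trans dag _; apply: (tau_avg_le hp) => t s _ mt.
    rewrite mulr1 /good; case: (lerP (delta / 2) (weightV p f t s)) => [_|lt] /=; last by rewrite addr0 ltW.
    by apply: le_trans (weightV_le1 f hp s mt) _; rewrite lerDr divr_ge0 // ?ler0n // ltW.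
  by clear; lra.
split=> //.
have Pg0 : 0 < Pg by apply: lt_le_trans pg; rewrite divr_gt0 // ltr0n.
set Pd := tau_avg _ _ _ _.
pose Gf t s := GG (2 * n) p Lam f h t (VV R f t (t :|: s)) (VV R f t (t :|: s)).
have Gf0 t s : 0 <= Gf t s by apply: (GG_ge0 hp Lam1) => S; exact: ler0n.
have avgG : tau_avg (2 * n) n p Gf <= h.+1%:R.
  rewrite tau_avg_top; apply: le_trans (GG_avg hp p1 f Lam1 nh Lh).
  rewrite le_eqVlt; apply/orP; left; apply/eqP; apply: eq_bigr => t _; congr (_ * _).
  by apply: eq_bigr => S tS; rewrite /Gf setDKUC.
have h0 : (0 : R) < h.+1%:R by rewrite ltr0n.
have d3 : 0 < delta ^+ 3 by exact: exprn_gt0.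
(* Markov's inequality: a good tau that is not DP has an exchange sum above 1 / w. As the mean is at
   most h + 1, this has probability at most delta^3 / 2, hence at most delta^2 times the probability
   of being good. *)
pose w := delta ^+ 3 / (2 * h.+1%:R).
have w0 : 0 < w by rewrite divr_gt0 // mulr_gt0 // ltr0n.
have low : Pg <= Pd + w * tau_avg (2 * n) n p Gf.
  rewrite -tau_avgZ -tau_avgD; apply: (tau_avg_le hp) => t s tn mt.
  have wG : 0 <= w * Gf t s by rewrite mulr_ge0 // ltW.
  case: (boolP (good p f delta t s)) => [gd|_] /=; last by rewrite andbF add0r.
  rewrite andbT; case: (boolP (isDP p f eta delta t s)) => [_|nd] /=; first by rewrite lerDl.
  rewrite add0r; case: (lerP (Gf t s) (2 * h.+1%:R / delta ^+ 3)) => [Gle|Ggt].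
    have mw : delta / 2 <= mu p t (VV R f t (t :|: s)) by rewrite -weightV_mu.
    have [g hg] := HH V F p wc ln Sigma f delta t (t :|: s) dth de1 tn mt mw Gle.
    case/negP: nd; apply: (isDP_mu hp) hg => //; apply: lt_le_trans gd; by rewrite divr_gt0 // ltr0n.
  have -> : 1 = w * (2 * h.+1%:R / delta ^+ 3) by rewrite /w; field; rewrite !gt_eqF.
  by rewrite ler_pM2l // ltW.
rewrite ler_pdivlMr //.
have wb : w * tau_avg (2 * n) n p Gf <= delta ^+ 3 / 2.
  apply: le_trans (ler_wpM2l (ltW w0) avgG) _; rewrite le_eqVlt; apply/orP; left; apply/eqP.
  by rewrite /w; field; rewrite gt_eqF.
have dg3 : delta ^+ 3 / 2 <= delta ^+ 2 * Pg.
  by rewrite exprSr -mulrA; apply: ler_wpM2l => //; exact: sqr_ge0.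
by clear -low wb dg3; lra.
Qed.
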